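(* Let $\beta>1$ and let $\{X_t\}_{t\ge0}$ be bounded from below with $X\in S_G^\beta(0,n)$ for every positive integer $n$ and $\hat{\mathbb E}[\sup_{t\ge0}|X_t|^\beta]<\infty$. Set $t_k^n=k/2^n$, $\mathcal I_n^\infty=\{t_k^n:k=0,1,\dots\}$ and $\mathcal I^\infty=\bigcup_{n=1}^\infty\mathcal I_n^\infty$. For $n,N\in\mathbb N$ define backwardly $$V^{n,N}_{t_N^n}=X_{t_N^n},\qquad V^{n,N}_{t_k^n}=\max\{X_{t_k^n},\hat{\mathbb E}_{t_k^n}[V^{n,N}_{t_{k+1}^n}]\},\quad k\le N-1,$$ and the increasing limits $$V^n_{t_k^n}=\lim_{N\ge k,\,N\to\infty}V^{n,N}_{t_k^n},\qquad V_{t_k^n}=\lim_{m\ge n,\,m\to\infty}V^m_{t_k^n}$$ (where $t_k^n=t^m_{k2^{m-n}}$). Then $\{V_t,t\in\mathcal I^\infty\}$ is the smallest $G$-supermartingale dominating $\{X_t,t\in\mathcal I^\infty\}$. Besides, $$V_0=\sup_{\tau\in\mathcal T_0^\infty}\hat{\mathbb E}[X_\tau],$$ where $\mathcal T_0^\infty$ is the collection of all $G$-stopping times $\tau$ taking values in $[0,\infty)$ with $\lim_{N\to\infty}c(\tau>N)=0$.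
   Context: Framework. Fix $0\le\underline\sigma\le\bar\sigma<\infty$ and $G(a)=\frac12(\bar\sigma^2a^+-\underline\sigma^2a^-)$. $\Omega=C_0([0,\infty);\mathbb R)$ is the space of continuous paths starting at $0$ (locally uniform topology, Borel $\sigma$-field $\mathcal B(\Omega)$), $B$ the canonical process, $\Omega_t=\{\omega_{\cdot\wedge t}:\omega\in\Omega\}$. $L_{ip}(\Omega_t)=\{\varphi(B_{t_1},\dots,B_{t_m}): m\ge1,\ t_i\in[0,t],\ \varphi \text{ bounded Lipschitz}\}$, $L_{ip}(\Omega)=\bigcup_tL_{ip}(\Omega_t)$. $\hat{\mathbb E}$ is the $G$-expectation, with conditional $G$-expectations $\hat{\mathbb E}_t$: for $X=\varphi(B_{t_1},B_{t_2}-B_{t_1},\dots,B_{t_m}-B_{t_{m-1}})$ one sets $\hat{\mathbb E}_{t_j}[X]=\varphi_j(B_{t_1},\dots,B_{t_j}-B_{t_{j-1}})$, where $\varphi_m=\varphi$ and $\varphi_{i-1}(x_1,\dots,x_{i-1})=u(t_i-t_{i-1},0)$ with $u$ the viscosity solution of $\partial_tu=G(\partial^2_{yy}u)$, $u(0,y)=\varphi_i(x_1,\dots,x_{i-1},y)$; $\hat{\mathbb E}=\hat{\mathbb E}_0$. $L_G^p(\Omega_t)$ is the completion of $L_{ip}(\Omega_t)$ under $\hat{\mathbb E}[|\cdot|^p]^{1/p}$. $\mathcal P$ is the weakly compact set of all probability measures $P$ on $\Omega$ with $E^P[X]\le\hat{\mathbb E}[X]$ for all $X\in L_{ip}(\Omega)$;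 it represents $\hat{\mathbb E}$, and for Borel $X$ such that $E^P[X]$ exists for all $P\in\mathcal P$ one sets $\hat{\mathbb E}[X]=\sup_{P\in\mathcal P}E^P[X]$. $c(A)=\sup_{P\in\mathcal P}P(A)$; ''q.s.'' means outside a set of capacity $c$ zero. Relations between random variables are q.s. $S_G^p(0,T)$ is the completion of $S_G^0(0,T)=\{h(t,B_{t_1\wedge t},\dots,B_{t_n\wedge t}):t_1,\dots,t_n\in[0,T],\ h\ \text{bounded Lipschitz on }\mathbb R^{n+1}\}$ under $\|\eta\|_{S_G^p}=\{\hat{\mathbb E}[\sup_{t\in[0,T]}|\eta_t|^p]\}^{1/p}$. Spaces. $\mathbb L^1(\Omega)$: Borel $X:\Omega\to[-\infty,\infty]$ with $\hat{\mathbb E}[|X|]<\infty$; $L_G^{1^*}(\Omega)$: $X\in\mathbb L^1(\Omega)$ with $X_n\downarrow X$ q.s. for some $\{X_n\}\subset L_G^1(\Omega)$; $L_G^{1^*_*}(\Omega)$: $X\in\mathbb L^1(\Omega)$ with $X_n\uparrow X$ q.s. for some $\{X_n\}\subset L_G^{1^*}(\Omega)$; $\bar L_G^{1^*_*}(\Omega)$: $X\in\mathbb L^1(\Omega)$ with $\hat{\mathbb E}[|X_n-X|]\to0$ for some $\{X_n\}\subset L_G^{1^*_*}(\Omega)$. The same definitions with $\Omega_t$ give the spaces over $\Omega_t$. Conditional expectation on $\bar L_G^{1^*_*}(\Omega)$. $\hat{\mathbb E}_t$ is extended from $L_{ip}(\Omega)$ to $L^1_G(\Omega)$ and $\bar L_G^{1^*_*}(\Omega)$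 by norm limits and monotone limits; it is characterized by $\hat{\mathbb E}_t[X]=\operatorname{ess\,sup}^P_{Q\in\mathcal P(t,P)}E^Q[X|\mathcal F_t]$ $P$-a.s. for every $P\in\mathcal P$, where $\mathcal F_t=\mathcal B(\Omega_t)$ and $\mathcal P(t,P)=\{Q\in\mathcal P:E^Q[X]=E^P[X]\ \forall X\in L_{ip}(\Omega_t)\}$. A random time $\tau:\Omega\to[0,\infty)$ is a $G$-stopping time if $I_{\{\tau\le t\}}\in L_G^{1^*}(\Omega_t)$ for each $t\ge0$. $X_\tau$ denotes $\omega\mapsto X_{\tau(\omega)}(\omega)$. $\{M_t\}$ (indexed by $\mathcal I^\infty$) is a $G$-supermartingale if $M_t\in\bar L_G^{1^*_*}(\Omega_t)$ for each $t$ and $\hat{\mathbb E}_s[M_t]\le M_s$ for all $s\le t$. $V$ dominates $X$ if $V_t\ge X_t$ for all $t$; smallest means that every $G$-supermartingale $U$ dominating $X$ satisfies $U_t\ge V_t$ for all $t$. *)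

(* Defs.v *)
From HB Require Import structures.
From mathcomp Require Import all_boot all_order all_algebra.
From mathcomp Require Import all_classical all_reals all_analysis measurable_realfun.
Import Order.TTheory GRing.Theory Num.Theory.
Import numFieldNormedType.Exports.

Set Implicit Arguments.
Unset Strict Implicit.
Unset Printing Implicit Defensive.

Local Open Scope classical_set_scope.
Local Open Scope ring_scope.

(* C_0([0,oo);R): a path is encoded by its unique extension to the real line
   that vanishes on ]-oo, 0]; this is a bijection onto the continuous functions
   on [0,oo) starting at 0, compatible with locally uniform convergence. *)
Definition is_path (R : realType) : set (R -> R) :=
  [set w : R -> R | continuous w /\ forall t : R, t <= 0 -> w t = 0].

Definition path_space (R : realType) : Type := set_type (@is_path R).

Definition path_val (R : realType) (w : path_space R) : R -> R := val w.

HB.instance Definition _ (R : realType) := Choice.on (path_space R).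

Lemma is_path0 (R : realType) : @is_path R (cst 0).
Proof. by split => // t; exact: cvg_cst. Qed.

HB.instance Definition _ (R : realType) :=
  isPointed.Build (path_space R) (exist (fun w => w \in @is_path R) _ (mem_set (@is_path0 R))).

(* The compact-open topology is that of uniform convergence on compacts. *)
Definition path_top (R : realType) : ptopologicalType :=
  initial_topology (@path_val R : path_space R -> {compact-open, R -> R}).

Definition Omega (R : realType) := g_sigma_algebraType (@open (path_top R)).

Definition B (R : realType) (t : R) (w : Omega R) : R :=
  path_val (w : path_space R) t.

Lemma is_path_stop (R : realType) (t : R) (w : Omega R) :
  @is_path R (fun s => B (Num.min s t) w).
Proof.
case: (set_valP (w : path_space R)) => cw w0; split; last first.
  by move=> s s0; apply: w0; rewrite ge_min s0.
move=> s; apply: (@continuous_comp _ _ _ (fun s : R => Num.min s t)); last exact: cw.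
by apply: (@continuous_min R R id (cst t)); [exact: cvg_id|exact: cvg_cst].
Qed.

Definition stop (R : realType) (t : R) (w : Omega R) : Omega R :=
  exist (fun w => w \in @is_path R) _ (mem_set (is_path_stop t w)).

(* B(Omega_t), as a sub-sigma-field of B(Omega): the pull-back of the Borel
   sets along w |-> w(. /\ t). Here and below the horizon t is an extended
   real, and t = +oo stands for the whole of Omega. *)
Definition Ft (R : realType) (t : \bar R) : set (set (Omega R)) :=
  match t with
  | r%:E => preimage_set_system setT (stop r) measurable
  | _ => measurable
  end.

Definition vec (R : realType) (m : nat) (s : seq R) : 'rV[R]_m :=
  \row_(i < m) s`_i.

Definition bounded_lipschitz (R : realType) (m : nat) (phi : 'rV[R]_m -> R) :=
  [bounded phi x | x in [set: 'rV[R]_m]] /\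
  [lipschitz phi x | x in [set: 'rV[R]_m]].

Definition Lip (R : realType) (t : \bar R) : set (Omega R -> R) :=
  [set X | exists (m : nat) (ts : m.+1.-tuple R) (phi : 'rV[R]_m.+1 -> R),
    [/\ bounded_lipschitz phi,
        (forall s, s \in ts -> 0 <= s /\ (s%:E <= t)%E) &
        forall w, X w = phi (vec m.+1 [seq B s w | s <- ts])]].

Definition Gfun (R : realType) (sl su a : R) : R :=
  2^-1 * (su ^+ 2 * Num.max a 0 - sl ^+ 2 * Num.max (- a) 0).

Definition C12 (R : realType) (psi : R -> R -> R) : Prop :=
  let D := [set p : R * R | 0 < p.1] in
  [/\ forall t y : R, 0 < t ->
        [/\ derivable (psi ^~ y) t 1, derivable (psi t) y 1 &
            derivable (derive1 (psi t)) y 1],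
      {in D, continuous (fun p : R * R => derive1 (psi ^~ p.2) p.1)},
      {in D, continuous (fun p : R * R => derive1 (psi p.1) p.2)} &
      {in D, continuous (fun p : R * R => derive1n 2 (psi p.1) p.2)}].

Definition viscosity_subsolution (R : realType) (sl su : R)
    (u : R -> R -> R) : Prop :=
  forall (psi : R -> R -> R) (t y : R), 0 < t -> C12 psi ->
    (forall s z, 0 < s -> u s z <= psi s z) -> u t y = psi t y ->
    derive1 (psi ^~ y) t - Gfun sl su (derive1n 2 (psi t) y) <= 0.

Definition viscosity_supersolution (R : realType) (sl su : R)
    (u : R -> R -> R) : Prop :=
  forall (psi : R -> R -> R) (t y : R), 0 < t -> C12 psi ->
    (forall s z, 0 < s -> psi s z <= u s z) -> u t y = psi t y ->
    0 <= derive1 (psi ^~ y) t - Gfun sl su (derive1n 2 (psi t) y).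

(* "The" viscosity solution with bounded initial datum f is the one in the
   class of bounded functions (without a growth condition uniqueness fails). *)
Definition G_heat_solution (R : realType) (sl su : R) (f : R -> R)
    (u : R -> R -> R) : Prop :=
  let D := [set p : R * R | 0 <= p.1] in
  [/\ {within D, continuous (fun p : R * R => u p.1 p.2)},
      [bounded u p.1 p.2 | p in D],
      forall y, u 0 y = f y,
      viscosity_subsolution sl su u &
      viscosity_supersolution sl su u].

Definition G_heat (R : realType) (sl su : R) (f : R -> R) : R -> R -> R :=
  xget (fun _ _ => 0) [set u : R -> R -> R | G_heat_solution sl su f u].

(* If phi is a function of m increments, ds the list of the last m - j time
   steps and xs = [:: x_1; ...; x_j], then G_backward ds phi xs is
   phi_j(x_1, ..., x_j). *)
Fixpoint G_backward (R : realType) (sl su : R) (ds : seq R)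
    (phi : seq R -> R) (xs : seq R) : R :=
  if ds is d :: ds' then
    G_heat sl su (fun y => G_backward sl su ds' phi (rcons xs y)) d 0
  else phi xs.

Definition increments (R : realType) (f : R -> R) (t0 : R) (ts : seq R) :
    seq R :=
  pairmap (fun s t => f t - f s) t0 ts.

(* Y is the conditional G-expectation at time t of X in L_ip(Omega): the time
   grid 0 < t_1 < ... < t_m is the concatenation of the times pre up to t = t_j
   (j = 0 and pre = [::] if t = 0) and of the times post after t. *)
Definition cond_Lip (R : realType) (sl su t : R) (X Y : Omega R -> R) : Prop :=
  exists (m : nat) (pre post : seq R) (phi : 'rV[R]_m.+1 -> R),
    [/\ bounded_lipschitz phi,
        [/\ size (pre ++ post) = m.+1, path <%R 0 (pre ++ post) &
            last 0 pre = t],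
        forall w, X w = phi (vec m.+1 (increments (fun s : R => B s w) 0 (pre ++ post))) &
        forall w, Y w = G_backward sl su (increments id t post)
                          (phi \o vec m.+1) (increments (fun s : R => B s w) 0 pre)].

Definition G_measures (R : realType) (sl su : R) :
    set (probability (Omega R) R) :=
  [set P | forall (X : Omega R -> R) (v : R),
    Lip +oo%E X -> cond_Lip sl su 0 X (cst v) ->
    (\int[P]_w (X w)%:E <= v%:E)%E].

(* The library integral of a function that
   agrees with a Borel one outside a Borel null set is that of the Borel one,
   so Ehat is meaningful for functions that are Borel up to a polar set. *)
Definition Ehat (R : realType) (sl su : R) (X : Omega R -> \bar R) : \bar R :=
  ereal_sup [set \int[P]_w X w | P in @G_measures R sl su]%E.

Definition cap (R : realType) (sl su : R) (A : set (Omega R)) : \bar R :=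
  ereal_sup [set P A | P in @G_measures R sl su].

Definition qs (R : realType) (sl su : R) (A : Omega R -> Prop) : Prop :=
  exists2 N : set (Omega R), measurable N /\ cap sl su N = 0%E &
    forall w, ~ N w -> A w.

(* Random variables are Borel; as they are identified when equal q.s.,
   B(Omega_t)-measurability is required of some version only. *)
Definition L0 (R : realType) (sl su : R) (t : \bar R) :
    set (Omega R -> \bar R) :=
  [set X : Omega R -> \bar R | measurable_fun setT X /\
    exists2 X' : Omega R -> \bar R,
      (forall A : set (\bar R), measurable A -> Ft t (X' @^-1` A)) &
      qs sl su (fun w => X w = X' w)].

Definition L1 (R : realType) (sl su : R) (t : \bar R) :
    set (Omega R -> \bar R) :=
  [set X | L0 sl su t X /\ (Ehat sl su (fun w => `|X w|) < +oo)%E].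

Definition cvg_L1 (R : realType) (sl su : R) (Xn : nat -> Omega R -> \bar R)
    (X : Omega R -> \bar R) : Prop :=
  (fun n => Ehat sl su (fun w => `|Xn n w - X w|)%E) @ \oo --> 0%E.

Definition qs_decreases (R : realType) (sl su : R)
    (Xn : nat -> Omega R -> \bar R) (X : Omega R -> \bar R) : Prop :=
  qs sl su (fun w => nonincreasing_seq (Xn ^~ w) /\ (Xn ^~ w) @ \oo --> X w).

Definition qs_increases (R : realType) (sl su : R)
    (Xn : nat -> Omega R -> \bar R) (X : Omega R -> \bar R) : Prop :=
  qs sl su (fun w => nondecreasing_seq (Xn ^~ w) /\ (Xn ^~ w) @ \oo --> X w).

(* L_G^1, L_G^{1^*}, L_G^{1^*_*} and the closure of the latter, over Omega_t;
   the completion L_G^1 is realized as the closure of L_ip in L^1. *)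
Definition LG1 (R : realType) (sl su : R) (t : \bar R) :
    set (Omega R -> \bar R) :=
  [set X | L1 sl su t X /\
    exists2 Xn : nat -> Omega R -> R, (forall n, Lip t (Xn n)) &
      cvg_L1 sl su (fun n w => (Xn n w)%:E) X].

Definition LGdec (R : realType) (sl su : R) (t : \bar R) :
    set (Omega R -> \bar R) :=
  [set X | L1 sl su t X /\
    exists2 Xn, (forall n, LG1 sl su t (Xn n)) & qs_decreases sl su Xn X].

Definition LGinc (R : realType) (sl su : R) (t : \bar R) :
    set (Omega R -> \bar R) :=
  [set X | L1 sl su t X /\
    exists2 Xn, (forall n, LGdec sl su t (Xn n)) & qs_increases sl su Xn X].

Definition LGbar (R : realType) (sl su : R) (t : \bar R) :
    set (Omega R -> \bar R) :=
  [set X | L1 sl su t X /\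
    exists2 Xn, (forall n, LGinc sl su t (Xn n)) & cvg_L1 sl su Xn X].

(* The relation "Y is a version of the conditional expectation of X at t" is
   extended from L_ip(Omega) successively by norm limits, decreasing limits,
   increasing limits and norm limits. *)
Definition cond_LG1 (R : realType) (sl su t : R) (X Y : Omega R -> \bar R) :
    Prop :=
  [/\ L1 sl su +oo%E X, L1 sl su t%:E Y &
    exists Xn Yn : nat -> Omega R -> R,
      [/\ forall n, cond_Lip sl su t (Xn n) (Yn n),
          cvg_L1 sl su (fun n w => (Xn n w)%:E) X &
          cvg_L1 sl su (fun n w => (Yn n w)%:E) Y]].

Definition cond_LGdec (R : realType) (sl su t : R) (X Y : Omega R -> \bar R) :
    Prop :=
  [/\ L1 sl su +oo%E X, L1 sl su t%:E Y &
    exists Xn Yn : nat -> Omega R -> \bar R,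
      [/\ forall n, cond_LG1 sl su t (Xn n) (Yn n),
          qs_decreases sl su Xn X & qs_decreases sl su Yn Y]].

Definition cond_LGinc (R : realType) (sl su t : R) (X Y : Omega R -> \bar R) :
    Prop :=
  [/\ L1 sl su +oo%E X, L1 sl su t%:E Y &
    exists Xn Yn : nat -> Omega R -> \bar R,
      [/\ forall n, cond_LGdec sl su t (Xn n) (Yn n),
          qs_increases sl su Xn X & qs_increases sl su Yn Y]].

Definition cond_LGbar (R : realType) (sl su t : R) (X Y : Omega R -> \bar R) :
    Prop :=
  [/\ L1 sl su +oo%E X, L1 sl su t%:E Y &
    exists Xn Yn : nat -> Omega R -> \bar R,
      [/\ forall n, cond_LGinc sl su t (Xn n) (Yn n),
          cvg_L1 sl su Xn X & cvg_L1 sl su Yn Y]].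

Definition Et (R : realType) (sl su t : R) (X : Omega R -> \bar R) :
    Omega R -> \bar R :=
  xget (cst 0%E) [set Y | cond_LGbar sl su t X Y].

(* S_G^0(0,T); for ts = [:: t_1; ...; t_n], h is a function on R^{n+1} *)
Definition SG0 (R : realType) (T : R) : set (R -> Omega R -> R) :=
  [set eta | exists (ts : seq R) (h : 'rV[R]_(size ts).+1 -> R),
    [/\ bounded_lipschitz h, forall s, s \in ts -> 0 <= s <= T &
        forall t w, 0 <= t <= T ->
          eta t w = h (vec _ (t :: [seq B (Num.min s t) w | s <- ts]))]].

Definition sup_power (R : realType) (p : R) (I : set R)
    (eta : R -> Omega R -> R) (w : Omega R) : \bar R :=
  ereal_sup [set (`|eta t w| `^ p)%:E | t in I].

Definition SG_norm (R : realType) (sl su p T : R) (eta : R -> Omega R -> R) :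
    \bar R :=
  poweR (Ehat sl su (sup_power p `[0, T] eta)) p^-1.

(* S_G^p(0,T), realized by processes. The suprema over an interval are required
   to be Borel up to a polar set, since Ehat makes sense for such functions
   only; this is automatic for continuous paths. *)
Definition SG (R : realType) (sl su p T : R) : set (R -> Omega R -> R) :=
  [set eta : R -> Omega R -> R |
    (forall t, 0 <= t <= T -> measurable_fun setT (eta t)) /\
    exists etan : nat -> R -> Omega R -> R,
      let delta n t w := etan n t w - eta t w in
      [/\ forall n, SG0 T (etan n),
          forall n, exists2 Z : Omega R -> \bar R, measurable_fun setT Z &
            qs sl su (fun w => sup_power p `[0, T] (delta n) w = Z w) &
          (fun n => SG_norm sl su p T (delta n)) @ \oo --> 0%E]].

Definition G_stopping_time (R : realType) (sl su : R) (tau : Omega R -> R) :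
    Prop :=
  (forall w, 0 <= tau w) /\
  forall t, 0 <= t ->
    LGdec sl su t%:E (fun w => (\1_[set w' | tau w' <= t] w)%:E).

Definition G_stopping_times_fin (R : realType) (sl su : R) :
    set (Omega R -> R) :=
  [set tau | G_stopping_time sl su tau /\
    (fun N : nat => cap sl su [set w | N%:R < tau w]) @ \oo --> 0%E].

Definition dyadic (R : realType) (n k : nat) : R := k%:R / 2 ^+ n.

Definition dyadics (R : realType) : set R :=
  [set t | exists n k, t = dyadic R n k].

(* Processes indexed by the dyadic times are functions on R, of which only the
   values at dyadic times matter. *)
Definition G_supermartingale (R : realType) (sl su : R)
    (M : R -> Omega R -> \bar R) : Prop :=
  (forall t : R, dyadics t -> LGbar sl su t%:E (M t)) /\
  forall s t : R, dyadics s -> dyadics t -> s <= t ->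
    qs sl su (fun w => Et sl su s (M t) w <= M s w)%E.

Definition dominates (R : realType) (sl su : R)
    (V U : R -> Omega R -> \bar R) : Prop :=
  forall t : R, dyadics t -> qs sl su (fun w => U t w <= V t w)%E.

Definition smallest_G_supermartingale_dominating (R : realType) (sl su : R)
    (V X : R -> Omega R -> \bar R) : Prop :=
  [/\ G_supermartingale sl su V, dominates sl su V X &
      forall U, G_supermartingale sl su U -> dominates sl su U X ->
        dominates sl su U V].

(* snell_steps X n j k is V^{n,N}_{t_k^n} for N = k + j; snellN and snell are
   V^{n,N} and V^n. *)
Fixpoint snell_steps (R : realType) (sl su : R) (X : R -> Omega R -> \bar R)
    (n j k : nat) (w : Omega R) : \bar R :=
  if j is j'.+1 then
    maxe (X (dyadic R n k) w)
         (Et sl su (dyadic R n k) (snell_steps sl su X n j' k.+1) w)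
  else X (dyadic R n k) w.

Definition snellN (R : realType) (sl su : R) (X : R -> Omega R -> \bar R)
    (n N k : nat) : Omega R -> \bar R :=
  snell_steps sl su X n (N - k) k.

Definition snell (R : realType) (sl su : R) (X : R -> Omega R -> \bar R)
    (n k : nat) (w : Omega R) : \bar R :=
  limn (fun N => snellN sl su X n N k w).

(* Main.v *)
(* The G-heat semigroup is an ultralimit of the iterates of the monotone schemes
   f |-> max_s (f(. + s sqrt h) + f(. - s sqrt h)) / 2, s in {sl, su}. It solves
   the equation, and comparing a bounded solution step by step with spatial
   averages of another one gives uniqueness for Lipschitz data. Hence the
   conditional expectation of a cylinder function is an iterate of the semigroup.

   A linear functional on cylinder functions dominated by the G-expectation is
   represented by a probability measure (Daniell; the compactness behind Dini's
   lemma comes from chaining with fourth moments). With Hahn-Banach, this shows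
   that E_t[X] is characterised q.s. by two facts: E^P[X; A] <= E^P[E_t[X]; A]
   for all P and A in F_t, and E^P[E_t[X]] is approximated by E^Q[X] with Q = P
   on F_t. Both are stable under the norm and monotone limits that define E_t.

   Consequently V^{n,N} lies in L_G^1 and is increasing in N and in n; V inherits
   the supermartingale property by the tower property, and minimality is a
   backward induction. Stopping at the first grid time where X = V^{n,N} attains
   V^{n,N}_0 up to e; this is a G-stopping time because the indicator of
   {u <= X} is the decreasing limit of (1 - r (u - X)^+)^+. Conversely, a
   G-stopping time is approximated from above by dyadic ones, along which X
   converges q.s. by continuity and is dominated. *)
From HB Require Import structures.
Require Import Defs.
From mathcomp Require Import all_boot all_order all_algebra.
From mathcomp Require Import all_classical all_reals all_analysis measurable_realfun.
From mathcomp Require Import ring lra.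
Import Order.TTheory GRing.Theory Num.Theory.
Import numFieldNormedType.Exports.
Set Implicit Arguments.
Unset Strict Implicit.
Unset Printing Implicit Defensive.
Local Open Scope classical_set_scope.
Local Open Scope ring_scope.

(** * The G-heat semigroup *)

(** Both the viscosity solution and the approximating sequences in [Et] are selected by choice, so
    the proof hinges on two uniqueness questions. For the equation, comparison rests on an
    asymmetry: minus a supersolution of the nonlinear equation is a subsolution of every linear
    equation with a fixed volatility. Linear equations commute with averages, and three averages
    give enough derivatives to enter the one-step inequality satisfied by the other solution. For
    conditional expectations, norm and increasing limits are soft, but a decreasing limit of suprema
    over measures needs compactness of the set of measures; it comes from the representation theorem
    once more, applied to an ultralimit of expectations. Ultralimits along one fixed ultrafilter
    serve as limits of functions, of paths, of Riemann sums and of expectations: they exist for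
    every bounded sequence and are linear and monotone. From the representation theorem on,
    variables are treated through real-valued versions; those known at time t are functions of the
    path stopped at t, so that measures agreeing on F_t cannot distinguish them. *)

Section ultralimit.
Context {R : realType}.
Implicit Types (x y : nat -> R) (l M a b : R).

Definition oo_ultra : set_system nat :=
  projT1 (cid (@ultraFilterLemma nat \oo _)).

Lemma oo_ultraP : UltraFilter oo_ultra.
Proof. by rewrite /oo_ultra; case: cid => F /= []. Qed.

Lemma oo_ultra_near (A : set nat) : \oo A -> oo_ultra A.
Proof. by rewrite /oo_ultra; case: cid => F /= [_ +]; apply. Qed.

#[global] Instance oo_ultra_proper : ProperFilter oo_ultra.
Proof. exact: (@ultra_proper _ _ oo_ultraP). Qed.

Lemma oo_ultra_le x y a b : x @ oo_ultra --> a -> y @ oo_ultra --> b ->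
  (\forall n \near oo_ultra, x n <= y n) -> a <= b.
Proof. by move=> xa yb xy; exact: (ler_cvg_to xa yb). Qed.

Definition ulim x : R := lim (x @ oo_ultra).

Definition bounded_seq x := exists M, forall n, `|x n| <= M.

(** The image of an ultrafilter is an ultrafilter, and an ultrafilter on the compact segment [-M, M]
    converges. *)
Lemma ulim_cvg x : bounded_seq x -> x @ oo_ultra --> ulim x.
Proof.
move=> [M xM]; apply/cvg_ex.
have : compact `[- M, M]%classic by exact: segment_compact.
rewrite compact_ultra => /(_ (x @ oo_ultra)).
case.
- have := oo_ultraP => U; constructor; first exact: fmap_proper_filter.
  move=> G GP xG; apply/seteqP; split => // A GA.
  have [//|xA] := @in_ultra_setVsetC _ _ (x @^-1` A) U.
  have := xG (~` A) xA => GCA.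
  have GF : Filter G by exact: filter_filter.
  by have /(@filter_ex _ _ GP)[z []] : G (A `&` ~` A) by exact: filterI.
- apply: nearW => n; rewrite /= in_itv /=.
  by rewrite -ler_norml.
- by move=> l [_ xl]; exists l.
Qed.

Lemma bounded_seq_cst l : bounded_seq (fun=> l).
Proof. by exists `|l|. Qed.

Lemma bounded_seqD x y : bounded_seq x -> bounded_seq y ->
  bounded_seq (fun n => x n + y n).
Proof.
move=> [M xM] [N yN]; exists (M + N) => n.
by rewrite (le_trans (ler_normD _ _))// lerD.
Qed.

Lemma bounded_seqN x : bounded_seq x -> bounded_seq (fun n => - x n).
Proof. by move=> [M xM]; exists M => n; rewrite normrN. Qed.

Lemma ulim_eq x l : x @ oo_ultra --> l -> ulim x = l.
Proof. by move=> xl; apply: cvg_lim. Qed.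

Lemma ulim_cst l : ulim (fun=> l) = l.
Proof. by apply: ulim_eq; exact: cvg_cst. Qed.

Lemma ulimD x y : bounded_seq x -> bounded_seq y ->
  ulim (fun n => x n + y n) = ulim x + ulim y.
Proof. by move=> bx by_; apply: ulim_eq; apply: cvgD; exact: ulim_cvg. Qed.

Lemma ulimZ l x : bounded_seq x -> ulim (fun n => l * x n) = l * ulim x.
Proof.
by move=> bx; apply: ulim_eq; apply: cvgM; [exact: cvg_cst|exact: ulim_cvg].
Qed.

Lemma ulimN x : bounded_seq x -> ulim (fun n => - x n) = - ulim x.
Proof. by move=> bx; apply: ulim_eq; apply: cvgN; exact: ulim_cvg. Qed.

Lemma ulim_le x y : bounded_seq x -> bounded_seq y ->
  (\forall n \near oo_ultra, x n <= y n) -> ulim x <= ulim y.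
Proof.
move=> bx by_ xy; exact: (ler_cvg_to (ulim_cvg bx) (ulim_cvg by_)).
Qed.

Lemma ulim_norm x y : bounded_seq x -> bounded_seq y -> forall e,
  (\forall n \near oo_ultra, `|x n - y n| <= e) -> `|ulim x - ulim y| <= e.
Proof.
move=> bx by_ e H.
rewrite -(ulimN by_) -ulimD//; last exact: bounded_seqN.
have bxy : bounded_seq (fun n => x n - y n).
  by apply: bounded_seqD => //; exact: bounded_seqN.
rewrite ler_norml; apply/andP; split.
  rewrite -(ulim_cst (- e)); apply: ulim_le => //; first exact: bounded_seq_cst.
  by apply: filterS H => n; rewrite ler_norml => /andP[].
rewrite -[leRHS](ulim_cst e); apply: ulim_le => //; first exact: bounded_seq_cst.
by apply: filterS H => n; rewrite ler_norml => /andP[].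
Qed.

End ultralimit.

(** * Sublinear, translation-invariant operators *)

Section sublinear_operators.
Context {R : realType}.
Implicit Types (f g : R -> R) (A : (R -> R) -> R -> R).

Record sublinear_op A : Prop := {
  slop_le : forall f g, (forall y, f y <= g y) -> forall y, A f y <= A g y;
  slopD : forall f g y, A (fun z => f z + g z) y <= A f y + A g y;
  slopZ : forall c f y, 0 <= c -> A (fun z => c * f z) y = c * A f y;
  slopC : forall c f y, A (fun z => f z + c) y = A f y + c;
  slop_shift : forall x f y, A (fun z => f (z + x)) y = A f (y + x) }.

Lemma sublinear_op_iter A n : sublinear_op A -> sublinear_op (iter n A).
Proof.
move=> sA; elim: n => [|n IH] /=; first by split=> //; move=> *; lra.
split=> [f g fg y|f g y|c f y c0|c f y|x f y].
- by apply: (slop_le sA) => z; exact: (slop_le IH).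
- apply: le_trans (slopD sA _ _ _); apply: (slop_le sA) => z.
  exact: (slopD IH).
- rewrite !iterS -(slopZ sA)//; congr (A _ y); apply/funext => z.
  exact: (slopZ IH).
- rewrite !iterS -(slopC sA)//; congr (A _ y); apply/funext => z.
  exact: (slopC IH).
- rewrite !iterS -(slop_shift sA)//; congr (A _ y); apply/funext => z.
  exact: (slop_shift IH).
Qed.

Section theory.
Variables (A : (R -> R) -> R -> R) (sA : sublinear_op A).

Lemma slop_cst c y : A (fun=> c) y = c.
Proof.
have A0 : A (fun=> 0) y = 0.
  rewrite -[RHS](mul0r (A (fun=> 0) y)) -(slopZ sA)//.
  by congr (A _ _); apply/funext => z; rewrite mul0r.
rewrite -[RHS]add0r -[in RHS]A0 -(slopC sA).
by congr (A _ _); apply/funext => z; rewrite add0r.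
Qed.

Lemma slop_dist f g d y : (forall z, f z <= g z + d z) -> A f y <= A g y + A d y.
Proof. by move=> fgd; apply: le_trans (slopD sA _ _ _); exact: (slop_le sA). Qed.

Lemma slop_distC f g c : (forall z, f z <= g z + c) ->
  forall y, A f y <= A g y + c.
Proof. by move=> fgc y; rewrite -(slopC sA); exact: (slop_le sA). Qed.

Lemma slop_bounded M f : (forall z, `|f z| <= M) -> forall y, `|A f y| <= M.
Proof.
move=> fM y; rewrite ler_norml; apply/andP; split.
  rewrite -(slop_cst (- M) y); apply: (slop_le sA) => z.
  by have := fM z; rewrite ler_norml => /andP[].
rewrite -[leRHS](slop_cst M y); apply: (slop_le sA) => z.
by have := fM z; rewrite ler_norml => /andP[].
Qed.

(** By translation invariance the values at x and y are the values at y of the operator on a shift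
    of f and on f itself. These two functions differ by at most a constant, and constants come out
    of the operator. *)
Lemma slop_lipschitz L f : (forall x y, `|f x - f y| <= L * `|x - y|) ->
  forall x y, `|A f x - A f y| <= L * `|x - y|.
Proof.
move=> fL.
have H x y : A f x <= A f y + L * `|x - y|.
  rewrite -[in leLHS](subrKC y x) -(slop_shift sA).
  apply: slop_distC => z; have := fL (z + (x - y)) z.
  rewrite [z + _]addrC addrK ler_norml => /andP[_ h].
  by rewrite addrC -lerBlDl (le_trans _ h)// [z + _]addrC.
move=> x y; have := H x y; have := H y x; rewrite (distrC y x) ler_norml => h1 h2.
by apply/andP; split; lra.
Qed.

End theory.
End sublinear_operators.

(** * The worst-case random walk and its action on quadratics and quartics *)

Section random_walk.
Context {R : realType}.
Variables (sl su : R) (hsl : 0 <= sl) (hsu : sl <= su).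
Implicit Types (f g : R -> R) (h s t : R).
Local Notation k := (su ^+ 2).
Local Notation G := (Gfun sl su).

(** One step of a symmetric walk with variance [s ^+ 2 * h]. Only the two extreme volatilities enter
    [scheme], because [Gfun] is the maximum of its two extreme linear parts ([GfunE]). *)
Definition rw_step s h f y : R :=
  2^-1 * (f (y + s * Num.sqrt h) + f (y - s * Num.sqrt h)).

Definition scheme h f y : R := Num.max (rw_step su h f y) (rw_step sl h f y).

Lemma sublinear_op_rw s h : sublinear_op (rw_step s h).
Proof.
split=> [f g fg y|f g y|c f y c0|c f y|x f y]; rewrite /rw_step.
- by rewrite ler_wpM2l// lerD.
- by lra.
- by lra.
- by lra.
- by congr (_ * (f _ + f _)); lra.
Qed.

Lemma sublinear_op_scheme h : sublinear_op (scheme h).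
Proof.
have S1 := sublinear_op_rw su h; have S2 := sublinear_op_rw sl h.
split=> [f g fg y|f g y|c f y c0|c f y|x f y]; rewrite /scheme.
- by rewrite ge_max !le_max (slop_le S1)//= (slop_le S2)// orbT.
- rewrite ge_max; apply/andP; split.
    by apply: le_trans (slopD S1 _ _ _) _; rewrite lerD// le_max lexx.
  by apply: le_trans (slopD S2 _ _ _) _; rewrite lerD// le_max lexx orbT.
- by rewrite (slopZ S1)// (slopZ S2)// maxr_pMr.
- by rewrite (slopC S1)// (slopC S2)// addr_maxl.
- by rewrite (slop_shift S1)// (slop_shift S2).
Qed.

Lemma GfunE a : G a = Num.max (2^-1 * (su ^+ 2 * a)) (2^-1 * (sl ^+ 2 * a)).
Proof.
have k12 : sl ^+ 2 <= su ^+ 2 by rewrite ler_sqr// nnegrE ?(le_trans hsl).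
rewrite /Gfun; have [a0|a0] := leP 0 a.
  rewrite (@max_r _ _ (- a)) ?oppr_le0//.
  rewrite max_l ?ler_pM2l ?ler_wpM2r// ?mulr0 ?subr0//.
rewrite (@max_l _ _ (- a)) ?oppr_ge0 ?(ltW a0)//.
rewrite max_r ?ler_pM2l ?ler_wnM2r// ?(ltW a0)//.
by rewrite !mulr0 mulrN sub0r opprK.
Qed.

Lemma Gfun_ge s a : s = su \/ s = sl -> 2^-1 * (s ^+ 2 * a) <= G a.
Proof. by rewrite GfunE le_max => -[] ->; rewrite lexx ?orbT. Qed.

Lemma Gfun_attained a : exists2 s, s = su \/ s = sl & G a = 2^-1 * (s ^+ 2 * a).
Proof.
rewrite GfunE; have [h|h] := leP (2^-1 * (su ^+ 2 * a)) (2^-1 * (sl ^+ 2 * a)).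
  by exists sl; [right|].
by exists su; [left|].
Qed.

Lemma Gfun_le a c : 0 <= c -> G (a + c) <= G a + 2^-1 * (k * c).
Proof.
move=> c0; have k12 : sl ^+ 2 <= su ^+ 2 by rewrite ler_sqr// nnegrE ?(le_trans hsl).
rewrite [in leLHS]GfunE ge_max; apply/andP; split.
  by rewrite mulrDr mulrDr lerD2r; apply: Gfun_ge; left.
rewrite mulrDr mulrDr; apply: lerD; first by apply: Gfun_ge; right.
by rewrite ler_pM2l// ler_wpM2r.
Qed.

(** The fourth moment of [z] plus a centred Gaussian of variance [k * tau], hence a solution of the
    heat equation with the largest volatility. A walk with volatility [su] or [sl] has moments no
    larger, so [quart] is a discrete supersolution. *)
Definition quart (tau z : R) : R :=
  z ^+ 4 + 6 * k * tau * z ^+ 2 + 3 * k ^+ 2 * tau ^+ 2.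

Lemma rw_step_quart s h tau y y0 : s = su \/ s = sl -> 0 <= h -> 0 <= tau ->
  rw_step s h (fun z => quart tau (z - y0)) y <= quart (tau + h) (y - y0).
Proof.
move=> ssu h0 t0; rewrite /rw_step /quart.
have s2 : s ^+ 2 <= k.
  by case: ssu => ->; rewrite // ler_sqr// nnegrE ?(le_trans hsl).
set q := Num.sqrt h; have qh : q ^+ 2 = h by rewrite sqr_sqrtr.
have s0 : 0 <= s ^+ 2 by exact: sqr_ge0.
rewrite -qh in h0 *; set b := s ^+ 2 in s2 s0.
set z := y - y0.
have -> : y + s * q - y0 = z + s * q by rewrite /z; lra.
have -> : y - s * q - y0 = z - s * q by rewrite /z; lra.
have -> : 2^-1 * ((z + s * q) ^+ 4 + 6 * k * tau * (z + s * q) ^+ 2 +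
    3 * k ^+ 2 * tau ^+ 2 +
   ((z - s * q) ^+ 4 + 6 * k * tau * (z - s * q) ^+ 2 +
    3 * k ^+ 2 * tau ^+ 2)) =
   z ^+ 4 + 6 * b * q ^+ 2 * z ^+ 2 + b ^+ 2 * (q ^+ 2) ^+ 2 +
   6 * k * tau * (z ^+ 2 + b * q ^+ 2) + 3 * k ^+ 2 * tau ^+ 2.
  by rewrite /b; field.
set m := q ^+ 2 in h0 *.
rewrite -subr_ge0.
have -> : z ^+ 4 + 6 * k * (tau + m) * z ^+ 2 + 3 * k ^+ 2 * (tau + m) ^+ 2 -
 (z ^+ 4 + 6 * b * m * z ^+ 2 + b ^+ 2 * m ^+ 2 +
  6 * k * tau * (z ^+ 2 + b * m) + 3 * k ^+ 2 * tau ^+ 2) =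
  6 * (k - b) * m * z ^+ 2 + 6 * k * tau * m * (k - b) +
  (3 * k ^+ 2 - b ^+ 2) * m ^+ 2 by ring.
have k0 : 0 <= k by exact: sqr_ge0.
have kb : 0 <= k - b by rewrite subr_ge0.
have z0 : 0 <= z ^+ 2 by exact: sqr_ge0.
have n6 : (0 : R) <= 6 by exact: ler0n.
rewrite !addr_ge0//.
- by do 3 apply: mulr_ge0 => //.
- by do 4 apply: mulr_ge0 => //.
- rewrite mulr_ge0 ?sqr_ge0// subr_ge0.
  have : b ^+ 2 <= k ^+ 2 by rewrite ler_sqr// nnegrE.
  by have := sqr_ge0 k; lra.
Qed.

Lemma rw_step_quad s h a c b y y0 : 0 <= h ->
  rw_step s h (fun z => c + b * (z - y0) + 2^-1 * a * (z - y0) ^+ 2) y =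
  c + b * (y - y0) + 2^-1 * a * (y - y0) ^+ 2 + h * (2^-1 * (s ^+ 2 * a)).
Proof.
move=> h0; rewrite /rw_step.
set q := Num.sqrt h; have <- : q ^+ 2 = h by rewrite sqr_sqrtr.
by field.
Qed.

(** A quadratic gains at most [h * G a] at each step, and the quartic error is carried along by
    [quart]. At the centre only the constant term of [quart] survives, which is of second order in
    the elapsed time. *)
Lemma iter_scheme_le f h n c b a K y0 : 0 <= h -> 0 <= K ->
  (forall z, f z <= c + b * (z - y0) + 2^-1 * a * (z - y0) ^+ 2 + K * (z - y0) ^+ 4) ->
  iter n (scheme h) f y0 <=
  c + n%:R * h * G a + K * (3 * k ^+ 2 * (n%:R * h) ^+ 2).
Proof.
move=> h0 K0 fle.
suff H z : iter n (scheme h) f z <=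
  (c + n%:R * h * G a) + b * (z - y0) + 2^-1 * a * (z - y0) ^+ 2 +
  K * quart (n%:R * h) (z - y0).
  by apply: le_trans (H y0) _; rewrite /quart subrr; lra.
elim: n z => [|n IH] z.
  by rewrite /= /quart !mul0r mulr0 !expr0n /=; apply: le_trans (fle z) _; lra.
rewrite iterS.
have step s : s = su \/ s = sl -> rw_step s h (iter n (scheme h) f) z <=
  c + n.+1%:R * h * G a + b * (z - y0) + 2^-1 * a * (z - y0) ^+ 2 +
  K * quart (n.+1%:R * h) (z - y0).
  move=> ss; have sR := sublinear_op_rw s h.
  apply: le_trans (slop_le sR IH z) _.
  apply: le_trans (slopD sR _ _ _) _.
  rewrite rw_step_quad// (slopZ sR)//.
  have := @rw_step_quart s h (n%:R * h) z y0 ss h0 (mulr_ge0 (ler0n _ _) h0).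
  move=> /(ler_wpM2l K0) Q; have := ler_wpM2l h0 (Gfun_ge a ss) => GG.
  have -> : n.+1%:R * h = n%:R * h + h by rewrite -natr1 mulrDl mul1r.
  apply: lerD; last exact: Q.
  rewrite [(n%:R * h + h) * _]mulrDl; lra.
by rewrite /scheme ge_max !step//; [right|left].
Qed.

(** For the lower bound it is enough to follow one walk, whose volatility attains [G a]: the scheme
    dominates each of its two walks, and this one gains exactly [h * G a] per step on the
    quadratic. *)
Lemma iter_scheme_ge f h n c b a K y0 : 0 <= h -> 0 <= K ->
  (forall z, c + b * (z - y0) + 2^-1 * a * (z - y0) ^+ 2 - K * (z - y0) ^+ 4 <= f z) ->
  c + n%:R * h * G a - K * (3 * k ^+ 2 * (n%:R * h) ^+ 2) <=
  iter n (scheme h) f y0.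
Proof.
move=> h0 K0 fge.
have [s ss Gs] := Gfun_attained a.
suff H z : (c + n%:R * h * G a) + b * (z - y0) + 2^-1 * a * (z - y0) ^+ 2 -
  K * quart (n%:R * h) (z - y0) <= iter n (scheme h) f z.
  by apply: le_trans (H y0); rewrite /quart subrr; lra.
elim: n z => [|n IH] z.
  by rewrite /= /quart !mul0r mulr0 !expr0n /=; apply: le_trans (fge z); lra.
rewrite iterS; apply: (@le_trans _ _ (rw_step s h (iter n (scheme h) f) z)); last first.
  by rewrite /scheme le_max; case: ss => ->; rewrite lexx ?orbT.
have sR := sublinear_op_rw s h.
apply: le_trans (slop_le sR IH z).
have := @rw_step_quart s h (n%:R * h) z y0 ss h0 (mulr_ge0 (ler0n _ _) h0).
move=> /(ler_wpM2l K0) Q.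
have -> : n.+1%:R * h = n%:R * h + h by rewrite -natr1 mulrDl mul1r.
have := rw_step_quad s a (c + n%:R * h * G a) b z y0 h0.
rewrite -Gs => E.
have -> : rw_step s h (fun y => c + n%:R * h * G a + b * (y - y0) +
     2^-1 * a * (y - y0) ^+ 2 - K * quart (n%:R * h) (y - y0)) z =
  rw_step s h (fun z0 => c + n%:R * h * G a + b * (z0 - y0) +
     2^-1 * a * (z0 - y0) ^+ 2) z -
  K * rw_step s h (fun y => quart (n%:R * h) (y - y0)) z.
  by rewrite /rw_step; ring.
rewrite {}E [(n%:R * h + h) * _]mulrDl; lra.
Qed.

End random_walk.

(** * The nonlinear heat semigroup as an ultralimit of schemes *)

Section heat_semigroup.
Context {R : realType}.
Variables (sl su : R) (hsl : 0 <= sl) (hsu : sl <= su).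
Implicit Types (f g : R -> R) (h s t M N c d x y a b e K L : R).
Local Notation k := (su ^+ 2).
Local Notation G := (Gfun sl su).

Definition bounded_lip (M L : R) f :=
  (forall x, `|f x| <= M) /\ (forall x y, `|f x - f y| <= L * `|x - y|).

Definition mesh n : R := 2^-1 ^+ n.
Definition nsteps t n : nat := Num.truncn (t * 2 ^+ n).

Lemma mesh_gt0 n : 0 < mesh n.
Proof. by rewrite exprn_gt0. Qed.

Lemma cvg_mesh : mesh @ \oo --> (0 : R).
Proof.
apply: cvg_expr; rewrite gtr0_norm// invf_lt1//; by rewrite ltr1n.
Qed.

Lemma nsteps_itv t n : 0 <= t ->
  (nsteps t n)%:R * mesh n <= t < (nsteps t n)%:R * mesh n + mesh n.
Proof.
move=> t0; have p0 : 0 < (2 : R) ^+ n by rewrite exprn_gt0.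
have t1 : 0 <= t * 2 ^+ n by rewrite mulr_ge0// ltW.
have /andP[a b] := truncn_itv t1.
rewrite /mesh exprVn; apply/andP; split.
  by rewrite ler_pdivrMr.
rewrite -[X in _ + X]mul1r -mulrDl ltr_pdivlMr// natr1; exact: b.
Qed.

Lemma cvg_nsteps t : 0 <= t -> (fun n => (nsteps t n)%:R * mesh n) @ \oo --> t.
Proof.
move=> t0; apply: (@squeeze_cvgr _ _ _ _ (fun n => t - mesh n) (cst t)).
- near=> n; have /andP[a /ltW b] := nsteps_itv n t0.
  by rewrite /= lerBlDr b a.
- rewrite -[X in _ --> X]subr0; apply: cvgB; [exact: cvg_cst|exact: cvg_mesh].
- exact: cvg_cst.
Unshelve. all: by end_near.
Qed.

(** Rounding down two times separately may lose one full step; [scheme_dist] shows that a single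
    step is harmless. *)
Lemma nstepsD s t n : 0 <= s -> 0 <= t ->
  nsteps (s + t) n = (nsteps s n + nsteps t n)%N \/
  nsteps (s + t) n = (nsteps s n + nsteps t n).+1.
Proof.
move=> s0 t0; have st0 : 0 <= s + t by rewrite addr_ge0.
have /andP[a1 a2] := nsteps_itv n s0; have /andP[b1 b2] := nsteps_itv n t0.
have /andP[c1 c2] := nsteps_itv n st0.
have h0 := mesh_gt0 n.
set a := nsteps s n in a1 a2 *; set b := nsteps t n in b1 b2 *.
set c := nsteps _ n in c1 c2 *; set h := mesh n in a1 a2 b1 b2 c1 c2 h0.
have H1 : (a + b < c.+1)%N.
  rewrite -(ltr_nat R) -(ltr_pM2r h0) -natr1 natrD; lra.
have H2 : (c < (a + b).+2)%N.
  rewrite -(ltr_nat R) -(ltr_pM2r h0) -addn2 !natrD; lra.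
move: H2; rewrite ltnS leq_eqVlt => /orP[/eqP->|H2]; first by right.
by left; apply/eqP; rewrite eqn_leq -ltnS H2 -ltnS.
Qed.

Definition heat t f y : R :=
  ulim (fun n => iter (nsteps t n) (scheme sl su (mesh n)) f y).

Let opS n m : sublinear_op (iter m (@scheme R sl su (mesh n))).
Proof. exact: sublinear_op_iter (sublinear_op_scheme _ _ _). Qed.

Lemma heat_seq_bounded M f t y : (forall x, `|f x| <= M) ->
  bounded_seq (fun n => iter (nsteps t n) (scheme sl su (mesh n)) f y).
Proof. by move=> fM; exists M => n; exact: (slop_bounded (opS n _) fM). Qed.

Lemma heat_cvg M f t y : (forall x, `|f x| <= M) ->
  (fun n => iter (nsteps t n) (scheme sl su (mesh n)) f y) @ oo_ultra --> heat t f y.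
Proof. by move=> fM; apply: ulim_cvg; exact: heat_seq_bounded fM. Qed.

Lemma heat0 f y : heat 0 f y = f y.
Proof.
rewrite /heat -[RHS](ulim_cst (f y)); congr (ulim _); apply/funext => n.
by rewrite /nsteps mul0r truncn0.
Qed.

Lemma heat_cst c t y : heat t (fun=> c) y = c.
Proof.
rewrite /heat -[RHS](ulim_cst c); congr (ulim _); apply/funext => n.
by rewrite (slop_cst (opS n _)).
Qed.

Lemma heat_bounded M f t y : (forall x, `|f x| <= M) -> `|heat t f y| <= M.
Proof.
move=> fM; rewrite -[heat _ _ _]subr0 -[0](ulim_cst (0 : R)).
apply: ulim_norm; [exact: heat_seq_bounded fM|exact: bounded_seq_cst|].
by apply: nearW => n; rewrite subr0; exact: (slop_bounded (opS n _) fM).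
Qed.

Lemma heat_dist M N f g d t y : (forall x, `|f x| <= M) -> (forall x, `|g x| <= N) ->
  (forall x, `|f x - g x| <= d) -> `|heat t f y - heat t g y| <= d.
Proof.
move=> fM gN fg; apply: ulim_norm; [exact: heat_seq_bounded fM|exact: heat_seq_bounded gN|].
apply: nearW => n.
have H f1 f2 : (forall x, `|f1 x - f2 x| <= d) ->
    iter (nsteps t n) (scheme sl su (mesh n)) f1 y <=
    iter (nsteps t n) (scheme sl su (mesh n)) f2 y + d.
  move=> f12; apply: (slop_distC (opS n _)) => z.
  by have := f12 z; rewrite ler_norml => /andP[_]; rewrite lerBlDl addrC.
have h1 := H _ _ fg; have h2 : forall x, `|g x - f x| <= d by move=> x; rewrite distrC.
have {}h2 := H _ _ h2.
by rewrite ler_norml; apply/andP; split; lra.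
Qed.

Lemma heat_le M N f g t y : (forall x, `|f x| <= M) -> (forall x, `|g x| <= N) ->
  (forall x, f x <= g x) -> heat t f y <= heat t g y.
Proof.
move=> fM gN fg; apply: ulim_le; [exact: heat_seq_bounded fM|exact: heat_seq_bounded gN|].
by apply: nearW => n; exact: (slop_le (opS n _)).
Qed.

Lemma heatD M N f g t y : (forall x, `|f x| <= M) -> (forall x, `|g x| <= N) ->
  heat t (fun z => f z + g z) y <= heat t f y + heat t g y.
Proof.
move=> fM gN; rewrite /heat -ulimD; [|exact: heat_seq_bounded fM|exact: heat_seq_bounded gN].
apply: ulim_le; last by apply: nearW => n; exact: (slopD (opS n _)).
  apply: (@heat_seq_bounded (M + N)) => x.
  by rewrite (le_trans (ler_normD _ _))// lerD.
by apply: bounded_seqD; [exact: heat_seq_bounded fM|exact: heat_seq_bounded gN].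
Qed.

Lemma heatZ M f c t y : (forall x, `|f x| <= M) -> 0 <= c ->
  heat t (fun z => c * f z) y = c * heat t f y.
Proof.
move=> fM c0; rewrite /heat -ulimZ; last exact: heat_seq_bounded fM.
by congr ulim; apply/funext => n; rewrite (slopZ (opS n _)).
Qed.

Lemma heatC M f c t y : (forall x, `|f x| <= M) ->
  heat t (fun z => f z + c) y = heat t f y + c.
Proof.
move=> fM; rewrite /heat -[c in RHS]ulim_cst -ulimD; last 2 first.
- exact: heat_seq_bounded fM.
- exact: bounded_seq_cst.
by congr ulim; apply/funext => n; rewrite (slopC (opS n _)).
Qed.

Lemma heat_shift f x t y : heat t (fun z => f (z + x)) y = heat t f (y + x).
Proof. by congr ulim; apply/funext => n; rewrite (slop_shift (opS n _)). Qed.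

Lemma heat_lip M L f t : bounded_lip M L f -> bounded_lip M L (heat t f).
Proof.
move=> [fM fL]; split=> [y|x y]; first exact: heat_bounded.
apply: ulim_norm; [exact: heat_seq_bounded fM|exact: heat_seq_bounded fM|].
by apply: nearW => n; exact: (slop_lipschitz (opS n _)).
Qed.

Lemma Gfun_abs a : `|G a| <= 2^-1 * k * `|a|.
Proof.
have k12 : sl ^+ 2 <= su ^+ 2 by rewrite ler_sqr// nnegrE ?(le_trans hsl).
have s0 := sqr_ge0 sl.
have [s ss ->] := Gfun_attained hsl hsu a.
rewrite normrM gtr0_norm// normrM mulrA ler_wpM2r// ler_wpM2l//.
by rewrite ger0_norm ?sqr_ge0//; case: ss => ->.
Qed.

Lemma cvg_quartic t c a K : 0 <= t ->
  (fun n => c + ((nsteps t n)%:R * mesh n) * G a +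
    K * (3 * k ^+ 2 * ((nsteps t n)%:R * mesh n) ^+ 2)) @ oo_ultra -->
  c + t * G a + K * (3 * k ^+ 2 * t ^+ 2).
Proof.
move=> t0.
have cs : (fun n => (nsteps t n)%:R * mesh n) @ oo_ultra --> t.
  by move=> B /(cvg_nsteps t0) ?; exact: oo_ultra_near.
apply: cvgD; first by apply: cvgD; [exact: cvg_cst|apply: cvgMl].
by do 2 (apply: cvgMr_tmp || apply: cvgM; first exact: cvg_cst); rewrite expr2; apply: cvgM.
Qed.

(** The limit of [iter_scheme_le]. The equation, the regularity in time and the fourth moments of
    increments are all read off from this estimate or from its mirror image. *)
Lemma heat_le_quartic M f t y c b a K : 0 <= t -> 0 <= K ->
  (forall x, `|f x| <= M) ->
  (forall z, f z <= c + b * (z - y) + 2^-1 * a * (z - y) ^+ 2 + K * (z - y) ^+ 4) ->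
  heat t f y <= c + t * G a + K * (3 * k ^+ 2 * t ^+ 2).
Proof.
move=> t0 K0 fM fle.
apply: (oo_ultra_le (heat_cvg (t := t) (y := y) fM) (@cvg_quartic t c a K t0)).
apply: nearW => n.
exact: (iter_scheme_le hsl hsu (nsteps t n) (ltW (mesh_gt0 n)) K0 fle).
Qed.

Lemma heat_ge_quartic M f t y c b a K : 0 <= t -> 0 <= K ->
  (forall x, `|f x| <= M) ->
  (forall z, c + b * (z - y) + 2^-1 * a * (z - y) ^+ 2 - K * (z - y) ^+ 4 <= f z) ->
  c + t * G a - K * (3 * k ^+ 2 * t ^+ 2) <= heat t f y.
Proof.
move=> t0 K0 fM fle; rewrite -mulNr.
apply: (oo_ultra_le (@cvg_quartic t c a (- K) t0) (heat_cvg (t := t) (y := y) fM)).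
apply: nearW => n; rewrite mulNr.
exact: (iter_scheme_ge hsl hsu (nsteps t n) (ltW (mesh_gt0 n)) K0 fle).
Qed.

Lemma bounded_lip_ge0 M L f : bounded_lip M L f -> 0 <= M /\ 0 <= L.
Proof.
move=> [fM fL]; split; first exact: le_trans (fM 0).
by have := fL 1 0; rewrite subr0 normr1 mulr1; exact: le_trans.
Qed.

Lemma heat_time M L f t y : bounded_lip M L f -> 0 <= t ->
  `|heat t f y - f y| <= L * (1 + k) * Num.sqrt t.
Proof.
move=> bf; have [M0 L0] := bounded_lip_ge0 bf; case: bf => fM fL.
rewrite le_eqVlt => /orP[/eqP<-|t0].
  by rewrite heat0 subrr normr0 sqrtr0 mulr0.
set q := Num.sqrt t; have q0 : 0 < q by rewrite sqrtr_gt0.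
have qt : t = q ^+ 2 by rewrite sqr_sqrtr// ltW.
(* The parabola [L * q + L / q * (z - y) ^+ 2] lies above the cone [L * |z - y|], and with
   [q = sqrt t] its height and its gain [t * G a] are of the same order. *)
set a := 2 * (L / q).
have a0 : 0 <= a by rewrite mulr_ge0// divr_ge0// ltW.
have az z : L * `|z - y| <= L * q + 2^-1 * a * (z - y) ^+ 2.
  rewrite -(real_normK (num_real (z - y))) /a; set w := `|_|.
  rewrite (_ : _ + _ = L * (q + w ^+ 2 / q)); last by field; rewrite gt_eqF.
  apply: ler_wpM2l => //; rewrite -(ler_pM2r q0) mulrDl divfK ?gt_eqF//.
  by have := sqr_ge0 (w - q); have := sqr_ge0 w; have := sqr_ge0 q; nra.
have GE : t * (2^-1 * k * a) = k * L * q.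
  by rewrite /a qt; field; rewrite gt_eqF.
have Ga : `|G a| <= 2^-1 * k * a by have := Gfun_abs a; rewrite (ger0_norm a0).
have GNa : `|G (- a)| <= 2^-1 * k * a.
  by have := Gfun_abs (- a); rewrite normrN (ger0_norm a0).
have up : heat t f y <= f y + L * q + t * G a + 0 * (3 * k ^+ 2 * t ^+ 2).
  apply: (@heat_le_quartic M f t y (f y + L * q) 0 a 0) => //; first exact: ltW.
  move=> z; have := fL z y; have := az z.
  by rewrite ler_norml => h1 /andP[h2 h3]; lra.
have dn : f y - L * q + t * G (- a) - 0 * (3 * k ^+ 2 * t ^+ 2) <= heat t f y.
  apply: (@heat_ge_quartic M f t y (f y - L * q) 0 (- a) 0) => //; first exact: ltW.
  move=> z; have := fL z y; have := az z.
  by rewrite ler_norml => h1 /andP[h2 h3]; lra.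
move: Ga GNa; rewrite !ler_norml => /andP[_ h1] /andP[h2 _].
have {}h1 := ler_wpM2l (ltW t0) h1; have {}h2 := ler_wpM2l (ltW t0) h2.
by apply/andP; split; lra.
Qed.

Lemma cvg_sqrt_mesh : (fun n => Num.sqrt (mesh n)) @ \oo --> (0 : R).
Proof.
rewrite -[X in _ --> X](sqrtr0 R); apply: continuous_cvg; last exact: cvg_mesh.
exact: sqrt_continuous.
Qed.

Lemma scheme_dist L f h y : (forall x y, `|f x - f y| <= L * `|x - y|) ->
  `|scheme sl su h f y - f y| <= L * (su * Num.sqrt h).
Proof.
move=> fL; have su0 := le_trans hsl hsu; have q0 := sqrtr_ge0 h.
have L0 : 0 <= L by have := fL 1 0; rewrite subr0 normr1 mulr1; exact: le_trans.
set q := Num.sqrt h in q0 *.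
have H s : s = su \/ s = sl -> `|rw_step s h f y - f y| <= L * (su * q).
  move=> ss; have [s0 s1] : 0 <= s /\ s <= su by case: ss => ->.
  have := fL (y + s * q) y; have := fL (y - s * q) y.
  rewrite addrAC subrr add0r (addrAC y) subrr add0r normrN normrM.
  rewrite (ger0_norm s0) (ger0_norm q0) !ler_norml => /andP[h1 h2] /andP[h3 h4].
  have : L * (s * q) <= L * (su * q) by rewrite ler_wpM2l// ler_wpM2r.
  by rewrite /rw_step -/q => h5; apply/andP; split; lra.
by rewrite /scheme /Num.max; case: ifPn => _; apply: H; [right|left].
Qed.

(** All iterates share the Lipschitz constant of f, so pointwise convergence along the ultrafilter
    is uniform on compact sets. *)
Lemma heat_unif M L f t y N e : bounded_lip M L f -> 0 < e ->
  \forall n \near oo_ultra, forall z, `|z - y| <= N ->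
    `|iter (nsteps t n) (scheme sl su (mesh n)) f z - heat t f z| <= e.
Proof.
move=> bf e0; have [M0 L0] := bounded_lip_ge0 bf; case: bf => fM fL.
have := @segment_compact R (y - N) (y + N).
move=> /compact_near_coveringP/(_ nat oo_ultra
  (fun n z => `|iter (nsteps t n) (scheme sl su (mesh n)) f z - heat t f z| <= e)).
move=> cN; apply: filterS (cN _ _).
- by move=> n Hn z; rewrite distrC => zy; apply: Hn; rewrite /= in_itv /= -ler_distlC// distrC.
- move=> z zN.
  have e2 : 0 < e / 2 by rewrite divr_gt0.
  have /cvgrPdist_le/(_ _ e2) cz := heat_cvg (t := t) (y := z) fM.
  have Lz : 0 < e / 4 / (L + 1) by rewrite !divr_gt0// ltr_wpDl.
  exists ([set z' | `|z - z'| < e / 4 / (L + 1)],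
          [set n | `|heat t f z - iter (nsteps t n) (scheme sl su (mesh n)) f z| <= e / 2]).
    by split => //=; exact: nbhsx_ballx.
  move=> [z' n] [/= zz' fn].
  have h1 := slop_lipschitz (opS n (nsteps t n)) fL z' z.
  have [_ h2] := heat_lip t (conj fM fL); have {}h2 := h2 z z'.
  have h3 : L * `|z - z'| <= e / 4.
    have h : (L + 1) * `|z - z'| <= e / 4.
      by rewrite mulrC -ler_pdivlMr ?ltr_wpDl// ltW.
    by apply: le_trans h; rewrite ler_wpM2r// lerDl.
  rewrite (distrC z' z) in h1.
  move: h1 h2 fn; rewrite !ler_norml => /andP[a1 a2] /andP[b1 b2] /andP[c1 c2].
  by apply/andP; split; lra.
Qed.

(** The scheme run for time t is uniformly near [heat t f] only on a bounded interval. The gap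
    elsewhere, at most 2M, is put under a parabola, whose propagation during time s is controlled by
    [iter_scheme_le]. *)
Lemma heat_semigroup M L f s t y : bounded_lip M L f -> 0 <= s -> 0 <= t ->
  heat (s + t) f y = heat s (heat t f) y.
Proof.
move=> bf s0 t0; have [M0 L0] := bounded_lip_ge0 bf.
have bg := heat_lip t bf; set g := heat t f in bg *.
have [fM fL] := bf; have [gM gL] := bg.
have k0 : 0 <= k by exact: sqr_ge0.
apply/eqP; rewrite -subr_eq0 -normr_le0; apply/ler_addgt0Pr => e e0; rewrite add0r.
apply: ulim_norm; [exact: heat_seq_bounded fM|exact: heat_seq_bounded gM|].
have skM : 0 <= 8 * (s * k * M) / e.
  by rewrite divr_ge0 ?(ltW e0)// mulr_ge0// mulr_ge0// mulr_ge0.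
(* With this [N] a parabola of curvature [4 * M / N ^+ 2] gains at most e / 4 during time s. *)
pose N := Num.sqrt (8 * (s * k * M) / e + 1).
have N2 : N ^+ 2 = 8 * (s * k * M) / e + 1.
  by rewrite sqr_sqrtr// addr_ge0.
have N20 : 0 < N ^+ 2 by rewrite N2 ltr_wpDl.
have N0 : 0 <= N by rewrite sqrtr_ge0.
have Nn0 : N != 0 by move: N20; rewrite lt0r sqrf_eq0 => /andP[].
have p0 : 0 <= 4 * M / N ^+ 2 by rewrite divr_ge0 ?mulr_ge0// ltW.
have e4 : 0 < e / 4 by rewrite divr_gt0.
have su0 := le_trans hsl hsu.
have hq : \forall n \near oo_ultra, L * (su * Num.sqrt (mesh n)) <= e / 2.
  apply: oo_ultra_near.
  have e2 : 0 < e / 2 / (L * su + 1) by rewrite !divr_gt0// ltr_wpDl// mulr_ge0.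
  have /cvgrPdist_le/(_ _ e2) := cvg_sqrt_mesh.
  apply: filterS => n; rewrite sub0r normrN ger0_norm ?sqrtr_ge0// => h.
  rewrite mulrA; apply: (@le_trans _ _ ((L * su + 1) * Num.sqrt (mesh n))).
    by rewrite ler_wpM2r ?sqrtr_ge0// lerDl.
  by rewrite mulrC -ler_pdivlMr// ltr_wpDl// mulr_ge0.
have hu := heat_unif t y N bf e4.
near=> n.
have q1 : L * (su * Num.sqrt (mesh n)) <= e / 2 by near: n.
have u1 : forall z, `|z - y| <= N ->
    `|iter (nsteps t n) (scheme sl su (mesh n)) f z - g z| <= e / 4 by near: n.
set S := scheme sl su (mesh n); set a := nsteps s n; set b := nsteps t n.
(* The possible extra step from rounding moves the iterate by at most [L * (su * sqrt (mesh n))]. *)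
have p1 : `|iter (nsteps (s + t) n) S f y - iter (a + b) S f y| <= e / 2.
  have [->|->] := nstepsD n s0 t0; first by rewrite subrr normr0 divr_ge0// ltW.
  apply: le_trans q1; rewrite iterS; apply: scheme_dist.
  exact: (slop_lipschitz (opS n _)).
pose F := iter b S f; have FM z : `|F z| <= M by exact: (slop_bounded (opS n _) fM).
pose D z := e / 4 + 2^-1 * (4 * M / N ^+ 2) * (z - y) ^+ 2.
have FD z : `|F z - g z| <= D z.
  rewrite /D; have d0 : 0 <= 2^-1 * (4 * M / N ^+ 2) * (z - y) ^+ 2.
    by apply: mulr_ge0; [exact: mulr_ge0|exact: sqr_ge0].
  have [zN|zN] := leP `|z - y| N; first by apply: le_trans (u1 _ zN) _; rewrite lerDl.
  apply: (@le_trans _ _ (2 * M)).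
    by rewrite (le_trans (ler_normB _ _))// mulr2n mulrDl mul1r lerD.
  apply: ler_wpDl; first exact: ltW.
  have -> : 2^-1 * (4 * M / N ^+ 2) * (z - y) ^+ 2 = (2 * M) * ((z - y) ^+ 2 / N ^+ 2).
    by field.
  rewrite ler_peMr ?mulr_ge0// ler_pdivlMr// mul1r -(real_normK (num_real (z - y))).
  by rewrite ler_sqr ?nnegrE// ltW.
have DE : iter a S D y <= e / 2.
  have := @iter_scheme_le R sl su hsl hsu D (mesh n) a (e / 4) 0 (4 * M / N ^+ 2) 0 y
    (ltW (mesh_gt0 n)) (lexx _).
  have h1 z : D z <= e / 4 + 0 * (z - y) + 2^-1 * (4 * M / N ^+ 2) * (z - y) ^+ 2 +
    0 * (z - y) ^+ 4 by rewrite /D; lra.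
  move=> /(_ h1) h2; apply: le_trans h2 _.
  have /andP[as_ _] := nsteps_itv n s0.
  have := Gfun_abs (4 * M / N ^+ 2); rewrite (ger0_norm p0) => G1.
  have {}G1 := le_trans (ler_norm _) G1.
  have ah : 0 <= a%:R * mesh n by rewrite mulr_ge0// ltW// mesh_gt0.
  have h3 : a%:R * mesh n * G (4 * M / N ^+ 2) <= e / 4.
    apply: le_trans (ler_wpM2l ah G1) _.
    apply: (@le_trans _ _ (s * (2^-1 * k * (4 * M / N ^+ 2)))).
      by rewrite ler_wpM2r// mulr_ge0// mulr_ge0.
    rewrite (_ : _ * _ = (2 * (s * k * M)) / N ^+ 2); last first.
      by field.
    rewrite ler_pdivrMr// N2 mulrDr mulr1.
    rewrite (_ : e / 4 * _ = 2 * (s * k * M)); last by field; rewrite gt_eqF.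
    by rewrite lerDl ltW.
  lra.
have p2 : `|iter (a + b) S f y - iter a S g y| <= e / 2.
  rewrite iterD -/F.
  have h1 : iter a S F y <= iter a S g y + iter a S D y.
    apply: (slop_dist (opS n a)) => z.
    by have := FD z; rewrite ler_norml => /andP[_]; rewrite lerBlDl.
  have h2 : iter a S g y <= iter a S F y + iter a S D y.
    apply: (slop_dist (opS n a)) => z.
    by have := FD z; rewrite distrC ler_norml => /andP[_]; rewrite lerBlDl.
  by rewrite ler_norml; apply/andP; split; lra.
rewrite (le_trans (ler_distD (iter (a + b) S f y) _ _))//.
by rewrite [e in leRHS](splitr e) lerD.
Unshelve. all: by end_near.
Qed.

End heat_semigroup.

(** * The semigroup solves the G-heat equation *)

Section viscosity_existence.
Context {R : realType}.
Implicit Types (f g : R -> R) (r s t y z e : R).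

Lemma mvt_ball f y r z : (forall x, `|x - y| < r -> derivable f x 1) ->
  `|z - y| < r ->
  exists2 c, `|c - y| <= `|z - y| & f z - f y = (f^`()%classic c) * (z - y).
Proof.
move=> df zr.
have D x : `|x - y| < r -> is_derive x 1 f (f^`()%classic x).
  by move=> xr; rewrite derive1E; exact/derivableP/df.
have C a b : (forall x, a <= x <= b -> `|x - y| < r) -> {within `[a, b], continuous f}.
  move=> H; apply: derivable_within_continuous => x; rewrite in_itv /= => xab.
  exact/df/H.
have DD a b : (forall x, a <= x <= b -> `|x - y| < r) ->
    forall x, x \in `]a, b[ -> is_derive x 1 f (f^`()%classic x).
  move=> H x; rewrite in_itv /= => /andP[/ltW h1 /ltW h2]; apply/D/H.
  by rewrite h1.
have [yz|zy] := leP y z.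
  have H x : y <= x <= z -> `|x - y| < r.
    move=> /andP[h1 h2]; apply: le_lt_trans zr.
    by rewrite !ger0_norm ?subr_ge0// lerD2r.
  have [c cyz E] := MVT_segment yz (DD _ _ H) (C _ _ H).
  exists c => //; move: cyz; rewrite in_itv /= => /andP[h1 h2].
  by rewrite !ger0_norm ?subr_ge0// lerD2r.
have H x : z <= x <= y -> `|x - y| < r.
  move=> /andP[h1 h2]; apply: le_lt_trans zr.
  by rewrite !ler0_norm ?subr_le0 ?(ltW zy)// lerN2 lerD2r.
have [c cyz E] := MVT_segment (ltW zy) (DD _ _ H) (C _ _ H).
exists c; last by rewrite -opprB E -mulrN opprB.
move: cyz; rewrite in_itv /= => /andP[h1 h2].
by rewrite !ler0_norm ?subr_le0 ?(ltW zy)// lerN2 lerD2r.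
Qed.

(** The expansion goes backwards in time only, since the semigroup compares time t with time t - d.
    The time derivative is evaluated near (t, y), the space derivatives only at time t. *)
Lemma C12_taylor (psi : R -> R -> R) t y e : C12 psi -> 0 < t -> 0 < e ->
  exists r, [/\ 0 < r, r < t & forall d z, 0 <= d -> d < r -> `|z - y| < r ->
   `|psi (t - d) z - (psi t y - d * (derive1 (psi ^~ y) t) +
      (derive1 (psi t) y) * (z - y) +
      2^-1 * (derive1n 2 (psi t) y) * (z - y) ^+ 2)| <= e * (d + (z - y) ^+ 2)].
Proof.
move=> [dpsi Ct _ Cyy] t0 e0.
set p := derive1 (psi ^~ y) t; set b := derive1 (psi t) y.
set a := derive1n 2 (psi t) y.
have nbhs_r (h : R * R -> R) : {for (t, y), continuous h} ->
    exists2 r : R, 0 < r & forall s z, `|s - t| < r -> `|z - y| < r -> `|h (s, z) - h (t, y)| <= e.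
  move=> /cvgrPdist_le/(_ _ e0)[/= [A B] [/= /nbhs_ballP[r1 /= r10 A1] /nbhs_ballP[r2 /= r20 B1]]] AB.
  exists (Num.min r1 r2); first by rewrite lt_min r10.
  move=> s z; rewrite !lt_min => /andP[s1 _] /andP[_ z2].
  rewrite distrC; apply: (AB (s, z)); split.
    by apply: A1; rewrite /ball /= distrC.
  by apply: B1; rewrite /ball /= distrC.
have Dty : (t, y) \in [set q : R * R | 0 < q.1] by rewrite inE.
have [r1 r10 H1] := nbhs_r _ (Ct _ Dty).
have [r2 r20 H2] := nbhs_r _ (Cyy _ Dty).
exists (Num.min (Num.min r1 r2) (t / 2)); split.
- by rewrite !lt_min r10 r20 divr_gt0.
- by rewrite gt_min; apply/orP; right; rewrite ltr_pdivrMr// ltr_pMr// ltr1n.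
move=> d z d0; rewrite !lt_min => /andP[/andP[d1 d2] dt] /andP[/andP[z1 z2] zt].
have td : 0 < t - d.
  by rewrite subr_gt0; apply: lt_trans dt _; rewrite ltr_pdivrMr// ltr_pMr// ltr1n.
have T1 : `|psi (t - d) z - psi t z + d * p| <= e * d.
  have dd : `|t - d - t| < t / 2 by rewrite addrAC subrr add0r normrN ger0_norm.
  have [|c ct E] := @mvt_ball (psi ^~ z) t (t / 2) (t - d) _ dd.
    move=> x xt; have x0 : 0 < x.
      move: xt; rewrite ltr_norml => /andP[h _].
      by have := t0; lra.
    have [D1 _ _] := dpsi x z x0; exact: D1.
  have {}E : psi (t - d) z - psi t z = derive1 (psi ^~ z) c * (t - d - t) := E.
  rewrite E.
  have -> : derive1 (psi ^~ z) c * (t - d - t) + d * p =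
    - (d * (derive1 (psi ^~ z) c - p)) by ring.
  rewrite normrN normrM (ger0_norm d0) mulrC ler_wpM2r//.
  apply: (H1 c z) => //; apply: le_lt_trans ct _.
  by rewrite addrAC subrr add0r normrN ger0_norm.
have T2 : `|psi t z - psi t y - b * (z - y) - 2^-1 * a * (z - y) ^+ 2| <= e * (z - y) ^+ 2.
  pose q z := psi t z - b * (z - y) - 2^-1 * a * (z - y) ^+ 2.
  have dq (x : R) : is_derive x 1 q ((psi t)^`()%classic x - b - a * (x - y)).
    have [_ dx _] := dpsi t x t0.
    have dx' : is_derive x 1 (psi t) ((psi t)^`()%classic x).
      by rewrite derive1E; exact/derivableP.
    rewrite /q; apply: is_derive_eq; rewrite -[_ *: _]/(_ * _) /=.
    by rewrite /GRing.scale /=; field.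
  have dq' (x : R) : `|x - y| < r2 -> derivable q x 1.
    by move=> _; exact: (@ex_derive _ _ _ _ _ _ _ (dq x)).
  have [c cz E] := mvt_ball dq' z2.
  have dp' (x : R) : `|x - y| < r2 -> derivable (psi t)^`()%classic x 1.
    by move=> _; have [_ _ D3] := dpsi t x t0; exact: D3.
  have [c' cc' E'] := mvt_ball dp' (le_lt_trans cz z2).
  have -> : psi t z - psi t y - b * (z - y) - 2^-1 * a * (z - y) ^+ 2 = q z - q y.
    by rewrite /q subrr; ring.
  rewrite E derive1E (@derive_val _ _ _ _ _ _ _ (dq c)).
  rewrite -/b in E'; rewrite E'.
  rewrite -(real_normK (num_real (z - y))) expr2 mulrA normrM ler_wpM2r//.
  rewrite -mulrBl normrM; apply: ler_pM => //.
  have := H2 t c'; rewrite subrr normr0; apply => //.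
  exact: le_lt_trans cc' (le_lt_trans cz z2).
move: T1 T2; rewrite !ler_norml => /andP[h1 h2] /andP[h3 h4].
by apply/andP; split; lra.
Qed.
End viscosity_existence.

Section heat_solution.
Context {R : realType}.
Variables (sl su : R) (hsl : 0 <= sl) (hsu : sl <= su).
Implicit Types (f g : R -> R) (s t y z a b c d e r K L M p : R).
Local Notation k := (su ^+ 2).
Local Notation G := (Gfun sl su).
Local Notation heat := (heat sl su).

Lemma Gfun_ge_sub a c : 0 <= c -> G a - 2^-1 * (k * c) <= G (a - c).
Proof.
by move=> c0; rewrite lerBlDr -{1}[a](subrK c); exact: Gfun_le.
Qed.

(** Away from 0 a large quartic beats a constant, a linear and a quadratic term: each of the three
    summands of [K] takes care of one of them, since |w| / r is at least 1. *)
Lemma quartic_far M c b a r : 0 < r -> exists2 K, 0 <= K &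
  forall w, r <= `|w| -> M <= c + b * w + 2^-1 * a * w ^+ 2 + K * w ^+ 4.
Proof.
move=> r0; set m := `|M| + `|c|.
have m0 : 0 <= m by rewrite addr_ge0.
pose K := m / r ^+ 4 + `|b| / r ^+ 3 + `|a| / r ^+ 2.
have t1 : 0 <= m / r ^+ 4 by rewrite divr_ge0// exprn_ge0// ltW.
have t2 : 0 <= `|b| / r ^+ 3 by rewrite divr_ge0// exprn_ge0// ltW.
have t3 : 0 <= `|a| / r ^+ 2 by rewrite divr_ge0// exprn_ge0// ltW.
exists K; first by rewrite !addr_ge0.
move=> w rw; set v := `|w| in rw *.
have v0 : 0 < v by exact: lt_le_trans rw.
have vr1 : 1 <= v / r by rewrite ler_pdivlMr// mul1r.
have E2 : w ^+ 2 = v ^+ 2 by rewrite real_normK ?num_real.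
have E4 : w ^+ 4 = v ^+ 4 by rewrite (exprM w 2 2) E2 -exprM.
have P n : 1 <= (v / r) ^+ n by rewrite exprn_ege1.
have h1 : m <= m * (v / r) ^+ 4 by rewrite ler_peMr.
have h2 : `|b| * v <= `|b| * v * (v / r) ^+ 3.
  by rewrite ler_peMr// mulr_ge0// ltW.
have h3 : `|a| * v ^+ 2 <= `|a| * v ^+ 2 * (v / r) ^+ 2.
  by rewrite ler_peMr// mulr_ge0// exprn_ge0// ltW.
have E : K * w ^+ 4 = m * (v / r) ^+ 4 + `|b| * v * (v / r) ^+ 3 +
   `|a| * v ^+ 2 * (v / r) ^+ 2.
  by rewrite E4 /K; field; rewrite gt_eqF.
have hb : - (`|b| * v) <= b * w.
  by rewrite lerNl -mulrN (le_trans (ler_norm _))// normrM normrN.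
have ha : - (`|a| * v ^+ 2) <= 2^-1 * a * w ^+ 2.
  rewrite E2 -mulNr ler_wpM2r ?sqr_ge0//.
  by have := ler_norm (- a); have := normr_ge0 a; rewrite normrN; lra.
have hM := ler_norm M; have hc := ler_norm (- c); rewrite normrN in hc.
by rewrite E /m in h1 *; lra.
Qed.

(** The value at t is the semigroup over a short time dd applied to [heat (t - dd) f]. Near y this
    function is below the Taylor parabola of psi, far from y a quartic takes over; [heat_le_quartic]
    and division by dd give the inequality up to a multiple of e. *)
Lemma heat_touch_up f M L (psi : R -> R -> R) t y : bounded_lip M L f ->
  0 < t -> C12 psi -> (forall s z, 0 < s -> heat s f z <= psi s z) ->
  heat t f y = psi t y ->
  derive1 (psi ^~ y) t - G (derive1n 2 (psi t) y) <= 0.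
Proof.
move=> bf t0 Cpsi hpsi htouch.
have k0 : 0 <= k by exact: sqr_ge0.
apply/ler_addgt0Pr => e0 e00; rewrite add0r.
pose e := e0 / (2 + k).
have e_gt0 : 0 < e by rewrite divr_gt0// ltr_wpDr.
have [r [r0 rt H]] := C12_taylor y Cpsi t0 e_gt0.
set p := derive1 (psi ^~ y) t in H *; set b := derive1 (psi t) y in H.
set a := derive1n 2 (psi t) y in H *.
have [M0 L0] := bounded_lip_ge0 bf.
(* [K] has to be fixed before dd, so the term [dd * (p - e)] is replaced by [r * |p - e|], which
   bounds it for every dd < r. *)
have [K K0 HK] := quartic_far M (psi t y - r * `|p - e|) b (a + 2 * e) r0.
(* The second bound on dd makes the quartic remainder, which is quadratic in dd, at most
   [e * dd]. *)
pose dd := Num.min (r / 2) (e / (3 * K * k ^+ 2 + 1)).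
have q0 : 0 < 3 * K * k ^+ 2 + 1.
  by rewrite ltr_wpDl// mulr_ge0 ?sqr_ge0// mulr_ge0.
have d0 : 0 < dd by rewrite lt_min (divr_gt0 r0)// (divr_gt0 e_gt0).
have dr : dd < r.
  by rewrite gt_min ltr_pdivrMr// ltr_pMr// ltr1n.
have dq : 3 * K * k ^+ 2 * dd <= e.
  have : (3 * K * k ^+ 2 + 1) * dd <= e.
    by rewrite mulrC -ler_pdivlMr// /dd ge_min lexx orbT.
  by rewrite mulrDl mul1r; have := d0; lra.
have fM z : `|heat (t - dd) f z| <= M by apply: heat_bounded; case: bf.
have := @heat_le_quartic R sl su hsl hsu M (heat (t - dd) f) dd y
  (psi t y - dd * (p - e)) b (a + 2 * e) K (ltW d0) K0 fM.
have maj z : heat (t - dd) f z <= psi t y - dd * (p - e) + b * (z - y) +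
   2^-1 * (a + 2 * e) * (z - y) ^+ 2 + K * (z - y) ^+ 4.
  have [zr|zr] := ltP `|z - y| r.
    have := H dd z (ltW d0) dr zr; rewrite ler_norml => /andP[_ h].
    have h' : heat (t - dd) f z <= psi (t - dd) z.
      by apply: hpsi; rewrite subr_gt0 (lt_trans dr).
    have : 0 <= K * (z - y) ^+ 4 by rewrite mulr_ge0// exprn_even_ge0.
    by lra.
  have h1 := HK (z - y) zr; have := fM z; rewrite ler_norml => /andP[_ h2].
  have : dd * (p - e) <= r * `|p - e|.
    apply: le_trans (_ : dd * `|p - e| <= _); last by rewrite ler_wpM2r// ltW.
    by rewrite ler_wpM2l ?ler_norm// ltW.
  by lra.
move=> /(_ maj).
rewrite -(heat_semigroup hsl hsu y bf (ltW d0)) ?subr_ge0 ?(ltW (lt_trans dr rt))//.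
rewrite subrKC htouch => h.
have {h} : dd * (p - e) <= dd * (G (a + 2 * e) + 3 * K * k ^+ 2 * dd) by lra.
rewrite ler_pM2l// => h.
have Ga : G (a + 2 * e) <= G a + 2^-1 * (k * (2 * e)).
  by apply: Gfun_le; rewrite // mulr_ge0// ltW.
have e2 : e0 = e * (2 + k) by rewrite /e divfK// gt_eqF// ltr_wpDr.
by rewrite e2; lra.
Qed.

Lemma heat_touch_down f M L (psi : R -> R -> R) t y : bounded_lip M L f ->
  0 < t -> C12 psi -> (forall s z, 0 < s -> psi s z <= heat s f z) ->
  heat t f y = psi t y ->
  0 <= derive1 (psi ^~ y) t - G (derive1n 2 (psi t) y).
Proof.
move=> bf t0 Cpsi hpsi htouch.
have k0 : 0 <= k by exact: sqr_ge0.
rewrite -oppr_le0; apply/ler_addgt0Pr => e0 e00; rewrite add0r.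
pose e := e0 / (2 + k).
have e_gt0 : 0 < e by rewrite divr_gt0// ltr_wpDr.
have [r [r0 rt H]] := C12_taylor y Cpsi t0 e_gt0.
set p := derive1 (psi ^~ y) t in H *; set b := derive1 (psi t) y in H.
set a := derive1n 2 (psi t) y in H *.
have [M0 L0] := bounded_lip_ge0 bf.
have [K K0 HK] := quartic_far M (- (psi t y + r * `|p + e|)) (- b) (- (a - 2 * e)) r0.
pose dd := Num.min (r / 2) (e / (3 * K * k ^+ 2 + 1)).
have q0 : 0 < 3 * K * k ^+ 2 + 1.
  by rewrite ltr_wpDl// mulr_ge0 ?sqr_ge0// mulr_ge0.
have d0 : 0 < dd by rewrite lt_min (divr_gt0 r0)// (divr_gt0 e_gt0).
have dr : dd < r.
  by rewrite gt_min ltr_pdivrMr// ltr_pMr// ltr1n.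
have dq : 3 * K * k ^+ 2 * dd <= e.
  have : (3 * K * k ^+ 2 + 1) * dd <= e.
    by rewrite mulrC -ler_pdivlMr// /dd ge_min lexx orbT.
  by rewrite mulrDl mul1r; have := d0; lra.
have fM z : `|heat (t - dd) f z| <= M by apply: heat_bounded; case: bf.
have := @heat_ge_quartic R sl su hsl hsu M (heat (t - dd) f) dd y
  (psi t y - dd * (p + e)) b (a - 2 * e) K (ltW d0) K0 fM.
have maj z : psi t y - dd * (p + e) + b * (z - y) +
   2^-1 * (a - 2 * e) * (z - y) ^+ 2 - K * (z - y) ^+ 4 <= heat (t - dd) f z.
  have [zr|zr] := ltP `|z - y| r.
    have := H dd z (ltW d0) dr zr; rewrite ler_norml => /andP[h _].
    have h' : psi (t - dd) z <= heat (t - dd) f z.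
      by apply: hpsi; rewrite subr_gt0 (lt_trans dr).
    have : 0 <= K * (z - y) ^+ 4 by rewrite mulr_ge0// exprn_even_ge0.
    by lra.
  have h1 := HK (z - y) zr; have := fM z; rewrite ler_norml => /andP[h2 _].
  have : dd * - (p + e) <= r * `|p + e|.
    apply: le_trans (_ : dd * `|p + e| <= _); last by rewrite ler_wpM2r// ltW.
    by rewrite -normrN ler_wpM2l ?ler_norm// ltW.
  by lra.
move=> /(_ maj).
rewrite -(heat_semigroup hsl hsu y bf (ltW d0)) ?subr_ge0 ?(ltW (lt_trans dr rt))//.
rewrite subrKC htouch => h.
have {h} : dd * (G (a - 2 * e) - 3 * K * k ^+ 2 * dd) <= dd * (p + e) by lra.
rewrite ler_pM2l// => h.
have Ga : G a - 2^-1 * (k * (2 * e)) <= G (a - 2 * e).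
  by apply: Gfun_ge_sub; rewrite // mulr_ge0// ltW.
have e2 : e0 = e * (2 + k) by rewrite /e divfK// gt_eqF// ltr_wpDr.
by rewrite e2; lra.
Qed.

(** A negative time is truncated to zero steps. Thus the semigroup extends to all real times, and
    its continuity can be proved on the whole plane. *)
Lemma heat_le0 f t y : t <= 0 -> heat t f y = f y.
Proof.
move=> t0; rewrite /heat -[RHS](ulim_cst (f y)); congr (ulim _); apply/funext => n.
suff -> : nsteps t n = 0%N by [].
apply/truncn0Pn; rewrite -ltNge; apply: le_lt_trans ltr01.
by rewrite mulr_le0_ge0// exprn_ge0.
Qed.

Lemma heat_time_dist f M L s t y : bounded_lip M L f ->
  `|heat s f y - heat t f y| <= L * (1 + k) * Num.sqrt `|s - t|.
Proof.
move=> bf.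
have k0 : 0 <= k by exact: sqr_ge0.
have [M0 L0] := bounded_lip_ge0 bf.
wlog st : s t / s <= t.
  move=> H; have [|/ltW ts] := leP s t; first exact: H.
  by rewrite distrC (distrC s); exact: H.
rewrite (distrC s t) (ger0_norm (_ : 0 <= t - s)) ?subr_ge0//.
have LK : 0 <= L * (1 + k) by rewrite mulr_ge0// addr_ge0.
have [s0|/ltW s0] := leP s 0; last first.
  have /= := heat_time hsl hsu y (@heat_lip R sl su M L f s bf) (_ : 0 <= t - s).
  rewrite subr_ge0 => /(_ st); rewrite -(heat_semigroup hsl hsu y bf)//.
    by rewrite subrK distrC.
  by rewrite subr_ge0.
rewrite (heat_le0 f y s0); have [t0|/ltW t0] := leP t 0.
  by rewrite heat_le0// subrr normr0 mulr_ge0// sqrtr_ge0.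
rewrite distrC; apply: le_trans (heat_time hsl hsu y bf t0) _.
by rewrite ler_wpM2l// ler_wsqrtr// lerDl oppr_ge0.
Qed.

Lemma heat_continuous f M L : bounded_lip M L f ->
  continuous (fun q : R * R => heat q.1 f q.2).
Proof.
move=> bf [t y]; apply/cvgrPdist_le => e e0.
have k0 : 0 <= k by exact: sqr_ge0.
have [M0 L0] := bounded_lip_ge0 bf.
have h1 : (fun q : R * R => L * (1 + k) * Num.sqrt `|t - q.1| + L * `|y - q.2|) @ (t, y) --> (0 : R).
  rewrite [X in _ --> X](_ : 0 = L * (1 + k) * Num.sqrt `|t - (t, y).1| + L * `|y - (t, y).2|); last first.
    by rewrite /= !subrr normr0 sqrtr0 !mulr0 addr0.
  apply: cvgD; apply: cvgM; [exact: cvg_cst| |exact: cvg_cst| ].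
    apply: (@cvg_comp _ _ _ (fun q : R * R => `|t - q.1|) Num.sqrt); last exact: sqrt_continuous.
    by apply: cvg_norm; apply: cvgB; [exact: cvg_cst|exact: cvg_fst].
  by apply: cvg_norm; apply: cvgB; [exact: cvg_cst|exact: cvg_snd].
have /cvgrPdist_le/(_ _ e0) := h1; apply: filterS => -[s z] /=.
rewrite sub0r normrN => h; apply: le_trans h.
have [_ hL] := @heat_lip R sl su M L f s bf.
apply: le_trans (ler_norm _); apply: le_trans (ler_distD (heat s f y) _ _) _.
by rewrite lerD// (heat_time_dist t s y bf).
Qed.

Lemma heat_solution f M L : bounded_lip M L f ->
  G_heat_solution sl su f (fun t y => heat t f y).
Proof.
move=> bf; split.
- apply: continuous_subspaceT; exact: heat_continuous bf.
- exists M; split; first exact: num_real.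
  move=> x Mx [s z] _ /=; apply: le_trans (ltW Mx).
  by apply: heat_bounded; case: bf.
- by move=> y; exact: heat0.
- by move=> psi t y t0 Cpsi h1 h2; exact: heat_touch_up bf t0 Cpsi h1 h2.
- by move=> psi t y t0 Cpsi h1 h2; exact: heat_touch_down bf t0 Cpsi h1 h2.
Qed.

End heat_solution.

(** * Comparison for the G-heat equation *)

Section test_functions.
Context {R : realType}.
Implicit Types (s t y z a b c h x : R).

Lemma is_derive_quadratic (f : R -> R) x c K :
  (forall h, `|f (x + h) - f x - c * h| <= K * h ^+ 2) -> is_derive x 1 f c.
Proof.
move=> H.
have cv : h^-1 *: ((f \o shift x) (h *: 1) - f x) @[h --> 0^'] --> c.
  apply/cvgrPdist_le => e e0.
  have K0 : 0 <= K by have := le_trans (normr_ge0 _) (H 1); rewrite expr1n mulr1.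
  have eK : 0 < e / (K + 1) by rewrite divr_gt0// ltr_wpDl.
  near=> h.
  have h0 : h != 0 by near: h; exact: nbhs_dnbhs_neq.
  have he : `|h| <= e / (K + 1).
    near: h; exact: dnbhs0_le.
  have -> : c - h^-1 *: ((f \o shift x) (h *: 1) - f x) =
            - (h^-1 * (f (x + h) - f x - c * h)).
    rewrite /= /GRing.scale /= mulr1 (addrC h x); field.
    exact: h0.
  rewrite normrN normrM normfV ler_pdivrMl ?normr_gt0//.
  apply: le_trans (H h) _; rewrite -(real_normK (num_real h)) expr2 mulrA mulrC.
  rewrite ler_wpM2l// mulrC; apply: (@le_trans _ _ (`|h| * (K + 1))).
    by rewrite ler_wpM2l// lerDl.
  by rewrite -ler_pdivlMr// ltr_wpDl.
by apply: DeriveDef; [apply/cvg_ex; exists c|exact: cvg_lim cv].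
Unshelve. all: by end_near.
Qed.

(** A penalty that vanishes on a half-line and is continuously differentiable, which is all that
    [C12] asks of a test function in time. *)
Definition pos2 x : R := (Num.max 0 x) ^+ 2.

Lemma pos2_taylor x h : `|pos2 (x + h) - pos2 x - 2 * Num.max 0 x * h| <= h ^+ 2.
Proof.
rewrite /pos2.
have [x0|x0] := leP x 0; have [xh|xh] := leP (x + h) 0;
  rewrite ?expr0n /= ?mulr0 ?mul0r ?subr0 ?sub0r ?normr0 ?sqr_ge0//.
- rewrite ger0_norm ?sqr_ge0//; nra.
- by rewrite ler_norml; apply/andP; split; nra.
- by rewrite ler_norml; apply/andP; split; nra.
Qed.

Definition test_fun (A : R -> R) (t0 y0 B0 B1 c1 c4 s z : R) : R :=
  A s + (B0 + B1 * (s - t0)) * (z - y0) ^+ 2 + c1 * (z - y0) + c4 * (z - y0) ^+ 4.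

Section test_fun.
Variables (A A' : R -> R) (t0 y0 B0 B1 c1 c4 : R).
Hypothesis dA : forall s, is_derive s 1 A (A' s).
Hypothesis cA' : continuous A'.
Local Notation psi := (test_fun A t0 y0 B0 B1 c1 c4).

Let ds s z : is_derive s 1 (psi ^~ z) (A' s + B1 * (z - y0) ^+ 2).
Proof.
rewrite /test_fun; apply: is_derive_eq; rewrite /GRing.scale /=; ring.
Qed.

Let dz s z : is_derive z 1 (psi s)
  ((B0 + B1 * (s - t0)) * (2 * (z - y0)) + c1 + c4 * (4 * (z - y0) ^+ 3)).
Proof.
rewrite /test_fun; apply: is_derive_eq; rewrite /GRing.scale /=; ring.
Qed.

Lemma test_fun_ds s z : derive1 (psi ^~ z) s = A' s + B1 * (z - y0) ^+ 2.
Proof. by rewrite derive1E; exact: (@derive_val _ _ _ _ _ _ _ (ds s z)). Qed.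

Lemma test_fun_dz s : derive1 (psi s) =
  (fun z => (B0 + B1 * (s - t0)) * (2 * (z - y0)) + c1 + c4 * (4 * (z - y0) ^+ 3)).
Proof.
by apply/funext => z; rewrite derive1E; exact: (@derive_val _ _ _ _ _ _ _ (dz s z)).
Qed.

Let dzz s z : is_derive z 1 (derive1 (psi s))
  (2 * (B0 + B1 * (s - t0)) + 12 * c4 * (z - y0) ^+ 2).
Proof.
rewrite test_fun_dz; apply: is_derive_eq; rewrite /GRing.scale /=; ring.
Qed.

Lemma test_fun_dzz s z : derive1n 2 (psi s) z =
  2 * (B0 + B1 * (s - t0)) + 12 * c4 * (z - y0) ^+ 2.
Proof.
by rewrite /= derive1E; exact: (@derive_val _ _ _ _ _ _ _ (dzz s z)).
Qed.

Lemma test_fun_C12 : C12 psi.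
Proof.
have cz : continuous (fun p : R * R => p.2 - y0).
  by move=> p; apply: cvgB; [exact: cvg_snd|exact: cvg_cst].
have cs : continuous (fun p : R * R => B0 + B1 * (p.1 - t0)).
  move=> p; apply: cvgD; first exact: cvg_cst.
  by apply: cvgM; [exact: cvg_cst|apply: cvgB; [exact: cvg_fst|exact: cvg_cst]].
split.
- move=> t y _; split.
  + exact: (@ex_derive _ _ _ _ _ _ _ (ds t y)).
  + exact: (@ex_derive _ _ _ _ _ _ _ (dz t y)).
  + exact: (@ex_derive _ _ _ _ _ _ _ (dzz t y)).
- rewrite (_ : (fun p => _) = (fun p : R * R => A' p.1 + B1 * ((p.2 - y0) * (p.2 - y0)))).
    move=> p _; apply: cvgD.
      by apply: (@cvg_comp _ _ _ fst A'); [exact: cvg_fst|exact: cA'].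
    by apply: cvgM; [exact: cvg_cst|apply: cvgM; exact: cz].
  by apply/funext => p; rewrite test_fun_ds expr2.
- rewrite (_ : (fun p => _) = (fun p : R * R => (B0 + B1 * (p.1 - t0)) * (2 * (p.2 - y0))
      + c1 + c4 * (4 * ((p.2 - y0) * ((p.2 - y0) * (p.2 - y0)))))).
    move=> p _; apply: cvgD; first apply: cvgD; last 2 first.
    + exact: cvg_cst.
    + apply: cvgM; first exact: cvg_cst.
      apply: cvgM; first exact: cvg_cst.
      by apply: cvgM; [exact: cz|apply: cvgM; exact: cz].
    + by apply: cvgM; [exact: cs|apply: cvgM; [exact: cvg_cst|exact: cz]].
  by apply/funext => p; rewrite test_fun_dz !exprS expr0 mulr1.
- rewrite (_ : (fun p => _) = (fun p : R * R => 2 * (B0 + B1 * (p.1 - t0)) +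
      12 * c4 * ((p.2 - y0) * (p.2 - y0)))).
    move=> p _; apply: cvgD; apply: cvgM; [exact: cvg_cst|exact: cs|exact: cvg_cst|].
    by apply: cvgM; exact: cz.
  by apply/funext => p; rewrite test_fun_dzz expr2.
Qed.

Lemma test_fun_continuous : continuous (fun p : R * R => psi p.1 p.2).
Proof.
have cz : continuous (fun p : R * R => p.2 - y0).
  by move=> p; apply: cvgB; [exact: cvg_snd|exact: cvg_cst].
have cA : continuous A.
  move=> x; apply: differentiable_continuous; apply/derivable1_diffP.
  exact: (@ex_derive _ _ _ _ _ _ _ (dA x)).
rewrite (_ : (fun p => _) = (fun p : R * R => A p.1 + (B0 + B1 * (p.1 - t0)) *
   ((p.2 - y0) * (p.2 - y0)) + c1 * (p.2 - y0) + c4 *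
   ((p.2 - y0) * ((p.2 - y0) * ((p.2 - y0) * (p.2 - y0)))))); last first.
  by apply/funext => p; rewrite /test_fun !exprS expr0 mulr1.
have cs : continuous (fun p : R * R => B0 + B1 * (p.1 - t0)).
  move=> p; apply: cvgD; first exact: cvg_cst.
  by apply: cvgM; [exact: cvg_cst|apply: cvgB; [exact: cvg_fst|exact: cvg_cst]].
move=> p; apply: cvgD; first apply: cvgD; first apply: cvgD.
- by apply: (@cvg_comp _ _ _ fst A); [exact: cvg_fst|exact: cA].
- by apply: cvgM; [exact: cs|apply: cvgM; exact: cz].
- by apply: cvgM; [exact: cvg_cst|exact: cz].
- apply: cvgM; first exact: cvg_cst.
  by do 3 (apply: cvgM; first exact: cz); exact: cz.
Qed.

End test_fun.
End test_functions.

(** * A one-step inequality for viscosity subsolutions *)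

Section viscosity_step.
Context {R : realType}.
Variables (k : R) (k0 : 0 <= k) (F : R -> R).
Hypothesis F_le : forall a c, 0 <= c -> F (a + c) <= F a + 2^-1 * (k * c).
Implicit Types (u psi : R -> R -> R) (s t z y a b c e h w x M B C K : R).

(** The nonlinearity is left arbitrary: the result serves both for [Gfun] and for the linear
    equations with a single volatility. *)
Definition visc_sub u := forall psi t y, 0 < t -> C12 psi ->
  (forall s z, 0 < s -> u s z <= psi s z) -> u t y = psi t y ->
  derive1 (psi ^~ y) t - F (derive1n 2 (psi t) y) <= 0.

(** A negative slope q is absorbed by the quadratic penalty, and linear growth is left over; this is
    the coercivity of the barrier in time. *)
Lemma linear_pos2_ge q t0 h x : 0 <= t0 -> 0 <= h -> - t0 <= x ->
  `|x| - ((`|q| + 1) * (t0 + h) + (`|q| + 1) ^+ 2) <= x * q + pos2 (x - h).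
Proof.
move=> t00 h0 xt0; have q1 : 0 <= `|q| by [].
have xq : - (`|q| * `|x|) <= x * q.
  by rewrite mulrC -normrM lerNl -normrN ler_norm.
set p := `|q| in q1 xq *; have p2 := sqr_ge0 (p + 1).
rewrite /pos2; have [xh|xh] := leP (x - h) 0.
  have xth : `|x| <= t0 + h.
    by rewrite ler_norml; apply/andP; split; lra.
  rewrite expr0n addr0.
  have := ler_wpM2l (addr_ge0 q1 ler01) xth; nra.
have x0 : 0 <= x by lra.
rewrite (ger0_norm x0) in xq *.
by have := sqr_ge0 (x - h - (p + 1)); nra.
Qed.

Lemma quartic_coercive m b a : 0 < m -> exists B, forall w,
  w ^+ 2 - B <= m * w ^+ 4 + a * w ^+ 2 + b * w.
Proof.
move=> m0; set p := `|a| + 2.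
exists (p ^+ 2 / (4 * m) + b ^+ 2 / 4) => w.
have h1 : p * w ^+ 2 - p ^+ 2 / (4 * m) <= m * w ^+ 4.
  rewrite -subr_ge0.
  have -> : m * w ^+ 4 - (p * w ^+ 2 - p ^+ 2 / (4 * m)) =
     m * (w ^+ 2 - p / (2 * m)) ^+ 2 by field; rewrite gt_eqF.
  by rewrite mulr_ge0 ?sqr_ge0// ltW.
have h2 := sqr_ge0 (w + b / 2).
have h3 : - `|a| <= a by rewrite lerNl -normrN ler_norm.
have h4 : - `|a| * w ^+ 2 <= a * w ^+ 2 by rewrite ler_wpM2r ?sqr_ge0.
by rewrite /p in h1 *; nra.
Qed.

Section barrier.
Variables (t0 h y0 g0 b a C lam e : R).
Hypotheses (t00 : 0 <= t0) (h0 : 0 <= h) (C0 : 0 <= C) (lam0 : 0 < lam) (e0 : 0 < e).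
Let m := C / lam + e.
Let q := F a + C * lam * k + e.

(** The time part of a strict supersolution after t0 that starts above the cubic majorant of [u t0].
    A test function must dominate u at all positive times, hence two penalties, one for times before
    t0 and one for times after t0 + h, both zero in between. The cubic term is interpolated as [C *
    |w| ^+ 3 <= C * (lam * w ^+ 2 + w ^+ 4 / lam)]; the terms in m are m times [quart], and q
    collects the gains of the parabola plus a surplus e. *)
Definition barrier_time v K s :=
  v + g0 + (s - t0) * q + 3 * k ^+ 2 * m * (s - t0) ^+ 2 +
  K * pos2 (t0 - s) + pos2 (s - t0 - h).

Definition barrier v K := test_fun (barrier_time v K) t0 y0 (2^-1 * a + C * lam) (6 * k * m) b m.

Let A' K s := q + 6 * k ^+ 2 * m * (s - t0) - K * (2 * Num.max 0 (t0 - s)) +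
  2 * Num.max 0 (s - t0 - h).

Let dA v K s : is_derive s 1 (barrier_time v K) (A' K s).
Proof.
have d1 : is_derive s 1 (fun s => pos2 (t0 - s)) (- (2 * Num.max 0 (t0 - s))).
  apply: (@is_derive_quadratic _ _ _ _ 1) => x; rewrite mul1r.
  have := pos2_taylor (t0 - s) (- x); rewrite sqrrN mulrN mulNr opprD addrA.
  by apply: le_trans; rewrite -addrA.
have d2 : is_derive s 1 (fun s => pos2 (s - t0 - h)) (2 * Num.max 0 (s - t0 - h)).
  apply: (@is_derive_quadratic _ _ _ _ 1) => x; rewrite mul1r.
  have := pos2_taylor (s - t0 - h) x.
  by rewrite (addrAC (s - t0)) (addrAC s).
rewrite /barrier_time; apply: is_derive_eq; rewrite /GRing.scale /= /A'; ring.
Qed.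

Let cA' K : continuous (A' K).
Proof.
have cm (f : R -> R) : continuous f -> continuous (fun s => Num.max 0 (f s)).
  by move=> cf s; apply: (@continuous_max _ _ (fun=> 0) f); [exact: cvg_cst|exact: cf].
have cl (c : R) : continuous (fun s => s - c : R).
  by move=> s; apply: cvgB; [exact: cvg_id|exact: cvg_cst].
have cm1 : continuous (fun s => Num.max 0 (t0 - s)).
  by apply: (cm (fun s => t0 - s)) => s; apply: cvgB; [exact: cvg_cst|exact: cvg_id].
have cm2 : continuous (fun s => Num.max 0 (s - t0 - h)).
  by apply: (cm (fun s => s - t0 - h)) => s; apply: cvgB; [exact: cl|exact: cvg_cst].
move=> s; apply: cvgD; first apply: cvgB; first apply: cvgD.
- exact: cvg_cst.
- by apply: cvgM; [exact: cvg_cst|exact: cl].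
- by apply: cvgM; [exact: cvg_cst|apply: cvgM; [exact: cvg_cst|exact: cm1]].
- by apply: cvgM; [exact: cvg_cst|exact: cm2].
Qed.

Lemma barrier_C12 v K : C12 (barrier v K).
Proof. exact: (test_fun_C12 t0 y0 _ _ _ _ (dA v K) (@cA' K)). Qed.

Lemma barrier_continuous v K : continuous (fun p : R * R => barrier v K p.1 p.2).
Proof. exact: (@test_fun_continuous R _ _ t0 y0 (2^-1 * a + C * lam) (6 * k * m) b m (dA v K)). Qed.

Let m0 : 0 < m.
Proof. by rewrite ltr_wpDl// divr_ge0// ltW. Qed.

(** The curvature exceeds a by three nonnegative terms. By [F_le] each costs at most k / 2 times
    itself, which one term of the time derivative pays for; the surplus e remains. *)
Lemma barrier_super v K s z : t0 < s ->
  e <= derive1 (barrier v K ^~ z) s - F (derive1n 2 (barrier v K s) z).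
Proof.
move=> st; rewrite (test_fun_ds _ _ _ _ _ _ (dA v K)) test_fun_dzz.
have x0 : 0 <= s - t0 by rewrite subr_ge0 ltW.
set w := z - y0.
have kmx : 0 <= k * m * (s - t0) by rewrite mulr_ge0// mulr_ge0// ltW.
have mw : 0 <= m * w ^+ 2 by rewrite mulr_ge0 ?sqr_ge0// ltW.
have cl0 : 0 <= C * lam by rewrite mulr_ge0// ltW.
rewrite (_ : 2 * _ + _ = a + (2 * (C * lam) + 12 * (k * m * (s - t0)) + 12 * (m * w ^+ 2))); last first.
  by field.
have c0 : 0 <= 2 * (C * lam) + 12 * (k * m * (s - t0)) + 12 * (m * w ^+ 2) by lra.
have := F_le a c0.
have p0 : 0 <= Num.max 0 (s - t0 - h) by rewrite le_max lexx.
rewrite /A' (@max_l _ _ 0 (t0 - s)) ?subr_le0 ?(ltW st)// !mulr0 subr0 /q.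
lra.
Qed.

Lemma barrier_coercive : exists2 B : R, 0 <= B & forall K s z, 0 <= K -> 0 <= s ->
  (z - y0) ^+ 2 + `|s - t0| - B + K * pos2 (t0 - s) <= barrier 0 K s z.
Proof.
have [B2 HB2] := quartic_coercive b (2^-1 * a + C * lam - 6 * k * m * t0) m0.
pose B1 := (`|q| + 1) * (t0 + h) + (`|q| + 1) ^+ 2.
exists (`|B1 + B2 - g0|) => // K s z K0 s0.
have x0 : - t0 <= s - t0 by lra.
have h1 := linear_pos2_ge q t00 h0 x0.
have h2 := HB2 (z - y0).
have h3 : 6 * k * m * (- t0) * (z - y0) ^+ 2 <= 6 * k * m * (s - t0) * (z - y0) ^+ 2.
  rewrite ler_wpM2r ?sqr_ge0// ler_wpM2l//; apply: mulr_ge0; last exact: ltW.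
  exact: mulr_ge0.
have h4 : 0 <= 3 * k ^+ 2 * m * (s - t0) ^+ 2.
  by rewrite mulr_ge0 ?sqr_ge0// mulr_ge0 ?(ltW m0)// mulr_ge0 ?sqr_ge0.
have h5 := ler_norm (B1 + B2 - g0).
by rewrite /barrier /test_fun /barrier_time -/B1 in h1 *; lra.
Qed.

Lemma barrierE v K s z : barrier v K s z = v + barrier 0 K s z.
Proof. by rewrite /barrier /test_fun /barrier_time; ring. Qed.

(** If the inequality failed, u minus the barrier would have a positive maximum, attained after t0.
    The barrier raised by that maximum touches u from above, and there the equation contradicts
    strictness. *)
Lemma barrier_comparison u M : visc_sub u ->
  (forall s z, `|u s z| <= M) -> continuous (fun p : R * R => u p.1 p.2) ->
  (forall z, u t0 z <= g0 + b * (z - y0) + 2^-1 * a * (z - y0) ^+ 2 + C * `|z - y0| ^+ 3) ->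
  0 < h ->
  u (t0 + h) y0 <= g0 + h * q + 3 * k ^+ 2 * m * h ^+ 2.
Proof.
move=> usub uM cu ule h_gt0; rewrite leNgt; apply/negP => ugt.
have vE K : barrier 0 K (t0 + h) y0 = g0 + h * q + 3 * k ^+ 2 * m * h ^+ 2.
  rewrite /barrier /test_fun /barrier_time /pos2.
  rewrite (_ : t0 + h - t0 - h = 0); last by ring.
  rewrite (_ : t0 - (t0 + h) = - h); last by ring.
  rewrite maxxx (@max_l _ _ 0 (- h)) ?oppr_le0//.
  rewrite !expr0n /=; ring.
pose v0 := u (t0 + h) y0 - barrier 0 0 (t0 + h) y0.
have v00 : 0 < v0 by rewrite /v0 vE subr_gt0.
have [B B0 HB] := barrier_coercive.
have M0 : 0 <= M by exact: le_trans (uM 0 0).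
have u_lt s z : `|u s z| <= M -> u s z <= M by move=> /(le_trans (ler_norm _)).
pose W : R := M + B + 1.
have W1 : 1 <= W by rewrite /W; lra.
have far z : W < `|z - y0| -> M + B < (z - y0) ^+ 2.
  move=> zW; apply: (@lt_le_trans _ _ `|z - y0|); first by rewrite /W in zW; lra.
  by rewrite -(real_normK (num_real (z - y0))) expr2 ler_peMr//; lra.
have init z : u t0 z <= barrier 0 0 t0 z.
  apply: le_trans (ule z) _; rewrite /barrier /test_fun /barrier_time /pos2 !subrr.
  set w := z - y0; have wn := real_normK (num_real w).
  rewrite (@max_l _ _ 0 (0 - h)) ?maxxx ?sub0r ?oppr_le0// !expr0n /=.
  have h1 : C * `|w| ^+ 3 <= C * (lam * w ^+ 2 + w ^+ 4 / lam).
    rewrite ler_wpM2l// (exprM w 2 2) -wn -subr_ge0.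
    have -> : lam * `|w| ^+ 2 + (`|w| ^+ 2) ^+ 2 / lam - `|w| ^+ 3 =
      `|w| ^+ 2 * ((lam - `|w| / 2) ^+ 2 + 3 / 4 * `|w| ^+ 2) / lam.
      by field; rewrite gt_eqF.
    by rewrite divr_ge0 ?(ltW lam0)// mulr_ge0 ?sqr_ge0// addr_ge0 ?sqr_ge0.
  have h2 : 0 <= e * w ^+ 4 by rewrite mulr_ge0 ?(ltW e0)// exprn_even_ge0.
  have -> : m * w ^+ 4 = C * (w ^+ 4 / lam) + e * w ^+ 4 by rewrite /m; ring.
  lra.
(* At time t0 the difference is at most 0. By continuity it stays below v0 shortly before t0,
   uniformly on the compact range of z; outside this range coercivity decides. *)
have [d d0 Hd] : exists2 d : R, 0 < d & forall s z, 0 <= s -> t0 - d < s -> s <= t0 ->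
    u s z - barrier 0 0 s z < v0.
  have /compact_near_coveringP/(_ R (nbhs t0) (fun s z => u s z - barrier 0 0 s z < v0)) :=
    @segment_compact R (y0 - W) (y0 + W).
  move=> H; have {}H := H _ _.
  have /nbhs_ballP[d /= d0 Hd] : \forall s \near t0, `[y0 - W, y0 + W]%classic `<=`
     (fun z => u s z - barrier 0 0 s z < v0).
    apply: H => z _.
    have cd : {for (t0, z), continuous (fun p : R * R => u p.1 p.2 - barrier 0 0 p.1 p.2)}.
      by apply: cvgB; [exact: cu|exact: barrier_continuous].
    have lt0 : u t0 z - barrier 0 0 t0 z < v0 by have := init z; lra.
    have := cvgr_lt _ cd _ lt0.
    move=> -[/= [U V] /= [U1 V1] UV].
    by exists (V, U) => //= -[z' s'] /= [Vz Us]; exact: (UV (s', z')).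
  exists d => // s z s0 ds st.
  have [zW|zW] := leP `|z - y0| W.
    apply: (Hd s); first by rewrite /ball /= ger0_norm ?subr_ge0//; lra.
    by rewrite /= in_itv /= -ler_distlC distrC.
  have := HB 0 s z (lexx _) s0; have := far _ zW; have := u_lt s z (uM s z).
  have := normr_ge0 (s - t0); rewrite mul0r; lra.
(* With this [K] the penalty of the past is at least [M + B + 1] at every time earlier than t0 by d
   or more. *)
pose K := (M + B + 1) / d ^+ 2.
have K0 : 0 <= K by rewrite divr_ge0 ?sqr_ge0//; lra.
pose D := fun p : R * R => u p.1 p.2 - barrier 0 K p.1 p.2.
have cD : continuous D.
  by move=> p; apply: cvgB; [exact: cu|exact: barrier_continuous].
have outside s z : 0 <= s -> ~ (`|s - t0| <= M + B /\ `|z - y0| <= W) -> D (s, z) < 0.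
  move=> s0 H; rewrite /D /= subr_lt0.
  have := HB K s z K0 s0; have := u_lt s z (uM s z).
  have p0 : 0 <= K * pos2 (t0 - s) by rewrite mulr_ge0// sqr_ge0.
  have [sW|sW] := leP `|s - t0| (M + B); last by have := sqr_ge0 (z - y0); lra.
  have [zW|zW] := leP `|z - y0| W; first by exfalso; apply: H.
  by have := far _ zW; have := normr_ge0 (s - t0); lra.
pose I := [set p : R * R | 0 <= p.1 <= t0 + M + B + h /\ y0 - W <= p.2 <= y0 + W].
have cI : compact I.
  rewrite (_ : I = `[0, t0 + M + B + h]%classic `*` `[y0 - W, y0 + W]%classic); last first.
    by apply/seteqP; split => p; rewrite /= !in_itv.
  exact: (compact_setX (@segment_compact R 0 (t0 + M + B + h)) (@segment_compact R (y0 - W) (y0 + W))).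
have Ih : I (t0 + h, y0).
  have i1 : 0 <= t0 + h <= t0 + M + B + h.
    by have := t00; have := h0; move=> *; apply/andP; split; lra.
  have i2 : y0 - W <= y0 <= y0 + W by apply/andP; split; lra.
  by split.
have [|[sm zm]] := @compact_EVT_max _ _ D I _ cI (continuous_subspaceT cD).
  by exists (t0 + h, y0).
rewrite inE => -[/= sI zI] Dmax.
have Dv0 : v0 <= D (sm, zm).
  apply: le_trans (Dmax (t0 + h, y0) (mem_set Ih)).
  by rewrite /v0 /D /= !vE.
have Dall s z : 0 <= s -> D (s, z) <= D (sm, zm).
  move=> s0; have [inI|] := pselect (`|s - t0| <= M + B /\ `|z - y0| <= W).
    apply: Dmax; rewrite inE /I /= s0 /=.
    case: inI; rewrite !ler_norml => /andP[a1 a2] /andP[a3 a4].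
    by split; [lra|apply/andP; split; lra].
  by move=> /(outside s z s0) /ltW h1; apply: le_trans h1 (le_trans (ltW v00) Dv0).
have sm0 : 0 <= sm by move: sI => /andP[].
(* A maximum at or before t0 is excluded: less than d before t0 by the choice of d, earlier by the
   penalty. *)
have smt : t0 < sm.
  rewrite ltNge; apply/negP => smt.
  have p0 : 0 <= K * pos2 (t0 - sm) by rewrite mulr_ge0// sqr_ge0.
  have [ds|ds] := ltP (t0 - d) sm.
    have := Hd sm zm sm0 ds smt; move: Dv0; rewrite /D /=.
    have -> : barrier 0 K sm zm = barrier 0 0 sm zm + K * pos2 (t0 - sm).
      by rewrite /barrier /test_fun /barrier_time; ring.
    by lra.
  have := HB K sm zm K0 sm0; have := u_lt sm zm (uM sm zm).
  have : M + B + 1 <= K * pos2 (t0 - sm).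
    rewrite /K mulrAC ler_pdivlMr ?exprn_gt0//.
    apply: ler_wpM2l; first lra.
    by rewrite /pos2 max_r ?subr_ge0// ler_sqr ?nnegrE; lra.
  move: Dv0; rewrite /D /=; have := sqr_ge0 (zm - y0); have := normr_ge0 (sm - t0); lra.
have sm_gt0 : 0 < sm by exact: le_lt_trans smt.
have h1 : forall s z, 0 < s -> u s z <= barrier (D (sm, zm)) K s z.
  by move=> s z s0; rewrite barrierE; have := Dall s z (ltW s0); rewrite {1}/D /=; lra.
have h2 : u sm zm = barrier (D (sm, zm)) K sm zm by rewrite barrierE /D /=; lra.
have := usub _ _ _ sm_gt0 (barrier_C12 _ _) h1 h2.
have := @barrier_super (D (sm, zm)) K sm zm smt.
by move: e0; lra.
Qed.

End barrier.

(** With [lam = sqrt h] both parts of the interpolated cubic term contribute to the order h^(3/2);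
    then e tends to 0. *)
Lemma visc_step u M t0 h y0 g0 b a C : visc_sub u ->
  (forall s z, `|u s z| <= M) -> continuous (fun p : R * R => u p.1 p.2) ->
  0 <= t0 -> 0 < h -> 0 <= C ->
  (forall z, u t0 z <= g0 + b * (z - y0) + 2^-1 * a * (z - y0) ^+ 2 + C * `|z - y0| ^+ 3) ->
  u (t0 + h) y0 <= g0 + h * F a + C * (k + 3 * k ^+ 2) * (h * Num.sqrt h).
Proof.
move=> usub uM cu t00 h0 C0 ule.
have lam0 : 0 < Num.sqrt h by rewrite sqrtr_gt0.
apply/ler_addgt0Pr => e1 e10.
pose e := e1 / (h + 3 * k ^+ 2 * h ^+ 2).
have p0 : 0 < h + 3 * k ^+ 2 * h ^+ 2.
  by rewrite ltr_wpDr// mulr_ge0 ?sqr_ge0// mulr_ge0 ?sqr_ge0.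
have e0 : 0 < e by rewrite divr_gt0.
have := barrier_comparison t00 (ltW h0) C0 lam0 e0 usub uM cu ule h0.
move=> H; apply: le_trans H _.
have -> : e1 = e * (h + 3 * k ^+ 2 * h ^+ 2) by rewrite /e divfK// gt_eqF.
set q := Num.sqrt h in lam0 *.
have hq : h = q ^+ 2 by rewrite sqr_sqrtr// ltW.
have -> : 3 * k ^+ 2 * (C / q + e) * h ^+ 2 = 3 * k ^+ 2 * C * (h * q) + e * (3 * k ^+ 2 * h ^+ 2).
  by rewrite hq; field; rewrite gt_eqF.
lra.
Qed.

End viscosity_step.

(** * Spatial averages *)

Section averages.
Context {R : realType}.
Implicit Types (f g : R -> R) (x y z e L M c d h : R).

(** Riemann sums over [y, y + e]. Their ultralimit is an average that is linear on all bounded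
    functions. *)
Definition mean_seq e f y (n : nat) : R :=
  n.+1%:R^-1 * \sum_(i < n.+1) f (y + e * i%:R / n.+1%:R).

Definition avg e f y : R := ulim (mean_seq e f y).

Lemma mean_le e f g y n : (forall x, f x <= g x) -> mean_seq e f y n <= mean_seq e g y n.
Proof. by move=> fg; rewrite ler_wpM2l// ler_sum. Qed.

Lemma mean_cst e c y n : mean_seq e (fun=> c) y n = c.
Proof.
by rewrite /mean_seq sumr_const card_ord -[c *+ _]mulr_natl mulKf// pnatr_eq0.
Qed.

Lemma meanD e f g y n :
  mean_seq e (fun x => f x + g x) y n = mean_seq e f y n + mean_seq e g y n.
Proof. by rewrite /mean_seq big_split mulrDr. Qed.

Lemma mean_bounded M e f y n : (forall x, `|f x| <= M) -> `|mean_seq e f y n| <= M.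
Proof.
move=> fM; rewrite ler_norml; apply/andP; split.
  rewrite -(mean_cst e (- M) y n); apply: mean_le => x.
  by have := fM x; rewrite ler_norml => /andP[].
rewrite -[leRHS](mean_cst e M y n); apply: mean_le => x.
by have := fM x; rewrite ler_norml => /andP[].
Qed.

Lemma mean_bounded_seq M e f y : (forall x, `|f x| <= M) -> bounded_seq (mean_seq e f y).
Proof. by move=> fM; exists M => n; exact: mean_bounded. Qed.

Lemma avg_le M N e f g y : (forall x, `|f x| <= M) -> (forall x, `|g x| <= N) ->
  (forall x, f x <= g x) -> avg e f y <= avg e g y.
Proof.
move=> fM gN fg; apply: ulim_le; [exact: mean_bounded_seq fM|exact: mean_bounded_seq gN|].
by apply: nearW => n; exact: mean_le.
Qed.

Lemma avg_cst e c y : avg e (fun=> c) y = c.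
Proof.
rewrite -[RHS](ulim_cst c); congr ulim; apply/funext => n; exact: mean_cst.
Qed.

Lemma avgD M N e f g y : (forall x, `|f x| <= M) -> (forall x, `|g x| <= N) ->
  avg e (fun x => f x + g x) y = avg e f y + avg e g y.
Proof.
move=> fM gN; rewrite /avg -ulimD; [|exact: mean_bounded_seq fM|exact: mean_bounded_seq gN].
by congr ulim; apply/funext => n; exact: meanD.
Qed.

Lemma avgZ M c e f y : (forall x, `|f x| <= M) ->
  avg e (fun x => c * f x) y = c * avg e f y.
Proof.
move=> fM; rewrite /avg -ulimZ; last exact: mean_bounded_seq fM.
by congr ulim; apply/funext => n; rewrite /mean_seq -mulr_sumr mulrCA.
Qed.

Lemma avg_shift e f x y : avg e (fun z => f (z + x)) y = avg e f (y + x).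
Proof.
congr ulim; apply/funext => n; congr (_ * _); apply: eq_bigr => i _.
by rewrite addrAC.
Qed.

Lemma avg_bounded M e f y : (forall x, `|f x| <= M) -> `|avg e f y| <= M.
Proof.
move=> fM; rewrite -[avg _ _ _]subr0 -[0](ulim_cst (0 : R)).
apply: ulim_norm; [exact: mean_bounded_seq fM|exact: bounded_seq_cst|].
by apply: nearW => n; rewrite subr0; exact: mean_bounded.
Qed.

Lemma avg_dist M N e f g d : (forall x, `|f x| <= M) -> (forall x, `|g x| <= N) ->
  (forall x, `|f x - g x| <= d) -> forall y, `|avg e f y - avg e g y| <= d.
Proof.
move=> fM gN fg y.
have gN' x : `|- 1 * g x| <= N by rewrite mulN1r normrN.
rewrite -[X in _ + X]mulN1r -(avgZ _ _ _ gN) -(avgD _ _ fM gN').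
by apply: avg_bounded => x; rewrite mulN1r.
Qed.

Lemma avg_lip M L e f : bounded_lip M L f -> bounded_lip M L (avg e f).
Proof.
move=> [fM fL]; split=> [y|x y]; first exact: avg_bounded.
rewrite -[in X in `|X - _|](subrKC y x) -avg_shift.
apply: (@avg_dist M M) => // z.
by have := fL (z + (x - y)) z; rewrite [z + _]addrC addrK.
Qed.

Lemma avg_near M L e f y : 0 <= e -> bounded_lip M L f -> `|avg e f y - f y| <= L * e.
Proof.
move=> e0 bf; have [M0 L0] := bounded_lip_ge0 bf; case: bf => fM fL.
rewrite -[X in _ - X](ulim_cst (f y)).
apply: ulim_norm; [exact: mean_bounded_seq fM|exact: bounded_seq_cst|].
apply: nearW => n.
rewrite -[X in _ - X](mean_cst e (f y) y n) -mulrBr -sumrB normrM gtr0_norm ?invr_gt0//.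
rewrite ler_pdivrMl//; apply: le_trans (ler_norm_sum _ _ _) _.
apply: (@le_trans _ _ (\sum_(i < n.+1) (L * e))); last first.
  by rewrite sumr_const card_ord -[_ *+ _]mulr_natl.
apply: ler_sum => i _; apply: le_trans (fL _ _) _.
rewrite ler_wpM2l// addrAC subrr add0r ger0_norm; last by rewrite divr_ge0 ?mulr_ge0.
by rewrite -mulrA ler_piMr// ler_pdivrMr// mul1r ler_nat ltnW.
Qed.

Definition fdiff e f y := (f (y + e) - f y) / e.

(** Shifting a Riemann sum by j cells exchanges j cells at the left end for j cells beyond the right
    end. Each exchange contributes [f (y + e) - f y] up to [2 * L * h], and there are about
    [h * m / e] of them. *)
Lemma avg_increment M L e f y h : 0 < e -> 0 <= h -> bounded_lip M L f ->
  `|avg e f (y + h) - avg e f y - fdiff e f y * h| <= 2 * L / e * h ^+ 2.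
Proof.
move=> e0 h0 bf; have [M0 L0] := bounded_lip_ge0 bf; case: bf => fM fL.
set c := fdiff e f y * h.
have fM' x : `|- f x| <= M by rewrite normrN.
pose s1 := mean_seq e f (y + h); pose s2 := mean_seq e f y.
have b1 : bounded_seq s1 by exact: mean_bounded_seq fM.
have b2 : bounded_seq s2 by exact: mean_bounded_seq fM.
have b12 : bounded_seq (fun n => s1 n - s2 n).
  by apply: bounded_seqD => //; exact: bounded_seqN.
rewrite (_ : avg e f (y + h) - _ - _ = ulim (fun n => s1 n - s2 n) - ulim (fun=> c)); last first.
  by rewrite ulim_cst ulimD// ?ulimN//; exact: bounded_seqN.
apply/ler_addgt0Pr => e1 e10.
apply: ulim_norm => //; first exact: bounded_seq_cst.
(* [K / n.+1] bounds the two errors made by rounding the shift h to a whole number of cells. *)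
pose K := L * e + `|fdiff e f y| * e.
have K0 : 0 <= K by rewrite addr_ge0// mulr_ge0// ltW.
have [N HN] : exists N : nat, forall n, (N <= n)%N -> K / n.+1%:R <= e1.
  exists (Num.truncn (K / e1)) => n Nn; rewrite ler_pdivrMr// mulrC -ler_pdivrMr//.
  apply: ltW; apply: (lt_le_trans (truncnS_gt _)); by rewrite ler_nat ltnS.
apply: oo_ultra_near; exists N => // n /= /HN Kn.
set m := n.+1%:R : R in Kn *; have m0 : 0 < m by rewrite ltr0n.
have e0' := ltW e0; have m0' := ltW m0.
pose j := Num.truncn (h * m / e).
have hm0 : 0 <= h * m / e by rewrite divr_ge0// mulr_ge0.
have /andP[j1 j2] := truncn_itv hm0.
have jh : j%:R * e / m <= h.
  by rewrite ler_pdivrMr// -ler_pdivlMr.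
have hj : h - j%:R * e / m <= e / m.
  rewrite lerBlDr -mulrDl ler_pdivlMr//.
  by move: j2 => /ltW; rewrite ler_pdivrMr// -natr1 mulrDl mul1r addrC.
pose G (i : nat) := f (y + e * i%:R / m).
have S1 : `|s1 n - m^-1 * \sum_(i < n.+1) G (i + j)%N| <= L * (e / m).
  rewrite /s1 /mean_seq -mulrBr -sumrB normrM gtr0_norm ?invr_gt0// ler_pdivrMl//.
  apply: le_trans (ler_norm_sum _ _ _) _.
  apply: (@le_trans _ _ (\sum_(i < n.+1) (L * (e / m)))); last first.
    by rewrite sumr_const card_ord -[_ *+ _]mulr_natl.
  apply: ler_sum => i _; apply: le_trans (fL _ _) _; rewrite ler_wpM2l//.
  rewrite (_ : _ - _ = h - j%:R * e / m); last first.
    by rewrite natrD /m; field; rewrite gt_eqF.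
  by rewrite ger0_norm// subr_ge0.
have S2 : \sum_(i < n.+1) G (i + j)%N = \sum_(i < n.+1) G i +
    \sum_(i < j) (G (n.+1 + i)%N - G i).
  rewrite sumrB -(big_mkord xpredT G) -(big_mkord xpredT (fun i => G (i + j)%N)).
  rewrite -(big_mkord xpredT (fun i => G (n.+1 + i)%N)) -(big_mkord xpredT G).
  rewrite -{1}[0%N]add0n.
  have -> : \sum_(0 + 0 <= i < n.+1) G (i + j)%N = \sum_(j <= i < n.+1 + j) G i.
    by rewrite (big_addn 0 _ j) addnK addn0; apply: eq_bigr.
  have -> : \sum_(0 <= i < j) G (n.+1 + i)%N = \sum_(n.+1 <= i < n.+1 + j) G i.
    rewrite -{2}[n.+1]add0n (big_addn 0 _ n.+1) addKn.
    by apply: eq_bigr => i _; rewrite addnC.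
  have A1 : \sum_(0 <= i < n.+1 + j) G i =
      \sum_(0 <= i < n.+1) G i + \sum_(n.+1 <= i < n.+1 + j) G i.
    by rewrite (@big_cat_nat _ _ _ n.+1)//= leq_addr.
  have A2 : \sum_(0 <= i < n.+1 + j) G i =
      \sum_(0 <= i < j) G i + \sum_(j <= i < n.+1 + j) G i.
    by rewrite (@big_cat_nat _ _ _ j)//= leq_addl.
  rewrite A1 in A2; rewrite addrA A2; ring.
have S3 : `|m^-1 * \sum_(i < j) (G (n.+1 + i)%N - G i) - fdiff e f y * (j%:R * e / m)| <= 2 * L / e * h ^+ 2.
  rewrite (_ : fdiff e f y * (j%:R * e / m) = m^-1 * \sum_(i < j) (f (y + e) - f y)); last first.
    by rewrite sumr_const card_ord -[_ *+ _]mulr_natl /fdiff; field; rewrite !gt_eqF.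
  rewrite -mulrBr -sumrB normrM gtr0_norm ?invr_gt0//.
  apply: (@le_trans _ _ (m^-1 * \sum_(i < j) (2 * L * h))).
    rewrite ler_wpM2l ?invr_ge0 ?(ltW e0)//; apply: le_trans (ler_norm_sum _ _ _) _.
    apply: ler_sum => i _.
    have iw : e * i%:R / m <= h.
      apply: le_trans jh; rewrite ler_wpM2r ?invr_ge0// mulrC.
      by rewrite ler_wpM2r// ler_nat ltnW.
    have i0 : 0 <= e * i%:R / m by rewrite divr_ge0// mulr_ge0.
    have L1 := fL (y + e * (n.+1 + i)%N%:R / m) (y + e).
    have L2 := fL (y + e * i%:R / m) y.
    rewrite (_ : y + e * (n.+1 + i)%N%:R / m - (y + e) = e * i%:R / m) in L1; last first.
      by rewrite natrD -/m; field; rewrite gt_eqF.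
    rewrite (_ : y + e * i%:R / m - y = e * i%:R / m) in L2; last by ring.
    rewrite (ger0_norm i0) in L1 L2.
    have L3 := ler_wpM2l L0 iw.
    rewrite (_ : G (n.+1 + i)%N - G i - (f (y + e) - f y) =
     (f (y + e * (n.+1 + i)%:R / m) - f (y + e)) - (f (y + e * i%:R / m) - f y)); last first.
      by rewrite /G; ring.
    apply: le_trans (ler_normB _ _) _.
    rewrite (_ : 2 * L * h = L * h + L * h); last by ring.
    by apply: lerD; [exact: le_trans L1 L3|exact: le_trans L2 L3].
  rewrite sumr_const card_ord -[_ *+ _]mulr_natl.
  rewrite (_ : m^-1 * _ = 2 * L / e * h * (j%:R * e / m)); last by field; rewrite !gt_eqF.
  by rewrite [h ^+ 2]expr2 [leRHS]mulrA ler_wpM2l// mulr_ge0// divr_ge0// mulr_ge0.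
have S4 : `|fdiff e f y * (j%:R * e / m) - c| <= `|fdiff e f y| * e / m.
  by rewrite /c -mulrBr normrM -[leRHS]mulrA ler_wpM2l// distrC ger0_norm ?subr_ge0.
have S5 : s1 n - s2 n - c = (s1 n - m^-1 * \sum_(i < n.+1) G (i + j)%N) +
   (m^-1 * \sum_(i < j) (G (n.+1 + i)%N - G i) - fdiff e f y * (j%:R * e / m)) +
   (fdiff e f y * (j%:R * e / m) - c).
  rewrite S2 mulrDr (_ : s2 n = m^-1 * \sum_(i < n.+1) G i)//; ring.
rewrite S5; apply: le_trans (ler_normD _ _) _.
apply: le_trans (lerD (ler_normD _ _) (lexx _)) _.
have KE : K / m = L * (e / m) + `|fdiff e f y| * e / m by rewrite /K; ring.
apply: le_trans (lerD (lerD S1 S3) S4) _.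
by rewrite addrAC -KE addrC lerD2l.
Qed.

Lemma avg_derive M L e f y : 0 < e -> bounded_lip M L f ->
  is_derive y 1 (avg e f) (fdiff e f y).
Proof.
move=> e0 bf; have [M0 L0] := bounded_lip_ge0 bf; have [fM fL] := bf.
have Le : 0 <= L / e by rewrite divr_ge0// ltW.
apply: (@is_derive_quadratic _ _ _ _ (4 * L / e)) => h.
have [h0|h0] := leP 0 h.
  apply: le_trans (avg_increment y e0 h0 bf) _.
  by rewrite ler_wpM2r ?sqr_ge0// -!mulrA ler_wpM2r// ler_nat.
have Nh0 : 0 <= - h by lra.
have := avg_increment (y + h) e0 Nh0 bf; rewrite addrK sqrrN => H.
have D : `|fdiff e f (y + h) - fdiff e f y| <= 2 * L / e * - h.
  rewrite /fdiff -mulrBl normrM normfV (gtr0_norm e0).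
  rewrite (_ : 2 * L / e * - h = 2 * L * - h / e); last by ring.
  rewrite ler_wpM2r ?invr_ge0 ?(ltW e0)//.
  have L1 := fL (y + h + e) (y + e); have L2 := fL (y + h) y.
  rewrite (_ : y + h + e - (y + e) = h) in L1; last by ring.
  rewrite (_ : y + h - y = h) in L2; last by ring.
  rewrite (ltr0_norm h0) in L1 L2.
  rewrite (_ : _ - _ - _ = (f (y + h + e) - f (y + e)) - (f (y + h) - f y)); last by ring.
  apply: le_trans (ler_normB _ _) _; lra.
have D2 := ler_wpM2r Nh0 D; rewrite -(ger0_norm Nh0) -normrM (ger0_norm Nh0) in D2.
rewrite (_ : _ - _ = - (avg e f y - avg e f (y + h) - fdiff e f (y + h) * - h) +
   - ((fdiff e f (y + h) - fdiff e f y) * - h)); last by ring.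
apply: le_trans (ler_normD _ _) _; rewrite !normrN.
rewrite (_ : 4 * L / e * h ^+ 2 = 2 * L / e * h ^+ 2 + 2 * L / e * - h * - h); last by ring.
exact: lerD.
Qed.

(** The coefficients g1 and g2 are arbitrary functions, so the property passes through random walk
    steps without any differentiation. *)
Definition taylor3 (C : R) g g1 g2 := forall y z,
  `|g z - g y - g1 y * (z - y) - 2^-1 * g2 y * (z - y) ^+ 2| <= C * `|z - y| ^+ 3.

Lemma derive_lip g g1 K : (forall x, is_derive x 1 g (g1 x)) ->
  (forall x, `|g1 x| <= K) -> forall x y, `|g x - g y| <= K * `|x - y|.
Proof.
move=> dg g1K x y.
have dr z : `|z - y| < `|x - y| + 1 -> derivable g z 1.
  by move=> _; exact: (@ex_derive _ _ _ _ _ _ _ (dg z)).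
have [|c _ ->] := @mvt_ball R g y _ x dr; first by rewrite ltrDl.
rewrite normrM ler_wpM2r// derive1E (@derive_val _ _ _ _ _ _ _ (dg c)).
exact: g1K.
Qed.

Lemma derive_taylor3 g g1 g2 C : (forall x, is_derive x 1 g (g1 x)) ->
  (forall x, is_derive x 1 g1 (g2 x)) ->
  (forall x y, `|g2 x - g2 y| <= C * `|x - y|) -> taylor3 C g g1 g2.
Proof.
move=> dg dg1 g2C y z.
have C0 : 0 <= C.
  by have := le_trans (normr_ge0 _) (g2C 1 0); rewrite subr0 normr1 mulr1.
have zr : `|z - y| < `|z - y| + 1 by rewrite ltrDl.
have D1 (x : R) : `|g1 x - g1 y - g2 y * (x - y)| <= C * `|x - y| ^+ 2.
  pose q x := g1 x - g2 y * (x - y).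
  have dq (t : R) : is_derive t 1 q (g2 t - g2 y).
    by rewrite /q; apply: is_derive_eq; rewrite /GRing.scale /=; ring.
  have dr (t : R) : `|t - y| < `|x - y| + 1 -> derivable q t 1.
    by move=> _; exact: (@ex_derive _ _ _ _ _ _ _ (dq t)).
  have [|c cx E] := @mvt_ball R q y _ x dr; first by rewrite ltrDl.
  rewrite (_ : _ - _ - _ = q x - q y); last by rewrite /q subrr; ring.
  rewrite E derive1E (@derive_val _ _ _ _ _ _ _ (dq c)) normrM expr2 mulrA.
  rewrite ler_wpM2r//; apply: le_trans (g2C _ _) _; exact: ler_wpM2l.
pose q x := g x - g1 y * (x - y) - 2^-1 * g2 y * (x - y) ^+ 2.
have dq (t : R) : is_derive t 1 q (g1 t - g1 y - g2 y * (t - y)).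
  by rewrite /q; apply: is_derive_eq; rewrite /GRing.scale /=; field.
have dr (t : R) : `|t - y| < `|z - y| + 1 -> derivable q t 1.
  by move=> _; exact: (@ex_derive _ _ _ _ _ _ _ (dq t)).
have [c cx E] := @mvt_ball R q y _ z dr zr.
rewrite (_ : _ - _ - _ - _ = q z - q y); last by rewrite /q subrr; ring.
rewrite E derive1E (@derive_val _ _ _ _ _ _ _ (dq c)) normrM (exprSr _ 2) mulrA.
rewrite ler_wpM2r//; apply: le_trans (D1 c) _.
by rewrite ler_wpM2l// ler_sqr ?nnegrE.
Qed.

(** After three averages the second derivative is a second difference quotient of the Lipschitz
    function [avg e f], whence a cubic Taylor remainder. *)
Definition avg3 e f := avg e (avg e (avg e f)).
Definition avg3' e f := fdiff e (avg e (avg e f)).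
Definition avg3'' e f := fdiff e (fdiff e (avg e f)).

Lemma avg3_taylor3 M L e f : 0 < e -> bounded_lip M L f ->
  taylor3 (8 * M / e ^+ 3) (avg3 e f) (avg3' e f) (avg3'' e f).
Proof.
move=> e0 bf; have [M0 L0] := bounded_lip_ge0 bf; have [fM fL] := bf.
have b1 := avg_lip e bf; have b2 := avg_lip e b1.
apply: derive_taylor3.
- by move=> x; exact: avg_derive e0 b2.
- move=> x; rewrite /avg3' /avg3''.
  have d1 := avg_derive x e0 b1.
  have d2 : is_derive x 1 (fun x => avg e (avg e f) (x + e)) (fdiff e (avg e f) (x + e)).
    have E : avg e (fun z => avg e f (z + e)) = (fun x => avg e (avg e f) (x + e)).
      by apply/funext => u; rewrite avg_shift.
    have bs : bounded_lip M L (fun z => avg e f (z + e)).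
      case: b1 => a1 a2; split => // u v.
      by have := a2 (u + e) (v + e); rewrite opprD addrACA subrr addr0.
    by have := avg_derive x e0 bs; rewrite E.
  rewrite /fdiff; apply: is_derive_eq.
  by rewrite scaler0 add0r /fdiff /GRing.scale /= mulrC.
(* One average has Lipschitz constant [2 * M / e], whatever that of f; each of the two difference
   quotients multiplies it by 2 / e. *)
- have lip1 x y : `|avg e f x - avg e f y| <= 2 * M / e * `|x - y|.
    apply: (@derive_lip _ (fdiff e f)) => t; first exact: avg_derive e0 bf.
    rewrite /fdiff normrM normfV (gtr0_norm e0) ler_wpM2r ?invr_ge0 ?(ltW e0)//.
    by apply: le_trans (ler_normB _ _) _; rewrite mulr2n mulrDl mul1r lerD.
  have lipd (g : R -> R) K : (forall x y, `|g x - g y| <= K * `|x - y|) ->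
      forall x y, `|fdiff e g x - fdiff e g y| <= 2 * K / e * `|x - y|.
    move=> gK x y; rewrite /fdiff -mulrBl normrM normfV (gtr0_norm e0).
    rewrite (mulrAC _ e^-1) ler_wpM2r ?invr_ge0 ?(ltW e0)//.
    have g1 := gK (x + e) (y + e); have g2 := gK x y.
    rewrite (_ : x + e - (y + e) = x - y) in g1; last by ring.
    rewrite (_ : _ - _ - _ = (g (x + e) - g (y + e)) - (g x - g y)); last by ring.
    apply: le_trans (ler_normB _ _) _; lra.
  have := lipd _ _ (lipd _ _ lip1) => H x y; apply: le_trans (H x y) _.
  by rewrite le_eqVlt; apply/orP; left; apply/eqP; field; rewrite gt_eqF.
Qed.

Lemma avg3_lip M L e f : bounded_lip M L f -> bounded_lip M L (avg3 e f).
Proof. by move=> bf; do 3 apply: avg_lip. Qed.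

Lemma avg3_near M L e f y : 0 <= e -> bounded_lip M L f ->
  `|avg3 e f y - f y| <= 3 * L * e.
Proof.
move=> e0 bf; have b1 := avg_lip e bf; have b2 := avg_lip e b1.
have h1 := avg_near y e0 bf; have h2 := avg_near y e0 b1; have h3 := avg_near y e0 b2.
rewrite /avg3 (_ : _ - _ = (avg e (avg e (avg e f)) y - avg e (avg e f) y) +
  ((avg e (avg e f) y - avg e f y) + (avg e f y - f y))); last by ring.
apply: le_trans (ler_normD _ _) _; apply: le_trans (lerD (lexx _) (ler_normD _ _)) _.
lra.
Qed.

Lemma avg3_le M N e f g y : (forall x, `|f x| <= M) -> (forall x, `|g x| <= N) ->
  (forall x, f x <= g x) -> avg3 e f y <= avg3 e g y.
Proof.
move=> fM gN fg.
have f1 x := avg_bounded e x fM; have g1 x := avg_bounded e x gN.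
have f2 x := avg_bounded e x f1; have g2 x := avg_bounded e x g1.
by do 3 (apply: avg_le; [eassumption|eassumption|move=> ? //]).
Qed.

Lemma avg3_dist M N e f g d y : (forall x, `|f x| <= M) -> (forall x, `|g x| <= N) ->
  (forall x, `|f x - g x| <= d) -> `|avg3 e f y - avg3 e g y| <= d.
Proof.
move=> fM gN fg.
have f1 x := avg_bounded e x fM; have g1 x := avg_bounded e x gN.
have f2 x := avg_bounded e x f1; have g2 x := avg_bounded e x g1.
by do 3 (apply: avg_dist; [eassumption|eassumption|move=> ? //]).
Qed.

Lemma avg3''_dist M N e f g d y : 0 < e -> (forall x, `|f x| <= M) -> (forall x, `|g x| <= N) ->
  (forall x, `|f x - g x| <= d) -> `|avg3'' e f y - avg3'' e g y| <= 4 * d / e ^+ 2.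
Proof.
move=> e0 fM gN fg.
have H f1 g1 d1 : (forall x, `|f1 x - g1 x| <= d1) ->
   forall x, `|fdiff e f1 x - fdiff e g1 x| <= 2 * d1 / e.
  move=> fg1 x; rewrite /fdiff -mulrBl normrM normfV (gtr0_norm e0).
  rewrite ler_wpM2r ?invr_ge0 ?(ltW e0)//.
  have a1 := fg1 (x + e); have a2 := fg1 x.
  rewrite (_ : _ - _ - _ = (f1 (x + e) - g1 (x + e)) - (f1 x - g1 x)); last by ring.
  apply: le_trans (ler_normB _ _) _; lra.
have := H _ _ _ (H _ _ _ (avg_dist e fM gN fg)) y => h; apply: le_trans h _.
by rewrite le_eqVlt; apply/orP; left; apply/eqP; field; rewrite gt_eqF.
Qed.

End averages.

(** * Comparison of solutions, one time step after another *)

Section comparison.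
Context {R : realType}.
Implicit Types (f g : R -> R) (u v w : R -> R -> R) (t h x y z e L M C D c a b s : R).

Lemma taylor3_addC C c g g1 g2 : taylor3 C g g1 g2 ->
  taylor3 C (fun z => g z + c) g1 g2.
Proof.
move=> T y z; have := T y z; set p := g1 y * _; set q := 2^-1 * _ * _.
by rewrite opprD addrACA subrr addr0.
Qed.

(** All that is kept of a subsolution: an inequality over one step against parabolas with a cubic
    error. In this form it is stable under suprema of translates ([step_sub_env]) and usable for
    averages ([step_sub_avg]). *)
Definition step_sub (F : R -> R) D u := forall t h y C c b a,
  0 <= t -> 0 < h -> 0 <= C ->
  (forall z, u t z <= c + b * (z - y) + 2^-1 * a * (z - y) ^+ 2 + C * `|z - y| ^+ 3) ->
  u (t + h) y <= c + h * F a + C * D * (h * Num.sqrt h).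

(** Sup-convolution with a cone. It makes v Lipschitz in space, and at time 0 it does not exceed an
    L-Lipschitz function that is above v. *)
Definition lip_env L v t y := sup [set v t (y + z) - L * `|z| | z in [set: R]].

Section lip_env.
Variables (L M : R) (v : R -> R -> R).
Hypotheses (L0 : 0 <= L) (vM : forall t y, `|v t y| <= M).

Let has_sup_env t y : has_sup [set v t (y + z) - L * `|z| | z in [set: R]].
Proof.
split; first by exists (v t (y + 0) - L * `|0 : R|); exists 0.
exists M => _ [z _ <-]; have := vM t (y + z).
by rewrite ler_norml => /andP[_]; have := mulr_ge0 L0 (normr_ge0 z); lra.
Qed.

Lemma lip_env_ge t y z : v t (y + z) - L * `|z| <= lip_env L v t y.
Proof. by apply: (ub_le_sup (has_sup_env t y).2); exists z. Qed.

Lemma lip_env_le t y c : (forall z, v t (y + z) - L * `|z| <= c) -> lip_env L v t y <= c.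
Proof.
move=> H; apply: ge_sup; first exact: (has_sup_env t y).1.
by move=> _ [z _ <-].
Qed.

Lemma lip_env_self t y : v t y <= lip_env L v t y.
Proof. by have := lip_env_ge t y 0; rewrite addr0 normr0 mulr0 subr0. Qed.

Lemma lip_env_bounded_lip t : bounded_lip M L (lip_env L v t).
Proof.
split=> [y|].
  rewrite ler_norml; apply/andP; split.
    apply: le_trans (lip_env_self t y).
    by have := vM t y; rewrite ler_norml => /andP[].
  apply: lip_env_le => z; have := vM t (y + z).
  by rewrite ler_norml => /andP[_]; have := mulr_ge0 L0 (normr_ge0 z); lra.
have H x y : lip_env L v t x <= lip_env L v t y + L * `|x - y|.
  apply: lip_env_le => z; have := lip_env_ge t y (x - y + z).
  rewrite addrA subrKC => h.
  have := ler_wpM2l L0 (ler_normD (x - y) z); lra.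
move=> x y; have h1 := H x y; have h2 := H y x; rewrite (distrC y) in h2.
by rewrite ler_norml; apply/andP; split; lra.
Qed.

Lemma step_sub_env F D : step_sub F D v -> step_sub F D (lip_env L v).
Proof.
move=> sv t h y C c b a t0 h0 C0 H; apply: lip_env_le => x.
rewrite lerBlDr (_ : _ + _ + _ + _ = (c + L * `|x|) + h * F a + C * D * (h * Num.sqrt h)); last by ring.
apply: (sv t h (y + x) C _ b a) => // z.
have := H (z - x); have := lip_env_ge t (z - x) x; rewrite subrK.
by rewrite (_ : z - x - y = z - (y + x)); [lra|ring].
Qed.

End lip_env.

Section linear.
Variables (s : R) (s0 : 0 <= s).
Local Notation rw := (rw_step s).
Let F a := 2^-1 * (s ^+ 2 * a).

Lemma taylor3_rw h C g g1 g2 : taylor3 C g g1 g2 ->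
  taylor3 C (rw h g) (rw h g1) (rw h g2).
Proof.
move=> T y z; rewrite /rw_step; set q := s * _.
have T1 := T (y + q) (z + q); have T2 := T (y - q) (z - q).
rewrite (_ : z + q - (y + q) = z - y) in T1; last by ring.
rewrite (_ : z - q - (y - q) = z - y) in T2; last by ring.
move: T1 T2; rewrite !ler_norml => /andP[a1 a2] /andP[b1 b2].
by apply/andP; split; lra.
Qed.

Lemma taylor3_iter_rw h C g g1 g2 n : taylor3 C g g1 g2 ->
  taylor3 C (iter n (rw h) g) (iter n (rw h) g1) (iter n (rw h) g2).
Proof. by move=> T; elim: n => //= n IH; exact: taylor3_rw. Qed.

(** First-order terms cancel in a symmetric step, so a walk step is an Euler step for the linear
    equation up to the cubic remainder. *)
Lemma taylor3_rw_ge h C g g1 g2 y : 0 <= h -> taylor3 C g g1 g2 ->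
  g y + h * F (g2 y) <= rw h g y + C * s ^+ 3 * (h * Num.sqrt h).
Proof.
move=> h0 T; rewrite /rw_step; set q := Num.sqrt h.
have hq : h = q ^+ 2 by rewrite sqr_sqrtr.
have q0 : 0 <= q by exact: sqrtr_ge0.
have T1 := T y (y + s * q); have T2 := T y (y - s * q).
rewrite (_ : y + s * q - y = s * q) in T1; last by ring.
rewrite (_ : y - s * q - y = - (s * q)) in T2; last by ring.
rewrite normrN sqrrN in T2.
have sq0 : 0 <= s * q by exact: mulr_ge0.
move: T1 T2; rewrite (ger0_norm sq0) !ler_norml => /andP[a1 _] /andP[b1 _].
rewrite hq /F.
have -> : C * s ^+ 3 * (q ^+ 2 * q) = C * (s * q) ^+ 3 by ring.
have -> : q ^+ 2 * (2^-1 * (s ^+ 2 * g2 y)) = 2^-1 * g2 y * (s * q) ^+ 2 by ring.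
lra.
Qed.

Lemma avg_rw M h e f y : (forall x, `|f x| <= M) -> avg e (rw h f) y = rw h (avg e f) y.
Proof.
move=> fM; rewrite /rw_step; set q := s * _.
have f1 x : `|f (x + q)| <= M by [].
have f2 x : `|f (x - q)| <= M by [].
have f12 x : `|f (x + q) + f (x - q)| <= M + M.
  by apply: le_trans (ler_normD _ _) _; rewrite lerD.
rewrite (avgZ _ _ _ f12) (avgD _ _ f1 f2).
by rewrite (avg_shift e f q y) (avg_shift e f (- q) y).
Qed.

Lemma avg3_iter_rw M h e f n : (forall x, `|f x| <= M) ->
  avg3 e (iter n (rw h) f) = iter n (rw h) (avg3 e f).
Proof.
have H g : (forall x, `|g x| <= M) -> avg e (iter n (rw h) g) = iter n (rw h) (avg e g).
  move=> gM; elim: n => //= n IH; rewrite -IH; apply/funext => x.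
  apply: (@avg_rw M) => z.
  exact: (slop_bounded (sublinear_op_iter n (sublinear_op_rw s h)) gM).
move=> fM; have f1 x := avg_bounded e x fM; have f2 x := avg_bounded e x f1.
by rewrite /avg3 H// H// H.
Qed.

Lemma iter_rw_le C g g1 g2 n h y : 0 < h -> 0 <= C -> taylor3 C g g1 g2 ->
  iter n.+1 (rw h) g y <= g y + n.+1%:R * h * F (g2 y) +
   C * (s ^+ 2 + 3 * s ^+ 4) * (n.+1%:R * h * Num.sqrt (n.+1%:R * h)).
Proof.
move=> h0 C0 T; set t := n.+1%:R * h.
have t0 : 0 < t by rewrite mulr_gt0.
set q := Num.sqrt t; have q0 : 0 < q by rewrite sqrtr_gt0.
have tq : t = q ^+ 2 by rewrite sqr_sqrtr// ltW.
have Cq0 : 0 <= C / q by rewrite divr_ge0// ltW.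
have := @iter_scheme_le R s s s0 (lexx s) g h n.+1 (g y) (g1 y)
  (g2 y + 2 * (C * q)) (C / q) y (ltW h0) Cq0.
have -> : scheme s s h = rw h by apply/funext => f; apply/funext => x; rewrite /scheme maxxx.
rewrite GfunE// maxxx -/t => H; apply: le_trans (H _) _.
  move=> z; have := T y z; rewrite ler_norml => /andP[_ h1].
  set d := z - y in h1 *; have dn := real_normK (num_real d).
  have h2 : C * `|d| ^+ 3 <= C * (q * d ^+ 2 + d ^+ 4 / q).
    rewrite ler_wpM2l// (exprM d 2 2) -dn -subr_ge0.
    have -> : q * `|d| ^+ 2 + (`|d| ^+ 2) ^+ 2 / q - `|d| ^+ 3 =
      `|d| ^+ 2 * ((q - `|d| / 2) ^+ 2 + 3 / 4 * `|d| ^+ 2) / q.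
      by field; rewrite gt_eqF.
    by rewrite divr_ge0 ?(ltW q0)// mulr_ge0 ?sqr_ge0// addr_ge0 ?sqr_ge0// mulr_ge0 ?sqr_ge0.
  have -> : C / q * d ^+ 4 = C * (d ^+ 4 / q) by ring.
  lra.
rewrite le_eqVlt; apply/orP; left; apply/eqP; rewrite /F tq; field.
by rewrite gt_eqF.
Qed.

Variables (M L D : R) (w : R -> R -> R).
Hypotheses (D0 : 0 <= D) (stw : step_sub F D w) (wb : forall t, 0 <= t -> bounded_lip M L (w t)).

(** A subsolution of the linear equation stays below the random walk started from a smooth majorant.
    Each step costs two cubic errors: [D] from the subsolution and [s ^+ 3] from the walk. *)
Lemma step_sub_iter t h C g g1 g2 n y : 0 <= t -> 0 < h -> 0 <= C ->
  taylor3 C g g1 g2 -> (forall z, w t z <= g z) ->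
  w (t + n%:R * h) y <= iter n (rw h) g y + n%:R * (C * (D + s ^+ 3) * (h * Num.sqrt h)).
Proof.
move=> t0 h0 C0 T wg; elim: n y => [|n IH] y.
  by rewrite !mul0r !addr0; exact: wg.
have Tn := taylor3_iter_rw h n T; set gn := iter n (rw h) g in IH Tn.
set g1n := iter n (rw h) g1 in Tn; set g2n := iter n (rw h) g2 in Tn.
set err := C * (D + s ^+ 3) * (h * Num.sqrt h) in IH *.
have tn0 : 0 <= t + n%:R * h by rewrite addr_ge0// mulr_ge0// ltW.
have := stw (c := gn y + n%:R * err) (b := g1n y) (a := g2n y) (y := y) tn0 h0 C0.
move=> H; rewrite -natr1 mulrDl mul1r addrA; apply: le_trans (H _) _.
  move=> z; apply: le_trans (IH z) _; have := Tn y z; rewrite ler_norml => /andP[_]; lra.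
have := taylor3_rw_ge y (ltW h0) Tn; rewrite iterS -/gn.
have -> : err = C * D * (h * Num.sqrt h) + C * s ^+ 3 * (h * Num.sqrt h) by rewrite /err; ring.
rewrite (mulrDl n%:R) mul1r; lra.
Qed.

(** The error constant depends on the scale e of the average only. A much finer smoothing at scale
    e' provides a majorant to which [step_sub_iter] applies; then the average at scale e is moved
    inside the walk, with which it commutes, and Taylor's formula is used at scale e. *)
Lemma step_sub_avg e t h y : 0 < e -> 0 <= t -> 0 < h ->
  avg3 e (w (t + h)) y <= avg3 e (w t) y + h * F (avg3'' e (w t) y) +
    8 * M / e ^+ 3 * (s ^+ 2 + 3 * s ^+ 4) * (h * Num.sqrt h).
Proof.
move=> e0 t0 h0; have bw := wb t0; have [M0 L0] := bounded_lip_ge0 bw.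
have bwh := wb (addr_ge0 t0 (ltW h0)).
set Ce := 8 * M / e ^+ 3.
have Ce0 : 0 <= Ce by apply: divr_ge0; [exact: mulr_ge0|exact: exprn_ge0 (ltW e0)].
apply/ler_addgt0Pr => d d0.
(* [K * e'] collects the errors due to the finer smoothing: [6 * L] from values, the middle term
   from the second derivative, and a positive margin. *)
pose K := 6 * L + h * (2^-1 * (s ^+ 2 * (12 * L / e ^+ 2))) + 1.
have K1 : 0 <= h * (2^-1 * (s ^+ 2 * (12 * L / e ^+ 2))).
  apply: mulr_ge0; first exact: ltW.
  apply: mulr_ge0 => //; apply: mulr_ge0; first exact: sqr_ge0.
  by rewrite divr_ge0 ?sqr_ge0// mulr_ge0.
have K0 : 0 < K by rewrite /K ltr_wpDl// addr_ge0// mulr_ge0.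
pose e' := d / 2 / K; have e'0 : 0 < e' by rewrite !divr_gt0.
pose p := avg3 e' (w t); have bp : bounded_lip M L p by exact: avg3_lip.
pose g z := p z + 3 * L * e'.
pose C' := 8 * M / e' ^+ 3.
have C'0 : 0 <= C' by apply: divr_ge0; [exact: mulr_ge0|exact: exprn_ge0 (ltW e'0)].
have Tg : taylor3 C' g (avg3' e' (w t)) (avg3'' e' (w t)).
  exact: taylor3_addC (avg3_taylor3 e'0 bw).
have wg z : w t z <= g z.
  have := avg3_near z (ltW e'0) bw; rewrite /g /p ler_norml => /andP[h1 _]; lra.
pose E := C' * (D + s ^+ 3) * h.
have E0 : 0 <= E by rewrite mulr_ge0 ?(ltW h0)// mulr_ge0// addr_ge0// exprn_ge0.
(* The mesh of the walk is chosen after e': over a total time h the cubic errors add up to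
   [E * sqrt (h / n.+1)]. *)
have [n Hn] : exists n : nat, E * Num.sqrt (h / n.+1%:R) <= d / 2.
  have dE : 0 < d / 2 / (E + 1) by rewrite !divr_gt0// ltr_wpDl.
  exists (Num.truncn (h / (d / 2 / (E + 1)) ^+ 2)).
  set m := (Num.truncn _).+1%:R.
  have m0 : 0 < m :> R by rewrite ltr0n.
  have hm : h / m <= (d / 2 / (E + 1)) ^+ 2.
    rewrite ler_pdivrMr// mulrC -ler_pdivrMr ?exprn_gt0//.
    exact: ltW (truncnS_gt _).
  have {}hm : Num.sqrt (h / m) <= d / 2 / (E + 1).
    by rewrite -[leRHS]ger0_norm ?(ltW dE)// -sqrtr_sqr ler_wsqrtr.
  apply: (@le_trans _ _ ((E + 1) * Num.sqrt (h / m))).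
    by rewrite ler_wpM2r ?sqrtr_ge0// lerDl.
  by rewrite mulrC -ler_pdivlMr// ltr_wpDl.
pose m := n.+1%:R : R; have m0 : 0 < m by rewrite ltr0n.
pose k := h / m; have k0 : 0 < k by rewrite divr_gt0.
have mk : n.+1%:R * k = h by rewrite /k mulrC divfK// gt_eqF.
have bg z : `|g z| <= M + 3 * L * e'.
  apply: le_trans (ler_normD _ _) _; rewrite lerD ?(bp.1)// ger0_norm//.
  by rewrite mulr_ge0 ?(ltW e'0)// mulr_ge0.
have W z : w (t + h) z <= iter n.+1 (rw k) g z + d / 2.
  have := step_sub_iter n.+1 z t0 k0 C'0 Tg wg; rewrite mk => H; apply: le_trans H _.
  rewrite lerD2l; apply: le_trans Hn.
  rewrite -/m -/k /E -[in X in _ <= X * _]mk; rewrite le_eqVlt; apply/orP; left.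
  by apply/eqP; ring.
have opn := sublinear_op_iter n.+1 (sublinear_op_rw s k).
have b1 z : `|iter n.+1 (rw k) g z| <= M + 3 * L * e' by exact: (slop_bounded opn bg).
have b2 : `|d / 2| <= d / 2 by rewrite ger0_norm// ltW// divr_gt0.
have b12 z : `|iter n.+1 (rw k) g z + d / 2| <= M + 3 * L * e' + d / 2.
  by apply: le_trans (ler_normD _ _) _; rewrite lerD ?b1.
have addc q r c : (forall x, `|q x| <= r) -> forall x, avg3 e (fun z => q z + c) x = avg3 e q x + c.
  move=> qr; have q1 x := avg_bounded e x qr; have q2 x := avg_bounded e x q1.
  have cc (x : R) : `|c| <= `|c| by [].
  have A f r' : (forall x, `|f x| <= r') -> avg e (fun z => f z + c) = (fun z => avg e f z + c).
    by move=> fr; apply/funext => x; rewrite (avgD _ _ fr cc) avg_cst.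
  by move=> x; rewrite /avg3 (A _ _ qr) (A _ _ q1) (A _ _ q2).
have W2 := avg3_le e y bwh.1 b12 W; apply: le_trans W2 _.
rewrite (addc _ _ _ b1) (avg3_iter_rw _ _ _ bg).
have -> : avg3 e g = (fun z => avg3 e p z + 3 * L * e') by apply/funext => z; rewrite -(addc _ _ _ bp.1).
have Tp : taylor3 Ce (fun z => avg3 e p z + 3 * L * e') (avg3' e p) (avg3'' e p).
  exact: taylor3_addC (avg3_taylor3 e0 bp).
have := iter_rw_le n y k0 Ce0 Tp; rewrite mk => H.
have pw x : `|p x - w t x| <= 3 * L * e' by exact: avg3_near (ltW e'0) bw.
have := avg3_dist e y bp.1 bw.1 pw; rewrite ler_norml => /andP[_ P1].
have := avg3''_dist y e0 bp.1 bw.1 pw; rewrite ler_norml => /andP[_ P2].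
have s2 : 0 <= 2^-1 * s ^+ 2 by rewrite mulr_ge0// sqr_ge0.
have P3 : h * F (avg3'' e p y) <= h * F (avg3'' e (w t) y) + h * (2^-1 * (s ^+ 2 * (4 * (3 * L * e') / e ^+ 2))).
  have := ler_wpM2l (mulr_ge0 (ltW h0) s2) P2; rewrite /F.
  lra.
have KE : K * e' = d / 2 by rewrite /e' mulrC divfK// gt_eqF.
have KE2 : 6 * L * e' + h * (2^-1 * (s ^+ 2 * (4 * (3 * L * e') / e ^+ 2))) + e' = d / 2.
  by rewrite -KE /K; ring.
lra.
Qed.

End linear.

(** u is compared along a time grid with minus an average of the envelope w of v. At each node one
    volatility s attains [Gfun] at the second derivative of the comparison function, and the
    inequality for the linear equation with that s closes the induction. *)
Lemma step_comparison sl su D M L f u v : 0 <= sl -> sl <= su -> 0 <= D -> bounded_lip M L f ->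
  step_sub (Gfun sl su) D u ->
  (forall s, s = su \/ s = sl -> step_sub (fun a => 2^-1 * (s ^+ 2 * a)) D v) ->
  (forall t y, `|v t y| <= M) ->
  (forall y, u 0 y <= f y) -> (forall y, v 0 y <= - f y) ->
  forall t y, 0 < t -> u t y <= - v t y.
Proof.
move=> hsl hsu D0 bf su_ sv vM u0 v0 t y t0.
have [M0 L0] := bounded_lip_ge0 bf; have [fM fL] := bf.
pose w := lip_env L v.
have bw r : bounded_lip M L (w r) by exact: lip_env_bounded_lip.
have sw s : s = su \/ s = sl -> step_sub (fun a => 2^-1 * (s ^+ 2 * a)) D w.
  by move=> /sv; exact: step_sub_env.
have w0 z : w 0 z <= - f z.
  apply: (lip_env_le L0 vM) => x; have := v0 (z + x); have := fL z (z + x).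
  rewrite opprD addNKr normrN ler_norml => /andP[_]; lra.
have vw : v t y <= w t y by exact: lip_env_self vM _ _.
suff : u t y <= - w t y by lra.
apply/ler_addgt0Pr => d d0.
(* The averaging error [3 * L * e] occurs twice, at time 0 and at time t. *)
pose e := d / 2 / (6 * L + 1); have e0 : 0 < e by rewrite !divr_gt0// ltr_wpDl// mulr_ge0.
pose Ce := 8 * M / e ^+ 3.
have Ce0 : 0 <= Ce by apply: divr_ge0; [exact: mulr_ge0|exact: exprn_ge0 (ltW e0)].
pose K := su ^+ 2 + 3 * su ^+ 4.
have su0 := le_trans hsl hsu.
have Ks s : s = su \/ s = sl -> [/\ 0 <= s & s ^+ 2 + 3 * s ^+ 4 <= K].
  case=> ->; split=> //; rewrite /K lerD// ?ler_wpM2l//.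
    by rewrite ler_sqr ?nnegrE.
  by rewrite lerXn2r ?nnegrE.
pose E := Ce * (D + K) * t.
have E0 : 0 <= E.
  rewrite mulr_ge0 ?(ltW t0)// mulr_ge0// addr_ge0//.
  by rewrite addr_ge0 ?sqr_ge0// mulr_ge0// exprn_ge0.
have [n Hn] : exists n : nat, E * Num.sqrt (t / n.+1%:R) <= d / 2.
  have dE : 0 < d / 2 / (E + 1) by rewrite !divr_gt0// ltr_wpDl.
  exists (Num.truncn (t / (d / 2 / (E + 1)) ^+ 2)).
  set m := (Num.truncn _).+1%:R.
  have m0 : 0 < m :> R by rewrite ltr0n.
  have hm : t / m <= (d / 2 / (E + 1)) ^+ 2.
    rewrite ler_pdivrMr// mulrC -ler_pdivrMr ?exprn_gt0//.
    exact: ltW (truncnS_gt _).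
  have {}hm : Num.sqrt (t / m) <= d / 2 / (E + 1).
    by rewrite -[leRHS]ger0_norm ?(ltW dE)// -sqrtr_sqr ler_wsqrtr.
  apply: (@le_trans _ _ ((E + 1) * Num.sqrt (t / m))).
    by rewrite ler_wpM2r ?sqrtr_ge0// lerDl.
  by rewrite mulrC -ler_pdivlMr// ltr_wpDl.
pose m := n.+1%:R : R; have m0 : 0 < m by rewrite ltr0n.
pose h := t / m; have h0 : 0 < h by rewrite divr_gt0.
have mh : n.+1%:R * h = t by rewrite /h mulrC divfK// gt_eqF.
pose err := Ce * (D + K) * (h * Num.sqrt h).
have claim j z : u (j%:R * h) z <= - avg3 e (w (j%:R * h)) z + 3 * L * e + j%:R * err.
  elim: j z => [|j IH] z.
    rewrite !mul0r addr0; apply: le_trans (u0 z) _.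
    have := avg3_near z (ltW e0) (bw 0); rewrite ler_norml => /andP[_ h1].
    have := w0 z; lra.
  have tj0 : 0 <= j%:R * h by rewrite mulr_ge0// ltW.
  set r := j%:R * h in IH tj0 *.
  have -> : j.+1%:R * h = r + h by rewrite -natr1 mulrDl mul1r.
  set W := avg3 e (w r) in IH.
  have T := avg3_taylor3 e0 (bw r).
  have := su_ r h z Ce (- W z + 3 * L * e + j%:R * err) (- avg3' e (w r) z)
    (- avg3'' e (w r) z) tj0 h0 Ce0.
  move=> H; apply: le_trans (H _) _.
    move=> x; apply: le_trans (IH x) _; have := T z x; rewrite -/W -/Ce ler_norml => /andP[h1 _].
    by clear -h1; clearbody W err Ce e; lra.
  have [s ss ->] := Gfun_attained hsl hsu (- avg3'' e (w r) z).
  have [s0 sK] := Ks s ss.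
  have := @step_sub_avg s s0 M L D w D0 (sw s ss) (fun t _ => bw t) e r h z e0 tj0 h0.
  rewrite -/W -/Ce => h2.
  have q0 : 0 <= h * Num.sqrt h by rewrite mulr_ge0 ?sqrtr_ge0// ltW.
  have h3 : Ce * (s ^+ 2 + 3 * s ^+ 4) * (h * Num.sqrt h) <= Ce * K * (h * Num.sqrt h).
    by rewrite ler_wpM2r// ler_wpM2l.
  have -> : j.+1%:R * err = j%:R * err + (Ce * D * (h * Num.sqrt h) + Ce * K * (h * Num.sqrt h)).
    by rewrite -natr1 mulrDl mul1r /err; ring.
  have -> : h * (2^-1 * (s ^+ 2 * - avg3'' e (w r) z)) = - (h * (2^-1 * (s ^+ 2 * avg3'' e (w r) z))).
    by rewrite !mulrN.
  clear -h2 h3; set X := h * (2^-1 * _) in h2 *; set q := h * Num.sqrt h in h2 h3 *.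
  set A := avg3 e (w (r + h)) z in h2 *; clearbody X q A W err Ce K e.
  set cD := Ce * D * q; set cK := Ce * K * q in h3 *.
  set cs := Ce * _ * q in h2 h3; clearbody cD cK cs.
  lra.
have := claim n.+1 y; rewrite mh.
have -> : n.+1%:R * err = E * Num.sqrt (t / n.+1%:R).
  by rewrite /err /E -/m -/h -[in RHS]mh; ring.
have := avg3_near y (ltW e0) (bw t); rewrite ler_norml => /andP[h1 _].
have : (6 * L + 1) * e = d / 2 by rewrite /e mulrC divfK// gt_eqF// ltr_wpDl// mulr_ge0.
lra.
Qed.

End comparison.

(** * Uniqueness and identification of the viscosity solution *)

Section G_heat_semigroup.
Context {R : realType}.
Variables (sl su : R) (hsl : 0 <= sl) (hsu : sl <= su).
Implicit Types (f g : R -> R) (u v psi : R -> R -> R) (t y s a c L M K : R).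
Local Notation k := (su ^+ 2).
Local Notation G := (Gfun sl su).

Lemma derive1_opp f x : derivable f x 1 -> derive1 (fun z => - f z) x = - derive1 f x.
Proof. by move=> df; rewrite !derive1E deriveN. Qed.

Lemma C12_opp psi : C12 psi -> [/\ C12 (fun t y => - psi t y),
  forall t y, 0 < t -> derive1 ((fun t y => - psi t y) ^~ y) t = - derive1 (psi ^~ y) t &
  forall t y, 0 < t -> derive1n 2 (fun y => - psi t y) y = - derive1n 2 (psi t) y].
Proof.
move=> [dpsi c1 c2 c3].
have e1 t y : 0 < t -> derive1 (fun t => - psi t y) t = - derive1 (psi ^~ y) t.
  by move=> t0; apply: derive1_opp; have [D1 _ _] := dpsi t y t0; exact: D1.
have e2 t : 0 < t -> derive1 (fun y => - psi t y) = (fun y => - derive1 (psi t) y).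
  move=> t0; apply/funext => y; apply: derive1_opp.
  by have [_ D2 _] := dpsi t y t0; exact: D2.
have e3 t y : 0 < t -> derive1n 2 (fun y => - psi t y) y = - derive1n 2 (psi t) y.
  move=> t0; rewrite /= e2//; apply: derive1_opp.
  by have [_ _ D3] := dpsi t y t0; exact: D3.
have near_pos (p : R * R) : 0 < p.1 -> \forall q \near p, 0 < q.1.
  move=> p0; have : nbhs p.1 [set x : R | 0 < x].
    by apply: open_nbhs_nbhs; split; [exact: open_gt|].
  exact: cvg_fst.
split; [|exact: e1|exact: e3]; split.
- move=> t y t0; have [D1 D2 D3] := dpsi t y t0; split.
  + exact: derivableN D1.
  + exact: derivableN D2.
  + rewrite (e2 _ t0); exact: derivableN D3.
- move=> p pD; have p0 : 0 < p.1 by move: pD; rewrite inE.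
  have near_eq := near_pos p p0.
  rewrite /continuous_at /= (e1 _ _ p0).
  apply: (cvg_trans _ (cvgN (c1 p pD))); apply: near_eq_cvg.
  by apply: filterS near_eq => q q0; rewrite /= (e1 _ _ q0).
- move=> p pD; have p0 : 0 < p.1 by move: pD; rewrite inE.
  have near_eq := near_pos p p0.
  rewrite /continuous_at /= (e2 _ p0).
  apply: (cvg_trans _ (cvgN (c2 p pD))); apply: near_eq_cvg.
  by apply: filterS near_eq => q q0; rewrite /= (e2 _ q0).
- move=> p pD; have p0 : 0 < p.1 by move: pD; rewrite inE.
  have near_eq := near_pos p p0.
  rewrite /continuous_at (e3 _ _ p0).
  apply: (cvg_trans _ (cvgN (c3 p pD))); apply: near_eq_cvg.
  by apply: filterS near_eq => q q0; rewrite (e3 _ _ q0).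
Qed.

(** Frozen before time 0: the equation is tested at positive times only, and continuity on the
    closed half-plane becomes continuity on the plane. *)
Definition time_ext u t y := u (Num.max 0 t) y.

Lemma time_ext_continuous u :
  {within [set p : R * R | 0 <= p.1], continuous (fun p : R * R => u p.1 p.2)} ->
  continuous (fun p : R * R => time_ext u p.1 p.2).
Proof.
move=> /subspace_continuousP H p.
have cm : continuous (fun t : R => Num.max 0 t).
  by move=> t; apply: (@continuous_max _ _ (fun=> 0) id); [exact: cvg_cst|exact: cvg_id].
have Dp q : [set p : R * R | 0 <= p.1] (Num.max 0 q.1, q.2 : R) by rewrite /= le_max lexx.
have := H _ (Dp p) => Hp A /Hp.
have c1 : (fun q : R * R => Num.max 0 q.1) @ p --> Num.max 0 p.1.
  by apply: (@cvg_comp _ _ _ fst (fun t : R => Num.max 0 t)); [exact: cvg_fst|exact: cm].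
have c2 : (fun q : R * R => q.2) @ p --> p.2 by exact: cvg_snd.
have cr := @cvg_pair _ _ _ _ _ _ _ _ _ _ _ c1 c2.
move=> /(cr _ _ _); apply: (@filterS _ (nbhs p)) => q /= h; exact: (h (Dp q)).
Qed.

Lemma visc_sub_ext F u : (forall psi t y, 0 < t -> C12 psi ->
    (forall s z, 0 < s -> u s z <= psi s z) -> u t y = psi t y ->
    derive1 (psi ^~ y) t - F (derive1n 2 (psi t) y) <= 0) ->
  visc_sub F (time_ext u).
Proof.
move=> H psi t y t0 Cpsi h1 h2.
have uE s z : 0 < s -> time_ext u s z = u s z by move=> s0; rewrite /time_ext max_r// ltW.
apply: H => //; last by rewrite -uE.
by move=> s z s0; rewrite -uE//; exact: h1.
Qed.

Lemma G_heat_solution_le f u v M L : bounded_lip M L f ->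
  G_heat_solution sl su f u -> G_heat_solution sl su f v ->
  forall t y, 0 <= t -> u t y <= v t y.
Proof.
move=> bf [cu bu u0 usub _] [cv bv v0 _ vsup] t y.
rewrite le_eqVlt => /orP[/eqP<-|t0]; first by rewrite u0 v0.
have k0 : 0 <= k by exact: sqr_ge0.
have k12 : sl ^+ 2 <= su ^+ 2 by rewrite ler_sqr// nnegrE ?(le_trans hsl).
have bnd w : [bounded w p.1 p.2 | p in [set p : R * R | 0 <= p.1]] ->
    exists N : R, forall s z, `|time_ext w s z| <= N.
  move=> [N [_ HN]]; exists (N + 1) => s z.
  by apply: (HN (N + 1) _ (Num.max 0 s, z)); rewrite ?ltrDl//= le_max lexx.
have [Nu HNu] := bnd _ bu; have [Nv HNv] := bnd _ bv.
have [M0 L0] := bounded_lip_ge0 bf.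
pose N := M + `|Nu| + `|Nv|.
have NM : M <= N by rewrite /N -addrA lerDl addr_ge0.
have Hu s z : `|time_ext u s z| <= N.
  apply: le_trans (HNu s z) _; apply: le_trans (ler_norm _) _.
  by rewrite /N addrAC lerDr addr_ge0.
have Hv s z : `|- time_ext v s z| <= N.
  rewrite normrN; apply: le_trans (HNv s z) _; apply: le_trans (ler_norm _) _.
  by rewrite /N lerDr addr_ge0.
have bf' : bounded_lip N L f.
  by case: bf => fM fL; split=> // x; exact: le_trans (fM x) NM.
pose D := k + 3 * k ^+ 2.
have D0 : 0 <= D by rewrite addr_ge0// mulr_ge0// sqr_ge0.
have stu : step_sub G D (time_ext u).
  move=> s h x C c b a s0 h0 C0.
  apply: (visc_step k0 _ _ Hu (time_ext_continuous cu)) => //.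
    by move=> a' c'; exact: Gfun_le.
  exact: visc_sub_ext usub.
(* [Gfun] dominates each of its linear parts; therefore minus a supersolution is a subsolution of
   the linear equation with volatility s. *)
have stv s : s = su \/ s = sl ->
    step_sub (fun a => 2^-1 * (s ^+ 2 * a)) D (fun t y => - time_ext v t y).
  move=> ss r h x C c b a r0 h0 C0.
  have cv' : continuous (fun p : R * R => - time_ext v p.1 p.2).
    by move=> p; apply: cvgN; exact: time_ext_continuous cv p.
  apply: (@visc_step R k k0 (fun a => 2^-1 * (s ^+ 2 * a)) _ (fun t y => - time_ext v t y) N
    r h x c b a C _ Hv cv' r0 h0 C0).
    move=> a' c' c0; rewrite mulrDr mulrDr lerD2l ler_pM2l// ler_wpM2r//.
    by case: ss => ->.
  apply: (@visc_sub_ext _ (fun t y => - v t y)) => psi t1 y1 t10 Cpsi h1 h2.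
  have [CN dN ddN] := C12_opp Cpsi.
  have := vsup _ t1 y1 t10 CN; rewrite dN// ddN// => H.
  have {}H : 0 <= - (psi ^~ y1)^`()%classic t1 - G (- (psi t1)^`(2)%classic y1).
    apply: H => [s' z s0'|]; first by rewrite lerNl; exact: h1.
    by rewrite -h2 opprK.
  have := Gfun_ge hsl hsu (- (psi t1)^`(2)%classic y1) ss.
  rewrite !mulrN; lra.
have u0' z : time_ext u 0 z <= f z by rewrite /time_ext maxxx u0.
have v0' z : - time_ext v 0 z <= - f z by rewrite /time_ext maxxx v0.
have := step_comparison hsl hsu D0 bf' stu stv Hv u0' v0' y t0.
by rewrite opprK /time_ext max_r// ltW.
Qed.

(** [G_heat] is some solution chosen by [xget]; comparison in both directions with the one given by
    the semigroup identifies it. *)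
Lemma G_heatE f M L t y : bounded_lip M L f -> 0 <= t -> G_heat sl su f t y = heat sl su t f y.
Proof.
move=> bf t0; have hs := heat_solution hsl hsu bf.
have gs : G_heat_solution sl su f (G_heat sl su f).
  by rewrite /G_heat; apply: xgetPex; exists (fun t y => heat sl su t f y).
apply/eqP; rewrite eq_le.
by rewrite (G_heat_solution_le bf gs hs y t0) (G_heat_solution_le bf hs gs y t0).
Qed.

End G_heat_semigroup.

(** * Conditional G-expectation of cylinder functions *)

Section paths.
Context {R : realType}.
Implicit Types (w : Omega R) (r s t y : R).

Definition mkpath (f : R -> R) (H : @is_path R f) : Omega R :=
  (exist (fun f : R -> R => f \in @is_path R) f (mem_set H) : path_space R).

Lemma B_mkpath f (H : @is_path R f) t : B t (mkpath H) = f t.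
Proof. by []. Qed.

Lemma B_continuous w : continuous (fun t => B t w).
Proof. by case: (set_valP (w : path_space R)). Qed.

Lemma B_le0 t w : t <= 0 -> B t w = 0.
Proof. by case: (set_valP (w : path_space R)) => _; apply. Qed.

Lemma B_inj w w' : (forall t, B t w = B t w') -> w = w'.
Proof. by move=> ww'; apply: val_inj; apply/funext => t; exact: ww'. Qed.

Lemma B_stop s t w : B s (stop t w) = B (Num.min s t) w.
Proof. by []. Qed.

(** [Num.max 0 s] and the absolute value make this usable for all s and t: it is always continuous
    and vanishes before time 0. *)
Definition ramp s t r : R := Num.min 1 (Num.max 0 ((r - Num.max 0 s) / `|t - s|)).

Lemma ramp_itv s t r : 0 <= ramp s t r <= 1.
Proof. by rewrite /ramp le_min ge_min ler01 lexx le_max lexx. Qed.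

Lemma ramp_le s t r : 0 <= s -> r <= s -> ramp s t r = 0.
Proof.
move=> s0 rs; rewrite /ramp (max_r s0) max_l ?min_r//.
by rewrite mulr_le0_ge0 ?subr_le0// invr_ge0.
Qed.

Lemma ramp_ge s t r : 0 <= s -> s < t -> t <= r -> ramp s t r = 1.
Proof.
move=> s0 st tr; rewrite /ramp (max_r s0).
have st0 : 0 < t - s by rewrite subr_gt0.
have h1 : 1 <= (r - s) / `|t - s|.
  by rewrite gtr0_norm// ler_pdivlMr// mul1r lerD2r.
by rewrite max_r ?(le_trans ler01)// min_l.
Qed.

Lemma ramp_continuous s t : continuous (ramp s t).
Proof.
have c1 : continuous (fun r => (r - Num.max 0 s) / `|t - s|).
  move=> r; apply: cvgM; last exact: cvg_cst.
  by apply: cvgB; [exact: cvg_id|exact: cvg_cst].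
have c2 : continuous (fun r => Num.max 0 ((r - Num.max 0 s) / `|t - s|)).
  by move=> r; apply: (@continuous_max _ _ (fun=> 0) (fun r => (r - Num.max 0 s) / `|t - s|)); [exact: cvg_cst|exact: c1].
by move=> r; apply: (@continuous_min _ _ (fun=> 1) (fun r => Num.max 0 ((r - Num.max 0 s) / `|t - s|))); [exact: cvg_cst|exact: c2].
Qed.

Lemma is_path_glue s t y w :
  @is_path R (fun r => B (Num.min r s) w + y * ramp s t r).
Proof.
have [c0 z0] := is_path_stop s w; split; last first.
  move=> r r0; rewrite (B_le0 w (_ : Num.min r s <= 0)) ?ge_min ?r0// add0r /ramp.
  rewrite max_l ?min_r ?mulr0//.
  by rewrite mulr_le0_ge0// subr_le0 le_max r0.
by move=> r; apply: cvgD; [exact: c0|apply: cvgM; [exact: cvg_cst|exact: ramp_continuous]].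
Qed.

(** For 0 <= s < t the past up to s is that of w and the increment over [s, t] is y. Prescribed
    increments are thus realised inside the path space, and the backward recursion can act on
    functions of paths. *)
Definition glue s t y w : Omega R := mkpath (is_path_glue s t y w).

Lemma B_glue s t y w r : B r (glue s t y w) = B (Num.min r s) w + y * ramp s t r.
Proof. by []. Qed.

Lemma B_glue_le s t y w r : 0 <= s -> r <= s -> B r (glue s t y w) = B r w.
Proof. by move=> s0 rs; rewrite B_glue ramp_le// mulr0 addr0 min_l. Qed.

Lemma B_glue_ge s t y w r : 0 <= s -> s < t -> t <= r -> B r (glue s t y w) = B s w + y.
Proof.
by move=> s0 st tr; rewrite B_glue ramp_ge// mulr1 min_r// (le_trans (ltW st)).
Qed.

End paths.

(** * Cylinder functions without coordinates *)

Section cylinder_functions.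
Context {R : realType}.
Implicit Types (w : Omega R) (r s y c : R) (ts ps g : seq R) (Z X Y : Omega R -> R) (t : \bar R).

Definition path_dist ts w w' : R := \sum_(s <- ts) `|B s w - B s w'|.

Lemma path_dist_ge0 ts w w' : 0 <= path_dist ts w w'.
Proof. by rewrite sumr_ge0. Qed.

Lemma path_dist_mem ts w w' s : s \in ts -> `|B s w - B s w'| <= path_dist ts w w'.
Proof.
move=> sts; rewrite /path_dist (big_rem s)//= lerDl.
by rewrite sumr_ge0.
Qed.

Lemma path_dist_sub ts ts' w w' : {subset ts <= ts'} ->
  path_dist ts w w' <= (size ts)%:R * path_dist ts' w w'.
Proof.
elim: ts => [|s ts IH] sub; first by rewrite /path_dist big_nil mul0r.
rewrite /path_dist big_cons -[size _]add1n natrD mulrDl mul1r lerD//.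
  by apply: path_dist_mem; apply: sub; rewrite mem_head.
by apply: IH => x xts; apply: sub; rewrite in_cons xts orbT.
Qed.

(** A description on the path space in which times may be repeated or unordered. Sums, products,
    maxima and changes of the set of times become immediate. *)
Definition cylon ts Z := exists M L, [/\ 0 <= L, forall w, `|Z w| <= M &
  forall w w', `|Z w - Z w'| <= L * path_dist ts w w'].

Lemma cylon_sub ts ts' Z : {subset ts <= ts'} -> cylon ts Z -> cylon ts' Z.
Proof.
move=> sub [M [L [L0 ZM ZL]]]; exists M, (L * (size ts)%:R); split=> //.
  by rewrite mulr_ge0.
move=> w w'; apply: le_trans (ZL w w') _.
by rewrite -mulrA ler_wpM2l// path_dist_sub.
Qed.

Lemma cylon_dep ts Z w w' : cylon ts Z -> (forall s, s \in ts -> B s w = B s w') ->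
  Z w = Z w'.
Proof.
move=> [M [L [_ _ ZL]]] ww'; apply/eqP; rewrite -subr_eq0 -normr_le0.
apply: le_trans (ZL w w') _; rewrite /path_dist big_seq big1 ?mulr0// => s /ww' ->.
by rewrite subrr normr0.
Qed.

Lemma cylon_cst ts c : cylon ts (fun=> c).
Proof. by exists `|c|, 0; split=> // w w'; rewrite subrr normr0 mul0r. Qed.

Lemma cylonD ts Z Z' : cylon ts Z -> cylon ts Z' -> cylon ts (fun w => Z w + Z' w).
Proof.
move=> [M [L [L0 ZM ZL]]] [M' [L' [L0' ZM' ZL']]]; exists (M + M'), (L + L'); split.
- exact: addr_ge0.
- by move=> w; rewrite (le_trans (ler_normD _ _))// lerD.
- move=> w w'; rewrite opprD addrACA (le_trans (ler_normD _ _))// mulrDl lerD//.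
Qed.

Lemma cylonM ts Z Z' : cylon ts Z -> cylon ts Z' -> cylon ts (fun w => Z w * Z' w).
Proof.
move=> [M [L [L0 ZM ZL]]] [M' [L' [L0' ZM' ZL']]]; exists (M * M'), (L * M' + M * L').
have M0 : 0 <= M by exact: le_trans (ZM point).
have M0' : 0 <= M' by exact: le_trans (ZM' point).
split.
- by rewrite addr_ge0// mulr_ge0.
- by move=> w; rewrite normrM ler_pM.
- move=> w w'; have -> : Z w * Z' w - Z w' * Z' w' =
    (Z w - Z w') * Z' w + Z w' * (Z' w - Z' w') by ring.
  rewrite (le_trans (ler_normD _ _))// !normrM mulrDl lerD//.
    by rewrite mulrAC ler_pM.
  by rewrite -mulrA ler_pM.
Qed.

Lemma cylonZ ts c Z : cylon ts Z -> cylon ts (fun w => c * Z w).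
Proof. by apply: cylonM; exact: cylon_cst. Qed.

Lemma cylonN ts Z : cylon ts Z -> cylon ts (fun w => - Z w).
Proof.
by move=> /(cylonZ (-1)); congr cylon; apply/funext => w; rewrite mulN1r.
Qed.

Lemma cylonB ts Z Z' : cylon ts Z -> cylon ts Z' -> cylon ts (fun w => Z w - Z' w).
Proof. by move=> cZ /cylonN; exact: cylonD. Qed.

Lemma cylon_norm ts Z : cylon ts Z -> cylon ts (fun w => `|Z w|).
Proof.
move=> [M [L [L0 ZM ZL]]]; exists M, L; split=> // w; first by rewrite normr_id.
by move=> w'; apply: le_trans (ZL w w'); exact: ler_dist_dist.
Qed.

Lemma maxrE (a b : R) : Num.max a b = 2^-1 * (a + b + `|a - b|).
Proof.
have [ab|ab] := leP a b; first by rewrite distrC ger0_norm ?subr_ge0//; field.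
by rewrite gtr0_norm ?subr_gt0//; field.
Qed.

Lemma cylon_max ts Z Z' : cylon ts Z -> cylon ts Z' ->
  cylon ts (fun w => Num.max (Z w) (Z' w)).
Proof.
move=> cZ cZ'; have := cylonZ 2^-1 (cylonD (cylonD cZ cZ') (cylon_norm (cylonB cZ cZ'))).
by congr cylon; apply/funext => w; rewrite maxrE.
Qed.

Lemma cylon_min ts Z Z' : cylon ts Z -> cylon ts Z' ->
  cylon ts (fun w => Num.min (Z w) (Z' w)).
Proof.
move=> cZ cZ'; have := cylonN (cylon_max (cylonN cZ) (cylonN cZ')).
by congr cylon; apply/funext => w; rewrite oppr_max !opprK.
Qed.

Definition cyl (t : \bar R) Z :=
  exists2 ts, (forall s, s \in ts -> 0 <= s /\ (s%:E <= t)%E) & cylon ts Z.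

Lemma cyl2 t Z Z' : cyl t Z -> cyl t Z' -> exists ts,
  [/\ (forall s, s \in ts -> 0 <= s /\ (s%:E <= t)%E), cylon ts Z & cylon ts Z'].
Proof.
move=> [ts1 H1 c1] [ts2 H2 c2]; exists (ts1 ++ ts2); split.
- by move=> s; rewrite mem_cat => /orP[/H1|/H2].
- by apply: cylon_sub c1 => s h; rewrite mem_cat h.
- by apply: cylon_sub c2 => s h; rewrite mem_cat h orbT.
Qed.

Lemma cyl_cst t c : cyl t (fun=> c).
Proof. by exists [::] => //; exact: cylon_cst. Qed.

Lemma cylD t Z Z' : cyl t Z -> cyl t Z' -> cyl t (fun w => Z w + Z' w).
Proof. by move=> c1 c2; have [ts [H a b]] := cyl2 c1 c2; exists ts => //; exact: cylonD. Qed.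

Lemma cylM t Z Z' : cyl t Z -> cyl t Z' -> cyl t (fun w => Z w * Z' w).
Proof. by move=> c1 c2; have [ts [H a b]] := cyl2 c1 c2; exists ts => //; exact: cylonM. Qed.

Lemma cylN t Z : cyl t Z -> cyl t (fun w => - Z w).
Proof. by move=> [ts H c]; exists ts => //; exact: cylonN. Qed.

Lemma cylB t Z Z' : cyl t Z -> cyl t Z' -> cyl t (fun w => Z w - Z' w).
Proof. by move=> c1 /cylN; exact: cylD. Qed.

Lemma cylZ t c Z : cyl t Z -> cyl t (fun w => c * Z w).
Proof. by move=> [ts H cZ]; exists ts => //; exact: cylonZ. Qed.

Lemma cyl_max t Z Z' : cyl t Z -> cyl t Z' -> cyl t (fun w => Num.max (Z w) (Z' w)).
Proof. by move=> c1 c2; have [ts [H a b]] := cyl2 c1 c2; exists ts => //; exact: cylon_max. Qed.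

Lemma cyl_min t Z Z' : cyl t Z -> cyl t Z' -> cyl t (fun w => Num.min (Z w) (Z' w)).
Proof. by move=> c1 c2; have [ts [H a b]] := cyl2 c1 c2; exists ts => //; exact: cylon_min. Qed.

Lemma cyl_sum t (I : Type) (rs : seq I) (F : I -> Omega R -> R) :
  (forall i, cyl t (F i)) -> cyl t (fun w => \sum_(i <- rs) F i w).
Proof.
move=> H; elim: rs => [|i rs IH].
  by rewrite (_ : (fun w => _) = (fun=> 0)); [exact: cyl_cst|apply/funext => w; rewrite big_nil].
have := cylD (H i) IH; congr cyl; apply/funext => w; by rewrite big_cons.
Qed.

Lemma cyl_le t t' Z : (t <= t')%E -> cyl t Z -> cyl t' Z.
Proof.
move=> tt' [ts H c]; exists ts => // s /H[s0 st]; split=> //; exact: le_trans tt'.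
Qed.

Lemma cyl_bounded t Z : cyl t Z -> exists2 M : R, 0 <= M & forall w, `|Z w| <= M.
Proof.
by move=> [ts _ [M [L [_ ZM _]]]]; exists M => //; exact: le_trans (ZM point).
Qed.

Lemma row_norm_ge m (v : 'rV[R]_m) i : `|v 0 i| <= `|v|.
Proof.
rewrite -[leRHS]/(mx_norm v) mx_normrE.
by apply: (le_trans _ (@le_bigmax _ _ _ _ (fun ij => `|v ij.1 ij.2|) (0, i))).
Qed.

Lemma row_norm_le_sum m (v : 'rV[R]_m) : `|v| <= \sum_i `|v 0 i|.
Proof.
rewrite -[leLHS]/(mx_norm v) mx_normrE; apply: bigmax_le; first by rewrite sumr_ge0.
by move=> [j i] _ /=; rewrite (ord1 j) (bigD1 i)//= lerDl sumr_ge0.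
Qed.

Lemma bounded_lipschitzP m (phi : 'rV[R]_m -> R) :
  bounded_lipschitz phi <-> exists M L, [/\ 0 <= L, forall v, `|phi v| <= M &
    forall v v', `|phi v - phi v'| <= L * `|v - v'|].
Proof.
split=> [[[M [_ bM]] [L [_ bL]]]|[M [L [L0 bM bL]]]].
  exists (M + 1), (`|L| + 1); split; first by rewrite addr_ge0.
    by move=> v; apply: (bM (M + 1)) => //; rewrite ltrDl.
  move=> v v'; apply: (bL (`|L| + 1) _ (v, v')) => //.
  by rewrite (le_lt_trans (ler_norm _))// ltrDl.
split.
  by exists M; split; rewrite ?num_real// => x Mx v _; exact: le_trans (bM v) (ltW Mx).
exists L; split; rewrite ?num_real// => x Lx [v v'] _ /=.
by apply: le_trans (bL v v') _; rewrite ler_wpM2r// ltW.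
Qed.

(** McShane's extension, with the distance truncated at [2 * M]. The truncation keeps the extension
    bounded and does not affect it on the range of the coordinates, where Z varies by at most
    [2 * M]. *)
Lemma mcshane m (c : 'I_m -> Omega R -> R) Z M L : 0 <= L ->
  (forall w, `|Z w| <= M) ->
  (forall w w', `|Z w - Z w'| <= L * \sum_i `|c i w - c i w'|) ->
  exists2 phi : 'rV[R]_m -> R, bounded_lipschitz phi &
    forall w, Z w = phi (\row_i c i w).
Proof.
move=> L0 ZM ZL; have M0 : 0 <= M by exact: le_trans (ZM point).
pose d (v : 'rV[R]_m) w := Num.min (2 * M) (L * \sum_i `|v 0 i - c i w|).
pose phi v := inf [set Z w + d v w | w in [set: Omega R]].
have d0 v w : 0 <= d v w.
  by rewrite le_min mulr_ge0//= mulr_ge0// sumr_ge0.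
have lb v : lbound [set Z w + d v w | w in [set: Omega R]] (- M).
  move=> _ [w _ <-]; have := ZM w; rewrite ler_norml => /andP[h _].
  by have := d0 v w; lra.
have hi v : has_inf [set Z w + d v w | w in [set: Omega R]].
  by split; [exists (Z point + d v point); exists point|exists (- M)].
have phi_le v w : phi v <= Z w + d v w by apply: (ge_inf (hi v).2); exists w.
have phi_ge v x : (forall w, x <= Z w + d v w) -> x <= phi v.
  by move=> H; apply: lb_le_inf; [exact: (hi v).1|move=> _ [w _ <-]].
exists phi; last first.
  move=> w; apply/eqP; rewrite eq_le; apply/andP; split.
    apply: phi_ge => w'; have h1 := ZL w w'; have h2 := ZM w; have h3 := ZM w'.
    rewrite /d; set D := \sum_i _; have -> : D = \sum_i `|c i w - c i w'|.
      by apply: eq_bigr => i _; rewrite mxE.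
    move: h1 h2 h3; rewrite !ler_norml => /andP[_ a] /andP[_ b] /andP[b' _].
    by rewrite -lerBlDl le_min; apply/andP; split; lra.
  apply: le_trans (phi_le _ w) _; rewrite gerDl /d big1 ?mulr0 ?ge_min ?lexx ?orbT//.
  by move=> i _; rewrite mxE subrr normr0.
apply/bounded_lipschitzP; exists (3 * M), (L * m%:R); split.
- by rewrite mulr_ge0.
- move=> v; rewrite ler_norml; apply/andP; split.
    by apply: (@le_trans _ _ (- M)); [lra|apply: phi_ge => w; apply: lb; exists w].
  apply: le_trans (phi_le v point) _; have := ZM point; rewrite ler_norml => /andP[_ h].
  have : d v point <= 2 * M by rewrite /d ge_min lexx.
  lra.
- have H v v' : phi v <= phi v' + L * m%:R * `|v - v'|.
    rewrite -lerBlDr; apply: phi_ge => w; rewrite lerBlDr; apply: le_trans (phi_le v w) _.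
    rewrite -addrA lerD2l.
    have h : L * \sum_i `|v 0 i - c i w| <= L * \sum_i `|v' 0 i - c i w| + L * m%:R * `|v - v'|.
      rewrite -mulrA -mulrDr ler_wpM2l//.
      rewrite -[m in m%:R]card_ord -sum1_card natr_sum mulr_suml -big_split /=.
      apply: ler_sum => i _; rewrite mul1r.
      have := row_norm_ge (v - v') i; rewrite !mxE => h1.
      apply: le_trans (lerD (lexx _) h1).
      rewrite (_ : v 0 i - c i w = (v' 0 i - c i w) + (v 0 i - v' 0 i)); last by ring.
      exact: ler_normD.
    have h0 : 0 <= L * m%:R * `|v - v'| by rewrite mulr_ge0// mulr_ge0.
    rewrite /d; set a := L * \sum_i `|v 0 i - _| in h *.
    set b := L * \sum_i _ in h *.
    by rewrite /Num.min; case: ifPn => h1; case: ifPn => h2; lra.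
  move=> v v'; have h1 := H v v'; have h2 := H v' v; rewrite (distrC v') in h2.
  by rewrite ler_norml; apply/andP; split; lra.
Qed.

Lemma vecE m (s : seq R) i : (vec m s) 0 i = s`_i.
Proof. by rewrite mxE. Qed.

Lemma Lip_cyl t Z : (0 <= t)%E -> Lip t Z <-> cyl t Z.
Proof.
move=> t0; split.
  move=> [m [ts [phi [/bounded_lipschitzP[M [L [L0 bM bL]]] Hts ZE]]]].
  exists (ts : seq R); first by move=> s sts; have [] := Hts s sts.
  exists M, L; split=> // [w|w w']; first by rewrite ZE.
  rewrite !ZE; apply: le_trans (bL _ _) _; rewrite ler_wpM2l//.
  apply: le_trans (row_norm_le_sum _) _.
  rewrite /path_dist [leRHS](big_nth 0) [leRHS]big_mkord size_tuple.
  apply: ler_sum => i _; rewrite mxE !vecE mxE !vecE.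
  by rewrite !(nth_map 0) ?size_tuple.
move=> [ts H cZ].
(* The definition of [Lip] asks for at least one time; 0 can always be added. *)
have {}cZ : cylon (0 :: ts) Z by apply: cylon_sub cZ => s h; rewrite in_cons h orbT.
case: cZ => M [L [L0 ZM ZL]].
pose c (i : 'I_(size ts).+1) w := B ((0 :: ts)`_i) w.
have [|phi bphi ZE] := @mcshane _ c Z M L L0 ZM.
  move=> w w'; have := ZL w w'.
  by rewrite /path_dist (big_nth 0) big_mkord.
exists (size ts), (in_tuple (0 :: ts)), phi; split=> //.
  move=> s; rewrite in_cons => /orP[/eqP->|/H//]; by split.
move=> w; rewrite ZE; congr phi; apply/rowP => i.
by rewrite vecE mxE (nth_map 0).
Qed.

End cylinder_functions.

(** * Conditional expectation as a backward recursion on path functionals *)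

Section conditional_expectation.
Context {R : realType}.
Variables (sl su : R) (hsl : 0 <= sl) (hsu : sl <= su).
Implicit Types (w : Omega R) (r s t y c : R) (ts ps g : seq R) (Z X Y xi : Omega R -> R).
Local Notation heat := (heat sl su).

Definition Astep s t Z w : R := heat (t - s) (fun y => Z (glue s t y w)) 0.

Lemma glue_lip ts Z s t w M L : 0 <= L -> (forall w, `|Z w| <= M) ->
  (forall w w', `|Z w - Z w'| <= L * path_dist ts w w') ->
  bounded_lip M (L * (size ts)%:R) (fun y => Z (glue s t y w)).
Proof.
move=> L0 ZM ZL; split=> // x y; apply: le_trans (ZL _ _) _.
rewrite -mulrA ler_wpM2l//.
elim: ts {ZL} => [|r ts IH]; first by rewrite /path_dist big_nil mul0r.
rewrite /path_dist big_cons -[size _]add1n natrD mulrDl mul1r lerD//.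
rewrite !B_glue opprD addrACA subrr add0r -mulrBl normrM.
have /andP[h0 h1] := ramp_itv s t r.
by rewrite (ger0_norm h0) ler_piMr.
Qed.

Lemma cylon_glue ts Z s t w : cylon ts Z -> exists M L, bounded_lip M L (fun y => Z (glue s t y w)).
Proof. by move=> [M [L [L0 ZM ZL]]]; exists M, (L * (size ts)%:R); exact: glue_lip. Qed.

Lemma cylon_Astep ts Z s t : cylon ts Z -> cylon [seq Num.min r s | r <- ts] (Astep s t Z).
Proof.
move=> [M [L [L0 ZM ZL]]]; exists M, L; split=> // [w|w w'].
  by apply: heat_bounded => y.
apply: (@heat_dist _ _ _ M M) => // y.
apply: le_trans (ZL _ _) _; rewrite ler_wpM2l// /path_dist big_map.
by apply: ler_sum => r _; rewrite !B_glue opprD addrACA subrr addr0.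
Qed.

Lemma Astep_le ts ts' Z Z' s t : cylon ts Z -> cylon ts' Z' ->
  (forall w, Z w <= Z' w) -> forall w, Astep s t Z w <= Astep s t Z' w.
Proof.
move=> [M [L [_ ZM _]]] [M' [L' [_ ZM' _]]] ZZ' w.
by apply: (@heat_le _ _ _ M M').
Qed.

Lemma AstepD ts Z Z' s t w : cylon ts Z -> cylon ts Z' ->
  Astep s t (fun w => Z w + Z' w) w <= Astep s t Z w + Astep s t Z' w.
Proof. by move=> [M [L [_ ZM _]]] [M' [L' [_ ZM' _]]]; exact: (@heatD _ _ _ M M'). Qed.

Lemma AstepM ts ps Z xi s t w : cylon ts Z -> cylon ps xi -> 0 <= s ->
  (forall r, r \in ps -> r <= s) -> (forall w, 0 <= xi w) ->
  Astep s t (fun w => xi w * Z w) w = xi w * Astep s t Z w.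
Proof.
move=> [M [L [_ ZM _]]] cxi s0 pss xi0; rewrite /Astep -(@heatZ _ _ _ M)//.
congr (heat _ _ _); apply/funext => y; congr (_ * _).
by apply: (cylon_dep cxi) => r /pss rs; rewrite B_glue_le.
Qed.

Lemma AstepC ts ps Z xi s t w : cylon ts Z -> cylon ps xi -> 0 <= s ->
  (forall r, r \in ps -> r <= s) ->
  Astep s t (fun w => Z w + xi w) w = Astep s t Z w + xi w.
Proof.
move=> [M [L [_ ZM _]]] cxi s0 pss; rewrite /Astep -(@heatC _ _ _ M)//.
congr (heat _ _ _); apply/funext => y; congr (_ + _).
by apply: (cylon_dep cxi) => r /pss rs; rewrite B_glue_le.
Qed.

Lemma Astep_id ps Z s t w : cylon ps Z -> 0 <= s -> (forall r, r \in ps -> r <= s) ->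
  Astep s t Z w = Z w.
Proof.
move=> cZ s0 pss; rewrite /Astep -[RHS](heat_cst sl su (Z w) (t - s) 0).
congr (heat _ _ _); apply/funext => y.
by apply: (cylon_dep cZ) => r /pss rs; rewrite B_glue_le.
Qed.

(** After s, Z looks at the path only at time t, so two successive steps merge by the semigroup
    property. *)
Lemma Astep_comp ps Z s q t w : 0 <= s -> s < q -> q < t ->
  (forall r, r \in ps -> r <= s) -> s \in ps -> cylon (t :: ps) Z ->
  Astep s q (Astep q t Z) w = Astep s t Z w.
Proof.
move=> s0 sq qt pss sps cZ; have q0 : 0 <= q by lra.
pose zeta y := Z (glue s t y w).
have [M [L bz]] := cylon_glue s t w cZ.
rewrite /Astep; have -> : t - s = (q - s) + (t - q) by ring.
rewrite (heat_semigroup hsl hsu 0 bz) ?subr_ge0 ?ltW//.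
congr (heat _ _ _); apply/funext => y.
rewrite -[y in RHS]add0r -heat_shift; congr (heat _ _ _); apply/funext => y'.
apply: (cylon_dep cZ) => r; rewrite in_cons => /orP[/eqP->|/pss rs].
  rewrite B_glue_ge// B_glue_ge// (B_glue_ge _ _ s0 (lt_trans sq qt))//; ring.
by rewrite !B_glue_le// (le_trans rs)// ltW.
Qed.

Fixpoint Egrid s g Z : Omega R -> R :=
  if g is t :: g' then Astep s t (Egrid t g' Z) else Z.

Lemma path_lt_all s g : path <%R s g -> forall r, r \in g -> s < r.
Proof. by move=> p r rg; have /allP := order_path_min lt_trans p; apply. Qed.

Lemma cylon_Egrid ts Z s g : cylon ts Z -> exists ts', cylon ts' (Egrid s g Z).
Proof.
elim: g s => [|t g IH] s cZ /=; first by exists ts.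
by have [ts' c'] := IH t cZ; exists [seq Num.min r s | r <- ts']; exact: cylon_Astep.
Qed.

Lemma cylon_Egrid_past ps Z s g : s \in ps -> (forall r, r \in ps -> r <= s) ->
  path <%R s g -> cylon (ps ++ g) Z -> cylon ps (Egrid s g Z).
Proof.
elim: g s ps => [|t g IH] s ps sps pss /=; first by rewrite cats0.
move=> /andP[st ptg] cZ.
have : cylon (t :: ps) (Egrid t g Z).
  apply: IH => //; first by rewrite mem_head.
    by move=> r; rewrite in_cons => /orP[/eqP->//|/pss rs]; rewrite (le_trans rs)// ltW.
  by apply: cylon_sub cZ => r; rewrite !mem_cat !in_cons orbCA orbA.
move=> /(cylon_Astep s t); apply: cylon_sub => r /mapP[r' + ->].
rewrite in_cons => /orP[/eqP->|r'p]; first by rewrite min_r// ltW.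
by rewrite min_l// pss.
Qed.

Lemma Egrid_le ts ts' Z Z' s g : cylon ts Z -> cylon ts' Z' ->
  (forall w, Z w <= Z' w) -> forall w, Egrid s g Z w <= Egrid s g Z' w.
Proof.
move=> c c' ZZ'; elim: g s => [|t g IH] s //=.
have [u cu] := cylon_Egrid t g c; have [u' cu'] := cylon_Egrid t g c'.
exact: Astep_le cu cu' (IH t).
Qed.

Lemma EgridD ts Z Z' s g w : cylon ts Z -> cylon ts Z' ->
  Egrid s g (fun w => Z w + Z' w) w <= Egrid s g Z w + Egrid s g Z' w.
Proof.
move=> c c'; elim: g s w => [|t g IH] s w //=.
have [u cu] := cylon_Egrid t g c; have [u' cu'] := cylon_Egrid t g c'.
have [v cv] := cylon_Egrid t g (cylonD c c').
have cu2 : cylon (u ++ u') (Egrid t g Z) by apply: cylon_sub cu => r h; rewrite mem_cat h.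
have cu2' : cylon (u ++ u') (Egrid t g Z') by apply: cylon_sub cu' => r h; rewrite mem_cat h orbT.
apply: le_trans (AstepD _ _ _ cu2 cu2').
exact: Astep_le cv (cylonD cu2 cu2') (IH t) _.
Qed.

Lemma EgridM ts ps Z xi s g w : cylon ts Z -> cylon ps xi -> 0 <= s -> path <%R s g ->
  (forall r, r \in ps -> r <= s) -> (forall w, 0 <= xi w) ->
  Egrid s g (fun w => xi w * Z w) w = xi w * Egrid s g Z w.
Proof.
move=> cZ cxi + + + xi0; elim: g s w => [|t g IH] s w //= s0 /andP[st ptg] pss.
have [u cu] := cylon_Egrid t g cZ.
rewrite -(AstepM _ _ cu cxi s0 pss xi0); congr (Astep _ _ _ _).
apply/funext => w'; apply: IH => //; first by rewrite (le_trans s0)// ltW.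
by move=> r /pss rs; rewrite (le_trans rs)// ltW.
Qed.

Lemma EgridC ts ps Z xi s g w : cylon ts Z -> cylon ps xi -> 0 <= s -> path <%R s g ->
  (forall r, r \in ps -> r <= s) ->
  Egrid s g (fun w => Z w + xi w) w = Egrid s g Z w + xi w.
Proof.
move=> cZ cxi; elim: g s w => [|t g IH] s w //= s0 /andP[st ptg] pss.
have [u cu] := cylon_Egrid t g cZ.
rewrite -(AstepC _ _ cu cxi s0 pss); congr (Astep _ _ _ _).
apply/funext => w'; apply: IH => //; first by rewrite (le_trans s0)// ltW.
by move=> r /pss rs; rewrite (le_trans rs)// ltW.
Qed.

Lemma Egrid_id ps Z s g w : cylon ps Z -> 0 <= s -> path <%R s g ->
  (forall r, r \in ps -> r <= s) -> Egrid s g Z w = Z w.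
Proof.
move=> cZ; elim: g s w => [|t g IH] s w //= s0 /andP[st ptg] pss.
rewrite -[RHS](Astep_id t w cZ s0 pss); congr (Astep _ _ _ _).
apply/funext => w'; apply: IH => //; first by rewrite (le_trans s0)// ltW.
by move=> r /pss rs; rewrite (le_trans rs)// ltW.
Qed.

Lemma Egrid_refine ps Z s g g' w : 0 <= s -> s \in ps -> (forall r, r \in ps -> r <= s) ->
  path <%R s g' -> subseq g g' -> cylon (ps ++ g) Z ->
  Egrid s g' Z w = Egrid s g Z w.
Proof.
elim: g' s ps g w => [|t' g' IH] s ps g w s0 sps pss.
  by move=> _; rewrite subseq0 => /eqP->.
move=> pg' sub cZ; have /= /andP[st' pg] := pg'.
have t'0 : 0 <= t' by rewrite (le_trans s0)// ltW.
have pst' r : r \in t' :: ps -> r <= t'.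
  by rewrite in_cons => /orP[/eqP->//|/pss rs]; rewrite (le_trans rs)// ltW.
case: g sub cZ => [|t g] sub cZ.
  rewrite cats0 in cZ; exact: (Egrid_id w cZ s0 pg' pss).
have pstg : path <%R s (t :: g).
  by apply: (subseq_path lt_trans) pg'.
move: sub => /=; case: eqVneq => [E|tt'] sub.
  have {}E : t = t' by rewrite E.
  rewrite {}E in cZ *.
  congr (Astep _ _ _ _); apply/funext => w'.
  apply: (IH t' (t' :: ps)) => //; first by rewrite mem_head.
  by apply: cylon_sub cZ => r; rewrite !mem_cat !in_cons orbCA orbA.
have t't : t' < t.
  by apply: (path_lt_all pg); apply: (mem_subseq sub); rewrite mem_head.
rewrite -(@Astep_comp ps _ s t' t)//; last first.
  apply: cylon_Egrid_past; rewrite ?mem_head//.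
  - move=> r; rewrite in_cons => /orP[/eqP->//|/pss rs].
    by rewrite (le_trans rs)// ltW// (lt_trans st').
  - by move: pstg => /= /andP[].
  - by apply: cylon_sub cZ => r; rewrite !mem_cat !in_cons orbCA orbA.
congr (Astep _ _ _ _); apply/funext => w'.
rewrite (IH t' (t' :: ps) (t :: g))// ?mem_head//.
by apply: cylon_sub cZ => r h; rewrite cat_cons in_cons h orbT.
Qed.

Lemma Egrid_cat s g1 g2 Z w : Egrid s (g1 ++ g2) Z w = Egrid s g1 (Egrid (last s g1) g2 Z) w.
Proof.
elim: g1 s w => [|t g1 IH] s w //=.
by congr (Astep _ _ _ _); apply/funext => w'; rewrite IH.
Qed.

Definition adequate t g Z := path <%R t g /\
  exists2 ps, t \in ps /\ (forall r, r \in ps -> r <= t) & cylon (ps ++ g) Z.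

Definition grid_after t ts := sort <=%O (undup [seq r <- ts | t < r]).

Lemma mem_grid_after t ts r : (r \in grid_after t ts) = (t < r) && (r \in ts).
Proof. by rewrite mem_sort mem_undup mem_filter. Qed.

Lemma grid_after_path t ts : path <%R t (grid_after t ts).
Proof.
rewrite lt_path_sortedE; apply/andP; split.
  by apply/allP => r; rewrite mem_grid_after => /andP[].
by rewrite lt_sorted_uniq_le sort_uniq undup_uniq sort_le_sorted.
Qed.

Lemma adequate_grid_after t ts Z : cylon ts Z -> adequate t (grid_after t ts) Z.
Proof.
move=> cZ; split; first exact: grid_after_path.
exists (t :: [seq r <- ts | r <= t]).
  split; first by rewrite mem_head.
  by move=> r; rewrite in_cons mem_filter => /orP[/eqP->|/andP[]].
apply: cylon_sub cZ => r rts; rewrite mem_cat in_cons mem_filter mem_grid_after rts !andbT.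
by case: ltP => _; rewrite ?orbT.
Qed.

Lemma lt_path_subseq t g g' : path <%R t g -> path <%R t g' -> {subset g <= g'} ->
  subseq g g'.
Proof.
move=> pg pg' sub; rewrite (_ : g = [seq r <- g' | r \in g]) ?filter_subseq//.
apply: lt_sorted_eq; first exact: path_sorted pg.
  by apply: sorted_filter; [exact: lt_trans|exact: path_sorted pg'].
by move=> r; rewrite mem_filter; case: (boolP (r \in g)) => //= /sub ->.
Qed.

Lemma Egrid_indep t g g' Z : 0 <= t -> adequate t g Z -> adequate t g' Z ->
  Egrid t g Z = Egrid t g' Z.
Proof.
move=> t0 [pg [ps [tps pst] cZ]] [pg' [ps' [tps' pst'] cZ']].
pose h := grid_after t (g ++ g').
have ph : path <%R t h by exact: grid_after_path.
have sg : subseq g h.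
  apply: (lt_path_subseq pg ph) => r rg; rewrite mem_grid_after mem_cat rg andbT.
  exact: path_lt_all pg r rg.
have sg' : subseq g' h.
  apply: (lt_path_subseq pg' ph) => r rg; rewrite mem_grid_after mem_cat rg orbT andbT.
  exact: path_lt_all pg' r rg.
apply/funext => w.
by rewrite -(Egrid_refine w t0 tps pst ph sg cZ) -(Egrid_refine w t0 tps' pst' ph sg' cZ').
Qed.

(** All adequate grids give the same function ([Egrid_indep], by a common refinement), so an
    arbitrary one is selected and each proof picks a convenient one through [condE_eq]. *)
Definition condE t Z := Egrid t (xget [::] [set g | adequate t g Z]) Z.

Lemma condE_eq t g Z : 0 <= t -> adequate t g Z -> condE t Z = Egrid t g Z.
Proof.
move=> t0 ad; apply: Egrid_indep => //.
exact: (@xgetPex _ [::] [set g | adequate t g Z] (ex_intro _ g ad)).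
Qed.

Lemma adequate2 t ts ts' Z Z' : cylon ts Z -> cylon ts' Z' ->
  exists g, adequate t g Z /\ adequate t g Z'.
Proof.
move=> c c'; exists (grid_after t (ts ++ ts')).
by split; apply: adequate_grid_after;
  [apply: cylon_sub c => r h|apply: cylon_sub c' => r h]; rewrite mem_cat h ?orbT.
Qed.

Lemma adequateD t g Z Z' : adequate t g Z -> adequate t g Z' ->
  adequate t g (fun w => Z w + Z' w).
Proof.
move=> [pg [ps [tps pst] cZ]] [_ [ps' [_ pst'] cZ']]; split=> //.
exists (ps ++ ps').
  by split; [rewrite mem_cat tps|move=> r; rewrite mem_cat => /orP[/pst|/pst']].
apply: cylonD.
  by apply: cylon_sub cZ => r; rewrite !mem_cat => /orP[->|->]; rewrite ?orbT.
by apply: cylon_sub cZ' => r; rewrite !mem_cat => /orP[->|->]; rewrite ?orbT.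
Qed.

Lemma adequateM t g Z Z' : adequate t g Z -> adequate t g Z' ->
  adequate t g (fun w => Z w * Z' w).
Proof.
move=> [pg [ps [tps pst] cZ]] [_ [ps' [_ pst'] cZ']]; split=> //.
exists (ps ++ ps').
  by split; [rewrite mem_cat tps|move=> r; rewrite mem_cat => /orP[/pst|/pst']].
apply: cylonM.
  by apply: cylon_sub cZ => r; rewrite !mem_cat => /orP[->|->]; rewrite ?orbT.
by apply: cylon_sub cZ' => r; rewrite !mem_cat => /orP[->|->]; rewrite ?orbT.
Qed.

Lemma cyl_cylon e Z : cyl e Z -> exists ts, cylon ts Z.
Proof. by move=> [ts _]; exists ts. Qed.

Section condE_theory.
Variable (t : R).
Hypothesis (t0 : 0 <= t).

Lemma condE_le e e' Z Z' : cyl e Z -> cyl e' Z' -> (forall w, Z w <= Z' w) ->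
  forall w, condE t Z w <= condE t Z' w.
Proof.
move=> /cyl_cylon[ts c] /cyl_cylon[ts' c'] ZZ' w; have [g [a a']] := adequate2 t c c'.
by rewrite (condE_eq t0 a) (condE_eq t0 a'); exact: Egrid_le c c' ZZ' _.
Qed.

Lemma condED e Z Z' w : cyl e Z -> cyl e Z' ->
  condE t (fun w => Z w + Z' w) w <= condE t Z w + condE t Z' w.
Proof.
move=> cZ cZ'; have [ts [_ c c']] := cyl2 cZ cZ'; have [g [a a']] := adequate2 t c c'.
rewrite (condE_eq t0 a) (condE_eq t0 a') (condE_eq t0 (adequateD a a')).
exact: EgridD c c'.
Qed.

Lemma condEM e Z xi w : cyl e Z -> cyl t%:E xi -> (forall w, 0 <= xi w) ->
  condE t (fun w => xi w * Z w) w = xi w * condE t Z w.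
Proof.
move=> /cyl_cylon[ts c] [ps Hps c'] xi0; have [g [a a']] := adequate2 t c c'.
rewrite (condE_eq t0 a) (condE_eq t0 (adequateM a' a)).
by apply: (EgridM _ c c') => //; [case: a|move=> r /Hps[]].
Qed.

Lemma condEC e Z xi w : cyl e Z -> cyl t%:E xi ->
  condE t (fun w => Z w + xi w) w = condE t Z w + xi w.
Proof.
move=> /cyl_cylon[ts c] [ps Hps c']; have [g [a a']] := adequate2 t c c'.
rewrite (condE_eq t0 a) (condE_eq t0 (adequateD a a')).
by apply: (EgridC _ c c') => //; [case: a|move=> r /Hps[]].
Qed.

Lemma condE_id Z w : cyl t%:E Z -> condE t Z w = Z w.
Proof.
move=> [ps Hps c]; rewrite (condE_eq t0 (adequate_grid_after t c)).
by apply: (Egrid_id _ c) => //; [exact: grid_after_path|move=> r /Hps[]].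
Qed.

Lemma cyl_condE e Z : cyl e Z -> cyl t%:E (condE t Z).
Proof.
move=> [ts Hts c]; pose ps := t :: [seq r <- ts | r <= t].
have c' : cylon (ps ++ grid_after t ts) Z.
  apply: cylon_sub c => r rts.
  by rewrite mem_cat in_cons mem_filter mem_grid_after rts !andbT; case: ltP => _; rewrite ?orbT.
rewrite (condE_eq t0 (adequate_grid_after t c)); exists ps.
  move=> s; rewrite in_cons mem_filter lee_fin => /orP[/eqP->//|/andP[st /Hts[]]]//.
apply: cylon_Egrid_past => //; [exact: mem_head| |exact: grid_after_path].
by move=> r; rewrite in_cons mem_filter => /orP[/eqP->|/andP[]].
Qed.

Lemma condEZ e c Z w : cyl e Z -> 0 <= c -> condE t (fun w => c * Z w) w = c * condE t Z w.
Proof. by move=> cZ c0; apply: condEM cZ _ _ => //; exact: cyl_cst. Qed.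

Lemma condE_cst c w : condE t (fun=> c) w = c.
Proof. by apply: condE_id; exact: cyl_cst. Qed.

End condE_theory.

(** The grid after s is taken to pass through t; the recursion along it is then literally the
    composition of the two conditional expectations. *)
Lemma condE_tower e s t Z w : 0 <= s -> s <= t -> cyl e Z ->
  condE s (condE t Z) w = condE s Z w.
Proof.
move=> s0; rewrite le_eqVlt => /orP[/eqP <-|st] cZ.
  by apply: condE_id => //; exact: cyl_condE cZ.
have t0 : 0 <= t by rewrite (le_trans s0)// ltW.
case: cZ => ts Hts c; pose g2 := grid_after t ts.
pose g1 := rcons (grid_after s [seq r <- ts | r < t]) t.
have p1 : path <%R s g1.
  rewrite rcons_path grid_after_path /=.
  have : all (fun r => r < t) (s :: grid_after s [seq r <- ts | r < t]).
    rewrite /= st /=; apply/allP => r; rewrite mem_grid_after mem_filter.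
    by move=> /andP[_ /andP[]].
  by move=> /allP; apply; exact: mem_last.
have l1 : last s g1 = t by rewrite last_rcons.
have p12 : path <%R s (g1 ++ g2) by rewrite cat_path p1 l1 grid_after_path.
pose ps := s :: [seq r <- ts | r <= s].
have pss r : r \in ps -> r <= s.
  by rewrite in_cons mem_filter => /orP[/eqP->|/andP[]].
have c' : cylon (ps ++ (g1 ++ g2)) Z.
  apply: cylon_sub c => r rts.
  rewrite !mem_cat in_cons mem_filter mem_rcons in_cons !mem_grid_after mem_filter rts !andbT.
  case: (ltP s r) => /= sr; last by rewrite orbT.
  by case: (ltgtP r t) => _; rewrite ?orbT.
have a12 : adequate s (g1 ++ g2) Z by split=> //; exists ps => //; split=> //; exact: mem_head.
rewrite (condE_eq s0 a12) Egrid_cat l1 (condE_eq t0 (adequate_grid_after t c)) -/g2.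
have a1 : adequate s g1 (Egrid t g2 Z).
  split=> //; exists ps; first by split=> //; exact: mem_head.
  apply: cylon_Egrid_past.
  - by rewrite mem_cat mem_rcons mem_head orbT.
  - move=> r; rewrite mem_cat mem_rcons in_cons mem_grid_after mem_filter.
    move=> /orP[/pss rs|/orP[/eqP->//|/andP[_ /andP[/ltW]]]]//.
    by rewrite (le_trans rs)// ltW.
  - exact: grid_after_path.
  - by rewrite -catA.
by rewrite (condE_eq s0 a1).
Qed.

Lemma condE_increment M L (f : R -> R) s t w : 0 <= s -> s < t -> bounded_lip M L f ->
  condE 0 (fun w => f (B t w - B s w)) w = heat (t - s) f 0.
Proof.
move=> s0 st bf; have [M0 L0] := bounded_lip_ge0 bf; have [fM fL] := bf.
have t0 : 0 <= t by rewrite (le_trans s0)// ltW.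
have cZ : cylon [:: s; t] (fun w => f (B t w - B s w)).
  exists M, L; split=> // w1 w2; apply: le_trans (fL _ _) _; rewrite ler_wpM2l//.
  rewrite /path_dist !big_cons big_nil addr0.
  rewrite (_ : B t w1 - B s w1 - _ = (B t w1 - B t w2) - (B s w1 - B s w2)); last by ring.
  by rewrite (le_trans (ler_normB _ _))// addrC.
have ce : cyl +oo%E (fun w => f (B t w - B s w)).
  by exists [:: s; t] => // r; rewrite !inE leey => /orP[/eqP->|/eqP->].
rewrite -(condE_tower _ (lexx 0) s0 ce).
have -> : condE s (fun w => f (B t w - B s w)) = (fun=> heat (t - s) f 0).
  apply/funext => w'.
  have a : adequate s [:: t] (fun w => f (B t w - B s w)).
    split; first by rewrite /= st.
    exists [:: s] => //; split; first exact: mem_head.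
    by move=> r; rewrite inE => /eqP->.
  rewrite (condE_eq s0 a) /= /Astep; congr (heat _ _ _); apply/funext => y.
  by rewrite B_glue_ge// B_glue_le// addrAC subrr add0r.
exact: condE_cst.
Qed.

End conditional_expectation.

(** * Agreement with the recursion by increments *)

Section conditional_G_expectation.
Context {R : realType}.
Variables (sl su : R) (hsl : 0 <= sl) (hsu : sl <= su).
Implicit Types (w : Omega R) (r s t y c : R) (ts ps g pre post : seq R) (Z X Y : Omega R -> R).
Local Notation condE := (condE sl su).
Local Notation Egrid := (Egrid sl su).
Local Notation path_of w := (fun s => B s w).

Lemma path_lt_le_last s g r : path <%R s g -> r \in g -> r <= last s g.
Proof.
elim: g s => [//|t g IH] s /= /andP[st ptg]; rewrite in_cons => /orP[/eqP->|]; last exact: IH.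
case: g ptg {IH} => [//|t' g] ptg.
by apply/ltW/(path_lt_all ptg); rewrite /= mem_last.
Qed.

Lemma eq_increments (f f' : R -> R) s g : (forall r, r \in s :: g -> f r = f' r) ->
  increments f s g = increments f' s g.
Proof.
elim: g s => [//|t g IH] s H /=; rewrite (H t) ?(H s) ?in_cons ?eqxx ?orbT//.
by congr (_ :: _); apply: IH => r rg; apply: H; rewrite in_cons rg orbT.
Qed.

Lemma increments_rcons (f : R -> R) s g t :
  increments f s (rcons g t) = rcons (increments f s g) (f t - f (last s g)).
Proof. by rewrite -!cats1 /increments pairmap_cat. Qed.

(** Induction on the future times: appending an increment y to the list amounts to gluing it to the
    path, and the chosen solution of the equation is the semigroup. *)
Lemma G_backwardE pre post t X (phi : seq R -> R) w :
  path <%R 0 (pre ++ post) -> last 0 pre = t -> cylon (0 :: pre ++ post) X ->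
  (forall w, X w = phi (increments (path_of w) 0 (pre ++ post))) ->
  G_backward sl su (increments id t post) phi (increments (path_of w) 0 pre) =
  Egrid t post X w.
Proof.
elim: post pre t w => [|t1 post IH] pre t w.
  by move=> _ _ _ XE; rewrite /= XE cats0.
move=> pp lt cX XE /=.
have lt' : last 0 (rcons pre t1) = t1 by rewrite last_rcons.
rewrite -cat_rcons in pp cX XE.
have ppre : path <%R 0 (rcons pre t1) by move: pp; rewrite cat_path => /andP[].
have ppr : path <%R 0 pre by move: ppre; rewrite rcons_path => /andP[].
have t0 : 0 <= t.
  rewrite -lt; have := mem_last 0 pre; rewrite in_cons => /orP[/eqP->//|/(path_lt_all ppr)/ltW//].
have tt1 : t < t1 by move: ppre; rewrite rcons_path lt => /andP[].
have E y : G_backward sl su (increments id t1 post) phi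
   (rcons (increments (path_of w) 0 pre) y) = Egrid t1 post X (glue t t1 y w).
  rewrite -(IH (rcons pre t1))//; congr (G_backward _ _ _ _ _).
  rewrite increments_rcons lt; congr rcons.
    apply: eq_increments => r; rewrite in_cons => /orP[/eqP->|rp]; first by rewrite B_glue_le.
    by rewrite B_glue_le// -lt path_lt_le_last.
  by rewrite B_glue_ge// B_glue_le// addrAC subrr add0r.
have [ts' cE] := cylon_Egrid sl su t1 post cX.
have [M [L bl]] := cylon_glue t t1 w cE.
rewrite /Astep -(G_heatE hsl hsu 0 bl) ?subr_ge0 ?ltW//.
by congr (G_heat _ _ _ _ _); apply/funext => y; exact: E.
Qed.

Lemma increments_dist (f f' : R -> R) s g r : r \in g ->
  `|(f r - f s) - (f' r - f' s)| <=
  \sum_(i < size g) `|(increments f s g)`_i - (increments f' s g)`_i|.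
Proof.
elim: g s => [//|t g IH] s; rewrite in_cons big_ord_recl /=.
move=> /orP[/eqP->|rg].
  by rewrite lerDl sumr_ge0.
have -> : f r - f s - (f' r - f' s) = (f t - f s - (f' t - f' s)) + (f r - f t - (f' r - f' t)) by ring.
by apply: le_trans (ler_normD _ _) _; rewrite lerD2l; exact: IH.
Qed.

Lemma increments_lip (f f' : R -> R) s g i : (i < size g)%N ->
  `|(increments f s g)`_i - (increments f' s g)`_i| <=
  2 * \sum_(r <- s :: g) `|f r - f' r|.
Proof.
move=> ig; rewrite /increments !(nth_pairmap 0)//.
have H r : r \in s :: g -> `|f r - f' r| <= \sum_(r <- s :: g) `|f r - f' r|.
  by move=> rg; rewrite (big_rem r)//= lerDl sumr_ge0.
have h1 := H _ (mem_nth 0 (_ : (i.+1 < size (s :: g))%N)).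
have h2 := H _ (mem_nth 0 (_ : (i < size (s :: g))%N)).
rewrite (_ : _ - _ - _ = (f g`_i - f' g`_i) - (f (s :: g)`_i - f' (s :: g)`_i)); last by ring.
apply: le_trans (ler_normB _ _) _; rewrite mulr2n mulrDl mul1r lerD//; first exact: h1.
by apply: h2; rewrite /= ltnW.
Qed.

Lemma cond_Lip_condE t X Y : cond_Lip sl su t X Y ->
  [/\ 0 <= t, cyl +oo%E X & Y = condE t X].
Proof.
move=> [m [pre [post [phi [bphi [sz pp lt] XE YE]]]]].
have ppr : path <%R 0 pre by move: pp; rewrite cat_path => /andP[].
have t0 : 0 <= t.
  rewrite -lt; have := mem_last 0 pre; rewrite in_cons => /orP[/eqP->//|/(path_lt_all ppr)/ltW//].
have /bounded_lipschitzP[M [L [L0 bM bL]]] := bphi.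
have cX : cylon (0 :: pre ++ post) X.
  exists M, (L * (m.+1%:R * 2)); split; first by rewrite mulr_ge0// mulr_ge0.
    by move=> w; rewrite XE.
  move=> w w'; rewrite !XE; apply: le_trans (bL _ _) _; rewrite -mulrA ler_wpM2l//.
  apply: le_trans (row_norm_le_sum _) _.
  apply: (@le_trans _ _ (\sum_(i < m.+1) (2 * path_dist (0 :: pre ++ post) w w'))).
    apply: ler_sum => i _; rewrite mxE !vecE mxE vecE.
    by apply: increments_lip; rewrite sz.
  by rewrite sumr_const card_ord -[_ *+ _]mulr_natl mulrA.
split=> //.
  exists (0 :: pre ++ post) => // s; rewrite in_cons leey => /orP[/eqP->//|sp].
  by split=> //; exact/ltW/(path_lt_all pp).
have ad : adequate t post X.
  split; first by move: pp; rewrite cat_path lt => /andP[].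
  exists (t :: 0 :: pre).
    split; first exact: mem_head.
    move=> r; rewrite !in_cons => /or3P[/eqP->//|/eqP->//|rp].
    by rewrite -lt path_lt_le_last.
  by apply: cylon_sub cX => r h; rewrite /= in_cons h orbT.
rewrite (condE_eq hsl hsu t0 ad); apply/funext => w; rewrite YE.
exact: (G_backwardE w pp lt cX XE).
Qed.

Lemma cond_Lip_exists t X : 0 <= t -> cyl +oo%E X -> cond_Lip sl su t X (condE t X).
Proof.
move=> t0 [ts Hts cX].
pose pre := grid_after 0 [seq r <- t :: ts | r <= t].
(* The time t + 1 guarantees at least one increment, as the definition of [cond_Lip] requires. *)
pose post := grid_after t (t + 1 :: ts).
have ppr : path <%R 0 pre by exact: grid_after_path.
have prele r : r \in pre -> r <= t by rewrite mem_grid_after mem_filter => /and3P[].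
have lt : last 0 pre = t.
  apply/eqP; rewrite eq_le; apply/andP; split.
    by have := mem_last 0 pre; rewrite in_cons => /orP[/eqP->//|/prele].
  case: (ltgtP 0 t) t0 => // [t0|<-] _; last first.
    by have := mem_last 0 pre; rewrite in_cons => /orP[/eqP->//|/(path_lt_all ppr)/ltW].
  by apply: path_lt_le_last => //; rewrite mem_grid_after t0 mem_filter lexx mem_head.
have ppo : path <%R t post by exact: grid_after_path.
have pp : path <%R 0 (pre ++ post) by rewrite cat_path ppr lt.
pose g := pre ++ post.
have gts r : r \in ts -> r = 0 \/ r \in g.
  move=> rts; have [r0 _] := Hts r rts.
  move: r0; rewrite le_eqVlt => /orP[/eqP<-|r0]; first by left.
  right; rewrite mem_cat !mem_grid_after mem_filter !in_cons rts r0 !orbT !andbT.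
  by case: leP.
have sg : (0 < size g)%N.
  have : t + 1 \in g by rewrite mem_cat !mem_grid_after mem_head ltrDl ltr01 orbT.
  by case: (g).
have cg : cylon (0 :: g) X.
  by apply: cylon_sub cX => r /gts[->|rg]; rewrite in_cons ?eqxx ?rg ?orbT.
have cg' : cylon g X.
  case: cX => M [L [L0 XM XL]]; exists M, (L * (size ts)%:R); split=> //.
    by rewrite mulr_ge0.
  move=> w w'; apply: le_trans (XL w w') _; rewrite -mulrA ler_wpM2l//.

  apply: (@le_trans _ _ (\sum_(s <- ts) path_dist g w w')).
    rewrite [leLHS]/path_dist [leLHS]big_seq [leRHS]big_seq.
    apply: ler_sum => s /gts[->|sg']; last exact: path_dist_mem.
    by rewrite !B_le0// subrr normr0 path_dist_ge0.
  by rewrite big_const_seq count_predT iter_addr_0 -[_ *+ _]mulr_natl.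
case: cg' => M [L [L0 XM XL]].
set m := (size g).-1; have sz : size g = m.+1 by rewrite prednK.
have [|phi bphi XE] := @mcshane R m.+1 (fun i w => (increments (path_of w) 0 g)`_i) X M
    (L * (size g)%:R) (mulr_ge0 L0 (ler0n _ _)) XM.
  move=> w w'; apply: le_trans (XL w w') _; rewrite -mulrA ler_wpM2l//.
  apply: (@le_trans _ _ (\sum_(s <- g) \sum_(i < m.+1)
     `|(increments (path_of w) 0 g)`_i - (increments (path_of w') 0 g)`_i|)).
    rewrite [leLHS]/path_dist [leLHS]big_seq [leRHS]big_seq.
    apply: ler_sum => s sg'; rewrite -sz.
    by have := increments_dist (path_of w) (path_of w') 0 sg'; rewrite !(B_le0 _ (lexx 0)) !subr0.
  by rewrite big_const_seq count_predT iter_addr_0 -[_ *+ _]mulr_natl.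
exists m, pre, post, phi; split=> //.
have ad : adequate t post X.
  split=> //; exists (t :: 0 :: pre).
    split; first exact: mem_head.
    by move=> r; rewrite !in_cons => /or3P[/eqP->//|/eqP->//|/prele].
  by apply: cylon_sub cg => r h; rewrite /= in_cons h orbT.
move=> w; rewrite (condE_eq hsl hsu t0 ad).
by rewrite (@G_backwardE _ _ t X (phi \o vec m.+1) w pp lt cg XE).
Qed.

Definition Ehat0 X : R := condE 0 X point.

Lemma condE0_cst e X w : cyl e X -> condE 0 X w = Ehat0 X.
Proof.
move=> cX; have [ts Hts c] := cyl_condE hsl hsu (lexx 0) cX.
apply: (cylon_dep c) => s /Hts[_]; rewrite lee_fin => s0.
by rewrite !B_le0.
Qed.

Lemma cond_Lip0 X v : cond_Lip sl su 0 X (cst v) -> cyl +oo%E X /\ v = Ehat0 X.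
Proof. by move=> /cond_Lip_condE[_ cX E]; split=> //; rewrite /Ehat0 -E. Qed.

Lemma cond_Lip0_exists X : cyl +oo%E X -> cond_Lip sl su 0 X (cst (Ehat0 X)).
Proof.
move=> cX; rewrite (_ : cst _ = condE 0 X); first exact: cond_Lip_exists.
by apply/funext => w; rewrite (condE0_cst w cX).
Qed.

End conditional_G_expectation.

(** * Representing measures *)

Section path_sigma_algebra.
Context {R : realType}.
Implicit Types (w v : Omega R) (r s e y c : R) (Z : Omega R -> R) (t : \bar R) (N n m : nat).

Lemma nat_ge (x : R) : exists k : nat, x <= k%:R.
Proof.
by exists (Num.bound `|x|); rewrite (le_trans (ler_norm x))// ltW// archi_boundP.
Qed.

Lemma dist_le2 (x y g h : R) : `|x - y| <= h -> g <= x -> x < g + h -> `|y - g| <= h + h.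
Proof. by rewrite !ler_norml => /andP[a b] c d; apply/andP; split; lra. Qed.

(** Otherwise a sequence of paths outside U converges to w uniformly on compact sets, hence in the
    compact-open topology. *)
Lemma path_open_uniform (U : set (path_top R)) w : open U -> U w ->
  exists N, exists2 e, 0 < e &
    forall v, (forall s, 0 <= s <= N%:R -> `|B s w - B s v| <= e) -> U v.
Proof.
move=> [W oO <-] Ow; apply: contrapT => /forallNP H.
have {}H n : exists v, (forall s, 0 <= s <= n%:R -> `|B s w - B s v| <= n.+1%:R^-1) /\
    ~ W (path_val v).
  apply: contrapT => /forallNP H'; apply: (H n); exists n.+1%:R^-1; first by rewrite invr_gt0.
  by move=> v vw; apply: contrapT => nO; apply: (H' v).
pose vn n := projT1 (cid (H n)).
have vnP n := projT2 (cid (H n)).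
pose F : set_system (R -> R) := (fun n => path_val (vn n)) @ \oo.
have FF : Filter F by exact: fmap_filter.
have cw : continuous (path_val w) by exact: B_continuous.
have : {compact-open, F --> path_val w}.
  apply/(compact_open_fam_compactP cw FF)/fam_cvgP => A cA P /uniform_nbhs[E [+ EP]].
  rewrite -entourage_ballE => -[d/= d0 dE].
  have [M [_ AM]] := compact_bounded cA.
  have [k kM] : exists k : nat, M + 1 <= k%:R /\ d^-1 <= k%:R.
    have [k kM] := nat_ge (Num.max (M + 1) d^-1).
    by exists k; move: kM; rewrite ge_max => /andP.
  exists k => // n /= kn; apply: EP => s As; apply: dE; rewrite /ball_ /ball /=.
  have [h1 _] := vnP n; have sM : `|s| <= M + 1 by apply: (AM (M + 1)) => //; rewrite ltrDl.
  have [s0|s0] := leP s 0; first by rewrite -/(B s w) -/(B s (vn n)) !B_le0// subrr normr0.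
  apply: (@le_lt_trans _ _ n.+1%:R^-1).
    apply: h1; rewrite (ltW s0)/= (le_trans (ler_norm _))// (le_trans sM)//.
    by case: kM => kM _; rewrite (le_trans kM)// ler_nat.
  rewrite invf_plt ?posrE//; case: kM => _ kM; rewrite (le_lt_trans kM)// ltr_nat ltnS//.
have nO : nbhs (path_val w : {compact-open, R -> R}) W by apply: open_nbhs_nbhs.
move=> /(_ _ nO) [k _ /(_ k (leqnn _))]; exact: (vnP k).2.
Qed.

Lemma path_unif_continuous w N e : 0 < e -> exists2 d, 0 < d &
  forall r s, 0 <= r <= N%:R -> `|r - s| <= d -> `|B r w - B s w| <= e.
Proof.
move=> e0; apply: contrapT => H.
have {}H n : exists p : R * R, [/\ 0 <= p.1 <= N%:R, `|p.1 - p.2| <= n.+1%:R^-1 &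
    e < `|B p.1 w - B p.2 w|].
  apply: contrapT => /forallNP H'; apply: H; exists n.+1%:R^-1; first by rewrite invr_gt0.
  move=> r s rN rs; rewrite leNgt; apply/negP => h; exact: (H' (r, s)).
pose p n := projT1 (cid (H n)); have pP n := projT2 (cid (H n)).
have b1 : bounded_seq (fst \o p).
  by exists N%:R => n /=; case: (pP n) => /andP[h1 h2] _ _; rewrite ger0_norm.
have c1 := ulim_cvg b1; set l := ulim _ in c1.
have c2 : (snd \o p) @ oo_ultra --> l.
  have d0 : (fun n => (p n).2 - (p n).1) @ oo_ultra --> (0 : R).
    apply: cvg_trans (_ : (fun n => (p n).2 - (p n).1) @ \oo --> (0 : R)).
      by move=> A; exact: oo_ultra_near.
    apply/cvgr0Pnorm_le => d dd; have [k kd] := nat_ge d^-1.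
    exists k => // n /= kn; case: (pP n) => _ h _.
    rewrite distrC (le_trans h)// invf_ple ?posrE// (le_trans kd)// ler_nat.
    exact: leqW.
  have -> : snd \o p = (fun n => (p n).1 + ((p n).2 - (p n).1)).
    by apply/funext => n /=; rewrite addrC subrK.
  by rewrite -[l]addr0; apply: cvgD.
have cw := @B_continuous R w.
have PU := @oo_ultraP.
have e1 : (fun n => B (p n).1 w) @ oo_ultra --> B l w.
  by move=> A hA; exact: (c1 _ (cw l _ hA)).
have e2 : (fun n => B (p n).2 w) @ oo_ultra --> B l w.
  by move=> A hA; exact: (c2 _ (cw l _ hA)).
have FU : Filter oo_ultra by exact: _.
have d1 : (fun n => B (p n).1 w - B (p n).2 w) @ oo_ultra --> (0 : R).
  by rewrite -(subrr (B l w)); exact: (cvgB e1 e2).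
have h0 : oo_ultra [set n | `|B (p n).1 w - B (p n).2 w| < e].
  have : oo_ultra [set n | ball (0:R) e (B (p n).1 w - B (p n).2 w)] := d1 _ (nbhsx_ballx (0:R) e e0).
  by apply: filterS => n; rewrite /ball/= sub0r normrN.
have [n /= h] := @filter_ex _ oo_ultra _ _ h0; case: (pP n) => _ _ h'.
by move: (lt_trans h' h); rewrite ltxx.
Unshelve. all: by end_near.
Qed.

Lemma dyadic_ge0 n m : 0 <= dyadic R n m.
Proof. by rewrite /dyadic divr_ge0. Qed.

Lemma nat_cell (x : R) : 0 <= x -> exists k : nat, k%:R <= x <= k.+1%:R.
Proof.
move=> x0; exists (Num.truncn x); have /andP[h1 h2] := truncn_itv x0.
by rewrite h1 ltW.
Qed.

Lemma dyadic_dense r e : 0 <= r -> 0 < e -> exists j i, dyadic R j i <= r /\ r - dyadic R j i <= e.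
Proof.
move=> r0 e0; have [j je] := nat_ge e^-1.
have p0 : 0 < 2 ^+ j :> R by rewrite exprn_gt0.
have pj : e^-1 <= 2 ^+ j.
  by rewrite (le_trans je)// -natrX ler_nat ltnW// ltn_expl.
have [|i /andP[h1 h2]] := @nat_cell (r * 2 ^+ j); first by rewrite mulr_ge0// ltW.
exists j, i; rewrite /dyadic ler_pdivrMr//; split=> //.
apply: (@le_trans _ _ (2 ^+ j)^-1).
  rewrite lerBlDr -[X in X + _]mul1r -mulrDl ler_pdivlMr//.
  by rewrite addrC natr1.
by rewrite invf_ple ?posrE.
Qed.

Lemma continuous_dyadic_le (f : R -> R) (a b c : R) : continuous f -> 0 <= a -> a < b ->
  (forall j i, a <= dyadic R j i <= b -> f (dyadic R j i) <= c) ->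
  forall r, a <= r <= b -> f r <= c.
Proof.
move=> cf a0 ab H r rab; rewrite leNgt; apply/negP => cfr.
have [d/= d0 dP] : \forall x \near r, c < f x.
  exact: (cf r _ (lt_nbhsr cfr)).
pose u := Num.max a (r - d / 2); pose v := Num.min b (r + d / 2).
have /andP[ar rb] := rab.
have uv : u < v by rewrite lt_min !gt_max ab; apply/andP; split; apply/andP; split; lra.
have [||j [i [h1 h2]]] := @dyadic_dense v (v - u).
- rewrite le_min (le_trans a0 (ltW ab))/=; lra.
- by rewrite subr_gt0.
have h3 : u <= dyadic R j i by lra.
move: h1 h3; rewrite le_min ge_max => /andP[h1 h1'] /andP[h3 h3'].
have : c < f (dyadic R j i).
  by apply: dP; rewrite /= ltr_norml; apply/andP; split; lra.
by rewrite ltNge H// h3.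
Qed.

Definition coord_sets : set (set (Omega R)) :=
  [set A | exists s c, 0 <= s /\ A = [set w | c < B s w]].

(** Paths within a tolerance of a step function with rational values. Testing at dyadic times makes
    this an event of countably many coordinates, and there are only countably many tubes. *)
Definition tube N n m (q : seq int) : set (Omega R) :=
  [set v | forall k j i, (k <= N * n.+1)%N ->
     k%:R / n.+1%:R <= dyadic R j i <= k.+1%:R / n.+1%:R ->
     `|B (dyadic R j i) v - (nth 0 q k)%:~R / m.+1%:R| <= 2 / m.+1%:R].

Lemma coord_measurable s : 0 <= s -> measurable_fun setT (B s : g_sigma_algebraType coord_sets -> R).
Proof.
move=> s0; apply: (@measurability _ _ _ _ setT _ _ (RGenOInfty.measurableE R)) => _ [_ [a ->] <-].
rewrite setTI; apply: sub_sigma_algebra; exists s, a; split=> //.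
by apply/seteqP; split=> w /=; rewrite in_itv/= andbT.
Qed.

Lemma tube_measurable N n m q : @measurable _ (g_sigma_algebraType coord_sets) (tube N n m q).
Proof.
have -> : tube N n m q = \bigcap_k \bigcap_j \bigcap_i [set v : Omega R | (k <= N * n.+1)%N ->
     k%:R / n.+1%:R <= dyadic R j i <= k.+1%:R / n.+1%:R ->
     `|B (dyadic R j i) v - (nth 0 q k)%:~R / m.+1%:R| <= 2 / m.+1%:R].
  by apply/seteqP; split=> [v H k _ j _ i _|v H k j i]; [exact: H|exact: (H k I j I i I)].
apply: bigcapT_measurable => k; apply: bigcapT_measurable => j; apply: bigcapT_measurable => i.
case: (boolP (k <= N * n.+1)%N) => [b1|b0]; last first.
  by rewrite (_ : [set _ | _] = setT)//; apply/seteqP; split.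
case: (boolP (k%:R / n.+1%:R <= dyadic R j i <= k.+1%:R / n.+1%:R)) => [b1'|b0']; last first.
  by rewrite (_ : [set _ | _] = setT)//; apply/seteqP; split.
pose s := dyadic R j i; pose c : R := (nth 0 q k)%:~R / m.+1%:R; pose e : R := 2 / m.+1%:R.
have -> : [set v : Omega R | true -> true -> `|B s v - c| <= e] =
   (B s : g_sigma_algebraType coord_sets -> R) @^-1` `[c - e, c + e].
  by apply/seteqP; split => v /=; rewrite in_itv/= ler_distl// => /(_ isT isT).
rewrite -[X in measurable X]setTI; apply: coord_measurable => //; exact: dyadic_ge0.
Qed.

(** An open set is the union of the tubes that it contains; uniform continuity on compact intervals
    puts each of its paths into such a tube. Thus the coordinates generate the Borel sets. *)
Lemma open_coord_measurable (U : set (path_top R)) : open U ->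
  @measurable _ (g_sigma_algebraType coord_sets) U.
Proof.
move=> oU.
pose T k : set (Omega R) := if @unpickle (nat * nat * nat * seq int)%type k is Some p then
   (if pselect (tube p.1.1.1 p.1.1.2 p.1.2 p.2 `<=` U) then tube p.1.1.1 p.1.1.2 p.1.2 p.2 else set0)
   else set0.
have -> : U = \bigcup_k T k.
  apply/seteqP; split; last first.
    move=> w [k _]; rewrite /T; case: unpickle => // p; case: pselect => // H; exact: H.
  move=> w Uw; have [N [e e0 H]] := path_open_uniform oU Uw.
  (* Two paths of one tube are at distance at most 4 / (m + 1), which this makes at most e. *)
  have [m me] := nat_ge (4 / e).
  have m0 : 0 < m.+1%:R :> R by [].
  have m1 : 0 < m.+1%:R^-1 :> R by rewrite invr_gt0.
  have [d d0 Hd] := path_unif_continuous w N m1.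
  have [n nd] := nat_ge d^-1.
  have n0 : 0 < n.+1%:R :> R by [].
  have nd' : n.+1%:R^-1 <= d.
    by rewrite invf_ple ?posrE// (le_trans nd)// ler_nat.
  (* The centre of the tube: values of w on the grid, rounded down to multiples of 1 / (m + 1). *)
  pose q := mkseq (fun k => Num.floor (B (k%:R / n.+1%:R) w * m.+1%:R)) (N * n.+1).+1.
  have tw : tube N n m q w.
    move=> k j i kN /andP[h1 h2]; rewrite nth_mkseq//.
    have a1 : `|B (k%:R / n.+1%:R) w - B (dyadic R j i) w| <= m.+1%:R^-1.
      apply: Hd; first by rewrite divr_ge0//= ler_pdivrMr// -natrM ler_nat.
      rewrite ler0_norm ?subr_le0// opprB (le_trans _ nd')// lerBlDr -[X in _ <= X + _]mul1r -mulrDl.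
      by rewrite addrC natr1.
    have /andP[] := real_floor_itv (num_real (B (k%:R / n.+1%:R) w * m.+1%:R)).
    set x := B _ w in a1 *; set f := Num.floor _; rewrite intrD => a2 a3.
    rewrite -ler_pdivrMr// in a2; rewrite -ltr_pdivlMr// mulrDl mul1r in a3.
    rewrite (_ : 2 / _ = m.+1%:R^-1 + m.+1%:R^-1); last by ring.
    exact: dist_le2 a1 a2 a3.
  exists (pickle (N, n, m, q)) => //; rewrite /T pickleK /=; case: pselect => // nT.
  exfalso; apply: nT => v tv; apply: H => s /andP[s0 sN].
  have [|k /andP[k1 k2]] := @nat_cell (s * n.+1%:R); first by rewrite mulr_ge0.
  rewrite -ler_pdivrMr// in k1; rewrite -ler_pdivlMr// in k2.
  have kN : (k <= N * n.+1)%N.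
    by rewrite -(ler_nat R) natrM -ler_pdivrMr// (le_trans k1).
  have K v' : tube N n m q v' -> `|B s v' - (nth 0 q k)%:~R / m.+1%:R| <= 2 / m.+1%:R.
    move=> tv'; apply: (@continuous_dyadic_le (fun s => `|B s v' - (nth 0 q k)%:~R / m.+1%:R|)
       (k%:R / n.+1%:R) (k.+1%:R / n.+1%:R)).
    - move=> r; apply: cvg_norm; apply: cvgB; [exact: B_continuous|exact: cvg_cst].
    - by rewrite divr_ge0.
    - by rewrite ltr_pM2r ?invr_gt0// ltr_nat.
    - by move=> j i ji; exact: tv'.
    - by rewrite k1.
  have h1 := K w tw; have h2 := K v tv.
  have h3 : 4 / m.+1%:R <= e.
    rewrite ler_pdivrMr// -ler_pdivrMl// mulrC (le_trans me)// ler_nat//.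
  set c : R := (nth 0 q k)%:~R / m.+1%:R in h1 h2.
  have -> : B s w - B s v = (B s w - c) - (B s v - c) by ring.
  rewrite (le_trans (ler_normB _ _))// (le_trans _ h3)//.
  by rewrite (_ : 4 / m.+1%:R = 2 / m.+1%:R + 2 / m.+1%:R); [exact: lerD|ring].
apply: bigcupT_measurable => k; rewrite /T; case: unpickle => [p|]; last exact: measurable0.
by case: pselect => H; [exact: tube_measurable|exact: measurable0].
Qed.

Lemma measurable_coord (A : set (Omega R)) : measurable A ->
  @measurable _ (g_sigma_algebraType coord_sets) A.
Proof.
apply: smallest_sub; last by move=> U; exact: open_coord_measurable.
exact: smallest_sigma_algebra.
Qed.

Lemma B_path_continuous s : continuous (B s : path_top R -> R).
Proof.
apply/continuousP => U oU; exists [set g | g @` [set s] `<=` U].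
  by apply: compact_open_open => //; exact: compact_set1.
apply/seteqP; split => w /= h; first by apply: h; exists s.
by move=> _ [_ -> <-].
Qed.

Lemma path_dist_near (ts : seq R) (w : path_top R) e : 0 < e ->
  nbhs w [set v : path_top R | path_dist ts w v < e].
Proof.
have FF : Filter (nbhs w) by exact: nbhs_filter.
elim: ts e => [|s ts IH] e e0.
  by apply: filterS filterT => v _; rewrite /= /path_dist big_nil.
have e2 : 0 < e / 2 by rewrite divr_gt0.
have h2 : nbhs w [set v : path_top R | `|B s w - B s v| < e / 2].
  exact: (@B_path_continuous s w _ (nbhsx_ballx (B s w) (e / 2) e2)).
apply: filterS2 (IH _ e2) h2 => v /= h1 h2; rewrite /path_dist big_cons.
by rewrite [ltRHS](splitr e) ltrD.
Qed.

Lemma cyl_open t Z (U : set R) : cyl t Z -> open U -> open (Z @^-1` U : set (path_top R)).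
Proof.
move=> [ts _ [M [L [L0 ZM ZL]]]] oU; rewrite openE => w /= Uw.
have FF : Filter (nbhs (w : path_top R)) by exact: nbhs_filter.
have /nbhs_ballP[e/= e0 eU] : nbhs (Z w) U by exact: open_nbhs_nbhs.
have L1 : 0 < L + 1 by lra.
have := path_dist_near ts w (divr_gt0 e0 L1); apply: filterS => v /=.
rewrite ltr_pdivlMr// => h; apply: eU; apply: le_lt_trans (ZL w v) _.
by apply: le_lt_trans h; rewrite mulrC ler_wpM2l ?path_dist_ge0//; lra.
Qed.

Lemma measurable_cyl t Z : cyl t Z -> measurable_fun setT (Z : Omega R -> R).
Proof.
move=> cZ; apply: (@measurability _ _ _ _ setT _ _ (RGenOpens.measurableE R)) => _ [_ [a [b ->]] <-].
rewrite setTI; apply: sub_sigma_algebra.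
by apply: cyl_open cZ _; exact: interval_open.
Qed.

End path_sigma_algebra.

Lemma cyl_coord (R : realType) (t : \bar R) (s c : R) : 0 <= s -> (s%:E <= t)%E ->
  cyl t (fun w : Omega R => Num.min 1 (Num.max (B s w - c) 0)).
Proof.
move=> s0 st; exists [:: s]; first by move=> r; rewrite inE => /eqP->.
exists 1, 1; split=> //.
  by move=> w; rewrite ger0_norm ?ge_min ?lexx// le_min ler01 /= le_max lexx orbT.
move=> w w'; rewrite mul1r /path_dist big_seq1.
apply: le_trans (_ : `|Num.max (B s w - c) 0 - Num.max (B s w' - c) 0| <= _).
  set a := Num.max _ _; set b := Num.max _ _; rewrite !ler_norml.
  rewrite /Num.min; case: ifPn => h1; case: ifPn => h2; have [|] := leP 0 (a - b) => h3; rewrite ?(ger0_norm h3) ?(ltr0_norm h3); apply/andP; split; lra.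
rewrite /Num.max; case: ifPn => h1; case: ifPn => h2; have [|] := leP 0 (B s w - B s w') => h3; rewrite ?(ger0_norm h3) ?(ltr0_norm h3) ler_norml; apply/andP; split; lra.
Qed.

Lemma integrable_cyl (R : realType) (P : probability (Omega R) R) t Z : @cyl R t Z ->
  P.-integrable setT (EFin \o Z).
Proof.
move=> cZ; have [M M0 ZM] := cyl_bounded cZ.
apply: measurable_bounded_integrable => //.
- exact: le_lt_trans (probability_le1 P measurableT) (ltry _).
- exact: measurable_cyl cZ.
- by exists M; split; rewrite ?num_real// => x Mx w _; exact: le_trans (ZM w) (ltW Mx).
Qed.

(** * Daniell's construction of a measure from a positive functional *)

Section daniell.
Context {R : realType}.
Implicit Types (w : Omega R) (Z : Omega R -> R) (c : R) (A X : set (Omega R)) (g : nat -> Omega R -> R).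
Local Notation cyl := (@cyl R +oo%E).
Variable Lam : (Omega R -> R) -> R.
Hypothesis LamD : forall Z Z', cyl Z -> cyl Z' -> Lam (fun w => Z w + Z' w) = Lam Z + Lam Z'.
Hypothesis LamZ : forall c Z, cyl Z -> Lam (fun w => c * Z w) = c * Lam Z.
Hypothesis Lam_ge0 : forall Z, cyl Z -> (forall w, 0 <= Z w) -> 0 <= Lam Z.
Hypothesis Lam1 : Lam (fun=> 1) = 1.
Hypothesis Lam_dini : forall g, (forall n, cyl (g n)) -> (forall n w, 0 <= g n w) ->
  (forall n m w, (n <= m)%N -> g m w <= g n w) ->
  (forall w, exists n, g n w = 0) -> forall e, 0 < e -> exists n, Lam (g n) <= e.

Let LamB Z Z' : cyl Z -> cyl Z' -> Lam (fun w => Z w - Z' w) = Lam Z - Lam Z'.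
Proof.
move=> cZ cZ'; rewrite (_ : (fun w => _) = (fun w => Z w + (-1) * Z' w)).
  by rewrite LamD ?LamZ ?mulN1r//; exact: cylZ.
by apply/funext => w; rewrite mulN1r.
Qed.

Let Lam_le Z Z' : cyl Z -> cyl Z' -> (forall w, Z w <= Z' w) -> Lam Z <= Lam Z'.
Proof.
move=> cZ cZ' ZZ'; rewrite -subr_ge0 -LamB//; apply: Lam_ge0; first exact: cylB.
by move=> w; rewrite subr_ge0.
Qed.

Let Lam_cst c : Lam (fun=> c) = c.
Proof.
rewrite (_ : (fun=> c) = (fun=> c * 1)); last by apply/funext => w; rewrite mulr1.
by rewrite LamZ ?Lam1 ?mulr1//; exact: cyl_cst.
Qed.

Let Lam_sum (I : Type) (s : seq I) (F : I -> Omega R -> R) : (forall i, cyl (F i)) ->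
  Lam (fun w => \sum_(i <- s) F i w) = \sum_(i <- s) Lam (F i).
Proof.
move=> cF; elim: s => [|i s IH].
  rewrite big_nil -[RHS](Lam_cst 0); congr Lam; apply/funext => w; exact: big_nil.
rewrite big_cons -IH -LamD//; last exact: cyl_sum.
by congr Lam; apply/funext => w; rewrite big_cons.
Qed.

Definition daniell_cover A g := [/\ forall n, cyl (g n), forall n w, 0 <= g n w,
  forall n m w, (n <= m)%N -> g n w <= g m w & forall w, A w -> exists n, 1 <= g n w].

(** Sets are covered by increasing sequences of cylinder functions that eventually reach 1 on the
    set; countable subadditivity then follows from a diagonal sum of covers. *)
Definition daniell_outer A : \bar R :=
  ereal_inf [set ereal_sup (range (fun n => (Lam (g n))%:E)) | g in daniell_cover A].

Let outer_le A g x : daniell_cover A g -> (forall n, ((Lam (g n))%:E <= x)%E) ->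
  (daniell_outer A <= x)%E.
Proof.
move=> cg H; apply: (@le_trans _ _ (ereal_sup (range (fun n => (Lam (g n))%:E)))).
  by apply: ereal_inf_lbound; exists g.
by apply: ge_ereal_sup => _ [n _ <-].
Qed.

Let outer_ge A y : (forall g, daniell_cover A g -> (y <= ereal_sup (range (fun n => (Lam (g n))%:E)))%E) ->
  (y <= daniell_outer A)%E.
Proof. by move=> H; apply: le_ereal_inf_tmp => _ [g cg <-]; exact: H. Qed.

Let outer0 : daniell_outer set0 = 0%E.
Proof.
apply/eqP; rewrite eq_le; apply/andP; split.
  apply: (@outer_le _ (fun _ _ => 0)); last by move=> n; rewrite Lam_cst.
  by split=> // n; exact: cyl_cst.
apply: outer_ge => g [c0 g0 _ _]; apply: le_trans (ereal_sup_ubound _).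
2: by exists 0%N.
by rewrite lee_fin Lam_ge0.
Qed.

Let outer_ge0 A : (0 <= daniell_outer A)%E.
Proof.
apply: outer_ge => g [c0 g0 _ _]; apply: le_trans (ereal_sup_ubound _).
2: by exists 0%N.
by rewrite lee_fin Lam_ge0.
Qed.

Let outer_cover A (e : R) : 0 < e -> (daniell_outer A < +oo)%E ->
  exists2 g, daniell_cover A g & forall n, ((Lam (g n))%:E <= daniell_outer A + e%:E)%E.
Proof.
move=> e0 Af; have fA : daniell_outer A \is a fin_num.
  by rewrite ge0_fin_numE// outer_ge0.
have [_ [g cg <-] h] := lb_ereal_inf_adherent e0 fA.
by exists g => // n; apply: le_trans (ltW h); apply: ereal_sup_ubound; exists n.
Qed.

Let outer_sub A (F : nat -> set (Omega R)) : subset_sigma_subadditive daniell_outer A F.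
Proof.
move=> AF; have [fin|/existsNP[k /negP]] := pselect (forall k, daniell_outer (F k) < +oo)%E; last first.
  rewrite -leNgt leye_eq => /eqP h; rewrite (_ : (\sum_(n <oo) _)%E = +oo%E) ?leey//.
  apply/eqP; rewrite -leye_eq -h.
  apply: le_trans (nneseries_lim_ge k.+1 _) => //.
  by rewrite big_nat_recr//= leeDr// sume_ge0.
apply/lee_addgt0Pr => e e0.
apply: le_trans (epsilon_trick xpredT _ (ltW e0)) => //.
have H k : exists2 g, daniell_cover (F k) g &
    forall n, ((Lam (g n))%:E <= daniell_outer (F k) + (e / (2 ^ k.+1)%:R)%:E)%E.
  by apply: outer_cover => //; rewrite divr_gt0// ltr0n expn_gt0.
pose g k := projT1 (cid2 (H k)).
have gc k : daniell_cover (F k) (g k) by rewrite /g; case: cid2.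
have gl k n : ((Lam (g k n))%:E <= daniell_outer (F k) + (e / (2 ^ k.+1)%:R)%:E)%E.
  by rewrite /g; case: cid2.
have cg k n : cyl (g k n) by have [] := gc k.
have g0 k n w : 0 <= g k n w by have [_ + _ _] := gc k; apply.
(* The diagonal cover: the sum of the n-th functions of the first n covers. *)
apply: (@outer_le _ (fun n w => \sum_(k <- iota 0 n) g k n w)).
  split.
  - by move=> n; apply: cyl_sum.
  - by move=> n w; rewrite sumr_ge0.
  - move=> n m w nm; rewrite -(subnKC nm) iotaD big_cat /= -[leLHS]addr0 lerD//.
      by apply: ler_sum => k _; have [_ _ + _] := gc k; apply; exact: leq_addr.
    by rewrite sumr_ge0.
  - move=> w /AF[k _ Fkw]; have [_ _ mon /(_ w Fkw)[n hn]] := gc k.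
    exists (maxn k.+1 n); apply: (le_trans hn).
    apply: (le_trans (mon n (maxn k.+1 n) w (leq_maxr _ _))).
    rewrite (bigD1_seq k) ?iota_uniq//=; last by rewrite mem_iota add0n leq_maxl.
    by rewrite lerDl sumr_ge0.
move=> n; rewrite Lam_sum// -sumEFin.
apply: (@le_trans _ _ (\sum_(k <- iota 0 n) (daniell_outer (F k) + (e / (2 ^ k.+1)%:R)%:E)%E)).
  by apply: lee_sum => k _; exact: gl.
have := @nneseries_lim_ge R (fun k => daniell_outer (F k) + (e / (2 ^ k.+1)%:R)%:E)%E xpredT 0%N n.
rewrite /index_iota subn0; apply => k _ _; rewrite adde_ge0// lee_fin divr_ge0// ?ltW//.
Qed.

HB.instance Definition _ := isSubsetOuterMeasure.Build R (Omega R) daniell_outer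
  outer0 outer_ge0 outer_sub.

Definition ind_approx c Z n w := Num.min 1 (n%:R * Num.max (Z w - c) 0).

Let ind_approx_cyl c Z n : cyl Z -> cyl (ind_approx c Z n).
Proof.
move=> cZ; apply: cyl_min; first exact: cyl_cst.
apply: cylZ; apply: cyl_max; last exact: cyl_cst.
by apply: cylB => //; exact: cyl_cst.
Qed.

Lemma ind_approx_itv c Z n w : 0 <= ind_approx c Z n w <= 1.
Proof.
by rewrite /ind_approx le_min ler01 /= ge_min lexx /= andbT mulr_ge0// le_max lexx orbT.
Qed.

Lemma ind_approx_mon c Z n m w : (n <= m)%N -> ind_approx c Z n w <= ind_approx c Z m w.
Proof.
move=> nm; rewrite /ind_approx le_min ge_min lexx /= ge_min; apply/orP; right.
by rewrite ler_wpM2r ?ler_nat// le_max lexx orbT.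
Qed.

Lemma ind_approx0 c Z n w : Z w <= c -> ind_approx c Z n w = 0.
Proof.
move=> h; rewrite /ind_approx max_r ?subr_le0// mulr0 min_r//.
Qed.

Lemma ind_approx1 c Z w : c < Z w -> exists k, forall n, (k <= n)%N -> ind_approx c Z n w = 1.
Proof.
move=> h; have h0 : 0 < Z w - c by rewrite subr_gt0.
have [k hk] := nat_ge (Z w - c)^-1; exists k => n kn.
rewrite /ind_approx max_l ?ltW// min_l// -ler_pdivrMr// mul1r (le_trans hk)// ler_nat//.
Qed.

(** A cover of X is multiplied by [ind_approx] and by its complement. The part of X outside is
    covered with a fixed index m of the approximation; as m is arbitrary, the resulting inequality
    bounds every term of the cover of the part inside. *)
Let carathe_cyl c Z : cyl Z -> caratheodory_measurable daniell_outer [set w | c < Z w].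
Proof.
move=> cZ; apply: le_caratheodory_measurable => X; apply: outer_ge => g [cg g0 gm gX].
set S := ereal_sup _; set e := ind_approx c Z.
have ce n : cyl (e n) by exact: ind_approx_cyl.
have cc : cyl (fun=> 1) by exact: cyl_cst.
have e01 n w := ind_approx_itv c Z n w.
have S_ge n : ((Lam (g n))%:E <= S)%E by apply: ereal_sup_ubound; exists n.
have S0 : (0 <= S)%E by apply: le_trans (S_ge 0%N); rewrite lee_fin Lam_ge0.
have [->|/eqP Soo] := eqVneq S +oo%E; first by rewrite leey.
have fS : S \is a fin_num by rewrite ge0_fin_numE// ltey; apply/eqP.
have key m : (daniell_outer (X `&` ~` [set w | (c < Z w)%R]) + (Lam (fun w => (g m w * e m w)%R))%:E <= S)%E.
  rewrite -leeBrDr//; apply: (@outer_le _ (fun n w => g n w * (1 - e m w))).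
    split.
    - by move=> n; apply: cylM => //; exact: cylB.
    - by move=> n w; rewrite mulr_ge0// subr_ge0; have /andP[] := e01 m w.
    - move=> n n' w nn; rewrite ler_wpM2r ?gm// subr_ge0; by have /andP[] := e01 m w.
    - move=> w [Xw /= /negP]; rewrite -leNgt => Zc; have [n hn] := gX w Xw.
      by exists n; rewrite /e ind_approx0// subr0 mulr1.
  move=> n; rewrite leeBrDr// -EFinD.
  have nN : (n <= maxn n m)%N by rewrite leq_maxl.
  have mN : (m <= maxn n m)%N by rewrite leq_maxr.
  apply: le_trans (S_ge (maxn n m)); rewrite lee_fin -LamD; [|by apply: cylM => //; exact: cylB|exact: cylM].
  apply: Lam_le => //.
    apply: cylD; last exact: cylM.
    by apply: cylM => //; exact: cylB.
  move=> w; have /andP[a b] := e01 m w.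
  have h1 := gm _ _ w nN; have h2 := gm _ _ w mN.
  have h3 : g n w * (1 - e m w) <= g (maxn n m) w * (1 - e m w) by rewrite ler_wpM2r// subr_ge0.
  have h4 : g m w * e m w <= g (maxn n m) w * e m w by rewrite ler_wpM2r.
  by apply: le_trans (lerD h3 h4) _; rewrite -mulrDr subrK mulr1.
rewrite addeC -leeBrDl; last first.
  have := key 0%N; rewrite ge0_fin_numE ?outer_ge0// => h.
  apply: le_lt_trans (_ : S < +oo)%E; last by rewrite -ge0_fin_numE.
  apply: le_trans h; rewrite leeDl// lee_fin Lam_ge0//; first exact: cylM.
  by move=> w; rewrite mulr_ge0//; have /andP[] := e01 0%N w.
have fD : daniell_outer (X `&` ~` [set w | (c < Z w)%R]) \is a fin_num.
  have := key 0%N; rewrite ge0_fin_numE ?outer_ge0// => h.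
  apply: le_lt_trans (_ : S < +oo)%E; last by rewrite -ge0_fin_numE.
  apply: le_trans h; rewrite leeDl// lee_fin Lam_ge0//; first exact: cylM.
  by move=> w; rewrite mulr_ge0//; have /andP[] := e01 0%N w.
apply: (@outer_le _ (fun n w => g n w * e n w)); last first.
  by move=> n; rewrite leeBrDl//.
split.
- by move=> n; exact: cylM.
- by move=> n w; rewrite mulr_ge0//; have /andP[] := e01 n w.
- move=> n m w nm; rewrite ler_pM//; first by have /andP[] := e01 n w.
    exact: gm.
  exact: ind_approx_mon.
- move=> w [Xw /= cw]; have [n hn] := gX w Xw; have [k hk] := ind_approx1 cw.
  exists (maxn n k); rewrite /e hk ?leq_maxr// mulr1 (le_trans hn)// gm// leq_maxl//.
Qed.

Let carathe A : measurable A -> caratheodory_measurable daniell_outer A.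
Proof.
move=> /measurable_coord; apply: smallest_sub.
  split; first exact: caratheodory_measurable_set0.
    by move=> D mD; rewrite setTD; exact: caratheodory_measurable_setC.
  by move=> F mF; exact: caratheodory_measurable_bigcup.
move=> _ [s [c [s0 ->]]].
have -> : [set w | c < B s w] = [set w : Omega R | 0 < Num.min 1 (Num.max (B s w - c) 0)].
  apply/seteqP; split => w /=; rewrite lt_min ltr01 /= lt_max ltxx orbF subr_gt0//.
apply: carathe_cyl; apply: cyl_coord => //; exact: leey.
Qed.

Let P0 (A : set (Omega R)) : \bar R := daniell_outer A.

Let P0_sigma_additive : semi_sigma_additive P0.
Proof.
move=> F mF tF mU; apply: (@caratheodory_measure_sigma_additive R (Omega R) daniell_outer) => //.
  by move=> i; exact: carathe.
exact: carathe.
Qed.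

HB.instance Definition _ := isMeasure.Build _ (Omega R) R P0 outer0 outer_ge0 P0_sigma_additive.

Let P0_setT : P0 setT = 1%E.
Proof.
apply/eqP; rewrite eq_le; apply/andP; split.
  apply: (@outer_le _ (fun _ _ => 1)); last by move=> n; rewrite Lam1.
  by split=> // [n|w _]; [exact: cyl_cst|exists 0%N].
apply: outer_ge => g [cg g0 gm gX]; apply/lee_addgt0Pr => e e0.
have cc : cyl (fun=> 1) by exact: cyl_cst.
(* Dini's property gives total mass 1: the positive parts of [1 - g n] decrease and eventually
   vanish at each path. *)
have [||||n hn] := @Lam_dini (fun n w => Num.max (1 - g n w) 0) _ _ _ _ e e0.
- by move=> n; apply: cyl_max; [exact: cylB|exact: cyl_cst].
- by move=> n w; rewrite le_max lexx orbT.
- move=> n m w nm; rewrite ge_max !le_max lexx orbT andbT lerD2l lerN2 gm//.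
- by move=> w; have [n hn] := gX w I; exists n; rewrite max_r// subr_le0.
apply: (@le_trans _ _ ((Lam (g n))%:E + e%:E)%E); last first.
  by rewrite leeD2r//; apply: ereal_sup_ubound; exists n.
rewrite -EFinD lee_fin -lerBlDl; apply: le_trans hn; rewrite -[X in X - _]Lam1 -LamB//.
apply: Lam_le; first exact: cylB.
  by apply: cyl_max; [exact: cylB|exact: cyl_cst].
by move=> w; rewrite le_max lexx.
Qed.

HB.instance Definition _ := Measure_isProbability.Build _ _ R P0 P0_setT.

Lemma layer_sum (d z : R) K : 0 <= d ->
  \sum_(k < K) Num.min d (Num.max (z - k%:R * d) 0) = Num.min (K%:R * d) (Num.max z 0).
Proof.
move=> d0; elim: K => [|K IH].
  by rewrite big_ord0 mul0r min_l// le_max lexx orbT.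
rewrite big_ord_recr /= IH -natr1 mulrDl mul1r; have : 0 <= K%:R * d by rewrite mulr_ge0.
move: (K%:R * d) => x x0.
by rewrite /Num.min /Num.max; do !case: ifPn; rewrite -?leNgt => *; lra.
Qed.

(** Z is cut into slices of height d. On the set where Z exceeds the top of a slice that slice
    equals d, so [Lam] of the slice bounds d times the measure of the set. The staircase so obtained
    is below Z by at most d. *)
Let int_le Z (M : R) : cyl Z -> (forall w, 0 <= Z w) -> (forall w, Z w <= M) ->
  (\int[P0]_w (Z w)%:E <= (Lam Z)%:E)%E.
Proof.
move=> cZ Z0 ZM; have M0 : 0 <= M by exact: le_trans (ZM point).
apply/lee_addgt0Pr => e e0.
have [K Ke] := nat_ge (M / e); set d := e; have d0 : 0 <= d := ltW e0.
have MK : M <= K%:R * d by rewrite -ler_pdivrMr.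
pose f k w := Num.min d (Num.max (Z w - k%:R * d) 0).
have cf k : cyl (f k).
  apply: cyl_min; first exact: cyl_cst.
  by apply: cyl_max; [apply: cylB => //; exact: cyl_cst|exact: cyl_cst].
pose A k := [set w | k.+1%:R * d < Z w].
have mA k : measurable (A k).
  have -> : A k = Z @^-1` `]k.+1%:R * d, +oo[.
    by apply/seteqP; split => w /=; rewrite in_itv/= andbT.
  by rewrite -[X in measurable X]setTI; apply: (measurable_cyl cZ).
have PA k : (d%:E * P0 (A k) <= (Lam (f k))%:E)%E.
  have -> : Lam (f k) = d * Lam (fun w => d^-1 * f k w).
    by rewrite LamZ// mulrA divff ?mul1r// gt_eqF.
  rewrite EFinM lee_pmul2l ?lte_fin//.
  apply: (@outer_le _ (fun _ w => d^-1 * f k w)) => //.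
  split.
  - by move=> _; exact: cylZ.
  - by move=> _ w; rewrite mulr_ge0 ?invr_ge0// /f le_min d0 le_max lexx orbT.
  - by [].
  - move=> w; rewrite /A /= => h; exists 0%N; rewrite mulrC ler_pdivlMr// mul1r /f.
    rewrite le_min lexx /= le_max; apply/orP; left.
    by move: h; rewrite -natr1 mulrDl mul1r; lra.
have mZ : measurable_fun setT (fun w => (Z w)%:E).
  by apply/measurable_EFinP; exact: (measurable_cyl cZ).
have mI k : measurable_fun setT (fun w : Omega R => (d%:E * (\1_(A k) w)%:E)%E).
  by apply: measurable_funeM; apply/measurable_EFinP; exact: measurable_indic.
have I0 k (w : Omega R) : (0 <= d%:E * (\1_(A k) w)%:E)%E by rewrite mule_ge0.
apply: (@le_trans _ _ (\int[P0]_w (d%:E + \sum_(k <- index_iota 0 K) (d%:E * (\1_(A k) w)%:E)))%E).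
  apply: ge0_le_integral => //.
  - by move=> w _; rewrite lee_fin.
  - by apply: emeasurable_funD => //; apply: emeasurable_sum.
  - move=> w _; rewrite big_mkord.
    rewrite (eq_bigr (fun k : 'I_K => (d * \1_(A k) w)%:E)) ?sumEFin// -EFinD lee_fin.
    have h : \sum_(k < K) Num.min d (Num.max ((Z w - d) - k%:R * d) 0) <= \sum_(k < K) d * \1_(A k) w.
      apply: ler_sum => k _; rewrite indicE; case: (boolP (w \in A k)) => [_|].
        by rewrite mulr1 ge_min lexx.
      rewrite notin_setE /A /= => /negP; rewrite -leNgt -natr1 mulrDl mul1r => h.
      by rewrite mulr0 max_r ?min_r//; lra.
    rewrite layer_sum// in h.
    have : Z w - d <= Num.min (K%:R * d) (Num.max (Z w - d) 0).
      by rewrite le_min le_max lexx /= andbT; have := ZM w; lra.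
    lra.
rewrite ge0_integralD//; try solve [by move=> w _; rewrite lee_fin|by move=> w _; apply: sume_ge0|by apply: emeasurable_sum].
have -> : (\int[P0]_w d%:E = d%:E)%E.
  by transitivity (d%:E * P0 setT)%E; [exact: integral_cst|rewrite P0_setT mule1].
rewrite addeC leeD2r//.
rewrite ge0_integral_sum//.
apply: (@le_trans _ _ (\sum_(k <- index_iota 0 K) (Lam (f k))%:E)%E).
  apply: lee_sum => k _; rewrite ge0_integralZl_EFin//; try solve [by move=> w _; rewrite lee_fin|by apply/measurable_EFinP; exact: measurable_indic].
  rewrite integral_indic// setIT; exact: PA.
rewrite sumEFin lee_fin -Lam_sum//; apply: Lam_le => //; first exact: cyl_sum.
by move=> w; rewrite big_mkord layer_sum// (max_l (Z0 w)) ge_min lexx orbT.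
Qed.

(** The upper bound for [M - Z] is the lower bound for Z, because the total mass is 1. *)
Let int_eq Z (M : R) : cyl Z -> (forall w, 0 <= Z w) -> (forall w, Z w <= M) ->
  (\int[P0]_w (Z w)%:E = (Lam Z)%:E)%E.
Proof.
move=> cZ Z0 ZM; apply/eqP; rewrite eq_le (int_le cZ Z0 ZM) /=.
have cM : cyl (fun w => M - Z w) by apply: cylB => //; exact: cyl_cst.
have mZ : measurable_fun setT (fun w => (Z w)%:E).
  by apply/measurable_EFinP; exact: (measurable_cyl cZ).
have mM : measurable_fun setT (fun w => (M - Z w)%:E).
  by apply/measurable_EFinP; exact: (measurable_cyl cM).
have := int_le cM (fun w => _) (fun w => _); move=> /(_ M) h.
have {}h : (\int[P0]_w (M - Z w)%:E <= (Lam (fun w => M - Z w))%:E)%E.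
  by apply: (@int_le _ M) => // w; [rewrite subr_ge0|rewrite gerBl].
rewrite LamB ?Lam_cst// in h; last exact: cyl_cst.
have e : (\int[P0]_w (Z w)%:E + \int[P0]_w (M - Z w)%:E = M%:E)%E.
  rewrite -ge0_integralD//.
  - rewrite (eq_integral (cst M%:E)); last by move=> w _; rewrite -EFinD addrC subrK.
    by transitivity (M%:E * P0 setT)%E; [exact: integral_cst|rewrite P0_setT mule1].
  - by move=> w _; rewrite lee_fin.
  - by move=> w _; rewrite lee_fin subr_ge0.
have f1 : (\int[P0]_w (Z w)%:E)%E \is a fin_num.
  rewrite ge0_fin_numE; last by apply: integral_ge0 => w _; rewrite lee_fin.
  exact: le_lt_trans (int_le cZ Z0 ZM) (ltry _).
have f2 : (\int[P0]_w (M - Z w)%:E)%E \is a fin_num.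
  rewrite ge0_fin_numE; last by apply: integral_ge0 => w _; rewrite lee_fin subr_ge0.
  exact: le_lt_trans h (ltry _).
move: e h; rewrite -(fineK f1) -(fineK f2) -EFinD => -[e]; rewrite !lee_fin; lra.
Qed.

Lemma daniell : exists P : probability (Omega R) R,
  forall Z, cyl Z -> (\int[P]_w (Z w)%:E = (Lam Z)%:E)%E.
Proof.
exists P0 => Z cZ; have [M M0 ZM] := cyl_bounded cZ.
have cM : cyl (fun w => Z w + M) by apply: cylD => //; exact: cyl_cst.
have mZ : measurable_fun setT (fun w => (Z w)%:E).
  by apply/measurable_EFinP; exact: (measurable_cyl cZ).
have Z1 w : - M <= Z w /\ Z w <= M by have := ZM w; rewrite ler_norml => /andP[].
have h : (\int[P0]_w (Z w + M)%:E = (Lam Z + M)%:E)%E.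
  rewrite (@int_eq _ (M + M) cM) ?LamD ?Lam_cst//; first exact: cyl_cst.
  - by move=> w; have [] := Z1 w; lra.
  - by move=> w; have [] := Z1 w; lra.
have iZ : P0.-integrable setT (EFin \o Z) by exact: integrable_cyl cZ.
have iM : P0.-integrable setT (EFin \o cst M) by exact: integrable_cyl (cyl_cst +oo%E M).
have : (\int[P0]_w ((EFin \o Z) w + (EFin \o cst M) w) = (Lam Z + M)%:E)%E by rewrite -h.
rewrite integralD//.
have -> : (\int[P0]_w (EFin \o cst M) w = M%:E)%E.
  by transitivity (M%:E * P0 setT)%E; [exact: (integral_cst _ measurableT M%:E)|rewrite P0_setT mule1].
have fZ := integrable_fin_num measurableT iZ.
by rewrite -[X in (X + _)%E](fineK fZ) -EFinD => -[/addIr E]; rewrite -[LHS](fineK fZ) E.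
Qed.

End daniell.

Section ultralimit_tail.
Context {R : realType}.
Implicit Types (x y : nat -> R) (M e : R).

Lemma bounded_seq_tail x M N : (forall n, (N <= n)%N -> `|x n| <= M) -> bounded_seq x.
Proof.
move=> H; exists (`|M| + \sum_(i < N) `|x i|) => n.
have s0 : 0 <= \sum_(i < N) `|x i| by rewrite sumr_ge0.
have [Nn|nN] := leqP N n.
  by rewrite (le_trans (H n Nn))// (le_trans (ler_norm M))// lerDl.
rewrite (bigD1 (Ordinal nN))//= addrCA lerDl addr_ge0// sumr_ge0//.
Qed.

Lemma ulim_norm_tail x y e N : bounded_seq x -> bounded_seq y ->
  (forall n, (N <= n)%N -> `|x n - y n| <= e) -> `|ulim x - ulim y| <= e.
Proof.
move=> bx by_ H; apply: ulim_norm => //; apply: oo_ultra_near.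
by exists N => // n /= Nn; exact: H.
Qed.

Lemma geometric_sum_le (q : R) N : 0 <= q -> q < 1 -> \sum_(j < N) q ^+ j <= (1 - q)^-1.
Proof.
move=> q0 q1; rewrite -[leRHS]mul1r ler_pdivlMr ?subr_gt0//.
have <- : 1 - q ^+ N = (\sum_(j < N) q ^+ j) * (1 - q).
  elim: N => [|N IH]; first by rewrite big_ord0 mul0r expr0 subrr.
  by rewrite big_ord_recr /= mulrDl -IH exprS; ring.
by rewrite gerBl exprn_ge0.
Qed.

End ultralimit_tail.

(** * Fourth moments of increments *)

Section capped_increments.
Context {R : realType}.
Variables (sl su : R) (hsl : 0 <= sl) (hsu : sl <= su).
Implicit Types (w : Omega R) (s t theta : R).
Local Notation E0 := (Ehat0 sl su).
Local Notation cyl := (@cyl R +oo%E).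

Lemma Ehat0_le Z Z' : cyl Z -> cyl Z' -> (forall w, Z w <= Z' w) -> E0 Z <= E0 Z'.
Proof. by move=> cZ cZ' H; exact: (condE_le hsl hsu (lexx 0) cZ cZ'). Qed.

Lemma Ehat0D Z Z' : cyl Z -> cyl Z' -> E0 (fun w => Z w + Z' w) <= E0 Z + E0 Z'.
Proof. by move=> cZ cZ'; exact: (condED hsl hsu (lexx 0) _ cZ cZ'). Qed.

Lemma Ehat0Z c Z : cyl Z -> 0 <= c -> E0 (fun w => c * Z w) = c * E0 Z.
Proof. by move=> cZ c0; exact: (condEZ hsl hsu (lexx 0) _ cZ). Qed.

Lemma Ehat0_cst c : E0 (fun=> c) = c.
Proof. exact: (condE_cst hsl hsu (lexx 0)). Qed.

Lemma Ehat0_sum (I : Type) (r : seq I) (F : I -> Omega R -> R) : (forall i, cyl (F i)) ->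
  E0 (fun w => \sum_(i <- r) F i w) <= \sum_(i <- r) E0 (F i).
Proof.
move=> cF; elim: r => [|i r IH].
  by rewrite big_nil (_ : (fun w => _) = fun=> 0) ?Ehat0_cst//; apply/funext => w; rewrite big_nil.
rewrite big_cons; apply: (@le_trans _ _ (E0 (F i) + E0 (fun w => \sum_(j <- r) F j w))).
  rewrite (_ : (fun w => _) = (fun w => F i w + \sum_(j <- r) F j w)).
    by apply: Ehat0D => //; exact: cyl_sum.
  by apply/funext => w; rewrite big_cons.
by rewrite lerD2l.
Qed.

(** A Lipschitz substitute for the indicator of an increment larger than theta; its expectation is a
    Chebyshev bound with the fourth power. *)
Definition capped theta s t w : R := (Num.min 1 (`|B t w - B s w| / theta)) ^+ 4.

Lemma cyl_B_incr s t : 0 <= s -> 0 <= t -> forall (f : R -> R) M L, bounded_lip M L f ->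
  cyl (fun w => f (B t w - B s w)).
Proof.
move=> s0 t0 f M L [fM fL]; exists [:: s; t].
  by move=> r; rewrite !inE leey => /orP[/eqP->|/eqP->].
have L0 : 0 <= L by have := fL 1 0; rewrite subr0 normr1 mulr1; apply: le_trans.
exists M, L; split=> // w w'; apply: le_trans (fL _ _) _; rewrite ler_wpM2l//.
rewrite /path_dist !big_cons big_nil addr0.
rewrite (_ : B t w - B s w - _ = (B s w' - B s w) + (B t w - B t w')); last by ring.
by apply: le_trans (ler_normD _ _) _; rewrite (distrC (B s w')).
Qed.

Lemma bounded_lip_capped theta : 0 < theta ->
  bounded_lip 1 (4 / theta) (fun x : R => (Num.min 1 (`|x| / theta)) ^+ 4).
Proof.
move=> t0.
have b (x : R) : 0 <= Num.min 1 (`|x| / theta) <= 1.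
  by rewrite le_min ler01 divr_ge0 ?(ltW t0)// ge_min lexx.
split=> [x|x y].
  by have /andP[h1 h2] := b x; rewrite ger0_norm ?exprn_ge0// exprn_ile1.
have /andP[a0 a1] := b x; have /andP[b0 b1] := b y.
have h : `|Num.min 1 (`|x| / theta) - Num.min 1 (`|y| / theta)| <= theta^-1 * `|x - y|.
  have h : `| `|x| / theta - `|y| / theta| <= theta^-1 * `|x - y|.
    rewrite -mulrBl normrM mulrC (ger0_norm (_ : 0 <= theta^-1)) ?invr_ge0 ?(ltW t0)//.
    by rewrite ler_wpM2l ?invr_ge0 ?(ltW t0)// ler_dist_dist.
  apply: le_trans h; move: (`|x| / theta) (`|y| / theta) => u v.
  have [h0|h0] := leP 0 (u - v); rewrite ?(ger0_norm h0) ?(ltr0_norm h0) ler_norml;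
  rewrite /Num.min; case: ifPn => h1; case: ifPn => h2; rewrite -?leNgt in h1 h2; apply/andP; split; lra.
move: h a0 a1 b0 b1; move: (Num.min 1 _) (Num.min 1 _) => v u h a0 a1 b0 b1.
have -> : u ^+ 4 - v ^+ 4 = (u - v) * (u ^+ 3 + u ^+ 2 * v + u * v ^+ 2 + v ^+ 3) by ring.
have c0 : 0 <= u ^+ 3 + u ^+ 2 * v + u * v ^+ 2 + v ^+ 3.
  by rewrite !addr_ge0 ?mulr_ge0 ?exprn_ge0.
rewrite normrM (ger0_norm c0) [leRHS](_ : _ = theta^-1 * `|x - y| * 4); last by ring.
apply: ler_pM => //.
have p3 := exprn_ile1 3 a0 a1; have p2 := exprn_ile1 2 a0 a1.
have q3 := exprn_ile1 3 b0 b1; have q2 := exprn_ile1 2 b0 b1.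
have m1 : u ^+ 2 * v <= 1 by rewrite mulr_ile1 ?exprn_ge0.
have m2 : u * v ^+ 2 <= 1 by rewrite mulr_ile1 ?exprn_ge0.
lra.
Qed.

Lemma cyl_capped theta s t : 0 <= s -> 0 <= t -> 0 < theta -> cyl (capped theta s t).
Proof. by move=> s0 t0 th; exact: cyl_B_incr s0 t0 _ _ _ (bounded_lip_capped th). Qed.

Lemma capped_ge0 theta s t w : 0 <= capped theta s t w.
Proof. by rewrite /capped exprn_even_ge0. Qed.

Lemma capped_lt1 theta s t w : 0 < theta -> capped theta s t w < 1 -> `|B t w - B s w| <= theta.
Proof.
move=> t0; rewrite /capped leNgt => h; apply/negP => h'; move: h.
by rewrite min_l ?expr1n ?ltxx// ler_pdivlMr// mul1r ltW.
Qed.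

(** Below [theta ^- 4] times the fourth power of the increment, whose largest moment is the Gaussian
    one, given by [heat_le_quartic] with K alone. *)
Lemma Ehat0_capped theta s t : 0 <= s -> s <= t -> 0 < theta ->
  E0 (capped theta s t) <= 3 * su ^+ 4 * (t - s) ^+ 2 / theta ^+ 4.
Proof.
move=> s0 st th; have bl := bounded_lip_capped th.
have t4 : 0 <= theta ^- 4 by rewrite invr_ge0 exprn_ge0// ltW.
move: st; rewrite le_eqVlt => /orP[/eqP<-|st].
  rewrite (_ : capped _ _ _ = fun=> 0) ?Ehat0_cst ?subrr ?expr0n/= ?mulr0 ?mul0r//.
  apply/funext => w; rewrite /capped subrr normr0 mul0r min_r ?ler01//.
  by rewrite expr0n.
rewrite /Ehat0 (condE_increment hsl hsu point s0 st bl).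
apply: le_trans (@heat_le_quartic R sl su hsl hsu 1 _ (t - s) 0 0 0 0 (theta ^- 4) _ t4 _ _) _.
- by rewrite subr_ge0 ltW.
- by case: bl.
- move=> z; rewrite subr0 !mul0r !mulr0 !mul0r !add0r.
  have z0 : 0 <= `|z| / theta by rewrite divr_ge0// ltW.
  apply: (@le_trans _ _ ((`|z| / theta) ^+ 4)).
    rewrite lerXn2r ?nnegrE//; first by rewrite le_min ler01.
    by rewrite ge_min lexx orbT.
  rewrite exprMn exprVn mulrC ler_wpM2l// -normrX ger0_norm// exprn_even_ge0//.
rewrite /Gfun oppr0 max_l// !mulr0 subrr !mulr0 !add0r.
by rewrite le_eqVlt; apply/orP; left; apply/eqP; field; rewrite gt_eqF.
Qed.

End capped_increments.

Lemma geometric_step (R : realFieldType) (c x y : R) : 0 <= c * x ->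
  c * (9 / 10 * x) + 10 * (c * y - c * x) <= 10 * (c * y - c * (9 / 10 * x)).
Proof. lra. Qed.

Lemma expr4_prod (R : comRingType) (c x y : R) a j :
  (c * x ^+ a * y ^+ j) ^+ 4 = c ^+ 4 * (x ^+ 4) ^+ a * (y ^+ 4) ^+ j.
Proof. by rewrite !exprMn; congr (_ * _ * _); rewrite -!exprM mulnC. Qed.

Lemma dist_le3 (R : realFieldType) (u z q b1 b2 b3 e : R) : `|u - q| <= 10 * b1 -> `|z - q| <= b2 ->
  b1 <= b3 -> b2 <= b3 -> b3 <= e / 11 -> `|u - z| <= e.
Proof. by rewrite !ler_norml => /andP[? ?] /andP[? ?] ? ? ?; apply/andP; split; lra. Qed.

(** * A continuous path from values at dyadic times *)

Section path_limit.
Context {R : realType}.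
Implicit Types (w : Omega R) (s t C : R).

Definition dfloor j t : nat := Num.truncn (t * 2 ^+ j).

(** The increment allowed at level j within the unit interval number a. Powers of 9/10 are summable,
    and its fourth power exceeds 5/8, hence 1/2: over 2^j increments of length 2^-j the fourth
    moments divided by the fourth power of the bound still decrease geometrically, like (4/5)^j. The
    factor 2^a makes the sum over the intervals converge. *)
Definition level_bound C j a : R := C * 2 ^+ a * (9 / 10) ^+ j.

Lemma dfloor_itv j t : 0 <= t -> dyadic R j (dfloor j t) <= t <= dyadic R j (dfloor j t).+1.
Proof.
move=> t0; have p0 : 0 < 2 ^+ j :> R by rewrite exprn_gt0.
have /truncn_itv/andP[h1 h2] : 0 <= t * 2 ^+ j by rewrite mulr_ge0// ltW.
by rewrite /dyadic ler_pdivrMr// h1 ler_pdivlMr// ltW.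
Qed.

Lemma dyadicS j i : dyadic R j.+1 (2 * i) = dyadic R j i.
Proof. by rewrite /dyadic natrM exprS invfM; field; rewrite expf_neq0. Qed.

Lemma dfloorS j t : 0 <= t -> dfloor j.+1 t = (2 * dfloor j t)%N \/ dfloor j.+1 t = (2 * dfloor j t).+1.
Proof.
move=> t0; have p0 k : 0 <= t * 2 ^+ k by rewrite mulr_ge0.
have /andP[h1 h2] := truncn_itv (p0 j); have /andP[h3 h4] := truncn_itv (p0 j.+1).
rewrite -!/(dfloor _ _) in h1 h2 h3 h4.
have a1 : (2 * dfloor j t <= dfloor j.+1 t)%N.
  rewrite -ltnS -(ltr_nat R) (le_lt_trans _ h4)// natrM exprS mulrCA ler_wpM2l//.
have a2 : (dfloor j.+1 t < 2 * (dfloor j t).+1)%N.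
  by rewrite -(ltr_nat R) (le_lt_trans h3)// natrM exprS mulrCA ltr_pM2l.
move: (dfloor j.+1 t) (dfloor j t) a1 a2 => x y; rewrite mulnS addnC addn2 ltnS leq_eqVlt.
move=> /orP[/eqP->|h1']; first by left.
by move=> h2'; right; apply/eqP; rewrite eqn_leq h2'.
Qed.

Lemma dfloor_block j t : 0 <= t -> (dfloor j t %/ 2 ^ j)%N = Num.truncn t.
Proof.
move=> t0; have tj : 0 <= t * 2 ^+ j by rewrite mulr_ge0.
apply/esym/truncn_def; have /andP[h1 h2] := truncn_itv tj.
have p0 : 0 < 2 ^+ j :> R by rewrite exprn_gt0.
rewrite -!/(dfloor _ _) in h1 h2; apply/andP; split.
  rewrite -(ler_pM2r p0) (le_trans _ h1)// -natrX -natrM ler_nat leq_divM//.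
rewrite -(ltr_pM2r p0) (lt_le_trans h2)// -natrX -natrM ler_nat.
by rewrite ltn_ceil// expn_gt0.
Qed.

Variables (C : R) (V : nat -> nat -> R).
Hypothesis C0 : 0 <= C.
Hypothesis V0 : forall j, V j 0 = 0.
Hypothesis VS : forall j i, V j.+1 (2 * i)%N = V j i.
Hypothesis Vincr : forall j i, `|V j i.+1 - V j i| <= level_bound C j (i %/ 2 ^ j).

Definition path_limit t : R := ulim (fun j => V j (dfloor j t)).

Let Cb a : 0 <= C * 2 ^+ a.
Proof. by rewrite mulr_ge0// exprn_ge0. Qed.

(** From one level to the next the dyadic floor of t moves by at most one increment of the finer
    level, and the series of ratio 9/10 has sum 10. *)
Lemma path_limit_near j t a : 0 <= t -> t <= a%:R ->
  forall j', (j <= j')%N -> `|V j' (dfloor j' t) - V j (dfloor j t)| <= 10 * level_bound C j a.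
Proof.
move=> t0 ta j' jj'.
have step l : `|V l.+1 (dfloor l.+1 t) - V l (dfloor l t)| <= level_bound C l.+1 a.
  have [->|e] := dfloorS l t0.
    by rewrite VS subrr normr0 mulr_ge0// exprn_ge0.
  rewrite e -[V l _]VS; apply: le_trans (Vincr _ _) _.
  rewrite ler_wpM2r ?exprn_ge0// ler_wpM2l// ler_eXn2l ?ltr1n//.
  have -> : ((2 * dfloor l t) %/ 2 ^ l.+1)%N = (dfloor l t %/ 2 ^ l)%N.
    by rewrite expnS divnMl.
  by rewrite dfloor_block// -(ler_nat R) (le_trans _ ta)// truncn_le.
have H d : `|V (j + d)%N (dfloor (j + d) t) - V j (dfloor j t)| <=
    10 * (level_bound C j a - level_bound C (j + d) a).
  elim: d => [|d IH]; first by rewrite addn0 !subrr normr0 mulr0.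
  rewrite addnS; apply: le_trans (le_trans _ (lerD (step (j + d)%N) IH)) _.
    by rewrite (_ : V (j + d).+1 _ - V j _ = (V (j + d).+1 (dfloor (j + d).+1 t) -
     V (j + d)%N (dfloor (j + d) t)) + (V (j + d)%N (dfloor (j + d) t) - V j (dfloor j t))) ?ler_normD//; ring.
  have := mulr_ge0 (Cb a) (_ : 0 <= (9 / 10) ^+ (j + d)); rewrite exprn_ge0// => /(_ isT).
  rewrite /level_bound exprS; exact: geometric_step.
rewrite -(subnKC jj'); apply: le_trans (H _) _; rewrite ler_wpM2l// gerBl.
by rewrite mulr_ge0// exprn_ge0.
Qed.

Lemma path_limit_bounded t : 0 <= t -> bounded_seq (fun j => V j (dfloor j t)).
Proof.
move=> t0; have [a ta] := nat_ge t.
exists (10 * level_bound C 0 a + `|V 0 (dfloor 0 t)|) => j.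
rewrite -[V j _](subrK (V 0 (dfloor 0 t))); apply: le_trans (ler_normD _ _) _.
by rewrite lerD2r; exact: path_limit_near.
Qed.

Lemma path_limit_dist j t a : 0 <= t -> t <= a%:R ->
  `|path_limit t - V j (dfloor j t)| <= 10 * level_bound C j a.
Proof.
move=> t0 ta; rewrite -[V j _ in X in `|X|]ulim_cst.
apply: (@ulim_norm_tail _ _ _ _ j).
- exact: path_limit_bounded.
- exact: bounded_seq_cst.
- by move=> n; exact: path_limit_near.
Qed.

Lemma level_bound_small a e : 0 < e -> exists j, level_bound C j a <= e.
Proof.
move=> e0; have h : (fun j => (9 / 10 : R) ^+ j) @ \oo --> (0 : R).
  by apply: cvg_expr; rewrite ger0_norm//; lra.
have c1 : 0 < C * 2 ^+ a + 1 by have := Cb a; lra.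
have /cvgr0Pnorm_le/(_ _ (divr_gt0 e0 c1))[j _ /(_ j (leqnn _))] /= := h.
rewrite ger0_norm; last by apply: exprn_ge0; lra.
rewrite ler_pdivlMr// => hj; exists j; rewrite /level_bound; apply: le_trans hj.
by rewrite mulrC ler_wpM2l ?exprn_ge0//; lra.
Qed.

Lemma path_limit_continuous_at t : 0 <= t -> forall e, 0 < e -> exists2 d, 0 < d &
  forall s, 0 <= s -> `|s - t| <= d -> `|path_limit s - path_limit t| <= e.
Proof.
move=> t0 e e0; have [a ta] := nat_ge (t + 1).
(* Ten bounds for each of the two limits and one for the increment between their dyadic floors. *)
have e21 : 0 < e / 21 by rewrite divr_gt0.
have [j hj] := level_bound_small a e21.
have p0 : 0 < 2 ^- j :> R by rewrite invr_gt0 exprn_gt0.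
have p1 : 2 ^- j <= 1 :> R by rewrite invf_le1 ?exprn_gt0// exprn_ege1// ler1n.
exists (2 ^- j) => // s s0 st.
have sa : s <= a%:R by move: st; rewrite ler_norml => /andP[_ h]; lra.
have ta' : t <= a%:R by lra.
have h1 := path_limit_dist j s0 sa; have h2 := path_limit_dist j t0 ta'.
have K x y : 0 <= x -> x <= y -> y <= a%:R -> y - x <= 2 ^- j ->
   `|V j (dfloor j y) - V j (dfloor j x)| <= level_bound C j a.
  move=> x0 xy ya yx; have y0 := le_trans x0 xy.
  have px : 0 <= x * 2 ^+ j by rewrite mulr_ge0.
  have py : 0 <= y * 2 ^+ j by rewrite mulr_ge0.
  have /andP[b1 b2] := truncn_itv px; have /andP[b3 b4] := truncn_itv py.
  rewrite -!/(dfloor _ _) in b1 b2 b3 b4.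
  have yx' : y * 2 ^+ j <= x * 2 ^+ j + 1.
    by rewrite -ler_pdivlMr ?exprn_gt0// mulrDl mul1r mulfK ?gt_eqF ?exprn_gt0//; lra.
  have xy' : x * 2 ^+ j <= y * 2 ^+ j by rewrite ler_wpM2r.
  have c1 : (dfloor j x <= dfloor j y)%N by rewrite -ltnS -(ltr_nat R); lra.
  have c2 : (dfloor j y <= (dfloor j x).+1)%N.
    by rewrite -ltnS -(ltr_nat R) -[X in _ < X]natr1; lra.
  move: c1; rewrite leq_eqVlt => /orP[/eqP->|c1].
    by rewrite subrr normr0 mulr_ge0// exprn_ge0.
  have -> : dfloor j y = (dfloor j x).+1 by apply/eqP; rewrite eqn_leq c2.
  apply: le_trans (Vincr _ _) _; rewrite ler_wpM2r ?exprn_ge0// ler_wpM2l// ler_eXn2l ?ltr1n//.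
  by rewrite dfloor_block// -(ler_nat R) (le_trans _ (le_trans xy ya))// truncn_le.
have h3 : `|V j (dfloor j s) - V j (dfloor j t)| <= level_bound C j a.
  move: st; have [ts|st] := leP t s => h; first by apply: K => //; rewrite ger0_norm ?subr_ge0// in h.
  rewrite distrC; apply: K => //; first exact: ltW.
  by move: h; rewrite ltr0_norm ?subr_lt0// opprB.
move: h1 h2 h3 hj; move: (path_limit s) (path_limit t) (V j _) (V j _) (level_bound _ _ _).
move=> x y u v b; rewrite !ler_norml => /andP[? ?] /andP[? ?] /andP[? ?] ?; apply/andP; split; lra.
Qed.

Lemma is_path_limit : @is_path R path_limit.
Proof.
have z t : t <= 0 -> path_limit t = 0.
  move=> t0; rewrite /path_limit (_ : (fun j => _) = fun=> 0) ?ulim_cst//.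
  apply/funext => j; have -> : dfloor j t = 0%N.
    apply/eqP; rewrite -leqn0 leqNgt truncn_gt_nat; apply/negP => h.
    have : t * 2 ^+ j <= 0 by rewrite mulr_le0_ge0.
    by rewrite leNgt (lt_le_trans ltr01 h).
  exact: V0.
split=> // t; apply/cvgrPdist_le => e e0.
have [t0|t0] := ltP t 0.
  near=> s; rewrite !z ?ltW// ?subrr ?normr0 ?ltW//; near: s; exact: lt_nbhsl.
have [d d0 H] := path_limit_continuous_at t0 e0; exists d => //= s ds.
have [s0|s0] := ltP s 0; last by rewrite distrC H// distrC ltW.
rewrite (z s (ltW s0)) -(z 0 (lexx 0)) distrC; apply: H => //.
rewrite sub0r normrN (ger0_norm t0); move: ds; rewrite /ball_ /= ger0_norm; first by lra.
by lra.
Unshelve. all: by end_near. Qed.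

End path_limit.

(** * Tightness by chaining *)

Section dini.
Context {R : realType}.
Variables (sl su : R) (hsl : 0 <= sl) (hsu : sl <= su).
Implicit Types (w : Omega R) (s t : R).
Local Notation E0 := (Ehat0 sl su).
Local Notation cyl := (@cyl R +oo%E).

Variables (C : R) (D : nat -> R).
Hypotheses (C1 : 1 <= C) (D0 : forall p, 0 <= D p).

(** The second sum ties the value at each time [D p] to the values at its dyadic floors. Thus
    [osc < 1] controls the path at countably many prescribed times and not only at dyadic ones. *)
Definition osc n w : R :=
  \sum_(a < n) \sum_(j < n) \sum_(l < 2 ^ j) capped (level_bound C j a)
     (dyadic R j (a * 2 ^ j + l)) (dyadic R j (a * 2 ^ j + l).+1) w +
  \sum_(p < n) \sum_(j < n) capped (level_bound C j p) (dyadic R j (dfloor j (D p))) (D p) w.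

Let lb0 j a : 0 < level_bound C j a.
Proof.
have h := C1; apply: mulr_gt0; last by apply: exprn_gt0; lra.
by apply: mulr_gt0; [lra|exact: exprn_gt0].
Qed.

Let cc1 j a i : cyl (capped (level_bound C j a) (dyadic R j i) (dyadic R j i.+1)).
Proof. by apply: cyl_capped; [exact: dyadic_ge0|exact: dyadic_ge0|exact: lb0]. Qed.

Let cc2 j a i p : cyl (capped (level_bound C j a) (dyadic R j i) (D p)).
Proof. by apply: cyl_capped; [exact: dyadic_ge0|exact: D0|exact: lb0]. Qed.

Lemma cyl_osc n : cyl (osc n).
Proof.
apply: cylD; apply: cyl_sum => i; apply: cyl_sum => j; last exact: cc2.
by apply: cyl_sum => l; exact: cc1.
Qed.

Let osc1_ge0 n w : 0 <= \sum_(a < n) \sum_(j < n) \sum_(l < 2 ^ j) capped (level_bound C j a)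
     (dyadic R j (a * 2 ^ j + l)) (dyadic R j (a * 2 ^ j + l).+1) w.
Proof.
apply: sumr_ge0 => i _; apply: sumr_ge0 => j _; apply: sumr_ge0 => l _; exact: capped_ge0.
Qed.

Let osc2_ge0 n w : 0 <= \sum_(p < n) \sum_(j < n) capped (level_bound C j p) (dyadic R j (dfloor j (D p))) (D p) w.
Proof. apply: sumr_ge0 => i _; apply: sumr_ge0 => j _; exact: capped_ge0. Qed.

Lemma osc_ge0 n w : 0 <= osc n w.
Proof. by rewrite addr_ge0. Qed.

Lemma osc_dyadic n w j i : osc n w < 1 -> (j < n)%N -> (i < n)%N ->
  `|B (dyadic R j i.+1) w - B (dyadic R j i) w| <= level_bound C j (i %/ 2 ^ j).
Proof.
move=> h jn i_n; apply: (capped_lt1 (lb0 _ _)); apply: le_lt_trans h.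
have an : (i %/ 2 ^ j < n)%N by rewrite (leq_ltn_trans _ i_n)// leq_div.
have ln : (i %% 2 ^ j < 2 ^ j)%N by rewrite ltn_mod expn_gt0.
rewrite /osc (bigD1 (Ordinal an))//= (bigD1 (Ordinal jn))//= (bigD1 (Ordinal ln))//=.
rewrite -divn_eq -!addrA lerDl.
by do ?[exact: capped_ge0|apply: addr_ge0|apply: sumr_ge0 => ? _].
Qed.

Lemma osc_time n w p j : osc n w < 1 -> (j < n)%N -> (p < n)%N ->
  `|B (D p) w - B (dyadic R j (dfloor j (D p))) w| <= level_bound C j p.
Proof.
move=> h jn pn; apply: (capped_lt1 (lb0 _ _)); apply: le_lt_trans h.
rewrite /osc [X in _ <= _ + X](bigD1 (Ordinal pn))//= [X in _ <= _ + (X + _)](bigD1 (Ordinal jn))//=.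
rewrite addrCA -!addrA lerDl.
by do ?[exact: capped_ge0|apply: addr_ge0|apply: sumr_ge0 => ? _].
Qed.

(** The bound is uniform in n and tends to 0 as C grows. The series over intervals has ratio 1/16,
    those over levels 4/5 for dyadic increments and 2/5 for the times [D p]; 14 exceeds 16/15 times
    5 + 5. *)
Lemma Ehat0_osc n : E0 (osc n) <= 3 * su ^+ 4 / C ^+ 4 * 14.
Proof.
have H1 := hsl; have H2 := hsu; have H3 := C1.
have k0 : 0 <= 3 * su ^+ 4 / C ^+ 4.
  by rewrite mulr_ge0 ?invr_ge0 ?exprn_ge0 ?mulr_ge0 ?exprn_ge0//; lra.
have S q c : 0 <= q -> q < 1 -> (1 - q)^-1 <= c -> \sum_(a < n) q ^+ a <= c :> R.
  by move=> q0 q1; apply: le_trans; exact: geometric_sum_le.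
have S1 : \sum_(a < n) (1 / 16) ^+ a <= 16 / 15 :> R.
  by apply: S; [lra|lra|rewrite (_ : (1 - 1 / 16)^-1 = 16 / 15 :> R)//; field].
have S2 : \sum_(j < n) (4 / 5) ^+ j <= 5 :> R.
  apply: S; [lra|lra|rewrite (_ : (1 - 4 / 5)^-1 = 5 :> R); [by []|by field]].
have S3 : \sum_(j < n) (2 / 5) ^+ j <= 5 :> R.
  apply: S; [lra|lra|rewrite (_ : (1 - 2 / 5)^-1 = 5 / 3 :> R); [lra|by field]].
have lbE j a : C ^+ 4 * 16 ^+ a * (5 / 8) ^+ j <= level_bound C j a ^+ 4.
  have -> : level_bound C j a ^+ 4 = C ^+ 4 * 16 ^+ a * ((9 / 10) ^+ 4) ^+ j.
    rewrite /level_bound (_ : 16 = 2 ^+ 4 :> R); last by ring.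
    exact: expr4_prod.
  rewrite ler_wpM2l//; first by rewrite mulr_ge0 ?exprn_ge0//; lra.
  by rewrite lerXn2r ?nnegrE//; lra.
have cl (s t : R) j a : 0 <= s -> s <= t -> t - s <= 2 ^- j ->
  E0 (capped (level_bound C j a) s t) <= 3 * su ^+ 4 / C ^+ 4 * ((1 / 16) ^+ a * (2 / 5) ^+ j).
  move=> s0 st tsj; apply: le_trans (Ehat0_capped hsl hsu s0 st (lb0 _ _)) _.
  have c1 : 0 < C ^+ 4 by rewrite exprn_gt0//; lra.
  have c2 : 0 < (16 : R) ^+ a by rewrite exprn_gt0.
  have c3 : 0 < (5 / 8 : R) ^+ j by rewrite exprn_gt0//; lra.
  have c4 : 0 < C ^+ 4 * 16 ^+ a * (5 / 8) ^+ j := mulr_gt0 (mulr_gt0 c1 c2) c3.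
  have su4 : 0 <= 3 * su ^+ 4 by rewrite mulr_ge0// exprn_ge0//; lra.
  apply: (@le_trans _ _ (3 * su ^+ 4 * (2 ^- j) ^+ 2 / (C ^+ 4 * 16 ^+ a * (5 / 8) ^+ j))).
    rewrite ler_pM//.
    - by rewrite mulr_ge0// exprn_ge0// subr_ge0.
    - by rewrite invr_ge0 exprn_ge0// ltW.
    - rewrite ler_wpM2l// lerXn2r// nnegrE ?subr_ge0// invr_ge0 exprn_ge0//.
    - by rewrite lef_pV2 ?posrE// exprn_gt0.
  have -> : (2 / 5) ^+ j = (2 ^- j) ^+ 2 * ((5 / 8) ^+ j)^-1 :> R.
    by rewrite -exprVn -exprM mulnC exprM -exprVn -exprMn; congr (_ ^+ j); field.
  have -> : (1 / 16) ^+ a = (16 ^+ a)^-1 :> R by rewrite -exprVn; congr (_ ^+ a); field.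
  rewrite le_eqVlt; apply/orP; left; apply/eqP.
  move: (gt_eqF c1) (gt_eqF c2) (gt_eqF c3) => /negbT d1 /negbT d2 /negbT d3.
  move: d1 d2 d3; move: (C ^+ 4) (16 ^+ a) (_ ^+ j) (su ^+ 4) (2 ^- j) => c d e f g d1 d2 d3.
  by field; rewrite d1 d2 d3.
apply: le_trans (Ehat0D hsl hsu _ _) _.
- by apply: cyl_sum => a; apply: cyl_sum => j; apply: cyl_sum => l; exact: cc1.
- by apply: cyl_sum => a; apply: cyl_sum => j; exact: cc2.
have p0 (j : nat) : 0 < 2 ^+ j :> R by rewrite exprn_gt0.
have A1 : E0 (fun w => \sum_(a < n) \sum_(j < n) \sum_(l < 2 ^ j) capped (level_bound C j a)
     (dyadic R j (a * 2 ^ j + l)) (dyadic R j (a * 2 ^ j + l).+1) w) <= 3 * su ^+ 4 / C ^+ 4 *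
     ((\sum_(a < n) (1 / 16) ^+ a) * (\sum_(j < n) (4 / 5) ^+ j)).
  apply: le_trans (Ehat0_sum hsl hsu _ _) _.
    by move=> a; apply: cyl_sum => j; apply: cyl_sum => l; exact: cc1.
  rewrite mulr_suml mulr_sumr; apply: ler_sum => a _.
  apply: le_trans (Ehat0_sum hsl hsu _ _) _.
    by move=> j; apply: cyl_sum => l; exact: cc1.
  rewrite mulr_sumr mulr_sumr; apply: ler_sum => j _.
  apply: le_trans (Ehat0_sum hsl hsu _ _) _.
    by move=> l; exact: cc1.
  apply: (@le_trans _ _ (\sum_(l < 2 ^ j) 3 * su ^+ 4 / C ^+ 4 * ((1 / 16) ^+ a * (2 / 5) ^+ j))).
    apply: ler_sum => l _; apply: cl; first exact: dyadic_ge0.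
      by rewrite /dyadic ler_pM2r ?invr_gt0// ler_nat.
    by rewrite /dyadic -mulrBl -natr1 addrAC subrr add0r mul1r.
  rewrite sumr_const card_ord -[X in X <= _]mulr_natl natrX.
  have -> : (4 / 5) ^+ j = 2 ^+ j * (2 / 5) ^+ j :> R.
    by rewrite -exprMn; congr (_ ^+ j); field.
  by rewrite le_eqVlt; apply/orP; left; apply/eqP; ring.
have A2 : E0 (fun w => \sum_(p < n) \sum_(j < n) capped (level_bound C j p) (dyadic R j (dfloor j (D p))) (D p) w)
   <= 3 * su ^+ 4 / C ^+ 4 * ((\sum_(a < n) (1 / 16) ^+ a) * (\sum_(j < n) (2 / 5) ^+ j)).
  apply: le_trans (Ehat0_sum hsl hsu _ _) _.
    by move=> a; apply: cyl_sum => j; exact: cc2.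
  rewrite mulr_suml mulr_sumr; apply: ler_sum => a _.
  apply: le_trans (Ehat0_sum hsl hsu _ _) _.
    by move=> j; exact: cc2.
  rewrite mulr_sumr mulr_sumr; apply: ler_sum => j _.
  have /andP[h1 h2] := dfloor_itv j (D0 a).
  apply: cl => //; first exact: dyadic_ge0.
  rewrite lerBlDr (le_trans h2)// /dyadic -natr1 mulrDl mul1r addrC//.
apply: le_trans (lerD A1 A2) _; rewrite -mulrDr ler_wpM2l//.
have T1 : 0 <= \sum_(a < n) (1 / 16) ^+ a :> R by apply: sumr_ge0 => a _; rewrite exprn_ge0//; lra.
have T2 : 0 <= \sum_(j < n) (4 / 5) ^+ j :> R by apply: sumr_ge0 => a _; rewrite exprn_ge0//; lra.
have T3 : 0 <= \sum_(j < n) (2 / 5) ^+ j :> R by apply: sumr_ge0 => a _; rewrite exprn_ge0//; lra.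
have U1 := ler_pM T1 T2 S1 S2; have U2 := ler_pM T1 T3 S1 S3.
apply: le_trans (lerD U1 U2) _; lra.
Qed.

End dini.

Section dini_theorem.
Context {R : realType}.
Variables (sl su : R) (hsl : 0 <= sl) (hsu : sl <= su).
Implicit Types (w : Omega R) (s t : R).
Local Notation E0 := (Ehat0 sl su).
Local Notation cyl := (@cyl R +oo%E).

Lemma path_dist_ultra (ts : seq R) (x : nat -> Omega R) v :
  (forall s, s \in ts -> (fun n => B s (x n)) @ oo_ultra --> B s v) ->
  forall e, 0 < e -> oo_ultra [set n | path_dist ts (x n) v < e].
Proof.
have FF : Filter oo_ultra by exact: _.
elim: ts => [|s ts IH] H e e0.
  by apply: filterS filterT => n _; rewrite /= /path_dist big_nil.
have e2 : 0 < e / 2 by rewrite divr_gt0.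
have H2 : oo_ultra [set n | `|B s v - B s (x n)| < e / 2].
  exact: (H s (mem_head _ _) _ (nbhsx_ballx (B s v) (e / 2) e2)).
have H1 : oo_ultra [set n | path_dist ts (x n) v < e / 2].
  by apply: IH => // r rts; apply: H; rewrite in_cons rts orbT.
apply: filterS2 H1 H2 => n /= h1 h2; rewrite /path_dist big_cons.
by rewrite [ltRHS](splitr e) ltrD// distrC.
Qed.

(* Relative compactness of the sets {osc < 1}: along the ultrafilter the
   coordinates at the controlled times converge to those of a genuine path. *)
Lemma osc_compact (C : R) (D : nat -> R) (x : nat -> Omega R) : 1 <= C -> (forall p, 0 <= D p) ->
  (forall n, osc C D n (x n) < 1) ->
  exists v, forall p, (fun n => B (D p) (x n)) @ oo_ultra --> B (D p) v.
Proof.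
move=> C1 D0 xosc; have C0 : 0 <= C by lra.
pose y j i n := B (dyadic R j i) (x n).
have yincr j i n : (j < n)%N -> (i < n)%N -> `|y j i.+1 n - y j i n| <= level_bound C j (i %/ 2 ^ j).
  by move=> jn i_n; exact: (osc_dyadic C1 (xosc n) jn i_n).
have lbm j a a' : (a <= a')%N -> level_bound C j a <= level_bound C j a'.
  move=> aa; rewrite ler_wpM2r ?exprn_ge0// ler_wpM2l// ler_eXn2l ?ltr1n//.
have yb j i : bounded_seq (y j i).
  apply: (@bounded_seq_tail _ _ (i%:R * level_bound C j i) (maxn j i).+1) => n.
  rewrite gtn_max => /andP[jn i_n].
  have H k : (k <= i)%N -> `|y j k n| <= k%:R * level_bound C j i.
    elim: k => [|k IH] ki.
      by rewrite /y B_le0 ?normr0 ?mul0r// /dyadic mul0r.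
    rewrite -[y j k.+1 n](subrK (y j k n)) (le_trans (ler_normD _ _))// -natr1 mulrDl mul1r addrC lerD//.
      by apply: IH; exact: ltnW.
    apply: le_trans (yincr j k n jn (ltn_trans ki i_n)) _; apply: lbm.
    by rewrite (leq_trans (leq_div _ _))// ltnW.
  exact: H.
pose V j i := ulim (y j i).
have V0 j : V j 0%N = 0.
  rewrite /V (_ : y j 0%N = fun=> 0) ?ulim_cst//.
  by apply/funext => n; rewrite /y B_le0// /dyadic mul0r.
have VS j i : V j.+1 (2 * i)%N = V j i by rewrite /V /y dyadicS.
have Vincr j i : `|V j i.+1 - V j i| <= level_bound C j (i %/ 2 ^ j).
  apply: (@ulim_norm_tail _ _ _ _ (maxn j i).+1) => // n.
  by rewrite gtn_max => /andP[jn i_n]; exact: yincr.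
exists (mkpath (is_path_limit C0 V0 VS Vincr)) => p; rewrite B_mkpath.
have close j n : (maxn j p < n)%N -> `|B (D p) (x n) - y j (dfloor j (D p)) n| <= level_bound C j p.
  by rewrite gtn_max => /andP[jn pn]; exact: (osc_time C1 (xosc n) jn pn).
have bD : bounded_seq (fun n => B (D p) (x n)).
  have [M yM] := yb 0%N (dfloor 0 (D p)).
  apply: (@bounded_seq_tail _ _ (level_bound C 0 p + M) (maxn 0 p).+1) => n hn.
  rewrite -[B _ _](subrK (y 0%N (dfloor 0 (D p)) n)) (le_trans (ler_normD _ _))// lerD//.
  exact: close.
have -> : path_limit V (D p) = ulim (fun n => B (D p) (x n)); last exact: ulim_cvg.
apply/eqP; rewrite -subr_eq0 -normr_le0; apply/ler_addgt0Pr => e e0; rewrite add0r.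
have [a ta] := nat_ge (D p).
have e11 : 0 < e / 11 by rewrite divr_gt0.
have [j hj] := level_bound_small C0 (maxn a p) e11.
have h1 := path_limit_dist C0 VS Vincr j (D0 p) ta.
have h2 : `|ulim (fun n => B (D p) (x n)) - V j (dfloor j (D p))| <= level_bound C j p.
  exact: (ulim_norm_tail bD (yb j _) (close j)).
have h3 := lbm j a (maxn a p) (leq_maxl _ _); have h4 := lbm j p (maxn a p) (leq_maxr _ _).
exact: dist_le3 h1 h2 h3 h4 hj.
Qed.

(** If all expectations exceed e, tightness yields paths x n with [osc < 1] and [g n (x n) > e / 2].
    They have an ultralimit v at all relevant times. Some g k vanishes at v, so g k is at most e / 4
    at x n for many n >= k, although it is at least [g n (x n)] there. *)
Lemma Ehat0_dini (g : nat -> Omega R -> R) : (forall n, cyl (g n)) -> (forall n w, 0 <= g n w) ->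
  (forall n m w, (n <= m)%N -> g m w <= g n w) -> (forall w, exists n, g n w = 0) ->
  forall e, 0 < e -> exists n, E0 (g n) <= e.
Proof.
move=> cg g0 gmon gz e e0; apply: contrapT => /forallNP H.
have {}H n : e < E0 (g n) by rewrite ltNge; apply/negP; exact: H.
have [M M0 gM] := cyl_bounded (cg 0%N).
have M1 : 0 < M + 1 by lra.
have su0 : 0 <= su by have := hsl; have := hsu; lra.
have gs n : exists ts, (forall s, s \in ts -> 0 <= s) /\ cylon ts (g n).
  by have [ts Hts c] := cg n; exists ts; split=> // s /Hts[].
pose ts n := projT1 (cid (gs n)).
have tsP n : (forall s, s \in ts n -> 0 <= s) /\ cylon (ts n) (g n) by rewrite /ts; case: cid.
(* An enumeration of the times on which all the functions g n depend. *)
pose D p := if @unpickle (nat * nat)%type p is Some ki then nth 0 (ts ki.1) ki.2 else 0.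
have D0 p : 0 <= D p.
  rewrite /D; case: unpickle => [[k i]|]//=; have [si|si] := ltnP i (size (ts k)).
    by apply: (tsP k).1; exact: mem_nth.
  by rewrite nth_default.
(* Chosen so that [(M + 1) * E0 (osc C D n)] is at most e / 2 for every n. *)
pose C := 1 + 3 * su ^+ 4 * 14 * (2 * (M + 1) / e).
have x0 : 0 <= 3 * su ^+ 4 * 14 by rewrite !mulr_ge0 ?exprn_ge0.
have x1 : 0 <= 2 * (M + 1) / e by rewrite divr_ge0 ?(ltW e0)//; lra.
have C1 : 1 <= C by rewrite /C lerDl mulr_ge0.
have small n : (M + 1) * E0 (osc C D n) <= e / 2.
  apply: (@le_trans _ _ ((M + 1) * (3 * su ^+ 4 * 14 / C))).
    rewrite ler_wpM2l ?(ltW M1)//; apply: le_trans (Ehat0_osc hsl hsu C1 D0 n) _.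
    rewrite mulrAC ler_wpM2l// lef_pV2 ?posrE ?exprn_gt0//; [|lra|lra].
    by rewrite exprS ler_peMr ?exprn_ege1//; lra.
  have : 3 * su ^+ 4 * 14 * (2 * (M + 1) / e) <= C by rewrite /C; lra.
  rewrite mulrA mulrA ler_pdivrMr// => h; rewrite mulrA ler_pdivrMr; last by lra.
  by move: h; rewrite -[C * e]mulrC; move: (3 * su ^+ 4 * 14) => q; lra.
have ex n : exists w, osc C D n w < 1 /\ e / 2 < g n w.
  apply: contrapT => /forallNP Hn; have := H n; rewrite ltNge => /negP; apply.
  have co : cyl (osc C D n) by exact: cyl_osc.
  apply: (@le_trans _ _ (E0 (fun w => e / 2 + (M + 1) * osc C D n w))).
    apply: (Ehat0_le hsl hsu (cg n)); first by apply: cylD; [exact: cyl_cst|exact: cylZ].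
    move=> w; have o0 := osc_ge0 C D n w.
    have [lt1|ge1] := ltP (osc C D n w) 1.
      have : ~ e / 2 < g n w by move=> h; exact: (Hn w).
      move=> /negP; rewrite -leNgt => h; rewrite (le_trans h)// lerDl mulr_ge0// ltW//.
    have := gmon 0%N n w (leq0n _); have := gM w; rewrite ler_norml => /andP[_ h1] h2.
    have : M + 1 <= (M + 1) * osc C D n w by rewrite ler_peMr// ltW.
    lra.
  apply: le_trans (Ehat0D hsl hsu (cyl_cst _ _) (cylZ _ co)) _.
  rewrite (Ehat0_cst hsl hsu) (Ehat0Z hsl hsu co) ?(ltW M1)//.
  by have := small n; lra.
pose x n := projT1 (cid (ex n)).
have xP n : osc C D n (x n) < 1 /\ e / 2 < g n (x n) by rewrite /x; case: cid.
have [v Hv] := osc_compact C1 D0 (fun n => (xP n).1).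
have [k gk] := gz v; have [_ [M' [L [L0 _ gL]]]] := tsP k.
have L1 : 0 < L + 1 by lra.
have e4 : 0 < e / 4 / (L + 1) by rewrite !divr_gt0.
have FF : Filter oo_ultra by exact: _.
have A1 : oo_ultra [set n | path_dist (ts k) (x n) v < e / 4 / (L + 1)].
  apply: path_dist_ultra e4 => s sts.
  have -> : s = D (pickle (k, index s (ts k))) by rewrite /D pickleK/= nth_index.
  exact: Hv.
have A2 : oo_ultra [set n | (k <= n)%N] by apply: oo_ultra_near; exists k.
have [n [/= h1 h2]] := @filter_ex _ oo_ultra _ _ (filterI A1 A2).
have h3 := gL (x n) v; rewrite gk subr0 ger0_norm// in h3.
have h4 := gmon k n (x n) h2; have [_ h5] := xP n.
have h6 : L * path_dist (ts k) (x n) v <= e / 4.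
  apply: (@le_trans _ _ ((L + 1) * path_dist (ts k) (x n) v)).
    by rewrite ler_wpM2r ?path_dist_ge0//; lra.
  by rewrite mulrC -ler_pdivlMr// ltW.
lra.
Qed.

Theorem measure_of_functional (Lam : (Omega R -> R) -> R) :
  (forall Z Z', cyl Z -> cyl Z' -> Lam (fun w => Z w + Z' w) = Lam Z + Lam Z') ->
  (forall c Z, cyl Z -> Lam (fun w => c * Z w) = c * Lam Z) ->
  (forall Z, cyl Z -> Lam Z <= E0 Z) ->
  exists2 P : probability (Omega R) R, G_measures sl su P &
    forall Z, cyl Z -> (\int[P]_w (Z w)%:E = (Lam Z)%:E)%E.
Proof.
move=> LD LZ LE.
have LN Z : cyl Z -> Lam Z = - Lam (fun w => - Z w).
  move=> cZ; rewrite (_ : (fun w => - Z w) = fun w => (-1) * Z w) ?LZ ?mulN1r ?opprK//.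
  by apply/funext => w; rewrite mulN1r.
have Lge Z : cyl Z -> - E0 (fun w => - Z w) <= Lam Z.
  by move=> cZ; rewrite (LN Z cZ) lerN2; apply: LE; exact: cylN.
have [|||P HP] := @daniell R Lam LD LZ.
- move=> Z cZ Z0; apply: le_trans (Lge Z cZ); rewrite oppr_ge0 -(Ehat0_cst hsl hsu 0).
  apply: (Ehat0_le hsl hsu); [exact: cylN|exact: cyl_cst|by move=> w; rewrite oppr_le0].
- apply/eqP; rewrite eq_le; apply/andP; split.
    by apply: le_trans (LE _ (cyl_cst _ 1)) _; rewrite Ehat0_cst.
  by apply: le_trans (Lge _ (cyl_cst _ 1)); rewrite Ehat0_cst ?opprK.
- move=> g cg g0 gm gz e e0; have [n hn] := Ehat0_dini cg g0 gm gz e0.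
  by exists n; apply: le_trans hn; exact: LE.
exists P => // X v LX cX; have [{}cX ->] := cond_Lip0 hsl hsu cX.
by rewrite HP// lee_fin LE.
Qed.

Lemma G_measures_Ehat0 (P : probability (Omega R) R) Z : G_measures sl su P -> cyl Z ->
  (\int[P]_w (Z w)%:E <= (E0 Z)%:E)%E.
Proof.
move=> GP cZ; apply: GP; last exact: cond_Lip0_exists.
by apply/Lip_cyl.
Qed.

End dini_theorem.

(** * Hahn-Banach through minimal sublinear functionals *)

Section hahn_banach.
Context {R : realType}.
Implicit Types (w : Omega R) (c : R) (Z Y X : Omega R -> R) (q : (Omega R -> R) -> R).
Local Notation cyl := (@cyl R +oo%E).

Definition sublin_below p q := [/\
  forall Z Z', cyl Z -> cyl Z' -> q (fun w => Z w + Z' w) <= q Z + q Z',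
  forall c Z, 0 < c -> cyl Z -> q (fun w => c * Z w) <= c * q Z &
  forall Z, cyl Z -> q Z <= p Z].

Lemma sublin_below_ge p q Z : sublin_below p q -> cyl Z -> - q (fun w => - Z w) <= q Z.
Proof.
move=> [qD qZ _] cZ; have h0 : 0 <= q (fun=> 0).
  have := qD _ _ (cyl_cst +oo%E 0) (cyl_cst +oo%E 0).
  by rewrite (_ : (fun w => 0 + 0) = fun=> 0) ?gerDl//; [lra|apply/funext => w; rewrite addr0].
have := qD _ _ cZ (cylN cZ); rewrite (_ : (fun w => Z w + - Z w) = fun=> 0); last first.
  by apply/funext => w; rewrite subrr.
lra.
Qed.

(** A sublinear functional below q that is pushed down in the direction of - Y until its value at -
    Y is at most [- q Y]. *)
Definition tilt q Y Z := inf [set q (fun w => Z w + t * Y w) - t * q Y | t in [set t | 0 <= t]].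

Lemma tilt_lb p q Y Z : sublin_below p q -> cyl Y -> cyl Z ->
  lbound [set q (fun w => Z w + t * Y w) - t * q Y | t in [set t | 0 <= t]] (- q (fun w => - Z w)).
Proof.
move=> sq cY cZ _ [t /= t0 <-]; have [qD qZ _] := sq.
have /orP[/eqP<-|{}t0] : (0 == t) || (0 < t) by rewrite -le_eqVlt.
  rewrite mul0r subr0 (_ : (fun w => Z w + 0 * Y w) = Z); first exact: (sublin_below_ge sq).
  by apply/funext => w; rewrite mul0r addr0.
have h1 : t * q Y <= q (fun w => t * Y w).
  rewrite -ler_pdivlMl//; have := qZ t^-1 (fun w => t * Y w) _ (cylZ t cY).
  rewrite invr_gt0 => /(_ t0); congr (_ <= _); congr q; apply/funext => w.
  by rewrite mulrA mulVf ?mul1r// gt_eqF.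
have := qD (fun w => Z w + t * Y w) (fun w => - Z w) (cylD cZ (cylZ t cY)) (cylN cZ).
rewrite (_ : (fun w => Z w + t * Y w + - Z w) = fun w => t * Y w); last first.
  by apply/funext => w; rewrite addrAC subrr add0r.
lra.
Qed.

Lemma tilt_le p q Y Z t : sublin_below p q -> cyl Y -> cyl Z -> 0 <= t ->
  tilt q Y Z <= q (fun w => Z w + t * Y w) - t * q Y.
Proof.
move=> sq cY cZ t0; apply: ge_inf; last by exists t.
by exists (- q (fun w => - Z w)); exact: (tilt_lb sq).
Qed.

Lemma tilt_ge q Y Z x : (forall t, 0 <= t -> x <= q (fun w => Z w + t * Y w) - t * q Y) ->
  x <= tilt q Y Z.
Proof.
move=> H; apply: lb_le_inf; last by move=> _ [t t0 <-]; exact: H.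
by exists (q (fun w => Z w + 0 * Y w) - 0 * q Y); exists 0 => //=.
Qed.

Lemma sublin_tilt p q Y : sublin_below p q -> cyl Y -> sublin_below q (tilt q Y).
Proof.
move=> sq cY; have [qD qZ _] := sq; split.
- move=> Z Z' cZ cZ'; rewrite -lerBlDr; apply: tilt_ge => t t0.
  rewrite lerBlDr -lerBlDl; apply: tilt_ge => t' t0'; rewrite lerBlDl.
  apply: le_trans (tilt_le sq cY (cylD cZ cZ') (addr_ge0 t0 t0')) _.
  have := qD _ _ (cylD cZ (cylZ t cY)) (cylD cZ' (cylZ t' cY)).
  rewrite (_ : (fun w => Z w + t * Y w + _) = (fun w => Z w + Z' w + (t + t') * Y w)); last first.
    by apply/funext => w; ring.
  lra.
- move=> c Z c0 cZ; rewrite -ler_pdivrMl//; apply: tilt_ge => t t0; rewrite ler_pdivrMl//.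
  apply: le_trans (tilt_le sq cY (cylZ c cZ) (mulr_ge0 (ltW c0) t0)) _.
  have := qZ c _ c0 (cylD cZ (cylZ t cY)).
  rewrite (_ : (fun w => c * (Z w + t * Y w)) = (fun w => c * Z w + c * t * Y w)); last first.
    by apply/funext => w; ring.
  lra.
- move=> Z cZ; apply: le_trans (tilt_le sq cY cZ (lexx 0)) _.
  rewrite mul0r subr0 (_ : (fun w => _) = Z)//.
  by apply/funext => w; rewrite mul0r addr0.
Qed.

Lemma sublin_trans p q r : sublin_below p q -> sublin_below q r -> sublin_below p r.
Proof. by move=> [_ _ qp] [a b rq]; split=> // Z cZ; exact: le_trans (rq Z cZ) (qp Z cZ). Qed.

(** Zorn's lemma. The infimum of a chain is again subadditive because, of two members of the chain,
    one lies below the other. *)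
Lemma sublin_minimal p : sublin_below p p ->
  exists2 q, sublin_below p q &
    forall r, sublin_below q r -> forall Z, cyl Z -> q Z <= r Z.
Proof.
move=> sp; pose T := {q | sublin_below p q}.
pose rr (x y : T) := `[< forall Z, cyl Z -> projT1 y Z <= projT1 x Z >].
have [|||[q sq] qmin] := @ZL_preorder T (exist _ p sp) rr.
- by move=> x; apply/asboolP => Z _.
- move=> x y z /asboolP xy /asboolP yz; apply/asboolP => Z cZ.
  exact: le_trans (yz Z cZ) (xy Z cZ).
- move=> A totA; have [[x0 Ax0]|noA] := pselect (exists x, A x); last first.
    by exists (exist _ p sp) => s As; exfalso; apply: noA; exists s.
  pose q Z := inf [set projT1 x Z | x in A].
  have lb Z : cyl Z -> lbound [set projT1 x Z | x in A] (- p (fun w => - Z w)).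
    move=> cZ _ [[x sx] Ax <-] /=; apply: le_trans (sublin_below_ge sx cZ).
    by rewrite lerN2; have [_ _ h] := sx; exact: h (cylN cZ).
  have qle Z x : cyl Z -> A x -> q Z <= projT1 x Z.
    by move=> cZ Ax; apply: ge_inf; [exists (- p (fun w => - Z w)); exact: lb|exists x].
  have qge Z c : (forall x, A x -> c <= projT1 x Z) -> c <= q Z.
    move=> H; apply: lb_le_inf; first by exists (projT1 x0 Z), x0.
    by move=> _ [x Ax <-]; exact: H.
  have sq : sublin_below p q.
    split.
    + move=> Z Z' cZ cZ'; rewrite -lerBlDr; apply: (qge) => x Ax.
      rewrite lerBlDr -lerBlDl; apply: (qge) => y Ay; rewrite lerBlDl.
      have [m [Am mx my]] : exists m, [/\ A m, projT1 m Z <= projT1 x Z & projT1 m Z' <= projT1 y Z'].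
        have [/asboolP xy|/asboolP yx] := totA x y Ax Ay.
          by exists y; split=> //; exact: xy.
        by exists x; split=> //; exact: yx.
      apply: le_trans (qle _ m (cylD cZ cZ') Am) _.
      have [mD _ _] := projT2 m; have := mD Z Z' cZ cZ'; lra.
    + move=> c Z c0 cZ; rewrite -ler_pdivrMl//; apply: (qge) => x Ax; rewrite ler_pdivrMl//.
      apply: le_trans (qle _ x (cylZ c cZ) Ax) _; have [_ mZ _] := projT2 x; exact: mZ.
    + move=> Z cZ; apply: le_trans (qle _ _ cZ Ax0) _; have [_ _] := projT2 x0; exact.
  by exists (exist _ q sq) => x Ax; apply/asboolP => Z cZ /=; exact: qle.
exists q => // r sr Z cZ.
have h : rr (exist _ q sq) (exist _ r (sublin_trans sq sr)).
  by apply/asboolP => Z' cZ' /=; case: sr => _ _; apply.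
by have /asboolP h' := qmin _ h; exact: h'.
Qed.

(** A minimal functional is below all its tilts, which forces additivity. Tilting p at X beforehand
    pins the value at X to [p X]. *)
Theorem hahn_banach p X : sublin_below p p -> cyl X ->
  exists Lam, [/\ (forall Z Z', cyl Z -> cyl Z' -> Lam (fun w => Z w + Z' w) = Lam Z + Lam Z'),
    (forall c Z, cyl Z -> Lam (fun w => c * Z w) = c * Lam Z),
    (forall Z, cyl Z -> Lam Z <= p Z) & Lam X = p X].
Proof.
move=> sp cX; have s1 := sublin_tilt sp cX.
have s1' : sublin_below (tilt p X) (tilt p X) by case: s1 => a b _; split.
have [q sq qmin] := sublin_minimal s1'.
have sqp := sublin_trans s1 sq; have [qD qZ qp] := sqp.
have qadd Z Z' : cyl Z -> cyl Z' -> q (fun w => Z w + Z' w) = q Z + q Z'.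
  move=> cZ cZ'; apply/eqP; rewrite eq_le qD//=.
  have := qmin _ (sublin_tilt sq cZ') Z cZ.
  have := tilt_le sq cZ' cZ (ler01); rewrite mul1r.
  rewrite (_ : (fun w => Z w + 1 * Z' w) = fun w => Z w + Z' w); last by apply/funext => w; rewrite mul1r.
  lra.
have q0 : q (fun=> 0) = 0.
  have := qadd _ _ (cyl_cst +oo%E 0) (cyl_cst +oo%E 0).
  rewrite (_ : (fun w : Omega R => 0 + 0) = fun=> 0); last by apply/funext => w; rewrite addr0.
  by move=> /eqP; rewrite -subr_eq subrr => /eqP.
have qN Z : cyl Z -> q (fun w => - Z w) = - q Z.
  move=> cZ; have := qadd _ _ cZ (cylN cZ).
  rewrite (_ : (fun w => Z w + - Z w) = fun=> 0) ?q0; last by apply/funext => w; rewrite subrr.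
  by move=> h; lra.
have qpos c Z : 0 < c -> cyl Z -> q (fun w => c * Z w) = c * q Z.
  move=> c0 cZ; apply/eqP; rewrite eq_le qZ//= -ler_pdivlMl//.
  have := qZ c^-1 (fun w => c * Z w) _ (cylZ c cZ); rewrite invr_gt0 => /(_ c0).
  congr (_ <= _); congr q; apply/funext => w.
  by rewrite mulrA mulVf ?mul1r// gt_eqF.
exists q; split=> //.
- move=> c Z cZ; have [c0|c0|->] := ltgtP c 0; last 1 first.
  + by rewrite mul0r (_ : (fun w => _) = fun=> 0)//; apply/funext => w; rewrite mul0r.
  + have := qpos (- c) Z; rewrite oppr_gt0 => /(_ c0 cZ).
    rewrite (_ : (fun w => - c * Z w) = fun w => - (c * Z w)); last by apply/funext => w; rewrite mulNr.
    by rewrite qN ?mulNr; [move=> /oppr_inj|exact: cylZ].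
  + exact: qpos.
- apply/eqP; rewrite eq_le qp//=.
  have [_ _ h] := sq; have := h _ (cylN cX); have := tilt_le sp cX (cylN cX) ler01.
  rewrite mul1r (_ : (fun w => - X w + 1 * X w) = fun=> 0); last by apply/funext => w; rewrite mul1r addNr.
  rewrite qN//.
  have p0 : p (fun=> 0) <= 0.
    have [_ pZ _] := sp; have := pZ 2^-1 (fun=> 0) _ (cyl_cst +oo%E 0); rewrite invr_gt0 ltr0n => /(_ isT).
    rewrite (_ : (fun w : Omega R => 2^-1 * 0) = fun=> 0); last by apply/funext => w; rewrite mulr0.
    have := sublin_below_ge sp (cyl_cst +oo%E 0); rewrite (_ : (fun w : Omega R => - 0) = fun=> 0); last by apply/funext => w; rewrite oppr0.
    by move=> a b; lra.
  lra.
Qed.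

End hahn_banach.

Section bounded_expectation.
Context {R : realType}.
Variable P : probability (Omega R) R.
Implicit Types (w : Omega R) (c : R) (Z Y X : Omega R -> R).

Definition bmeas Z := measurable_fun setT Z /\ exists M, forall w, `|Z w| <= M.

Definition EP Z : R := fine (\int[P]_w (Z w)%:E).

Lemma bmeas_cyl t Z : cyl t Z -> bmeas Z.
Proof.
move=> cZ; split; first exact: measurable_cyl cZ.
by have [M _ ZM] := cyl_bounded cZ; exists M.
Qed.

Lemma bmeas_integrable Z : bmeas Z -> P.-integrable setT (EFin \o Z).
Proof.
move=> [mZ [M ZM]]; apply: measurable_bounded_integrable => //.
- exact: le_lt_trans (probability_le1 P measurableT) (ltry _).
- by exists M; split; rewrite ?num_real// => x Mx w _; exact: le_trans (ZM w) (ltW Mx).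
Qed.

Lemma EPE Z : bmeas Z -> (\int[P]_w (Z w)%:E = (EP Z)%:E)%E.
Proof.
by move=> bZ; rewrite /EP fineK//; exact: (integrable_fin_num measurableT (bmeas_integrable bZ)).
Qed.

Lemma bmeasD Z Y : bmeas Z -> bmeas Y -> bmeas (fun w => Z w + Y w).
Proof.
move=> [mZ [M ZM]] [mY [K YK]]; split; first exact: measurable_funD.
by exists (M + K) => w; rewrite (le_trans (ler_normD _ _))// lerD.
Qed.

Lemma bmeasM Z Y : bmeas Z -> bmeas Y -> bmeas (fun w => Z w * Y w).
Proof.
move=> [mZ [M ZM]] [mY [K YK]]; split; first exact: measurable_funM.
by exists (M * K) => w; rewrite normrM ler_pM.
Qed.

Lemma bmeas_cst c : bmeas (fun=> c).
Proof. by split=> //; exists `|c|. Qed.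

Lemma bmeasZ c Z : bmeas Z -> bmeas (fun w => c * Z w).
Proof. by apply: bmeasM; exact: bmeas_cst. Qed.

Lemma bmeasB Z Y : bmeas Z -> bmeas Y -> bmeas (fun w => Z w - Y w).
Proof.
move=> bZ /(bmeasZ (-1)) bY; have := bmeasD bZ bY; congr bmeas.
by apply/funext => w; rewrite mulN1r.
Qed.

Lemma bmeas_norm Z : bmeas Z -> bmeas (fun w => `|Z w|).
Proof.
move=> [mZ [M ZM]]; split; last by exists M => w; rewrite normr_id.
exact: measurableT_comp.
Qed.

Lemma bmeas_indic (A : set (Omega R)) : measurable A -> bmeas (\1_A : Omega R -> R).
Proof.
move=> mA; split; first exact: measurable_indic.
by exists 1 => w; rewrite indicE; case: (w \in A); rewrite ?normr1 ?normr0.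
Qed.

Lemma EPD Z Y : bmeas Z -> bmeas Y -> EP (fun w => Z w + Y w) = EP Z + EP Y.
Proof.
move=> bZ bY; apply: EFin_inj; rewrite EFinD -!EPE//; last exact: bmeasD.
rewrite -integralD//; [exact: bmeas_integrable|exact: bmeas_integrable].
Qed.

Lemma EPZ c Z : bmeas Z -> EP (fun w => c * Z w) = c * EP Z.
Proof.
move=> bZ; apply: EFin_inj; rewrite EFinM -!EPE//; last exact: bmeasZ.
rewrite -integralZl//; exact: bmeas_integrable.
Qed.

Lemma EPB Z Y : bmeas Z -> bmeas Y -> EP (fun w => Z w - Y w) = EP Z - EP Y.
Proof.
move=> bZ bY; rewrite (_ : (fun w => _) = (fun w => Z w + (-1) * Y w)).
  by rewrite EPD ?EPZ ?mulN1r//; exact: bmeasZ.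
by apply/funext => w; rewrite mulN1r.
Qed.

Lemma EP_cst c : EP (fun=> c) = c.
Proof.
rewrite /EP; have -> : (\int[P]_w c%:E = c%:E)%E; last by [].
transitivity (c%:E * P setT)%E; first exact: (integral_cst _ measurableT c%:E).
by rewrite [P setT]probability_setT mule1.
Qed.

Lemma EP_le Z Y : bmeas Z -> bmeas Y -> (forall w, Z w <= Y w) -> EP Z <= EP Y.
Proof.
move=> bZ bY ZY; rewrite -lee_fin -!EPE//; apply: le_integral => //.
- exact: bmeas_integrable.
- exact: bmeas_integrable.
- by move=> w _; rewrite lee_fin.
Qed.

Lemma EP_norm Z : bmeas Z -> `|EP Z| <= EP (fun w => `|Z w|).
Proof.
move=> bZ; have bN := bmeas_norm bZ; rewrite ler_norml; apply/andP; split.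
  rewrite -mulN1r -EPZ//; apply: EP_le => //; first exact: bmeasZ.
  by move=> w; rewrite mulN1r lerNl -normrN ler_norm.
by apply: EP_le => // w; exact: ler_norm.
Qed.

Lemma EP_indic (A : set (Omega R)) : measurable A -> (EP (\1_A : Omega R -> R))%:E = P A.
Proof.
by move=> mA; rewrite -EPE ?integral_indic ?setIT//; exact: bmeas_indic.
Qed.

End bounded_expectation.

(** * Measures and the conditional expectation of cylinder functions *)

Section approximation.
Context {R : realType}.
Implicit Types (P Q : probability (Omega R) R) (A D : set (Omega R)) (xi Z X : Omega R -> R) (c e t : R).

Lemma vanishing_sets P (D : nat -> set (Omega R)) : (forall n, measurable (D n)) ->
  (forall n m, (n <= m)%N -> D m `<=` D n) -> (forall w, exists n, ~ D n w) ->
  forall e, 0 < e -> exists N, forall n, (N <= n)%N -> EP P (\1_(D n) : Omega R -> R) <= e.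
Proof.
move=> mD Dn D0 e e0.
have h : P \o D @ \oo --> P (\bigcap_n D n).
  apply: nonincreasing_cvg_mu => //.
  - exact: le_lt_trans (probability_le1 P (mD 0%N)) (ltry _).
  - exact: bigcapT_measurable.
  - by move=> n m nm; apply/subsetPset; exact: Dn.
rewrite (_ : \bigcap_n D n = set0) ?measure0 in h; last first.
  by apply/seteqP; split=> // w Dw; have [n] := D0 w; apply; exact: Dw.
have h' : (fun n => EP P (\1_(D n) : Omega R -> R)) @ \oo --> (0 : R).
  rewrite (_ : (fun n => _) = fine \o (P \o D)); first exact: (fine_cvg h).
  by apply/funext => n /=; rewrite -EP_indic.
have /cvgr0Pnorm_le/(_ _ e0)[N _ HN] := h'; exists N => n Nn.
exact: le_trans (ler_norm _) (HN n Nn).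
Qed.

(** The approximation holds under two measures at once, so that one cylinder function can serve to
    compare them. The sets with this property form a sigma-field containing the generators of
    F_t. *)
Definition approximable P Q t A := measurable A /\ forall e, 0 < e -> exists xi,
  [/\ cyl t%:E xi, (forall w, 0 <= xi w <= 1), EP P (fun w => `|\1_A w - xi w|) <= e &
   EP Q (fun w => `|\1_A w - xi w|) <= e].

Let bm_diff t A xi : measurable A -> cyl t%:E xi -> bmeas (fun w => `|\1_A w - xi w|).
Proof.
move=> mA cx; apply: bmeas_norm; apply: bmeasB; [exact: bmeas_indic|exact: bmeas_cyl cx].
Qed.

Lemma approximableC P Q t A : approximable P Q t A -> approximable P Q t (~` A).
Proof.
move=> [mA H]; split; first exact: measurableC.
move=> e e0; have [xi [cx x01 h1 h2]] := H e e0; exists (fun w => 1 - xi w); split.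
- by apply: cylB => //; exact: cyl_cst.
- by move=> w; have := x01 w => /andP[a b]; apply/andP; split; lra.
- congr (_ <= _): h1; congr EP; apply/funext => w.
  by rewrite !indicE in_setC; case: (w \in A) => /=; rewrite ?mulr1n ?mulr0n [RHS]distrC; congr `|_|; ring.
- congr (_ <= _): h2; congr EP; apply/funext => w.
  by rewrite !indicE in_setC; case: (w \in A) => /=; rewrite ?mulr1n ?mulr0n [RHS]distrC; congr `|_|; ring.
Qed.

Lemma approximableU P Q t A D : approximable P Q t A -> approximable P Q t D -> approximable P Q t (A `|` D).
Proof.
move=> [mA HA] [mD HD]; split; first exact: measurableU.
move=> e e0; have e2 : 0 < e / 2 by rewrite divr_gt0.
have [xi [cx x01 h1 h2]] := HA _ e2; have [eta [cy y01 k1 k2]] := HD _ e2.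
exists (fun w => Num.max (xi w) (eta w)).
have cm := cyl_max cx cy; have mU := measurableU _ _ mA mD.
have key w : `|\1_(A `|` D) w - Num.max (xi w) (eta w)| <= `|\1_A w - xi w| + `|\1_D w - eta w|.
  rewrite !indicE in_setU; have /andP[a b] := x01 w; have /andP[c d] := y01 w.
  case: (w \in A); case: (w \in D) => /=; rewrite /Num.max; case: ifPn => h;
  rewrite -?leNgt in h; rewrite ?sub0r ?normrN; rewrite !ger0_norm ?subr_ge0//; lra.
split=> //.
- by move=> w; have /andP[a b] := x01 w; have /andP[c d] := y01 w; rewrite le_max a /= ge_max b d.
- apply: le_trans (EP_le P _ _ key) _; [exact: bm_diff cm|by apply: bmeasD; apply: bm_diff; eassumption|].
  rewrite EPD; [lra|exact: bm_diff cx|exact: bm_diff cy].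
- apply: le_trans (EP_le Q _ _ key) _; [exact: bm_diff cm|by apply: bmeasD; apply: bm_diff; eassumption|].
  rewrite EPD; [lra|exact: bm_diff cx|exact: bm_diff cy].
Qed.

Lemma approximable0 P Q t : approximable P Q t set0.
Proof.
split=> // e e0; exists (fun=> 0); split; [exact: cyl_cst|by move=> w; rewrite lexx ler01| |].
- rewrite (_ : (fun w => _) = fun=> 0) ?EP_cst ?ltW//.
  by apply/funext => w; rewrite indic0 subrr normr0.
- rewrite (_ : (fun w => _) = fun=> 0) ?EP_cst ?ltW//.
  by apply/funext => w; rewrite indic0 subrr normr0.
Qed.

Lemma approximable_bigcup P Q t (F : nat -> set (Omega R)) :
  (forall k, approximable P Q t (F k)) -> approximable P Q t (\bigcup_k F k).
Proof.
move=> HF; have mF k := (HF k).1; have mU : measurable (\bigcup_k F k) by exact: bigcupT_measurable.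
split=> // e e0; have e2 : 0 < e / 2 by rewrite divr_gt0.
pose U n := \big[setU/set0]_(k < n) F k.
have aU n : approximable P Q t (U n).
  by rewrite /U; elim/big_ind : _ => //; [exact: approximable0|move=> ? ?; exact: approximableU].
have mUn n := (aU n).1.
pose D n := (\bigcup_k F k) `\` U n.
have mD n : measurable (D n) by exact: measurableD.
have Dn n m : (n <= m)%N -> D m `<=` D n.
  move=> nm w [a b]; split=> // c; apply: b; rewrite /U -bigcup_mkord.
  by move: c; rewrite /U -bigcup_mkord => -[k /= kn Fk]; exists k => //=; exact: leq_trans kn nm.
have D0 w : exists n, ~ D n w.
  have [[k _ Fk]|nF] := pselect ((\bigcup_k F k) w); last by exists 0%N => -[].
  by exists k.+1 => -[_]; apply; rewrite /U -bigcup_mkord; exists k => //=.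
have [N1 H1] := vanishing_sets P mD Dn D0 e2; have [N2 H2] := vanishing_sets Q mD Dn D0 e2.
pose n := maxn N1 N2; have {}H1 := H1 n (leq_maxl _ _); have {}H2 := H2 n (leq_maxr _ _).
have [xi [cx x01 h1 h2]] := (aU n).2 _ e2; exists xi.
have key w : `|\1_(\bigcup_k F k) w - xi w| <= (\1_(D n) : Omega R -> R) w + `|\1_(U n) w - xi w|.
  rewrite -lerBlDr; apply: le_trans (lerB_dist _ _) _.
  rewrite (_ : _ - _ - _ = (\1_(\bigcup_k F k) w : R) - \1_(U n) w); last by ring.
  rewrite !indicE /D in_setD; case: (boolP (w \in U n)) => h /=.
    have -> : w \in \bigcup_k F k.
      move: h; rewrite !inE /U -bigcup_mkord => -[k _ Fk]; by exists k.
    by rewrite subrr normr0.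
  by rewrite andbT subr0 ger0_norm.
have bI := bmeas_indic (mD n).
split=> //.
- apply: le_trans (EP_le P _ _ key) _; [exact: bm_diff cx|by apply: bmeasD => //; exact: bm_diff cx|].
  rewrite EPD//; [lra|exact: bm_diff cx].
- apply: le_trans (EP_le Q _ _ key) _; [exact: bm_diff cx|by apply: bmeasD => //; exact: bm_diff cx|].
  rewrite EPD//; [lra|exact: bm_diff cx].
Qed.

Lemma approximable_gt P Q t Z c : cyl t%:E Z -> approximable P Q t [set w | c < Z w].
Proof.
move=> cZ; have mgt a b : measurable [set w | a < b * (Z w - c)].
  have cZ' : cyl t%:E (fun w => b * (Z w - c)) by apply: cylZ; apply: cylB => //; exact: cyl_cst.
  have -> : [set w | a < b * (Z w - c)] = (fun w => b * (Z w - c)) @^-1` `]a, +oo[.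
    by apply/seteqP; split => w /=; rewrite in_itv/= andbT.
  by rewrite -[X in measurable X]setTI; apply: (measurable_cyl cZ').
have mA : measurable [set w | c < Z w].
  by have := mgt 0 1; congr measurable; apply/seteqP; split => w /=; rewrite mul1r subr_gt0.
split=> // e e0.
pose D n := [set w | c < Z w /\ n%:R * (Z w - c) < 1].
have mD n : measurable (D n).
  rewrite (_ : D n = [set w | c < Z w] `&` [set w | -1 < - n%:R * (Z w - c)]).
    exact: measurableI.
  by apply/seteqP; split => w /= [a b]; split=> //; move: b; rewrite mulNr ltrN2.
have Dn n m : (n <= m)%N -> D m `<=` D n.
  move=> nm w [a b]; split=> //; apply: le_lt_trans b.
  by rewrite ler_wpM2r ?ler_nat// subr_ge0 ltW.
have D0 w : exists n, ~ D n w.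
  have [h|h] := leP (Z w) c; first by exists 0%N => -[]; rewrite ltNge h.
  have h0 : 0 < Z w - c by rewrite subr_gt0.
  have [n hn] := nat_ge (Z w - c)^-1; exists n => -[_]; apply/negP; rewrite -leNgt.
  by rewrite -ler_pdivrMr// mul1r.
have [N1 H1] := vanishing_sets P mD Dn D0 e0; have [N2 H2] := vanishing_sets Q mD Dn D0 e0.
pose n := maxn N1 N2; have {}H1 := H1 n (leq_maxl _ _); have {}H2 := H2 n (leq_maxr _ _).
have cx : cyl t%:E (ind_approx c Z n).
  apply: cyl_min; first exact: cyl_cst.
  apply: cylZ; apply: cyl_max; last exact: cyl_cst.
  by apply: cylB => //; exact: cyl_cst.
exists (ind_approx c Z n).
have key w : `|\1_[set w | c < Z w] w - ind_approx c Z n w| <= (\1_(D n) : Omega R -> R) w.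
  rewrite !indicE; case: (boolP (w \in D n)) => [|].
    rewrite inE => -[a b]; rewrite mem_set//; have /andP[x y] := ind_approx_itv c Z n w.
    by rewrite ger0_norm ?subr_ge0//; lra.
  rewrite notin_setE => nD; have [h|h] := leP (Z w) c.
    by rewrite ind_approx0// memNset ?subrr ?normr0//=; apply/negP; rewrite -leNgt.
  have h0 : 0 <= Z w - c by rewrite subr_ge0 ltW.
  rewrite mem_set//= /ind_approx max_l// min_l ?subrr ?normr0//.
  by rewrite leNgt; apply/negP => h'; apply: nD.
have bI := bmeas_indic (mD n).
split=> //.
- by move=> w; exact: ind_approx_itv.
- by apply: le_trans (EP_le P _ _ key) _ => //; exact: bm_diff cx.
- by apply: le_trans (EP_le Q _ _ key) _ => //; exact: bm_diff cx.
Qed.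

Lemma approximable_Ft P Q t A : 0 <= t -> Ft t%:E A -> approximable P Q t A.
Proof.
move=> t0 [A' /measurable_coord mA' <-]; rewrite setTI; move: A' mA'; apply: smallest_sub.
  split.
  - by rewrite preimage_set0; exact: approximable0.
  - by move=> A' aA'; rewrite setTD preimage_setC; exact: approximableC.
  - by move=> F aF; rewrite preimage_bigcup; exact: approximable_bigcup.
move=> _ [s [c [s0 ->]]] /=.
have -> : stop t @^-1` [set w | c < B s w] =
    [set w : Omega R | 0 < Num.min 1 (Num.max (B (Num.min s t) w - c) 0)].
  by apply/seteqP; split => w /=; rewrite B_stop lt_min ltr01 /= lt_max ltxx orbF subr_gt0.
apply: approximable_gt; apply: cyl_coord; first by rewrite le_min s0.
by rewrite lee_fin ge_min lexx orbT.
Qed.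

Lemma Ft_measurable (t : \bar R) A : (0 <= t)%E -> Ft t A -> measurable A.
Proof.
case: t => [t|_ //|//]; rewrite lee_fin => t0 FA.
pose P0 : probability (Omega R) R := \d_point; exact: (approximable_Ft P0 P0 t0 FA).1.
Qed.

Lemma EP_approx P t A xi Z M e : measurable A -> cyl t%:E xi -> bmeas Z -> (forall w, `|Z w| <= M) ->
  EP P (fun w => `|\1_A w - xi w|) <= e ->
  `|EP P (fun w => Z w * \1_A w) - EP P (fun w => Z w * xi w)| <= M * e.
Proof.
move=> mA cx bZ ZM h; have bI := bmeas_indic mA; have bx := bmeas_cyl cx.
have M0 : 0 <= M by exact: le_trans (ZM point).
rewrite -EPB; [|exact: bmeasM|exact: bmeasM].
rewrite (_ : (fun w => _) = (fun w => Z w * (\1_A w - xi w))); last by apply/funext => w; ring.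
apply: le_trans (EP_norm P _) _; first by apply: bmeasM => //; exact: bmeasB.
apply: (@le_trans _ _ (M * EP P (fun w => `|\1_A w - xi w|))); last by rewrite ler_wpM2l.
rewrite -EPZ; last exact: bm_diff cx.
apply: EP_le.
- by apply: bmeas_norm; apply: bmeasM => //; exact: bmeasB.
- by apply: bmeasZ; exact: bm_diff cx.
- by move=> w; rewrite normrM ler_wpM2r.
Qed.

Lemma agree_Ft P Q t : 0 <= t -> (forall xi, cyl t%:E xi -> EP Q xi = EP P xi) ->
  forall A, Ft t%:E A -> Q A = P A.
Proof.
move=> t0 H A FA; have [mA aA] := approximable_Ft P Q t0 FA.
rewrite -!EP_indic//; congr EFin; apply/eqP; rewrite -subr_eq0 -normr_le0.
apply/ler_addgt0Pr => e e0; rewrite add0r; have e2 : 0 < e / 2 by rewrite divr_gt0.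
have [xi [cx _ h1 h2]] := aA _ e2.
have b1 : bmeas (fun=> 1 : R) := @bmeas_cst R 1.
have k1 := @EP_approx P t A xi (fun=> 1) 1 (e / 2) mA cx b1 _ h1.
have k2 := @EP_approx Q t A xi (fun=> 1) 1 (e / 2) mA cx b1 _ h2.
have n1 (w : Omega R) : `|1 : R| <= 1 by rewrite normr1.
have {}k1 := k1 n1; have {}k2 := k2 n1.
have E (g : Omega R -> R) : (fun w => 1 * g w) = g by apply/funext => w; rewrite mul1r.
rewrite !E in k1 k2; rewrite (H xi cx) in k2.
clear n1 E; move: k1 k2; rewrite !ler_norml => /andP[? ?] /andP[? ?]; apply/andP; split; lra.
Qed.

Lemma EP_cond_le P t A Z Y : 0 <= t -> bmeas Z -> bmeas Y ->
  (forall xi, cyl t%:E xi -> (forall w, 0 <= xi w <= 1) -> EP P (fun w => Z w * xi w) <= EP P (fun w => Y w * xi w)) ->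
  Ft t%:E A -> EP P (fun w => Z w * \1_A w) <= EP P (fun w => Y w * \1_A w).
Proof.
move=> t0 bZ bY H FA; have [mA aA] := approximable_Ft P P t0 FA.
have [M ZM] := bZ.2; have [K YK] := bY.2.
have M0 : 0 <= M by exact: le_trans (ZM point).
have K0 : 0 <= K by exact: le_trans (YK point).
apply/ler_addgt0Pr => e e0; have e2 : 0 < e / (M + K + 1) by rewrite divr_gt0//; lra.
have [xi [cx x01 h1 _]] := aA _ e2.
have k1 := EP_approx mA cx bZ ZM h1; have k2 := EP_approx mA cx bY YK h1.
have k3 := H xi cx x01.
have k4 : M * (e / (M + K + 1)) + K * (e / (M + K + 1)) <= e.
  rewrite -mulrDl mulrA ler_pdivrMr; last by lra.
  by rewrite mulrC ler_wpM2l ?ltW//; lra.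
move: k1 k2 k3 k4; rewrite !ler_norml => /andP[? ?] /andP[? ?] ? ?; lra.
Qed.

Variables (sl su : R) (hsl : 0 <= sl) (hsu : sl <= su).

Lemma G_measures_EP P Z : G_measures sl su P -> cyl +oo%E Z -> EP P Z <= Ehat0 sl su Z.
Proof.
by move=> GP cZ; rewrite -lee_fin -EPE; [exact: G_measures_Ehat0|exact: bmeas_cyl cZ].
Qed.

(** Hahn-Banach for the functional sending Z to the P-expectation of its conditional expectation. It
    is at most the G-expectation by the tower property, so the linear functional found is a measure
    of the family. On functions known at t it is at most the P-expectation; applied to both signs
    this gives equality. *)
Lemma cond_attained P t X : 0 <= t -> G_measures sl su P -> cyl +oo%E X ->
  exists Q, [/\ G_measures sl su Q, (forall xi, cyl t%:E xi -> EP Q xi = EP P xi) &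
    EP Q X = EP P (condE sl su t X)].
Proof.
move=> t0 GP cX; pose p Z := EP P (condE sl su t Z).
have cc Z : cyl +oo%E Z -> cyl t%:E (condE sl su t Z) by exact: (cyl_condE hsl hsu t0).
have bc Z : cyl +oo%E Z -> bmeas (condE sl su t Z) by move=> /cc; exact: bmeas_cyl.
have sp : sublin_below p p.
  split=> //.
  - move=> Z Z' cZ cZ'; rewrite /p -EPD; [|exact: bc|exact: bc].
    apply: EP_le; [by apply: bc; exact: cylD|by apply: bmeasD; exact: bc|].
    by move=> w; exact: (condED hsl hsu t0 w cZ cZ').
  - move=> c Z c0 cZ; rewrite /p -EPZ; last exact: bc.
    apply: EP_le; [by apply: bc; exact: cylZ|by apply: bmeasZ; exact: bc|].
    by move=> w; rewrite (condEZ hsl hsu t0 _ cZ)// ltW.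
have [Lam [LD LZ Lp LX]] := hahn_banach sp cX.
have LE Z : cyl +oo%E Z -> Lam Z <= Ehat0 sl su Z.
  move=> cZ; apply: le_trans (Lp Z cZ) _.
  rewrite /Ehat0 -(condE_tower hsl hsu _ (lexx 0) t0 cZ).
  by apply: G_measures_EP => //; apply: cyl_le (cc Z cZ); rewrite leey.
have [Q GQ HQ] := measure_of_functional hsl hsu LD LZ LE.
have QL Z : cyl +oo%E Z -> EP Q Z = Lam Z.
  by move=> cZ; apply: EFin_inj; rewrite -EPE ?HQ//; exact: bmeas_cyl cZ.
exists Q; split=> //; last by rewrite QL.
have H xi : cyl t%:E xi -> EP Q xi <= EP P xi.
  move=> cx; have cx' : cyl +oo%E xi by apply: cyl_le cx; rewrite leey.
  rewrite QL//; apply: le_trans (Lp _ cx') _; rewrite /p (_ : condE sl su t xi = xi)//.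
  by apply/funext => w; exact: (condE_id hsl hsu t0).
move=> xi cx; apply/eqP; rewrite eq_le H//=.
have bx := bmeas_cyl cx.
have := H _ (cylZ (-1) cx); rewrite !EPZ//; lra.
Qed.

(** For xi >= 0 known at t, with Y the conditional expectation of X, the conditional expectation of
    [xi * (X - Y)] is 0, hence so is its G-expectation. Indicators of F_t are approximated by such
    xi. *)
Lemma cond_dominates P t X A : 0 <= t -> G_measures sl su P -> cyl +oo%E X -> Ft t%:E A ->
  EP P (fun w => X w * \1_A w) <= EP P (fun w => condE sl su t X w * \1_A w).
Proof.
move=> t0 GP cX; have cY := cyl_condE hsl hsu t0 cX.
have cY' : cyl +oo%E (condE sl su t X) by apply: cyl_le cY; rewrite leey.
apply: EP_cond_le => //; [exact: bmeas_cyl cX|exact: bmeas_cyl cY|].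
move=> xi cx x01; have cx' : cyl +oo%E xi by apply: cyl_le cx; rewrite leey.
have bx := bmeas_cyl cx; have bX := bmeas_cyl cX; have bY := bmeas_cyl cY.
rewrite -subr_le0 -EPB; [|exact: bmeasM|exact: bmeasM].
pose Y := condE sl su t X.
rewrite (_ : (fun w => _) = (fun w => xi w * (X w + - Y w))); last by apply/funext => w; rewrite /Y; ring.
have cXY : cyl +oo%E (fun w => X w + - Y w) by exact: cylB.
apply: le_trans (G_measures_EP GP (cylM cx' cXY)) _.
rewrite /Ehat0 -(condE_tower hsl hsu _ (lexx 0) t0 (cylM cx' cXY)).
rewrite (_ : condE sl su t _ = fun=> 0) ?(condE_cst hsl hsu (lexx 0))//.
apply/funext => w; rewrite (condEM hsl hsu t0 _ cXY cx); last by move=> w'; have /andP[] := x01 w'.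
by rewrite (condEC hsl hsu t0 _ cX (cylN cY)) /Y subrr mulr0.
Qed.

End approximation.

(** * Conditional expectation in terms of the representing measures *)

Section quasi_sure.
Context {R : realType}.
Variables (sl su : R) (hsl : 0 <= sl) (hsu : sl <= su).
Implicit Types (P Q : probability (Omega R) R) (A N : set (Omega R)) (x y z : Omega R -> R) (e s t : R).
Local Notation GM := (@G_measures R sl su).
Local Notation qs := (@qs R sl su).

Lemma G_measures_nonempty : exists P, GM P.
Proof.
have sp : sublin_below (Ehat0 sl su) (Ehat0 sl su).
  split=> //.
  - by move=> Z Z' cZ cZ'; exact: (Ehat0D hsl hsu cZ cZ').
  - by move=> c Z c0 cZ; rewrite (Ehat0Z hsl hsu cZ) // ltW.
have [Lam [LD LZ Lp _]] := hahn_banach sp (cyl_cst +oo%E 0).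
by have [P GP _] := measure_of_functional hsl hsu LD LZ Lp; exists P.
Qed.

Lemma cap_eq0 N : measurable N -> cap sl su N = 0%E <-> forall P, GM P -> P N = 0%E.
Proof.
move=> mN; split=> [h P GP|h].
  by apply/eqP; rewrite eq_le measure_ge0 andbT -h; apply: ereal_sup_ubound; exists P.
have [P0 GP0] := G_measures_nonempty.
apply/eqP; rewrite eq_le; apply/andP; split.
  by apply: ge_ereal_sup => _ [P GP <-]; rewrite h.
by rewrite -(h _ GP0); apply: ereal_sup_ubound; exists P0.
Qed.

Lemma qsI (A : Omega R -> Prop) N : measurable N -> (forall P, GM P -> P N = 0%E) ->
  (forall w, ~ N w -> A w) -> qs A.
Proof. by move=> mN N0 NA; exists N => //; split=> //; exact/cap_eq0. Qed.

Lemma qsE (A : Omega R -> Prop) : qs A -> exists N, [/\ measurable N,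
  (forall P, GM P -> P N = 0%E) & forall w, ~ N w -> A w].
Proof. by move=> [N [mN N0] NA]; exists N; split=> //; exact/cap_eq0. Qed.

Lemma qs_true (A : Omega R -> Prop) : (forall w, A w) -> qs A.
Proof. by move=> H; apply: (@qsI _ set0). Qed.

Lemma qs_all (A : nat -> Omega R -> Prop) : (forall n, qs (A n)) -> qs (fun w => forall n, A n w).
Proof.
move=> H; have {}H n := qsE (H n); pose N n := projT1 (cid (H n)).
have NP n : [/\ measurable (N n), (forall P, GM P -> P (N n) = 0%E) & forall w, ~ N n w -> A n w].
  by rewrite /N; case: cid.
apply: (@qsI _ (\bigcup_n N n)).
- by apply: bigcupT_measurable => n; case: (NP n).
- move=> P GP; apply/negligibleP; first by apply: bigcupT_measurable => n; case: (NP n).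
  apply: negligible_bigcup => n; case: (NP n) => mN N0 _; exists (N n); split=> //; exact: N0.
- by move=> w nw n; case: (NP n) => _ _; apply => Nw; apply: nw; exists n.
Qed.

Lemma qs_imp (A D : Omega R -> Prop) : qs A -> (forall w, A w -> D w) -> qs D.
Proof. by move=> [N hN NA] AD; exists N => // w /NA/AD. Qed.

Lemma qs_and (A D E : Omega R -> Prop) : qs A -> qs D -> (forall w, A w -> D w -> E w) -> qs E.
Proof.
move=> qA qD H; have := @qs_all (fun n => if n is 0%N then A else D) _.
move=> /(_ (fun n => match n with 0%N => qA | _.+1 => qD end)) h.
by apply: (qs_imp h) => w hw; apply: H; [exact: (hw 0%N)|exact: (hw 1%N)].
Qed.

Lemma qs_ae (A : Omega R -> Prop) P : qs A -> GM P -> {ae P, forall w, A w}.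
Proof.
move=> /qsE[N [mN N0 NA]] GP; exists N; split=> //; first exact: N0.
by move=> w /= nA; apply: contrapT => /NA.
Qed.

Lemma qs_meas A : measurable A -> (forall P, GM P -> P A = 0%E) -> qs (fun w => ~ A w).
Proof. by move=> mA A0; exact: (@qsI _ A). Qed.

Definition rint P x := P.-integrable setT (EFin \o x).

Lemma rint_meas P x : rint P x -> measurable_fun setT x.
Proof. by move=> /measurable_int /measurable_EFinP. Qed.

Lemma rint_bmeas P x : bmeas x -> rint P x.
Proof. exact: bmeas_integrable. Qed.

Lemma rintD P x y : rint P x -> rint P y -> rint P (fun w => x w + y w).
Proof. by move=> hx hy; rewrite /rint (_ : _ \o _ = (EFin \o x) \+ (EFin \o y))%E//; exact: integrableD. Qed.

Lemma rintZ P (c : R) x : rint P x -> rint P (fun w => c * x w).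
Proof. by move=> hx; rewrite /rint (_ : _ \o _ = (fun w => c%:E * (EFin \o x) w))%E//; exact: integrableZl. Qed.

Lemma rintB P x y : rint P x -> rint P y -> rint P (fun w => x w - y w).
Proof. by move=> hx hy; rewrite /rint (_ : _ \o _ = (EFin \o x) \- (EFin \o y))%E//; exact: integrableB. Qed.

Lemma rint_le P x y : measurable_fun setT x -> (forall w, `|x w| <= `|y w|) -> rint P y -> rint P x.
Proof.
move=> mx xy hy; apply: (le_integrable measurableT _ _ hy); first exact/measurable_EFinP.
by move=> w _ /=; rewrite lee_fin.
Qed.

Lemma rint_ae P x y : rint P x -> measurable_fun setT y -> {ae P, forall w, x w = y w} -> rint P y.
Proof.
move=> /integrableP[mx ix] my xy; apply/integrableP; split; first exact/measurable_EFinP.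
rewrite (_ : (\int[P]_w `|(EFin \o y) w| = \int[P]_w `|(EFin \o x) w|)%E)//.
apply: ae_eq_integral => //.
- by apply: measurableT_comp => //; exact/measurable_EFinP.
- exact: measurableT_comp.
- by apply: filterS xy => w /= ->.
Qed.

Lemma rint_norm P x : rint P x -> rint P (fun w => `|x w|).
Proof.
move=> hx; apply: (rint_le _ _ hx) => [|w]; last by rewrite normr_id.
by apply: measurableT_comp => //; exact: rint_meas hx.
Qed.

Lemma rint_ind P x A : measurable A -> rint P x -> rint P (fun w => x w * \1_A w).
Proof.
move=> mA hx; apply: (rint_le _ _ hx) => [|w].
  by apply: measurable_funM; [exact: rint_meas hx|exact: measurable_indic].
by rewrite indicE; case: (w \in A); rewrite ?mulr1 ?mulr0 ?normr0.
Qed.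

Lemma rEPE P x : rint P x -> (\int[P]_w (x w)%:E = (EP P x)%:E)%E.
Proof. by move=> hx; rewrite /EP fineK//; exact: (integrable_fin_num measurableT hx). Qed.

Lemma rEPD P x y : rint P x -> rint P y -> EP P (fun w => x w + y w) = EP P x + EP P y.
Proof.
move=> hx hy; apply: EFin_inj; rewrite EFinD -!rEPE//; last exact: rintD.
by rewrite -integralD.
Qed.

Lemma rEPB P x y : rint P x -> rint P y -> EP P (fun w => x w - y w) = EP P x - EP P y.
Proof.
move=> hx hy; apply: EFin_inj; rewrite EFinB -!rEPE//; last exact: rintB.
by rewrite -integralB.
Qed.

Lemma rEPZ P (c : R) x : rint P x -> EP P (fun w => c * x w) = c * EP P x.
Proof.
move=> hx; apply: EFin_inj; rewrite EFinM -!rEPE//; last exact: rintZ.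
by rewrite -integralZl.
Qed.

Lemma rEP_ge0 P x : rint P x -> {ae P, forall w, 0 <= x w} -> 0 <= EP P x.
Proof.
move=> hx x0; rewrite -lee_fin -rEPE// (_ : (\int[P]_w (x w)%:E = \int[P]_w `|x w|%:E)%E).
  by apply: integral_ge0 => w _; rewrite lee_fin.
apply: ae_eq_integral => //.
- by apply/measurable_EFinP; exact: rint_meas hx.
- by apply/measurable_EFinP; exact: rint_meas (rint_norm hx).
- by apply: filterS x0 => w xw _ /=; rewrite ger0_norm.
Qed.

Lemma rEP_le P x y : rint P x -> rint P y -> {ae P, forall w, x w <= y w} -> EP P x <= EP P y.
Proof.
move=> hx hy xy; rewrite -subr_ge0 -rEPB//; apply: rEP_ge0; first exact: rintB.
by apply: filterS xy => w; rewrite subr_ge0.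
Qed.

Lemma rEP_norm P x : rint P x -> `|EP P x| <= EP P (fun w => `|x w|).
Proof.
move=> hx; have hn := rint_norm hx; rewrite ler_norml; apply/andP; split.
  rewrite -mulN1r -rEPZ//; apply: rEP_le => //; first exact: rintZ.
  by apply: aeW => w; rewrite mulN1r lerNl -normrN ler_norm.
by apply: rEP_le => //; apply: aeW => w; exact: ler_norm.
Qed.

Lemma rEP_eq0 P x : rint P x -> {ae P, forall w, 0 <= x w} -> EP P x <= 0 -> {ae P, forall w, x w = 0}.
Proof.
move=> hx x0 E0; have E : EP P x = 0 by apply/eqP; rewrite eq_le E0 rEP_ge0.
have mx : measurable_fun setT (EFin \o x) by apply/measurable_EFinP; exact: rint_meas hx.
have : ae_eq P setT (EFin \o x) (cst 0%E).
  apply/(ae_eq_integral_abs P measurableT mx).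
  rewrite -[RHS]/(0%:E) -E -rEPE//; apply: ae_eq_integral => //.
  - exact: measurableT_comp.
  - by apply: filterS x0 => w xw _ /=; rewrite ger0_norm.
by apply: filterS => w /(_ I) /= [].
Qed.

Lemma rEP_ind_split P x A : measurable A -> rint P x ->
  EP P x = EP P (fun w => x w * \1_A w) + EP P (fun w => x w * \1_(~` A) w).
Proof.
move=> mA hx; rewrite -rEPD; [|exact: rint_ind|by apply: rint_ind => //; exact: measurableC].
congr EP; apply/funext => w; rewrite !indicE in_setC.
by case: (w \in A) => /=; rewrite mulr1 mulr0 ?addr0 ?add0r.
Qed.

Lemma rEP_dominated P (xn : nat -> Omega R -> R) x g : (forall n, measurable_fun setT (xn n)) ->
  measurable_fun setT x -> {ae P, forall w, (xn ^~ w) @ \oo --> x w} -> rint P g ->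
  {ae P, forall w n, `|xn n w| <= g w} ->
  (fun n => EP P (xn n)) @ \oo --> EP P x.
Proof.
move=> mxn mx cx hg xg.
have [] := @dominated_convergence _ _ _ P setT measurableT (fun n => EFin \o xn n) (EFin \o x) (EFin \o g).
- by move=> n; apply/measurable_EFinP.
- exact/measurable_EFinP.
- apply: filterS cx => w h _ /=; apply: cvg_EFin; [exact: nearW|exact: h].
- exact: hg.
- by apply: filterS xg => w h n _ /=; rewrite lee_fin.
move=> hx _ h; have := h; rewrite (_ : (\int[P]_w (EFin \o x) w)%E = (EP P x)%:E); last exact: rEPE.
move=> /fine_cvg; apply: cvg_trans; apply: near_eq_cvg; exact: nearW.
Qed.

Lemma stop_measurable t : 0 <= t -> measurable_fun setT (stop t : Omega R -> Omega R).
Proof.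
move=> t0 _ A mA; have [P _] := G_measures_nonempty.
exact: (approximable_Ft P P t0 (ex_intro2 _ _ A mA erefl)).1.
Qed.

Lemma stop_stop s t w : s <= t -> stop s (stop t w) = stop s w.
Proof.
move=> st; apply: B_inj => r; rewrite !B_stop; congr B.
by rewrite /Num.min; do !case: ifPn; rewrite -?leNgt => *; apply/eqP; rewrite eq_le; apply/andP; split; lra.
Qed.

Lemma FtE t A : Ft t%:E A <-> exists2 D, measurable D & A = stop t @^-1` D.
Proof. by split=> [[D mD <-]|[D mD ->]]; exists D => //; rewrite setTI. Qed.

Lemma Ft_le s t A : 0 <= t -> s <= t -> Ft s%:E A -> Ft t%:E A.
Proof.
move=> t0 st /FtE[D mD ->]; have [s0|s0] := leP 0 s.
  apply/FtE; exists (stop s @^-1` D); first by rewrite -[X in measurable X]setTI; exact: stop_measurable.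
  by apply/funext => w /=; rewrite stop_stop.
apply/FtE; exists (stop s @^-1` D); last by apply/funext => w /=; rewrite stop_stop.
have st0 w : stop s w = stop 0 w.
  apply: B_inj => r; rewrite !B_stop; rewrite !(B_le0 w)// ge_min ?lexx ?(ltW s0) ?orbT//.
have -> : stop s @^-1` D = stop 0 @^-1` D by apply/funext => w /=; rewrite st0.
by rewrite -[X in measurable X]setTI; apply: stop_measurable.
Qed.

Definition agree t P Q := forall A, Ft t%:E A -> Q A = P A.

(** A function of the stopped path is integrated against the image measure under [stop t], and the
    two image measures coincide. *)
Lemma agree_EP t P Q (g : Omega R -> R) : 0 <= t -> agree t P Q -> measurable_fun setT g ->
  rint P (fun w => g (stop t w)) -> rint Q (fun w => g (stop t w)) ->
  EP P (fun w => g (stop t w)) = EP Q (fun w => g (stop t w)).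
Proof.
move=> t0 PQ mg hP hQ; have ms := stop_measurable t0.
have mE : measurable_fun setT (EFin \o g) by exact/measurable_EFinP.
apply: EFin_inj; rewrite -!rEPE//.
have e1 := integral_pushforward ms mE hP measurableT.
have e2 := integral_pushforward ms mE hQ measurableT.
rewrite !preimage_setT in e1 e2.
rewrite -[LHS]e1 -[RHS]e2; apply: eq_measure_integral => A mA _.
by apply/esym/PQ/FtE; exists A.
Qed.

End quasi_sure.

(** * Conditional expectation characterised by domination and attainment *)

Section conditional_pairs.
Context {R : realType}.
Variables (sl su : R) (hsl : 0 <= sl) (hsu : sl <= su).
Implicit Types (P Q : probability (Omega R) R) (A N : set (Omega R)) (x y z g : Omega R -> R) (e s t r : R).
Local Notation GM := (@G_measures R sl su).
Local Notation qs := (@qs R sl su).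

(** The norm of the upper expectation enters only through its upper bounds e, which keeps all
    computations real. *)
Definition nle x e := forall P, GM P -> EP P (fun w => `|x w|) <= e.

Definition Lr x := measurable_fun setT x /\
  exists M, forall P, GM P -> rint P x /\ EP P (fun w => `|x w|) <= M.

Lemma Lr_rint x P : Lr x -> GM P -> rint P x.
Proof. by move=> [_ [M H]] GP; case: (H P GP). Qed.

Lemma Lr_nle x : Lr x -> exists2 M, 0 <= M & nle x M.
Proof.
move=> [_ [M H]]; have [P GP] := G_measures_nonempty hsl hsu.
exists M; last by move=> Q GQ; case: (H Q GQ).
have [h1 h2] := H P GP; apply: le_trans h2; apply: rEP_ge0; first exact: rint_norm.
exact: aeW.
Qed.

Lemma LrI x M : measurable_fun setT x -> (forall P, GM P -> rint P x) -> nle x M -> Lr x.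
Proof. by move=> mx h1 h2; split=> //; exists M => P GP; split; [exact: h1|exact: h2]. Qed.

Lemma nleD x y e e' : (forall P, GM P -> rint P x) -> (forall P, GM P -> rint P y) ->
  nle x e -> nle y e' -> nle (fun w => x w + y w) (e + e').
Proof.
move=> hx hy nx ny P GP; apply: le_trans (lerD (nx P GP) (ny P GP)).
rewrite -rEPD; [|by apply: rint_norm; exact: hx|by apply: rint_norm; exact: hy].
apply: rEP_le.
- by apply: rint_norm; apply: rintD; [exact: hx|exact: hy].
- by apply: rintD; apply: rint_norm; [exact: hx|exact: hy].
- by apply: aeW => w; exact: ler_normD.
Qed.

Lemma LrD x y : Lr x -> Lr y -> Lr (fun w => x w + y w).
Proof.
move=> hx hy; have [M _ nx] := Lr_nle hx; have [K _ ny] := Lr_nle hy.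
apply: (@LrI _ (M + K)).
- exact: measurable_funD hx.1 hy.1.
- by move=> P GP; apply: rintD; [exact: Lr_rint hx GP|exact: Lr_rint hy GP].
- by apply: nleD => // P GP; [exact: Lr_rint hx GP|exact: Lr_rint hy GP].
Qed.

Lemma LrZ (c : R) x : Lr x -> Lr (fun w => c * x w).
Proof.
move=> hx; have [M _ nx] := Lr_nle hx; apply: (@LrI _ (`|c| * M)).
- exact: measurable_funM (measurable_cst c) hx.1.
- by move=> P GP; apply: rintZ; exact: Lr_rint hx GP.
- move=> P GP; rewrite (_ : (fun w => _) = (fun w => `|c| * `|x w|)); last by apply/funext => w; rewrite normrM.
  rewrite rEPZ; last by apply: rint_norm; exact: Lr_rint hx GP.
  by rewrite ler_wpM2l// nx.
Qed.

Lemma LrB x y : Lr x -> Lr y -> Lr (fun w => x w - y w).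
Proof.
move=> hx /(LrZ (-1)) hy; have := LrD hx hy; congr Lr; apply/funext => w; by rewrite mulN1r.
Qed.

Lemma Lr_le x y : measurable_fun setT x -> (forall w, `|x w| <= `|y w|) -> Lr y -> Lr x.
Proof.
move=> mx xy hy; have [M _ ny] := Lr_nle hy.
have rx P : GM P -> rint P x by move=> GP; apply: rint_le xy (Lr_rint hy GP).
apply: (@LrI _ M) => // P GP; apply: le_trans (ny P GP); apply: rEP_le.
- by apply: rint_norm; exact: rx.
- by apply: rint_norm; exact: Lr_rint hy GP.
- exact: aeW.
Qed.

Lemma Lr_norm x : Lr x -> Lr (fun w => `|x w|).
Proof.
move=> hx; apply: (Lr_le _ _ hx) => [|w]; last by rewrite normr_id.
by apply: measurableT_comp => //; exact: hx.1.
Qed.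

Lemma Lr_bmeas x : bmeas x -> Lr x.
Proof.
move=> bx; have [M xM] := bx.2; apply: (@LrI _ M); first exact: bx.1.
  by move=> P _; exact: rint_bmeas.
move=> P _; rewrite -[leRHS](EP_cst P); apply: EP_le => //; first exact: bmeas_norm.
exact: bmeas_cst.
Qed.

Lemma Lr_max x y : Lr x -> Lr y -> Lr (fun w => Num.max (x w) (y w)).
Proof.
move=> hx hy; apply: (Lr_le _ _ (LrD (Lr_norm hx) (Lr_norm hy))).
  exact: measurable_maxr hx.1 hy.1.
move=> w /=; rewrite [leRHS]ger0_norm ?addr_ge0//.
by rewrite /Num.max; case: ifPn => _; rewrite ?lerDl ?lerDr.
Qed.

Lemma nle_EP x y e A P : Lr x -> Lr y -> nle (fun w => x w - y w) e -> measurable A -> GM P ->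
  `|EP P (fun w => x w * \1_A w) - EP P (fun w => y w * \1_A w)| <= e.
Proof.
move=> hx hy ne mA GP; have rx := Lr_rint hx GP; have ry := Lr_rint hy GP.
rewrite -rEPB; [|exact: rint_ind|exact: rint_ind].
have rd : rint P (fun w => x w * \1_A w - y w * \1_A w) by apply: rintB; exact: rint_ind.
apply: le_trans (rEP_norm rd) _; apply: le_trans (ne P GP); apply: rEP_le.
- exact: rint_norm.
- by apply: rint_norm; exact: rintB.
- apply: aeW => w; rewrite -mulrBl normrM ler_piMr//.
  by rewrite indicE; case: (w \in A); rewrite ?normr1 ?normr0.
Qed.

Lemma nle_EP0 x y e P : Lr x -> Lr y -> nle (fun w => x w - y w) e -> GM P ->
  `|EP P x - EP P y| <= e.
Proof.
move=> hx hy ne GP; have := nle_EP hx hy ne measurableT GP.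
have E (g : Omega R -> R) : (fun w => g w * \1_setT w) = g by apply/funext => w; rewrite indicT mulr1.
by rewrite !E.
Qed.

(** Being a function of the stopped path, outside a polar set, is the form in which measurability at
    time t is used: measures that agree on F_t integrate such variables alike. *)
Definition adapted t y := exists2 y' : Omega R -> R, measurable_fun setT y' &
  qs (fun w => y w = y' (stop t w)).

Lemma agree_adapted t P Q y A : 0 <= t -> GM P -> GM Q -> agree t P Q -> Lr y -> adapted t y ->
  Ft t%:E A -> EP Q (fun w => y w * \1_A w) = EP P (fun w => y w * \1_A w).
Proof.
move=> t0 GP GQ PQ hy [y' my' yy'] /FtE[D mD AD].
pose gg w := y' w * (\1_D w : R).
have mg : measurable_fun setT gg by apply: measurable_funM => //; exact: measurable_indic.
have mA : measurable A by rewrite AD -[X in measurable X]setTI; exact: (stop_measurable hsl hsu t0).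
have E : qs (fun w => y w * \1_A w = gg (stop t w)).
  by apply: (qs_imp yy') => w ->; rewrite /gg !indicE AD.
have rg P' : GM P' -> rint P' (fun w => gg (stop t w)) /\ EP P' (fun w => y w * \1_A w) = EP P' (fun w => gg (stop t w)).
  move=> GP'; have hA := rint_ind mA (Lr_rint hy GP').
  have mgs : measurable_fun setT (fun w => gg (stop t w)) by exact: measurableT_comp mg (stop_measurable hsl hsu t0).
  have ae := qs_ae hsl hsu E GP'.
  have rgs : rint P' (fun w => gg (stop t w)).
    exact: rint_ae hA mgs ae.
  split=> //; apply/eqP; rewrite eq_le !rEP_le//; apply: filterS ae => w ->//.
by rewrite (rg P GP).2 (rg Q GQ).2; apply/esym/(agree_EP hsl hsu t0 PQ mg); [exact: (rg P GP).1|exact: (rg Q GQ).1].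
Qed.

(* [rdom t x y]: E^P[x | F_t] <= y for every P. [rpair t x y]: moreover y is
   the essential supremum over the measures agreeing with P on F_t. *)
Definition rdom t x y := [/\ Lr x, Lr y, adapted t y &
  forall P, GM P -> forall A, Ft t%:E A -> EP P (fun w => x w * \1_A w) <= EP P (fun w => y w * \1_A w)].

Definition rpair t x y := rdom t x y /\ forall P, GM P -> forall e, 0 < e ->
  exists Q, [/\ GM Q, agree t P Q & EP P y <= EP Q x + e].

Lemma Ft_meas t A : 0 <= t -> Ft t%:E A -> measurable A.
Proof. by move=> t0; apply: Ft_measurable; rewrite lee_fin. Qed.

Lemma Ft_setC t A : Ft t%:E A -> Ft t%:E (~` A).
Proof. by move=> /FtE[D mD ->]; apply/FtE; exists (~` D) => //; exact: measurableC. Qed.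

Lemma Ft_setT t : Ft t%:E [set: Omega R].
Proof. by apply/FtE; exists setT. Qed.

(** Q nearly attains the total expectation. By domination it gains nothing on the complement of A,
    so it nearly attains on A too, and one Q serves all A. *)
Lemma rpair_loc t x y P e : 0 <= t -> rpair t x y -> GM P -> 0 < e ->
  exists Q, [/\ GM Q, agree t P Q & forall A, Ft t%:E A ->
    EP P (fun w => y w * \1_A w) <= EP Q (fun w => x w * \1_A w) + e].
Proof.
move=> t0 [[hx hy ay dom] att] GP e0; have [Q [GQ PQ yx]] := att P GP e e0.
exists Q; split=> // A FA; have mA := Ft_meas t0 FA; have FC := Ft_setC FA.
have h1 := dom Q GQ _ FC; rewrite (agree_adapted t0 GP GQ PQ hy ay FC) in h1.
have h2 := rEP_ind_split mA (Lr_rint hy GP); have h3 := rEP_ind_split mA (Lr_rint hx GQ).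
lra.
Qed.

Lemma adapted_lt t y y' : 0 <= t -> adapted t y -> adapted t y' -> exists A, [/\ Ft t%:E A &
  qs (fun w => A w <-> y w < y' w)].
Proof.
move=> t0 [v mv yv] [v' mv' yv']; exists (stop t @^-1` [set w | v w < v' w]); split.
  apply/FtE; exists [set w | v w < v' w] => //.
  rewrite (_ : [set w | v w < v' w] = setT `&` (fun w => v w < v' w) @^-1` [set true]).
    exact: measurable_fun_ltr mv mv' measurableT [set true] _.
  by apply/seteqP; split => w /=; [split|case].
by apply: (qs_and hsl hsu yv yv') => w -> ->.
Qed.

(** On {y' < y}, an event known at t, near attainment of y and domination by y' show that y - y' has
    P-expectation at most 0 there, for every P. *)
Lemma rpair_mono t x y x' y' : 0 <= t -> rpair t x y -> rdom t x' y' ->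
  qs (fun w => x w <= x' w) -> qs (fun w => y w <= y' w).
Proof.
move=> t0 xy [hx' hy' ay' dom'] xx'; have [[hx hy ay dom] att] := xy.
have [A [FA EA]] := adapted_lt t0 ay' ay; have mA := Ft_meas t0 FA.
suff H : qs (fun w => ~ A w).
  by apply: (qs_and hsl hsu H EA) => w nA [_ h]; rewrite leNgt; apply/negP => /h.
apply: (qs_meas hsl hsu mA) => P GP.
pose d w := y w * \1_A w - y' w * \1_A w.
have ry := rint_ind mA (Lr_rint hy GP); have ry' := rint_ind mA (Lr_rint hy' GP).
have rd : rint P d by exact: rintB.
have d0 : {ae P, forall w, 0 <= d w}.
  apply: filterS (qs_ae hsl hsu EA GP) => w h; rewrite /d indicE.
  by case: (boolP (w \in A)) => [|_]; rewrite ?mulr0 ?subrr// inE => /h /ltW; rewrite !mulr1 subr_ge0.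
have dE : EP P d <= 0.
  rewrite rEPB// subr_le0; apply/ler_addgt0Pr => e e0.
  have [Q [GQ PQ H]] := rpair_loc t0 xy GP e0; apply: le_trans (H A FA) _; rewrite lerD2r.
  rewrite -(agree_adapted t0 GP GQ PQ hy' ay' FA); apply: le_trans (dom' Q GQ A FA).
  apply: rEP_le; [exact: rint_ind (Lr_rint hx GQ)|exact: rint_ind (Lr_rint hx' GQ)|].
  apply: filterS (qs_ae hsl hsu xx' GQ) => w h; rewrite ler_wpM2r// indicE; by case: (_ \in _).
have [N [mN N0 NA]] : {ae P, forall w, ~ A w}.
  apply: filterS2 (rEP_eq0 rd d0 dE) (qs_ae hsl hsu EA GP) => w dw h Aw.
  have lt := h.1 Aw; move: dw; rewrite /d indicE mem_set// !mulr1 => /eqP.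
  by rewrite subr_eq0 => /eqP E; move: lt; rewrite E ltxx.
apply/(negligibleP P mA); exists N; split=> // w Aw; apply: NA => /=; exact.
Qed.

(** The factor 2 arises because {y' < y} and its complement are treated with different measures
    Q. *)
Lemma rpair_contract t x y x' y' e : 0 <= t -> rpair t x y -> rpair t x' y' ->
  nle (fun w => x w - x' w) e -> nle (fun w => y w - y' w) (2 * e).
Proof.
move=> t0 xy xy' ne P GP.
have half u v u' v' A : rpair t u v -> rpair t u' v' -> nle (fun w => u w - u' w) e -> Ft t%:E A ->
    EP P (fun w => v w * \1_A w) - EP P (fun w => v' w * \1_A w) <= e.
  move=> uv [[hu' hv' av' dom'] _] nu FA; have [[hu hv av dom] _] := uv; have mA := Ft_meas t0 FA.
  apply/ler_addgt0Pr => d d0; have [Q [GQ PQ H]] := rpair_loc t0 uv GP d0.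
  have h1 := H A FA; have h2 := dom' Q GQ A FA; rewrite (agree_adapted t0 GP GQ PQ hv' av' FA) in h2.
  have := nle_EP hu hu' nu mA GQ; rewrite ler_norml => /andP[_ h3]; lra.
have [[hx hy ay dom] att] := xy; have [[hx' hy' ay' dom'] att'] := xy'.
have [A [FA EA]] := adapted_lt t0 ay' ay; have mA := Ft_meas t0 FA; have FC := Ft_setC FA.
have mC := Ft_meas t0 FC.
have rd : rint P (fun w => y w - y' w) by apply: rintB; [exact: Lr_rint hy GP|exact: Lr_rint hy' GP].
rewrite (rEP_ind_split mA (rint_norm rd)) mulr2n mulrDl mul1r.
have ne' : nle (fun w => x' w - x w) e.
  by move=> Q GQ; rewrite (_ : (fun w => _) = (fun w => `|x w - x' w|)) ?ne//; apply/funext => w; rewrite distrC.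
have ry := Lr_rint hy GP; have ry' := Lr_rint hy' GP.
apply: lerD.
  apply: le_trans (half _ _ _ _ A xy xy' ne FA); rewrite -rEPB; [|exact: rint_ind|exact: rint_ind].
  apply: rEP_le; [by apply: rint_ind => //; exact: rint_norm|by apply: rintB; exact: rint_ind|].
  apply: filterS (qs_ae hsl hsu EA GP) => w h; rewrite -mulrBl indicE.
  case: (boolP (w \in A)) => [|_]; rewrite ?mulr0// !mulr1 inE => /h lt.
  by rewrite ger0_norm// subr_ge0 ltW.
apply: le_trans (half _ _ _ _ (~` A) xy' xy ne' FC); rewrite -rEPB; [|exact: rint_ind|exact: rint_ind].
apply: rEP_le; [by apply: rint_ind => //; exact: rint_norm|by apply: rintB; exact: rint_ind|].
apply: filterS (qs_ae hsl hsu EA GP) => w h; rewrite -mulrBl indicE.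
case: (boolP (w \in ~` A)) => [|_]; rewrite ?mulr0// !mulr1 inE => nA.
by rewrite distrC ger0_norm// subr_ge0 leNgt; apply/negP => /h.
Qed.

Lemma agree_trans s t P Q Q' : 0 <= t -> s <= t -> agree s P Q -> agree t Q Q' -> agree s P Q'.
Proof. by move=> t0 st PQ QQ A FA; rewrite QQ ?PQ//; exact: (Ft_le hsl hsu t0 st FA). Qed.

Lemma rpair_tower s t x y z : 0 <= s -> s <= t -> rpair t x y -> rpair s y z -> rpair s x z.
Proof.
move=> s0 st [[hx hy ay dom] att] [[_ hz az dom'] att']; have t0 := le_trans s0 st; split.
  split=> // P GP A FA; apply: le_trans (dom P GP A _) (dom' P GP A FA).
  exact: (Ft_le hsl hsu t0 st FA).
move=> P GP e e0; have e2 : 0 < e / 2 by rewrite divr_gt0.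
have [Q [GQ PQ h]] := att' P GP _ e2; have [Q' [GQ' QQ h']] := att Q GQ _ e2.
exists Q'; split=> //; [exact: agree_trans t0 st PQ QQ|lra].
Qed.

Lemma rpair_lim t (xn yn : nat -> Omega R -> R) x y : 0 <= t -> (forall n, rpair t (xn n) (yn n)) ->
  Lr x -> Lr y -> adapted t y ->
  (forall e, 0 < e -> exists k : nat, forall n, (k <= n)%N -> nle (fun w => xn n w - x w) e) ->
  (forall e, 0 < e -> exists k : nat, forall n, (k <= n)%N -> nle (fun w => yn n w - y w) e) ->
  rpair t x y.
Proof.
move=> t0 H hx hy ay cx cy.
have close e : 0 < e -> exists n, nle (fun w => xn n w - x w) e /\ nle (fun w => yn n w - y w) e.
  move=> e0; have [N1 h1] := cx e e0; have [N2 h2] := cy e e0.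
  by exists (maxn N1 N2); split; [apply: h1; exact: leq_maxl|apply: h2; exact: leq_maxr].
split.
  split=> // P GP A FA; have mA := Ft_meas t0 FA; apply/ler_addgt0Pr => e e0.
  have [n [h1 h2]] := close _ (divr_gt0 e0 (ltr0Sn _ 1)); have [[hxn hyn _ dom] _] := H n.
  have := nle_EP hxn hx h1 mA GP; have := nle_EP hyn hy h2 mA GP; have := dom P GP A FA.
  by rewrite !ler_norml => h3 /andP[? ?] /andP[? ?]; lra.
move=> P GP e e0; have [n [h1 h2]] := close (e / 3) (divr_gt0 e0 (ltr0Sn _ 2)).
have [[hxn hyn _ _] att] := H n.
have [Q [GQ PQ h3]] := att P GP (e / 3) (divr_gt0 e0 (ltr0Sn _ 2)); exists Q; split=> //.
have := nle_EP0 hxn hx h1 GQ; have := nle_EP0 hyn hy h2 GP.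
by rewrite !ler_norml => /andP[? ?] /andP[? ?]; lra.
Qed.

Lemma EP_monotone P A (xn : nat -> Omega R -> R) x : GM P -> measurable A -> (forall n, Lr (xn n)) -> Lr x ->
  qs (fun w => (forall n, `|xn n w| <= `|xn 0%N w| + `|x w|) /\ (xn ^~ w) @ \oo --> x w) ->
  (fun n => EP P (fun w => xn n w * \1_A w)) @ \oo --> EP P (fun w => x w * \1_A w).
Proof.
move=> GP mA hxn hx H; have ae := qs_ae hsl hsu H GP.
have h0 := LrD (Lr_norm (hxn 0%N)) (Lr_norm hx).
apply: (@rEP_dominated _ _ _ _ (fun w => `|xn 0%N w| + `|x w|)).
- by move=> n; apply: measurable_funM; [exact: (hxn n).1|exact: measurable_indic].
- by apply: measurable_funM; [exact: hx.1|exact: measurable_indic].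
- by apply: filterS ae => w [_ h]; apply: cvgM => //; exact: cvg_cst.
- exact: Lr_rint h0 GP.
- apply: filterS ae => w [h _] n; apply: le_trans (h n); rewrite normrM ler_piMr//.
  by rewrite indicE; case: (w \in A); rewrite ?normr1 ?normr0.
Qed.

Lemma EP_monotone0 P (xn : nat -> Omega R -> R) x : GM P -> (forall n, Lr (xn n)) -> Lr x ->
  qs (fun w => (forall n, `|xn n w| <= `|xn 0%N w| + `|x w|) /\ (xn ^~ w) @ \oo --> x w) ->
  (fun n => EP P (xn n)) @ \oo --> EP P x.
Proof.
move=> GP hxn hx H; have := EP_monotone GP measurableT hxn hx H.
have E (g : Omega R -> R) : (fun w => g w * \1_setT w) = g by apply/funext => w; rewrite indicT mulr1.
by rewrite E (_ : (fun n => _) = (fun n => EP P (xn n)))//; apply/funext => n; rewrite E.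
Qed.

Definition rinc (xn : nat -> Omega R -> R) x :=
  qs (fun w => {homo xn ^~ w : n m / (n <= m)%N >-> n <= m} /\ (xn ^~ w) @ \oo --> x w).

Definition rdec (xn : nat -> Omega R -> R) x :=
  qs (fun w => {homo xn ^~ w : n m / (n <= m)%N >-> m <= n} /\ (xn ^~ w) @ \oo --> x w).

Lemma rinc_le xn x : rinc xn x -> qs (fun w => forall n, xn n w <= x w).
Proof.
move=> H; apply: (qs_imp H) => w [mon cv] n; have <- : lim ((xn ^~ w) @ \oo) = x w by exact/cvg_lim.
by apply: nondecreasing_cvgn_le => //; apply/cvg_ex; exists (x w).
Qed.

Lemma rdec_ge xn x : rdec xn x -> qs (fun w => forall n, x w <= xn n w).
Proof.
move=> H; apply: (qs_imp H) => w [mon cv] n; have <- : lim ((xn ^~ w) @ \oo) = x w by exact/cvg_lim.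
by apply: nonincreasing_cvgn_ge => //; apply/cvg_ex; exists (x w).
Qed.

Lemma rinc_dom xn x : rinc xn x ->
  qs (fun w => (forall n, `|xn n w| <= `|xn 0%N w| + `|x w|) /\ (xn ^~ w) @ \oo --> x w).
Proof.
move=> H; apply: (qs_and hsl hsu H (rinc_le H)) => w [mon cv] le; split=> // n.
by have := mon 0%N n (leq0n n); have := le n; rewrite !ler_norml; have := ler_norm (x w);
  have := ler_norm (- xn 0%N w); rewrite normrN => *; apply/andP; split; have := normr_ge0 (x w);
  have := normr_ge0 (xn 0%N w); lra.
Qed.

Lemma rdec_dom xn x : rdec xn x ->
  qs (fun w => (forall n, `|xn n w| <= `|xn 0%N w| + `|x w|) /\ (xn ^~ w) @ \oo --> x w).
Proof.
move=> H; apply: (qs_and hsl hsu H (rdec_ge H)) => w [mon cv] le; split=> // n.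
by have := mon 0%N n (leq0n n); have := le n; rewrite !ler_norml; have := ler_norm (- x w);
  have := ler_norm (xn 0%N w); rewrite normrN => *; apply/andP; split; have := normr_ge0 (x w);
  have := normr_ge0 (xn 0%N w); lra.
Qed.

(** For attainment fix n with [EP P (yn n)] close to [EP P y]; a measure good for xn n is good for
    x, which is larger. *)
Lemma rpair_inc t (xn yn : nat -> Omega R -> R) x y : 0 <= t -> (forall n, rpair t (xn n) (yn n)) ->
  Lr x -> Lr y -> adapted t y -> rinc xn x -> rinc yn y -> rpair t x y.
Proof.
move=> t0 H hx hy ay ix iy.
have hxn n : Lr (xn n) by case: (H n) => -[].
have hyn n : Lr (yn n) by case: (H n) => -[].
split.
  split=> // P GP A FA; have mA := Ft_meas t0 FA.
  apply: (ler_cvg_to (EP_monotone GP mA hxn hx (rinc_dom ix)) (EP_monotone GP mA hyn hy (rinc_dom iy))).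
  by apply: nearW => n; case: (H n) => -[_ _ _ dom] _; exact: dom.
move=> P GP e e0; have e2 : 0 < e / 2 by rewrite divr_gt0.
have := EP_monotone0 GP hyn hy (rinc_dom iy).
move=> /cvgrPdist_le /(_ _ e2)[n _ /(_ n (leqnn _))] /=; rewrite ler_norml => /andP[_ h].
have [_ att] := H n; have [Q [GQ PQ h']] := att P GP _ e2; exists Q; split=> //.
have : EP Q (xn n) <= EP Q x.
  apply: rEP_le; [exact: Lr_rint (hxn n) GQ|exact: Lr_rint hx GQ|].
  by apply: filterS (qs_ae hsl hsu (rinc_le ix) GQ) => w; apply.
lra.
Qed.

Definition RG (t : \bar R) x := Lr x /\ forall e, 0 < e -> exists2 Z, cyl t Z & nle (fun w => Z w - x w) e.

(* Weak compactness: the functionals E^{Q_n} have a cluster point, which is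
   again represented by a measure; it is tested on decreasing quasi-continuous
   variables. *)
Lemma rpair_dec t (xn yn : nat -> Omega R -> R) x y : 0 <= t -> (forall n, rpair t (xn n) (yn n)) ->
  (forall n, RG +oo%E (xn n)) ->
  Lr x -> Lr y -> adapted t y -> rdec xn x -> rdec yn y -> rpair t x y.
Proof.
move=> t0 H Hx hx hy ay ix iy.
have hxn n : Lr (xn n) by case: (H n) => -[].
have hyn n : Lr (yn n) by case: (H n) => -[].
split.
  split=> // P GP A FA; have mA := Ft_meas t0 FA.
  apply: (ler_cvg_to (EP_monotone GP mA hxn hx (rdec_dom ix)) (EP_monotone GP mA hyn hy (rdec_dom iy))).
  by apply: nearW => n; case: (H n) => -[_ _ _ dom] _; exact: dom.
move=> P GP e e0; have e2 : 0 < e / 2 by rewrite divr_gt0.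
have HQ n : exists Q, [/\ GM Q, agree t P Q & EP P (yn n) <= EP Q (xn n) + e / 2].
  by have [_ att] := H n; exact: att.
pose q n := projT1 (cid (HQ n)).
have qP n : [/\ GM (q n), agree t P (q n) & EP P (yn n) <= EP (q n) (xn n) + e / 2] by rewrite /q; case: cid.
pose Lam Z := ulim (fun n => EP (q n) Z).
have bs Z : cyl +oo%E Z -> bounded_seq (fun n => EP (q n) Z).
  move=> cZ; have bZ := bmeas_cyl cZ; have [M ZM] := bZ.2; exists M => n.
  apply: le_trans (EP_norm (q n) bZ) _; rewrite -[leRHS](EP_cst (q n)).
  by apply: EP_le => //; [exact: bmeas_norm|exact: bmeas_cst].
have [|||Q GQ QL] := measure_of_functional hsl hsu (Lam := Lam).
- move=> Z Z' cZ cZ'; rewrite /Lam -ulimD; [|exact: bs|exact: bs].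
  by congr ulim; apply/funext => n; rewrite EPD//; [exact: bmeas_cyl cZ|exact: bmeas_cyl cZ'].
- move=> c Z cZ; rewrite /Lam -ulimZ; last exact: bs.
  by congr ulim; apply/funext => n; rewrite EPZ//; exact: bmeas_cyl cZ.
- move=> Z cZ; rewrite -[leRHS]ulim_cst; apply: ulim_le; [exact: bs|exact: bounded_seq_cst|].
  by apply: nearW => n; apply: (G_measures_EP hsl hsu) => //; case: (qP n).
have QE Z : cyl +oo%E Z -> EP Q Z = Lam Z.
  by move=> cZ; apply: EFin_inj; rewrite -EPE ?QL//; exact: bmeas_cyl cZ.
exists Q; split=> //.
  apply: (agree_Ft t0) => xi cx; have cx' : cyl +oo%E xi by apply: cyl_le cx; rewrite leey.
  rewrite QE// /Lam -[RHS]ulim_cst; congr ulim; apply/funext => n; have [GQn PQn _] := qP n.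
  have ax : adapted t xi.
    exists xi; first exact: measurable_cyl cx.
    apply: qs_true => // w; case: cx => ts Hts c; apply: (cylon_dep c) => s /Hts[_]; rewrite lee_fin => st.
    by rewrite B_stop min_l.
  have := agree_adapted t0 GP GQn PQn (Lr_bmeas (bmeas_cyl cx)) ax (Ft_setT t).
  have E (g : Omega R -> R) : (fun w => g w * \1_setT w) = g by apply/funext => w; rewrite indicT mulr1.
  by rewrite E.
(* For n >= m the expectation of xn n under q n is at most that of xn m. The latter is replaced by a
   cylinder function, on which the q n converge to Q along the ultrafilter. *)
have key m : EP P y - e / 2 <= EP Q (xn m).
  apply/ler_addgt0Pr => d d0; have d2 : 0 < d / 2 by rewrite divr_gt0.
  have [_ /(_ _ d2)[Z cZ nZ]] := Hx m.
  have lZ := Lr_bmeas (bmeas_cyl cZ).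
  have h1 := nle_EP0 lZ (hxn m) nZ GQ; rewrite (QE Z cZ) in h1.
  have h2 : EP P y - e / 2 - d / 2 <= Lam Z.
    rewrite -[leLHS]ulim_cst; apply: ulim_le; [exact: bounded_seq_cst|exact: bs|].
    apply: oo_ultra_near; exists m => // n /= mn; have [GQn _ h] := qP n.
    have h3 := nle_EP0 lZ (hxn m) nZ GQn.
    have h4 : EP (q n) (xn n) <= EP (q n) (xn m).
      apply: rEP_le; [exact: Lr_rint (hxn n) GQn|exact: Lr_rint (hxn m) GQn|].
      by apply: filterS (qs_ae hsl hsu ix GQn) => w [mon _]; exact: mon.
    have h5 : EP P y <= EP P (yn n).
      apply: rEP_le; [exact: Lr_rint hy GP|exact: Lr_rint (hyn n) GP|].
      by apply: filterS (qs_ae hsl hsu (rdec_ge iy) GP) => w; apply.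
    by move: h3; rewrite ler_norml => /andP[? ?]; lra.
  by move: h1; rewrite ler_norml => /andP[? ?]; lra.
have cvQ := EP_monotone0 GQ hxn hx (rdec_dom ix).
have : EP P y - e / 2 <= EP Q x.
  by apply: (ler_cvg_to (cvg_cst _) cvQ); exact: nearW.
lra.
Qed.

Lemma rpair_cyl t Z : 0 <= t -> cyl +oo%E Z -> rpair t Z (condE sl su t Z).
Proof.
move=> t0 cZ; have cY := cyl_condE hsl hsu t0 cZ.
have ax : adapted t (condE sl su t Z).
  exists (condE sl su t Z); first exact: measurable_cyl cY.
  apply: qs_true => // w; case: cY => ts Hts c; apply: (cylon_dep c) => s /Hts[_]; rewrite lee_fin => st.
  by rewrite B_stop min_l.
split; first split => //.
- exact: Lr_bmeas (bmeas_cyl cZ).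
- exact: Lr_bmeas (bmeas_cyl cY).
- by move=> P GP A FA; exact: (cond_dominates hsl hsu t0 GP cZ FA).
move=> P GP e e0; have [Q [GQ PQ E]] := cond_attained hsl hsu t0 GP cZ.
by exists Q; split=> //; [exact: agree_Ft|rewrite E lerDl ltW].
Qed.

End conditional_pairs.

(** * Completeness and monotone completeness of adapted variables *)

Section limits_of_adapted.
Context {R : realType}.
Variables (sl su : R) (hsl : 0 <= sl) (hsu : sl <= su).
Implicit Types (P Q : probability (Omega R) R) (A : set (Omega R)) (x y z g : Omega R -> R) (e s t r M : R).
Local Notation GM := (@G_measures R sl su).
Local Notation qs := (@qs R sl su).
Local Notation nle := (@nle R sl su).
Local Notation Lr := (@Lr R sl su).
Local Notation adapted := (@adapted R sl su).
Local Notation rinc := (@rinc R sl su).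
Local Notation rdec := (@rdec R sl su).

Lemma fine_limn_esup (u : nat -> R) l : u @ \oo --> l -> fine (limn_esup (fun n => (u n)%:E)) = l.
Proof.
move=> ul; have h : (fun n => (u n)%:E) @ \oo --> l%:E by apply: cvg_EFin => //; exact: nearW.
by rewrite is_cvg_limn_esupE; [rewrite (cvg_lim _ h)|apply/cvg_ex; exists l%:E].
Qed.

Lemma bounded_variation_cvg (u : nat -> R) k M :
  (forall n, \sum_(k <= j < n) `|u j.+1 - u j| <= M) ->
  exists l, u @ \oo --> l /\ `|u k - l| <= M.
Proof.
move=> H; pose D n := \sum_(k <= j < n) `|u j.+1 - u j|.
have DS n : (k <= n)%N -> D n.+1 = D n + `|u n.+1 - u n| by move=> kn; rewrite /D big_nat_recr.
have Dinc : {homo D : n m / (n <= m)%N >-> n <= m}.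
  apply: homo_leq => //; [by move=> a b c; exact: le_trans|move=> n].
  have [kn|nk] := leqP k n; first by rewrite DS// lerDl.
  by rewrite /D !big_geq// ltnW.
have uD n : (k <= n)%N -> `|u n - u k| <= D n.
  move=> kn; rewrite -(subnKC kn); elim: (n - k)%N => [|d IH].
    by rewrite addn0 subrr normr0 /D sumr_ge0.
  rewrite addnS DS ?leq_addr//.
  rewrite (_ : u (k + d).+1 - u k = (u (k + d)%N - u k) + (u (k + d).+1 - u (k + d)%N)); last by ring.
  by rewrite (le_trans (ler_normD _ _))// lerD2r.
have cD : cvgn D.
  by apply: nondecreasing_is_cvgn => //; exists M => _ [n _ <-]; exact: H.
pose E n := u (maxn n k) + D (maxn n k).
have cE : cvgn E.
  apply: nondecreasing_is_cvgn.
    apply: homo_leq => //; [by move=> a b c; exact: le_trans|move=> n].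
    rewrite /E; have [kn|nk] := leqP k n.
      rewrite (maxn_idPl (leqW kn)) DS//.
      by have := ler_norm (- (u n.+1 - u n)); rewrite normrN; lra.
    by rewrite (maxn_idPr nk).
  exists (u k + M + M) => _ [n _ <-]; rewrite /E.
  have h1 := uD _ (leq_maxr n k); have h2 := H (maxn n k); rewrite -/(D _) in h2.
  by move: h1; rewrite ler_norml => /andP[_ h1]; lra.
have cu : u @ \oo --> limn E - limn D.
  have h : (fun n => E n - D n) @ \oo --> limn E - limn D by apply: cvgB.
  apply: cvg_trans h; apply: near_eq_cvg; exists k => // n /= kn.
  by rewrite /E (maxn_idPl kn) addrK.
exists (limn E - limn D); split=> //.
rewrite distrC; have h : (fun n => `|u n - u k|) @ \oo --> `|limn E - limn D - u k|.
  by apply: cvg_norm; apply: cvgB => //; exact: cvg_cst.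
rewrite -(cvg_lim _ h)//; apply: limr_le; first by apply/cvg_ex; eexists; exact: h.
by exists k => // n /= kn; apply: le_trans (uD n kn) (H n).
Qed.

Lemma nle_qs x x' e : Lr x -> Lr x' -> qs (fun w => x w = x' w) -> nle x e -> nle x' e.
Proof.
move=> hx hx' E ne P GP; apply: le_trans (ne P GP).
apply: rEP_le; [exact: rint_norm (Lr_rint hx' GP)|exact: rint_norm (Lr_rint hx GP)|].
by apply: filterS (qs_ae hsl hsu E GP) => w ->.
Qed.

Lemma Lr_stop t y v : 0 <= t -> Lr y -> measurable_fun setT v -> qs (fun w => y w = v (stop t w)) ->
  Lr (fun w => v (stop t w)).
Proof.
move=> t0 hy mv yv; have mvs : measurable_fun setT (fun w => v (stop t w)).
  exact: measurableT_comp mv (stop_measurable hsl hsu t0).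
have [M _ nM] := Lr_nle hsl hsu hy; apply: (@LrI _ _ _ _ M) => // P GP.
  exact: rint_ae (Lr_rint hy GP) mvs (qs_ae hsl hsu yv GP).
have rv := rint_ae (Lr_rint hy GP) mvs (qs_ae hsl hsu yv GP).
apply: le_trans (nM P GP); apply: rEP_le; [exact: rint_norm|exact: rint_norm (Lr_rint hy GP)|].
by apply: filterS (qs_ae hsl hsu yv GP) => w ->.
Qed.

Lemma geometric_nneseries_le (a : nat -> \bar R) k : (forall n, (0 <= a n)%E) ->
  (forall n, (a n <= ((1 / 2) ^+ (n + k))%:E)%E) ->
  (\sum_(n <oo) a n <= (2 * (1 / 2) ^+ k)%:E)%E.
Proof.
move=> a0 H; apply: lime_le; first by apply: is_cvg_nneseries => n _ _; exact: a0.
apply: nearW => n.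
have h m : (\sum_(0 <= j < m) a j <= (2 * (1 / 2) ^+ k - 2 * (1 / 2) ^+ (m + k))%:E)%E.
  elim: m => [|m IH]; first by rewrite big_geq// add0n subrr.
  rewrite big_nat_recr//=; apply: le_trans (leeD IH (H _)) _; rewrite -EFinD lee_fin addSn exprS.
  by move: (_ ^+ (m + k)) (_ ^+ k) => p q; lra.
apply: le_trans (h n) _; rewrite lee_fin gerBl mulr_ge0// exprn_ge0//; lra.
Qed.

(** Along a rapidly Cauchy subsequence the sum of the successive differences is integrable under all
    measures, with one bound. The limit superior of the versions is defined everywhere and is again
    a function of the stopped path. *)
Lemma adapted_complete t (yn : nat -> Omega R -> R) : 0 <= t -> (forall n, Lr (yn n)) ->
  (forall n, adapted t (yn n)) ->
  (forall e, 0 < e -> exists k : nat, forall n m, (k <= n)%N -> (k <= m)%N -> nle (fun w => yn n w - yn m w) e) ->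
  exists y, [/\ Lr y, adapted t y &
    forall e, 0 < e -> exists k : nat, forall n, (k <= n)%N -> nle (fun w => yn n w - y w) e].
Proof.
move=> t0 hy ay C; have p0 k : 0 < (1 / 2) ^+ k :> R by rewrite exprn_gt0//; lra.
pose phi k := projT1 (cid (C _ (p0 k))).
have phiP k n m : (phi k <= n)%N -> (phi k <= m)%N -> nle (fun w => yn n w - yn m w) ((1 / 2) ^+ k).
  by rewrite /phi; case: cid => /= a H; exact: H.
(* Partial sums make the indices nondecreasing while keeping [phi k <= psi k]. *)
pose psi k := \sum_(i < k.+1) phi i.
have psi1 k : (phi k <= psi k)%N by rewrite /psi big_ord_recr /= leq_addl.
have psi2 k : (psi k <= psi k.+1)%N by rewrite /psi [leqRHS]big_ord_recr /= leq_addr.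
have exv k : exists v : Omega R -> R, measurable_fun setT v /\ qs (fun w => yn (psi k) w = v (stop t w)).
  by have [v mv h] := ay (psi k); exists v.
pose v k := projT1 (cid (exv k)).
have mv k : measurable_fun setT (v k) by rewrite /v; case: cid => ? [].
have yv k : qs (fun w => yn (psi k) w = v k (stop t w)) by rewrite /v; case: cid => ? [].
pose u k w := v k (stop t w).
have hu k : Lr (u k) by exact: Lr_stop (hy (psi k)) (mv k) (yv k).
have yu n k e : nle (fun w => yn n w - yn (psi k) w) e -> nle (fun w => yn n w - u k w) e.
  apply: nle_qs; [exact: LrB|exact: LrB|by apply: (qs_imp (yv k)) => w ->].
pose d k w := `|u k.+1 w - u k w|.
have hd k : Lr (d k) by apply: Lr_norm => //; exact: LrB.
have nd k P : GM P -> EP P (d k) <= (1 / 2) ^+ k.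
  move=> GP; have h : nle (fun w => yn (psi k.+1) w - u k w) ((1 / 2) ^+ k).
    by apply: yu; apply: phiP => //; exact: leq_trans (psi1 k) (psi2 k).
  apply: (nle_qs _ _ _ h) => //; [exact: LrB|exact: LrB|by apply: (qs_imp (yv k.+1)) => w ->].
pose V w := fine (limn_esup (fun k => (v k w)%:E)).
have mV : measurable_fun setT V.
  apply: measurableT_comp => //; apply: measurable_fun_limn_esup => k; exact/measurable_EFinP.
pose y w := V (stop t w).
have my : measurable_fun setT y by exact: measurableT_comp mV (stop_measurable hsl hsu t0).
pose S k w := (\sum_(j <oo) (d (j + k)%N w)%:E)%E.
have d0 j w : (0 <= (d j w)%:E)%E by rewrite lee_fin /d normr_ge0.
have mS k : measurable_fun setT (S k).
  by apply: (@ge0_emeasurable_sum _ _ _ _ _ xpredT) => // j _; apply/measurable_EFinP; exact: (hd (j + k)%N).1.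
have uyS k w : (`|u k w - y w|%:E <= S k w)%E.
  have [h|h] := leP +oo%E (S k w); first by move: h; rewrite leye_eq => /eqP ->; rewrite leey.
  have S0 : (0 <= S k w)%E by apply: nneseries_ge0 => j _ _.
  have fS : S k w \is a fin_num by rewrite ge0_fin_numE.
  have [|l [cl ul]] := @bounded_variation_cvg (u ^~ w) k (fine (S k w)).
    move=> n; rewrite -{1}[k]add0n big_addn -lee_fin fineK// -sumEFin.
    by apply: le_trans (nneseries_lim_ge (n - k) _) => // j _ _; exact: d0.
  by rewrite /y /V (fine_limn_esup cl) -[leRHS]fineK// lee_fin.
have intS k P : GM P -> (\int[P]_w S k w <= (2 * (1 / 2) ^+ k)%:E)%E.
  move=> GP; rewrite integral_nneseries//; last first.
    by move=> j; apply/measurable_EFinP; exact: (hd (j + k)%N).1.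
  apply: geometric_nneseries_le => n; first by apply: integral_ge0 => w _; exact: d0.
  by rewrite rEPE ?lee_fin ?nd//; exact: Lr_rint (hd (n + k)%N) GP.
have intuy k P : GM P -> (\int[P]_w `|u k w - y w|%:E <= (2 * (1 / 2) ^+ k)%:E)%E.
  move=> GP; apply: le_trans (intS k P GP); apply: ge0_le_integral => //.
  apply/measurable_EFinP; apply: measurableT_comp => //; apply: measurable_funB => //; exact: (hu k).1.
have ruy k P : GM P -> rint P (fun w => u k w - y w).
  move=> GP; apply/integrableP; split.
    by apply/measurable_EFinP; apply: measurable_funB => //; exact: (hu k).1.
  by apply: le_lt_trans (intuy k P GP) _; rewrite ltry.
have nuy k : nle (fun w => u k w - y w) (2 * (1 / 2) ^+ k).
  by move=> P GP; rewrite -lee_fin -rEPE; [exact: intuy|exact: rint_norm (ruy k P GP)].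
have hy' : Lr y.
  have [M _ nM] := Lr_nle hsl hsu (hu 0%N).
  have ry P : GM P -> rint P y.
    move=> GP; rewrite (_ : y = fun w => u 0%N w - (u 0%N w - y w)); last by apply/funext => w; ring.
    by apply: rintB; [exact: Lr_rint (hu _) GP|exact: ruy].
  apply: (@LrI _ _ _ _ (M + 2 * (1 / 2) ^+ 0)) => // P GP.
  rewrite (_ : (fun w => `|y w|) = (fun w => `|u 0%N w + (y w - u 0%N w)|)); last first.
    by apply/funext => w; congr `|_|; ring.
  apply: (nleD _ _ nM _ GP) => [Q GQ|Q GQ|Q GQ].
  - exact: Lr_rint (hu _) GQ.
  - by apply: rintB; [exact: ry|exact: Lr_rint (hu _) GQ].
  - rewrite (_ : (fun w => _) = (fun w => `|u 0%N w - y w|)); first exact: nuy.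
    by apply/funext => w; rewrite distrC.
exists y; split=> //; first by exists V => //; exact: qs_true.
move=> e e0; have h : (fun j => (1 / 2 : R) ^+ j) @ \oo --> (0 : R).
  by apply: cvg_expr; rewrite ger0_norm//; lra.
have e3 : 0 < e / 3 by rewrite divr_gt0.
have /cvgr0Pnorm_le/(_ _ e3)[k _ /(_ k (leqnn _))] /= := h.
rewrite ger0_norm ?(ltW (p0 k))// => hk; exists (phi k) => n kn P GP.
have n1 : nle (fun w => yn n w - u k w) ((1 / 2) ^+ k) by apply: yu; apply: phiP.
have := @nleD _ _ _ _ _ _ _ _ _ n1 (nuy k) P GP.
rewrite (_ : (fun w => `|yn n w - u k w + (u k w - y w)|) = (fun w => `|yn n w - y w|)); last first.
  by apply/funext => w; congr `|_|; ring.
move=> /(_ _ _) H; apply: le_trans (H _ _) _; [| |lra].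
- by move=> Q GQ; apply: rintB; [exact: Lr_rint (hy n) GQ|exact: Lr_rint (hu k) GQ].
- by move=> Q GQ; exact: ruy.
Qed.

(** Makes the sequence decrease at every path, where the hypothesis gives it outside a polar set
    only; q.s. nothing changes. *)
Fixpoint running_min (v : nat -> Omega R -> R) n w :=
  if n is n'.+1 then Num.min (running_min v n' w) (v n'.+1 w) else v 0%N w.

(** Monotone convergence bounds the integral of the total decrease under every measure, so the limit
    is finite q.s. *)
Lemma adapted_rdec t (yn : nat -> Omega R -> R) M : 0 <= t -> (forall n, Lr (yn n)) ->
  (forall n, adapted t (yn n)) -> (forall n, nle (yn n) M) ->
  (forall n, qs (fun w => yn n.+1 w <= yn n w)) ->
  exists y, [/\ Lr y, adapted t y & rdec yn y].
Proof.
move=> t0 hy ay nM mon.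
have exv k : exists v : Omega R -> R, measurable_fun setT v /\ qs (fun w => yn k w = v (stop t w)).
  by have [v mv h] := ay k; exists v.
pose v k := projT1 (cid (exv k)).
have mv k : measurable_fun setT (v k) by rewrite /v; case: cid => ? [].
have yv k : qs (fun w => yn k w = v k (stop t w)) by rewrite /v; case: cid => ? [].
have mm n : measurable_fun setT (running_min v n).
  by elim: n => [|n IH] //=; exact: measurable_minr.
pose u n w := running_min v n (stop t w).
have uS n w : u n.+1 w <= u n w by rewrite /u /= ge_min lexx.
have uni w : {homo u ^~ w : n m / (n <= m)%N >-> m <= n}.
  by apply: homo_leq => //; move=> a b c h1 h2; exact: le_trans h2 h1.
have yu : qs (fun w => forall n, yn n w = u n w).
  apply: (qs_and hsl hsu (qs_all hsl hsu yv) (qs_all hsl hsu mon)) => w h1 h2 n.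
  rewrite h1 /u; elim: n => [//|n IH] /=; rewrite -IH min_r// -!h1; exact: h2.
have hu n : Lr (u n) by apply: (Lr_stop t0 (hy n) (mm n)); apply: (qs_imp yu).
have nu n : nle (u n) M.
  by apply: (nle_qs (hy n) (hu n) _ (nM n)); apply: (qs_imp yu).
pose V w := fine (limn_esup (fun k => (running_min v k w)%:E)).
have mV : measurable_fun setT V.
  apply: measurableT_comp => //; apply: measurable_fun_limn_esup => k; exact/measurable_EFinP.
pose y w := V (stop t w).
have my : measurable_fun setT y by exact: measurableT_comp mV (stop_measurable hsl hsu t0).
pose g n w := (u 0%N w - u n w)%:E.
have mg n : measurable_fun setT (g n).
  by apply/measurable_EFinP; apply: measurable_funB; [exact: (hu 0%N).1|exact: (hu n).1].
have g0 n w : (0 <= g n w)%E by rewrite lee_fin subr_ge0 uni.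
have gnd w : nondecreasing_seq (g ^~ w).
  by move=> n m nm; rewrite lee_fin lerD2l lerN2 uni.
pose S w := limn (g ^~ w).
have gS n w : (g n w <= S w)%E.
  by rewrite /S (cvg_lim _ (ereal_nondecreasing_cvgn (gnd w)))//; apply: ereal_sup_ubound; exists n.
have mS : measurable_fun setT S.
  apply: (emeasurable_fun_cvg g) => // w _; exact: ereal_nondecreasing_is_cvgn.
have intS P : GM P -> (\int[P]_w S w <= (M + M)%:E)%E.
  move=> GP; rewrite /S monotone_convergence//; apply: lime_le.
    apply: ereal_nondecreasing_is_cvgn => n m nm; apply: ge0_le_integral => // w _; exact: gnd.
  apply: nearW => n; rewrite rEPE; last by apply: rintB; [exact: Lr_rint (hu _) GP|exact: Lr_rint (hu _) GP].
  rewrite lee_fin rEPB; [|exact: Lr_rint (hu _) GP|exact: Lr_rint (hu _) GP].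
  have := le_trans (rEP_norm (Lr_rint (hu 0%N) GP)) (nu 0%N P GP).
  have := le_trans (rEP_norm (Lr_rint (hu n) GP)) (nu n P GP).
  by rewrite !ler_norml => /andP[? ?] /andP[? ?]; lra.
have S0 w : (0 <= S w)%E by apply: le_trans (gS 0%N w).
have mN : measurable [set w | S w = +oo%E].
  rewrite (_ : [set w | S w = +oo%E] = setT `&` S @^-1` [set +oo%E]).
    by apply: mS => //; exact: emeasurable_set1.
  by apply/seteqP; split => w /=; [split|case].
have Sfin : qs (fun w => ~ S w = +oo%E).
  apply: (qs_meas hsl hsu mN) => P GP.
  have iS : P.-integrable setT S.
    apply/integrableP; split=> //; rewrite (_ : (\int[P]_w `|S w| = \int[P]_w S w)%E).
      by apply: le_lt_trans (intS P GP) _; rewrite ltry.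
    by apply: eq_integral => w _; rewrite gee0_abs.
  have [N [mN' N0 NA]] := integrable_ae measurableT iS.
  apply/(negligibleP P mN); exists N; split=> // w /= h; apply: NA => /= h'.
  by have := h' I; rewrite h.
have ucv w : ~ S w = +oo%E -> (u ^~ w) @ \oo --> y w.
  move=> nS; have fS : S w \is a fin_num by rewrite ge0_fin_numE// ltey; apply/eqP.
  have cu : cvgn (u ^~ w).
    apply: nonincreasing_is_cvgn; first exact: uni.
    exists (u 0%N w - fine (S w)) => _ [n _ <-]; have := gS n w; rewrite -[X in (_ <= X)%E]fineK// lee_fin; lra.
  by rewrite /y /V (fine_limn_esup cu).
have dy : rdec yn y.
  apply: (qs_and hsl hsu Sfin yu) => w nS E; rewrite (_ : yn ^~ w = u ^~ w); last by apply/funext => n.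
  by split; [exact: uni|exact: ucv].
have uyS : qs (fun w => (`|y w|%:E <= `|u 0%N w|%:E + S w)%E).
  apply: (qs_imp Sfin) => w nS; have fS : S w \is a fin_num by rewrite ge0_fin_numE// ltey; apply/eqP.
  have h1 : ((u 0%N w - y w)%:E <= S w)%E.
    have h : (fun n => u 0%N w - u n w) @ \oo --> u 0%N w - y w by apply: cvgB; [exact: cvg_cst|exact: ucv].
    rewrite -[leRHS]fineK// lee_fin -(cvg_lim _ h)//; apply: limr_le; first by apply/cvg_ex; eexists; exact: h.
    by apply: nearW => n; rewrite -lee_fin fineK//; exact: gS.
  have h2 : y w <= u 0%N w.
    rewrite -(cvg_lim _ (ucv w nS))//; apply: limr_le; first by apply/cvg_ex; eexists; exact: ucv.
    by apply: nearW => n; exact: uni.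
  rewrite -[S w]fineK// -EFinD lee_fin; move: h1; rewrite -[leRHS]fineK// lee_fin => h1.
  have := ler_norm (u 0%N w); have := ler_norm (- u 0%N w); rewrite normrN ler_norml => *.
  by apply/andP; split; lra.
have inty P : GM P -> (\int[P]_w `|y w|%:E <= (M + (M + M))%:E)%E.
  move=> GP; apply: (@le_trans _ _ (\int[P]_w (`|u 0%N w|%:E + S w))%E).
    apply: ae_ge0_le_integral => //.
    - by apply/measurable_EFinP; exact: measurableT_comp.
    - by move=> w _; rewrite adde_ge0// lee_fin.
    - apply: emeasurable_funD => //; apply/measurable_EFinP; apply: measurableT_comp => //; exact: (hu 0%N).1.
    - by apply: filterS (qs_ae hsl hsu uyS GP).
  rewrite ge0_integralD//; last first.
    by apply/measurable_EFinP; apply: measurableT_comp => //; exact: (hu 0%N).1.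
  rewrite EFinD; apply: leeD; last exact: intS.
  by rewrite rEPE ?lee_fin; [exact: nu|exact: rint_norm (Lr_rint (hu _) GP)].
have ry P : GM P -> rint P y.
  move=> GP; apply/integrableP; split; first exact/measurable_EFinP.
  by apply: le_lt_trans (inty P GP) _; rewrite ltry.
exists y; split=> //; last by exists V => //; exact: qs_true.
apply: (@LrI _ _ _ _ (M + (M + M))) => // P GP.
by rewrite -lee_fin -rEPE; [exact: inty|exact: rint_norm (ry P GP)].
Qed.

Lemma adapted_rinc t (yn : nat -> Omega R -> R) M : 0 <= t -> (forall n, Lr (yn n)) ->
  (forall n, adapted t (yn n)) -> (forall n, nle (yn n) M) ->
  (forall n, qs (fun w => yn n w <= yn n.+1 w)) ->
  exists y, [/\ Lr y, adapted t y & rinc yn y].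
Proof.
move=> t0 hy ay nM mon.
have LN y : Lr y -> Lr (fun w => - y w).
  by move=> /(LrZ hsl hsu (-1)); congr Lr; apply/funext => w; rewrite mulN1r.
have aN y : adapted t y -> adapted t (fun w => - y w).
  by move=> [v mv yv]; exists (fun w => - v w); [exact: measurableT_comp|apply: (qs_imp yv) => w ->].
have [||||y [h1 h2 h3]] := @adapted_rdec t (fun n w => - yn n w) M t0.
- by move=> n; exact: LN.
- by move=> n; exact: aN.
- move=> n P GP; rewrite (_ : (fun w => _) = fun w => `|yn n w|); first exact: nM.
  by apply/funext => w; rewrite normrN.
- by move=> n; apply: (qs_imp (mon n)) => w; rewrite lerN2.
exists (fun w => - y w); split; [exact: LN|exact: aN|].
apply: (qs_imp h3) => w [m c]; split; first by move=> n k nk; rewrite -lerN2; exact: m.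
by rewrite (_ : yn ^~ w = fun n => - - yn n w); [exact: cvgN|apply/funext => n; rewrite opprK].
Qed.

End limits_of_adapted.

(** * Existence of conditional expectations along norm and monotone limits *)

Section existence_of_pairs.
Context {R : realType}.
Variables (sl su : R) (hsl : 0 <= sl) (hsu : sl <= su).
Implicit Types (P Q : probability (Omega R) R) (A : set (Omega R)) (x y z : Omega R -> R) (xn yn : nat -> Omega R -> R) (e M : R).
Local Notation GM := (@G_measures R sl su).
Local Notation qs := (@qs R sl su).
Local Notation nle := (@nle R sl su).
Local Notation Lr := (@Lr R sl su).
Local Notation adapted := (@adapted R sl su).
Local Notation rinc := (@rinc R sl su).
Local Notation rdec := (@rdec R sl su).
Local Notation rpair := (@rpair R sl su).
Local Notation RG := (@RG R sl su).

Definition rcvg xn x := forall e, 0 < e -> exists k : nat, forall n, (k <= n)%N -> nle (fun w => xn n w - x w) e.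

Lemma nleC x y e : nle (fun w => x w - y w) e -> nle (fun w => y w - x w) e.
Proof.
move=> h P GP; rewrite (_ : (fun w => _) = fun w => `|x w - y w|); first exact: h.
by apply/funext => w; rewrite distrC.
Qed.

Lemma nle_trans x y z e e' : Lr x -> Lr y -> Lr z -> nle (fun w => x w - y w) e ->
  nle (fun w => y w - z w) e' -> nle (fun w => x w - z w) (e + e').
Proof.
move=> hx hy hz n1 n2 P GP.
have := @nleD _ _ _ _ _ _ _ _ _ n1 n2 P GP.
rewrite (_ : (fun w => `|x w - y w + (y w - z w)|) = (fun w => `|x w - z w|)); last first.
  by apply/funext => w; congr `|_|; ring.
by apply=> Q GQ; apply: rintB; [exact: Lr_rint hx GQ|exact: Lr_rint hy GQ|exact: Lr_rint hy GQ|exact: Lr_rint hz GQ].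
Qed.

Lemma nle_mono x e e' : e <= e' -> nle x e -> nle x e'.
Proof. by move=> ee h P GP; apply: le_trans (h P GP) ee. Qed.

Lemma rcvg_cauchy xn x : (forall n, Lr (xn n)) -> Lr x -> rcvg xn x -> forall e, 0 < e ->
  exists k : nat, forall n m, (k <= n)%N -> (k <= m)%N -> nle (fun w => xn n w - xn m w) e.
Proof.
move=> hxn hx c e e0; have e2 : 0 < e / 2 by rewrite divr_gt0.
have [k hk] := c _ e2; exists k => n m kn km; rewrite [e]splitr.
by apply: (nle_trans (hxn n) hx (hxn m)); [exact: hk|apply: nleC; exact: hk].
Qed.

Lemma RG_seq t x : RG t x -> exists2 Zn, (forall n, cyl t (Zn n)) & rcvg Zn x.
Proof.
move=> [hx H]; have h n : exists Z, cyl t Z /\ nle (fun w => Z w - x w) n.+1%:R^-1.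
  have [|Z cZ nZ] := H n.+1%:R^-1; first by rewrite invr_gt0.
  by exists Z.
exists (fun n => projT1 (cid (h n))) => [n|e e0]; first by case: cid => ? [].
have [k ke] := nat_ge e^-1; exists k => n kn; case: cid => Z [_ /=]; apply: nle_mono.
by rewrite invf_ple ?posrE// (le_trans ke)// ler_nat ltnW.
Qed.

Lemma RG_of_rcvg t x xn : Lr x -> (forall n, RG t (xn n)) -> rcvg xn x -> RG t x.
Proof.
move=> hx hxn c; split=> // e e0; have e2 : 0 < e / 2 by rewrite divr_gt0.
have [k hk] := c _ e2; have [hk' /(_ _ e2)[Z cZ nZ]] := hxn k; exists Z => //.
rewrite [e]splitr; apply: (nle_trans _ hk' hx nZ); last exact: hk.
exact: Lr_bmeas (bmeas_cyl cZ).
Qed.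

Lemma RG_cyl t Z : cyl t Z -> RG t Z.
Proof.
move=> cZ; split; first exact: Lr_bmeas (bmeas_cyl cZ).
move=> e e0; exists Z => // P GP; rewrite (_ : (fun w => _) = fun=> 0) ?EP_cst ?ltW//.
by apply/funext => w; rewrite subrr normr0.
Qed.

Section at_time.
Variable t : R.
Hypothesis t0 : 0 <= t.

(** [rpair_contract] makes the conditional expectations a Cauchy sequence. *)
Lemma rpair_exists_lim xn yn x : (forall n, rpair t (xn n) (yn n)) -> Lr x -> rcvg xn x ->
  exists2 y, rpair t x y & rcvg yn y.
Proof.
move=> H hx c.
have hxn n : Lr (xn n) by case: (H n) => -[].
have hyn n : Lr (yn n) by case: (H n) => -[].
have [||y [hy ay cy]] := @adapted_complete _ sl su hsl hsu t yn t0 hyn.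
- by move=> n; case: (H n) => -[].
- move=> e e0; have e2 : 0 < e / 2 by rewrite divr_gt0.
  have [k hk] := rcvg_cauchy hxn hx c e2; exists k => n m kn km.
  have -> : e = 2 * (e / 2) by field.
  by apply: (rpair_contract hsl hsu t0 (H n) (H m)); exact: hk.
exists y; last exact: cy.
first [exact: (rpair_lim hsl hsu t0 H hx hy ay c cy)|exact: (rpair_lim t0 H hx hy ay c cy)].
Qed.

Lemma rpair_exists_RG x : RG +oo%E x -> exists y Zn, [/\ rpair t x y, RG t%:E y,
  forall n, cyl +oo%E (Zn n), rcvg Zn x & rcvg (fun n => condE sl su t (Zn n)) y].
Proof.
move=> Gx; have [Zn cZ c] := RG_seq Gx.
have [y xy cy] := rpair_exists_lim (fun n => rpair_cyl hsl hsu t0 (cZ n)) Gx.1 c.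
exists y, Zn; split=> //; apply: (@RG_of_rcvg _ _ (fun n => condE sl su t (Zn n))) => //.
  by case: xy => -[].
by move=> n; apply: RG_cyl; exact: cyl_condE.
Qed.

Lemma rpair_exists_dec xn yn x : (forall n, rpair t (xn n) (yn n)) -> (forall n, RG +oo%E (xn n)) ->
  Lr x -> rdec xn x -> exists2 y, rpair t x y & rdec yn y.
Proof.
move=> H Hx hx ix.
have hxn n : Lr (xn n) by case: (H n) => -[].
have hyn n : Lr (yn n) by case: (H n) => -[].
have mono n m : (n <= m)%N -> qs (fun w => yn m w <= yn n w).
  move=> nm; apply: (rpair_mono hsl hsu t0 (H m) (H n).1).
  by apply: (qs_imp ix) => w [mon _]; exact: mon.
have [M0 M00 n0] := Lr_nle hsl hsu (hyn 0%N); have [Mx _ nx] := Lr_nle hsl hsu hx.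
have [|||y [hy ay dy]] := @adapted_rdec _ sl su hsl hsu t yn (M0 + M0 + Mx) t0 hyn.
- by move=> n; case: (H n) => -[].
- move=> n P GP; have r0 := Lr_rint (hyn 0%N) GP; have rn := Lr_rint (hyn n) GP.
  have rN := rint_norm r0.
  apply: (@le_trans _ _ (EP P (fun w => `|yn 0%N w| + (yn 0%N w - yn n w)))).
    apply: rEP_le; [exact: rint_norm|by apply: rintD => //; exact: rintB|].
    apply: filterS (qs_ae hsl hsu (mono 0%N n (leq0n n)) GP) => w h.
    have := ler_norm (yn 0%N w); have := ler_norm (- yn 0%N w); rewrite normrN => *.
    by rewrite ler_norml; apply/andP; split; lra.
  rewrite rEPD ?rEPB//; last exact: rintB.
  have h1 := n0 P GP; have := le_trans (rEP_norm r0) h1.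
  have := le_trans (rEP_norm (Lr_rint hx GP)) (nx P GP).
  have : EP P x <= EP P (yn n).
    apply: (@le_trans _ _ (EP P (xn n))).
      apply: rEP_le; [exact: Lr_rint hx GP|exact: Lr_rint (hxn n) GP|].
      by apply: filterS (qs_ae hsl hsu (rdec_ge ix) GP) => w; apply.
    have [[_ _ _ dom] _] := H n; have := dom P GP _ (Ft_setT t).
    have E (g : Omega R -> R) : (fun w => g w * \1_setT w) = g by apply/funext => w; rewrite indicT mulr1.
    by rewrite !E.
  by rewrite !ler_norml => ? /andP[? ?] /andP[? ?]; lra.
- by move=> n; exact: mono.
by exists y => //; exact: (rpair_dec hsl hsu t0 H Hx hx hy ay ix dy).
Qed.

Lemma rpair_exists_inc xn yn x : (forall n, rpair t (xn n) (yn n)) ->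
  Lr x -> rinc xn x -> exists2 y, rpair t x y & rinc yn y.
Proof.
move=> H hx ix.
have hxn n : Lr (xn n) by case: (H n) => -[].
have hyn n : Lr (yn n) by case: (H n) => -[].
have mono n m : (n <= m)%N -> qs (fun w => yn n w <= yn m w).
  move=> nm; apply: (rpair_mono hsl hsu t0 (H n) (H m).1).
  by apply: (qs_imp ix) => w [mon _]; exact: mon.
have [M0 M00 n0] := Lr_nle hsl hsu (hyn 0%N); have [Mx _ nx] := Lr_nle hsl hsu hx.
have [|||y [hy ay dy]] := @adapted_rinc _ sl su hsl hsu t yn (M0 + M0 + Mx + 1) t0 hyn.
- by move=> n; case: (H n) => -[].
- move=> n P GP; have r0 := Lr_rint (hyn 0%N) GP; have rn := Lr_rint (hyn n) GP.
  have rN := rint_norm r0.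
  apply: (@le_trans _ _ (EP P (fun w => `|yn 0%N w| + (yn n w - yn 0%N w)))).
    apply: rEP_le; [exact: rint_norm|by apply: rintD => //; exact: rintB|].
    apply: filterS (qs_ae hsl hsu (mono 0%N n (leq0n n)) GP) => w h.
    have := ler_norm (yn 0%N w); have := ler_norm (- yn 0%N w); rewrite normrN => *.
    by rewrite ler_norml; apply/andP; split; lra.
  rewrite rEPD ?rEPB//; last exact: rintB.
  have h1 := n0 P GP; have := le_trans (rEP_norm r0) h1.
  (* Slack 1 is enough for a bound uniform in n: [EP P (yn n)] is at most [EP Q x + 1]. *)
  have [_ att] := H n; have [Q [GQ PQ hQ]] := att P GP 1 ltr01.
  have := le_trans (rEP_norm (Lr_rint hx GQ)) (nx Q GQ).
  have : EP Q (xn n) <= EP Q x.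
    apply: rEP_le; [exact: Lr_rint (hxn n) GQ|exact: Lr_rint hx GQ|].
    by apply: filterS (qs_ae hsl hsu (rinc_le ix) GQ) => w; apply.
  by rewrite !ler_norml => ? /andP[? ?] /andP[? ?]; lra.
- by move=> n; exact: mono.
by exists y => //; exact: (rpair_inc hsl hsu t0 H hx hy ay ix dy).
Qed.

End at_time.
End existence_of_pairs.

(** * Real-valued versions of extended-valued variables *)

Section translation.
Context {R : realType}.
Variables (sl su : R) (hsl : 0 <= sl) (hsu : sl <= su).
Implicit Types (P Q : probability (Omega R) R) (A : set (Omega R)) (x y z : Omega R -> R) (X Y : Omega R -> \bar R) (e M s : R) (t : \bar R).
Local Notation GM := (@G_measures R sl su).
Local Notation qs := (@qs R sl su).
Local Notation nle := (@nle R sl su).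
Local Notation Lr := (@Lr R sl su).
Local Notation adapted := (@adapted R sl su).
Local Notation rinc := (@rinc R sl su).
Local Notation rdec := (@rdec R sl su).
Local Notation rpair := (@rpair R sl su).
Local Notation RG := (@RG R sl su).
Local Notation rcvg := (@rcvg R sl su).
Local Notation Ehat := (@Ehat R sl su).
Local Notation L1 := (@L1 R sl su).

(** Infinite values are sent to 0; for an integrable variable this happens on a polar set. *)
Definition toR X w : R := fine (X w).

Definition timed t x := match t with s%:E => 0 <= s /\ adapted s x | +oo%E => True | -oo%E => False end.

Lemma Ehat_ge P X : GM P -> (\int[P]_w X w <= Ehat X)%E.
Proof. by move=> GP; apply: ereal_sup_ubound; exists P. Qed.

Lemma Ehat_le X (y : \bar R) : (forall P, GM P -> (\int[P]_w X w <= y)%E) -> (Ehat X <= y)%E.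
Proof. by move=> H; apply: ge_ereal_sup => _ [P GP <-]; exact: H. Qed.

(** Integrability under each measure makes X finite q.s. The F_t-measurable version has level sets
    invariant under stopping at t, hence is a function of the stopped path. *)
Lemma L1_toR t X : (0 <= t)%E -> L1 t X -> [/\ measurable_fun setT X, Lr (toR X),
  qs (fun w => X w = (toR X w)%:E) & timed t (toR X)].
Proof.
move=> t0 [[mX [X' FX' XX']] EX].
have E0 : (0 <= Ehat (fun w => `|X w|))%E.
  have [P GP] := G_measures_nonempty hsl hsu; apply: le_trans (Ehat_ge _ GP); exact: integral_ge0.
have fE : Ehat (fun w => `|X w|%E) \is a fin_num by rewrite ge0_fin_numE.
have iX P : GM P -> P.-integrable setT X.
  by move=> GP; apply/integrableP; split=> //; apply: le_lt_trans (Ehat_ge _ GP) EX.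
have mx : measurable_fun setT (toR X) by exact: measurableT_comp.
have xX w : (`|toR X w|%:E <= `|X w|)%E.
  by rewrite /toR; case: (X w) => [r| |] //=; rewrite normr0 leey.
have rx P : GM P -> (\int[P]_w `|toR X w|%:E <= Ehat (fun w => `|X w|))%E.
  move=> GP; apply: le_trans (Ehat_ge _ GP); apply: ge0_le_integral => //.
  - by apply/measurable_EFinP; exact: measurableT_comp.
  - exact: measurableT_comp.
have rxx P : GM P -> rint P (toR X).
  move=> GP; apply/integrableP; split; first exact/measurable_EFinP.
  exact: le_lt_trans (rx P GP) EX.
have hx : Lr (toR X).
  apply: (@LrI _ _ _ _ (fine (Ehat (fun w => `|X w|%E)))) => // P GP.
  rewrite -lee_fin -rEPE; last exact: rint_norm (rxx P GP).
  by rewrite fineK//; exact: rx.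
have mN : measurable [set w | ~~ (X w \is a fin_num)].
  rewrite (_ : [set w | _] = setT `&` X @^-1` [set +oo%E; -oo%E]).
    by apply: mX => //; apply: measurableU; exact: emeasurable_set1.
  apply/seteqP; split => w /=; first by case: (X w) => // _; split=> //; [left|right].
  by move=> [_ [->|->]].
have qX : qs (fun w => X w = (toR X w)%:E).
  have h : qs (fun w => ~ ~~ (X w \is a fin_num)).
    apply: (qs_meas hsl hsu mN) => P GP.
    have [N [mN' N0 NA]] := integrable_ae measurableT (iX P GP).
    apply/(negligibleP P mN); exists N; split=> // w /= h; apply: NA => /= h'.
    by move: h; rewrite h'.
  by apply: (qs_imp h) => w /negP; rewrite negbK => h'; rewrite /toR fineK.
split=> //.
case: t t0 FX' => [s|_ _|] //; rewrite lee_fin => s0 FX'; split=> //.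
have mX' : measurable_fun setT X' by move=> _ A mA; rewrite setTI; exact: Ft_meas s0 (FX' A mA).
have sX' w : X' (stop s w) = X' w.
  have /FtE[D mD h] := FX' [set X' w] (emeasurable_set1 _).
  have : (stop s @^-1` D) w by rewrite -h.
  have : (stop s @^-1` D) (stop s w) <-> (stop s @^-1` D) w by rewrite /preimage /= stop_stop.
  by rewrite -h /= => h1 h2; apply: (proj2 h1).
exists (fun w => fine (X' w)); first exact: measurableT_comp.
by apply: (qs_imp XX') => w E; rewrite sX' /toR E.
Qed.

Lemma L1_of_real t X x : measurable_fun setT X -> qs (fun w => X w = (x w)%:E) -> Lr x -> timed t x ->
  L1 t X.
Proof.
move=> mX Xx hx tx; split.
  split=> //; case: t tx => [s [s0 [y' my' yy']]|_|//]; last by exists X => //; [move=> A mA; rewrite -[X @^-1` A]setTI; exact: mX|exact: qs_true].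
  exists (fun w => (y' (stop s w))%:E); last by apply: (qs_and hsl hsu Xx yy') => w -> ->.
  move=> A mA; apply/FtE; exists ((fun w => (y' w)%:E) @^-1` A) => //.
  rewrite -[X in measurable X]setTI; have my : measurable_fun setT (fun w => (y' w)%:E) by exact/measurable_EFinP.
  exact: my.
have [M _ nM] := Lr_nle hsl hsu hx; apply: (@le_lt_trans _ _ M%:E); last exact: ltry.
apply: Ehat_le => P GP; rewrite (_ : (\int[P]_w `|X w| = \int[P]_w `|x w|%:E)%E).
  by rewrite rEPE ?lee_fin ?nM//; exact: rint_norm (Lr_rint hx GP).
apply: ae_eq_integral => //; [exact: measurableT_comp| |].
  by apply/measurable_EFinP; apply: measurableT_comp => //; exact: hx.1.
by apply: filterS (qs_ae hsl hsu Xx GP) => w ->.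
Qed.

Lemma L1_EFin t x : Lr x -> timed t x -> L1 t (fun w => (x w)%:E).
Proof.
move=> hx tx; apply: (L1_of_real _ _ hx tx); first by apply/measurable_EFinP; exact: hx.1.
exact: qs_true.
Qed.

Lemma L1_oo t X : (0 <= t)%E -> L1 t X -> L1 +oo%E X.
Proof. by move=> t0 /(L1_toR t0)[mX hx qx _]; exact: (@L1_of_real +oo%E _ _ mX qx hx I). Qed.

Lemma Ehat_nle X x e : measurable_fun setT X -> qs (fun w => X w = `|x w|%:E) -> Lr x ->
  (Ehat X <= e%:E)%E <-> nle x e.
Proof.
move=> mX Xx hx.
have E P : GM P -> (\int[P]_w X w = (EP P (fun w => `|x w|))%:E)%E.
  move=> GP; rewrite -rEPE; last exact: rint_norm (Lr_rint hx GP).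
  apply: ae_eq_integral => //.
    by apply/measurable_EFinP; apply: measurableT_comp => //; exact: hx.1.
  by apply: filterS (qs_ae hsl hsu Xx GP) => w ->.
split=> [h P GP|h]; last by apply: Ehat_le => P GP; rewrite E// lee_fin h.
by rewrite -lee_fin -E//; apply: le_trans (Ehat_ge _ GP) h.
Qed.

Lemma cvge0P (u : nat -> \bar R) : (forall n, (0 <= u n)%E) -> u @ \oo --> 0%E <->
  forall e, 0 < e -> exists k : nat, forall n, (k <= n)%N -> (u n <= e%:E)%E.
Proof.
move=> u0; split=> [/fine_cvgP[[k1 _ h1]] c e e0|H].
  have /cvgr0Pnorm_le/(_ _ e0)[k2 _ h2] := c; exists (maxn k1 k2) => n; rewrite geq_max => /andP[n1 n2].
  have f := h1 n n1; have := h2 n n2; rewrite /= -[u n]fineK// lee_fin; exact: le_trans (ler_norm _).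
apply/fine_cvgP; split.
  have [k hk] := H 1 ltr01; exists k => // n /= kn; rewrite ge0_fin_numE//.
  by apply: le_lt_trans (hk n kn) _; rewrite ltry.
apply/cvgr0Pnorm_le => e e0; have [k hk] := H e e0; exists k => // n /= kn.
rewrite ger0_norm ?fine_ge0// -lee_fin fineK ?hk// ge0_fin_numE//.
by apply: le_lt_trans (hk n kn) _; rewrite ltry.
Qed.

Lemma cvg_L1P (Xn : nat -> Omega R -> \bar R) X t t' : (0 <= t)%E -> (0 <= t')%E -> (forall n, L1 t (Xn n)) -> L1 t' X ->
  cvg_L1 sl su Xn X <-> rcvg (fun n => toR (Xn n)) (toR X).
Proof.
move=> t0 t0' hXn hX; have [mX hx qx _] := L1_toR t0' hX.
have H n e : (Ehat (fun w => `|Xn n w - X w|)%E <= e%:E)%E <-> nle (fun w => toR (Xn n) w - toR X w) e.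
  have [mXn hxn qxn _] := L1_toR t0 (hXn n).
  apply: Ehat_nle; [|by apply: (qs_and hsl hsu qx qxn) => w -> ->|exact: LrB].
  by apply: measurableT_comp => //; apply: emeasurable_funB.
have E0 n : (0 <= Ehat (fun w => `|Xn n w - X w|)%E)%E.
  have [P GP] := G_measures_nonempty hsl hsu; apply: le_trans (Ehat_ge _ GP); exact: integral_ge0.
split=> [/(cvge0P E0) h e e0|h].
  by have [k hk] := h e e0; exists k => n kn; apply/H/hk.
by apply/(cvge0P E0) => e e0; have [k hk] := h e e0; exists k => n kn; apply/H/hk.
Qed.

Lemma qs_decreasesP (Xn : nat -> Omega R -> \bar R) X t t' : (0 <= t)%E -> (0 <= t')%E -> (forall n, L1 t (Xn n)) -> L1 t' X ->
  qs_decreases sl su Xn X <-> rdec (fun n => toR (Xn n)) (toR X).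
Proof.
move=> t0 t0' hXn hX; have [mX hx qx _] := L1_toR t0' hX.
have qxn : qs (fun w => forall n, Xn n w = (toR (Xn n) w)%:E).
  by apply: (qs_all hsl hsu) => n; have [] := L1_toR t0 (hXn n).
split=> H.
  apply: (qs_and hsl hsu H (_ : qs (fun w => X w = (toR X w)%:E /\ forall n, Xn n w = (toR (Xn n) w)%:E))).
    exact: (qs_and hsl hsu qx qxn).
  move=> w [mon cv] [xw xnw]; split.
    by move=> n m nm; rewrite -lee_fin -!xnw; exact: mon.
  rewrite xw (_ : Xn ^~ w = fun n => (toR (Xn n) w)%:E) in cv; last by apply/funext.
  exact: (fine_cvg cv).
apply: (qs_and hsl hsu H (_ : qs (fun w => X w = (toR X w)%:E /\ forall n, Xn n w = (toR (Xn n) w)%:E))).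
  exact: (qs_and hsl hsu qx qxn).
move=> w [mon cv] [xw xnw]; split.
  by move=> n m nm; rewrite !xnw lee_fin; exact: mon.
rewrite xw (_ : Xn ^~ w = fun n => (toR (Xn n) w)%:E); last by apply/funext.
by apply: cvg_EFin => //; exact: nearW.
Qed.

Lemma qs_increasesP (Xn : nat -> Omega R -> \bar R) X t t' : (0 <= t)%E -> (0 <= t')%E -> (forall n, L1 t (Xn n)) -> L1 t' X ->
  qs_increases sl su Xn X <-> rinc (fun n => toR (Xn n)) (toR X).
Proof.
move=> t0 t0' hXn hX; have [mX hx qx _] := L1_toR t0' hX.
have qxn : qs (fun w => forall n, Xn n w = (toR (Xn n) w)%:E).
  by apply: (qs_all hsl hsu) => n; have [] := L1_toR t0 (hXn n).
split=> H.
  apply: (qs_and hsl hsu H (_ : qs (fun w => X w = (toR X w)%:E /\ forall n, Xn n w = (toR (Xn n) w)%:E))).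
    exact: (qs_and hsl hsu qx qxn).
  move=> w [mon cv] [xw xnw]; split.
    by move=> n m nm; rewrite -lee_fin -!xnw; exact: mon.
  rewrite xw (_ : Xn ^~ w = fun n => (toR (Xn n) w)%:E) in cv; last by apply/funext.
  exact: (fine_cvg cv).
apply: (qs_and hsl hsu H (_ : qs (fun w => X w = (toR X w)%:E /\ forall n, Xn n w = (toR (Xn n) w)%:E))).
  exact: (qs_and hsl hsu qx qxn).
move=> w [mon cv] [xw xnw]; split.
  by move=> n m nm; rewrite !xnw lee_fin; exact: mon.
rewrite xw (_ : Xn ^~ w = fun n => (toR (Xn n) w)%:E); last by apply/funext.
by apply: cvg_EFin => //; exact: nearW.
Qed.

End translation.

(** * Extension to monotone and norm limits *)

Section pairs_of_the_definitions.
Context {R : realType}.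
Variables (sl su : R) (hsl : 0 <= sl) (hsu : sl <= su).
Implicit Types (x y z : Omega R -> R) (X Y : Omega R -> \bar R) (s : R) (t : \bar R).
Local Notation qs := (@qs R sl su).
Local Notation Lr := (@Lr R sl su).
Local Notation adapted := (@adapted R sl su).
Local Notation rpair := (@rpair R sl su).
Local Notation RG := (@RG R sl su).
Local Notation L1 := (@L1 R sl su).
Local Notation LG1 := (@LG1 R sl su).
Local Notation LGdec := (@LGdec R sl su).
Local Notation LGinc := (@LGinc R sl su).
Local Notation LGbar := (@LGbar R sl su).

Lemma L1_cyl (Z : Omega R -> R) : cyl +oo%E Z -> L1 +oo%E (fun w => (Z w)%:E).
Proof. by move=> cZ; apply: L1_EFin => //; exact: Lr_bmeas (bmeas_cyl cZ). Qed.

Lemma LG1_RG t X : (0 <= t)%E -> LG1 t X -> RG t (toR X).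
Proof.
move=> t0 [LX [Xn /(_ _)LXn c]].
have cXn n : cyl t (Xn n) by apply/Lip_cyl.
have [_ hx _ _] := L1_toR hsl hsu t0 LX.
have L n : L1 +oo%E (fun w => (Xn n w)%:E).
  by apply: L1_EFin => //; exact: Lr_bmeas (bmeas_cyl (cXn n)).
apply: (RG_of_rcvg hx (fun n => RG_cyl sl su (cXn n))).
exact: (proj1 (cvg_L1P hsl hsu (leey 0%E) t0 L LX) c).
Qed.

Lemma RG_LG1 t X : (0 <= t)%E -> L1 t X -> RG t (toR X) -> LG1 t X.
Proof.
move=> t0 LX GX; split=> //; have [Zn cZ c] := RG_seq GX.
exists Zn => [n|]; first exact/Lip_cyl.
have L n : L1 +oo%E (fun w => (Zn n w)%:E).
  by apply: L1_EFin => //; exact: Lr_bmeas (bmeas_cyl (cZ n)).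
exact: (proj2 (cvg_L1P hsl hsu (leey 0%E) t0 L LX) c).
Qed.

Lemma RG_qs t x y : RG t x -> Lr y -> qs (fun w => x w = y w) -> RG t y.
Proof.
move=> Gx hy xy; apply: (RG_of_rcvg hy (fun _ : nat => Gx)) => e e0; exists 0%N => _ _ P GP.
apply: le_trans (ltW e0); rewrite -[leRHS](EP_cst P 0); apply: rEP_le.
- by apply: rint_norm; apply: rintB; [exact: Lr_rint Gx.1 GP|exact: Lr_rint hy GP].
- exact: Lr_rint (Lr_bmeas sl su (bmeas_cst 0)) GP.
- by apply: filterS (qs_ae hsl hsu xy GP) => w ->; rewrite subrr normr0.
Qed.

Lemma LG1_L1 t X : LG1 t X -> L1 t X. Proof. by case. Qed.

Lemma LG1_sub_LGdec t X : LG1 t X -> LGdec t X.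
Proof.
move=> LX; split; first exact: LG1_L1.
exists (fun=> X) => //; apply: (qs_true hsl hsu) => w; split; [by []|exact: cvg_cst].
Qed.

Lemma LGdec_sub_LGinc t X : LGdec t X -> LGinc t X.
Proof.
move=> LX; split; first by case: LX.
exists (fun=> X) => //; apply: (qs_true hsl hsu) => w; split; [by []|exact: cvg_cst].
Qed.

Lemma cvg_L1_cst t X : (0 <= t)%E -> L1 t X -> cvg_L1 sl su (fun=> X) X.
Proof.
move=> t0 LX; apply/(cvg_L1P hsl hsu t0 t0 (fun=> LX) LX) => e e0; exists 0%N => _ _ P GP.
rewrite (_ : (fun w => _) = fun=> 0) ?EP_cst ?ltW//.
by apply/funext => w; rewrite subrr normr0.
Qed.

Lemma LGinc_sub_LGbar t X : (0 <= t)%E -> LGinc t X -> LGbar t X.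
Proof.
move=> t0 LX; split; first by case: LX.
by exists (fun=> X) => //; apply: (@cvg_L1_cst t) => //; case: LX.
Qed.

Lemma LG1_oo t X : (0 <= t)%E -> LG1 t X -> LG1 +oo%E X.
Proof.
move=> t0 LX; apply: RG_LG1 => //; first exact: (L1_oo hsl hsu t0 LX.1).
have [hx H] := LG1_RG t0 LX; split=> // e /H[Z [ts tst [K [M h]]] n]; exists Z => //.
by exists ts; [move=> s /tst[s0 _]; split=> //; exact: leey|exists K, M].
Qed.

Lemma LGdec_oo t X : (0 <= t)%E -> LGdec t X -> LGdec +oo%E X.
Proof.
move=> t0 [LX [Xn LXn d]]; split; first exact: (L1_oo hsl hsu t0).
by exists Xn => // n; exact: (LG1_oo t0).
Qed.

Lemma LGinc_oo t X : (0 <= t)%E -> LGinc t X -> LGinc +oo%E X.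
Proof.
move=> t0 [LX [Xn LXn d]]; split; first exact: (L1_oo hsl hsu t0).
by exists Xn => // n; exact: (LGdec_oo t0).
Qed.

Lemma LGbar_oo t X : (0 <= t)%E -> LGbar t X -> LGbar +oo%E X.
Proof.
move=> t0 [LX [Xn LXn d]]; split; first exact: (L1_oo hsl hsu t0).
by exists Xn => // n; exact: (LGinc_oo t0).
Qed.

Section at_time.
Variable t : R.
Hypothesis t0 : 0 <= t.
Let t0E : (0 <= t%:E)%E. Proof. by rewrite lee_fin. Qed.

Lemma L1_adapted X : L1 t%:E X -> Lr (toR X) /\ adapted t (toR X).
Proof. by case/(L1_toR hsl hsu t0E) => _ h _ []. Qed.

Lemma L1_EFin_pair x y : rpair t x y -> L1 t%:E (fun w => (y w)%:E).
Proof. by case=> -[_ hy ay _] _; apply: L1_EFin. Qed.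

(** The first of four statements, one for each layer of the definition: each layer takes one of the
    limits under which pairs are stable. *)
Lemma cond_LG1_pair X Y : cond_LG1 sl su t X Y -> RG +oo%E (toR X) /\ rpair t (toR X) (toR Y).
Proof.
move=> [LX LY [Xn [Yn [h c1 c2]]]].
have C n := cond_Lip_condE hsl hsu (h n).
have LXn n : L1 +oo%E (fun w => (Xn n w)%:E).
  by case: (C n) => _ cX _; apply: L1_EFin => //; exact: Lr_bmeas (bmeas_cyl cX).
have LYn n : L1 +oo%E (fun w => (Yn n w)%:E).
  case: (C n) => _ cX ->; apply: L1_EFin => //.
  exact: Lr_bmeas (bmeas_cyl (cyl_condE hsl hsu t0 cX)).
have [_ hx _ _] := L1_toR hsl hsu (leey 0%E) LX; have [hy ay] := L1_adapted LY.
move/(cvg_L1P hsl hsu (leey 0%E) (leey 0%E) LXn LX) : c1 => c1.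
move/(cvg_L1P hsl hsu (leey 0%E) t0E LYn LY) : c2 => c2; split.
  by apply: (RG_of_rcvg hx _ c1) => n; case: (C n) => _ cX _; exact: RG_cyl.
apply: (rpair_lim t0 _ hx hy ay c1 c2) => n; have [_ cX E] := C n.
by rewrite /toR /= E; exact: rpair_cyl.
Qed.

Lemma cond_LGdec_pair X Y : cond_LGdec sl su t X Y -> rpair t (toR X) (toR Y).
Proof.
move=> [LX LY [Xn [Yn [h c1 c2]]]].
have [_ hx _ _] := L1_toR hsl hsu (leey 0%E) LX; have [hy ay] := L1_adapted LY.
have LXn n : L1 +oo%E (Xn n) by case: (h n).
have LYn n : L1 t%:E (Yn n) by case: (h n).
move/(qs_decreasesP hsl hsu (leey 0%E) (leey 0%E) LXn LX) : c1 => c1.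
move/(qs_decreasesP hsl hsu t0E t0E LYn LY) : c2 => c2.
by apply: (rpair_dec hsl hsu t0 _ _ hx hy ay c1 c2) => n; case: (cond_LG1_pair (h n)).
Qed.

Lemma cond_LGinc_pair X Y : cond_LGinc sl su t X Y -> rpair t (toR X) (toR Y).
Proof.
move=> [LX LY [Xn [Yn [h c1 c2]]]].
have [_ hx _ _] := L1_toR hsl hsu (leey 0%E) LX; have [hy ay] := L1_adapted LY.
have LXn n : L1 +oo%E (Xn n) by case: (h n).
have LYn n : L1 t%:E (Yn n) by case: (h n).
move/(qs_increasesP hsl hsu (leey 0%E) (leey 0%E) LXn LX) : c1 => c1.
move/(qs_increasesP hsl hsu t0E t0E LYn LY) : c2 => c2.
by apply: (rpair_inc hsl hsu t0 _ hx hy ay c1 c2) => n; exact: cond_LGdec_pair.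
Qed.

Lemma cond_LGbar_pair X Y : cond_LGbar sl su t X Y -> rpair t (toR X) (toR Y).
Proof.
move=> [LX LY [Xn [Yn [h c1 c2]]]].
have [_ hx _ _] := L1_toR hsl hsu (leey 0%E) LX; have [hy ay] := L1_adapted LY.
have LXn n : L1 +oo%E (Xn n) by case: (h n).
have LYn n : L1 t%:E (Yn n) by case: (h n).
move/(cvg_L1P hsl hsu (leey 0%E) (leey 0%E) LXn LX) : c1 => c1.
move/(cvg_L1P hsl hsu t0E t0E LYn LY) : c2 => c2.
by apply: (rpair_lim t0 _ hx hy ay c1 c2) => n; exact: cond_LGinc_pair.
Qed.

Lemma cond_LG1_exists X : LG1 +oo%E X -> exists Y, cond_LG1 sl su t X Y /\ RG t%:E (toR Y).
Proof.
move=> LX; have [y [Zn [xy Gy cZ c1 c2]]] := rpair_exists_RG hsl hsu t0 (LG1_RG (leey 0%E) LX).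
have LY := L1_EFin_pair xy.
exists (fun w => (y w)%:E); split=> //; split=> //; first exact: LX.1.
exists Zn, (fun n => condE sl su t (Zn n)); split.
- by move=> n; exact: cond_Lip_exists.
- have L n : L1 +oo%E (fun w => (Zn n w)%:E) by exact: L1_cyl (cZ n).
  exact: (proj2 (cvg_L1P hsl hsu (leey 0%E) (leey 0%E) L LX.1) c1).
- have L n : L1 +oo%E (fun w => (condE sl su t (Zn n) w)%:E).
    by apply: L1_EFin => //; exact: Lr_bmeas (bmeas_cyl (cyl_condE hsl hsu t0 (cZ n))).
  exact: (proj2 (cvg_L1P hsl hsu (leey 0%E) t0E L LY) c2).
Qed.

Lemma cond_LGdec_exists X : LGdec +oo%E X -> exists Y, cond_LGdec sl su t X Y.
Proof.
move=> [LX [Xn LXn /(qs_decreasesP hsl hsu (leey 0%E) (leey 0%E) (fun n => (LXn n).1) LX) d]].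
have [_ hx _ _] := L1_toR hsl hsu (leey 0%E) LX.
pose Yn n := projT1 (cid (cond_LG1_exists (LXn n))).
have Y1 n : cond_LG1 sl su t (Xn n) (Yn n) by rewrite /Yn; case: cid => ? [].
have [y xy dy] := rpair_exists_dec hsl hsu t0 (fun n => (cond_LG1_pair (Y1 n)).2)
  (fun n => (cond_LG1_pair (Y1 n)).1) hx d.
have LY := L1_EFin_pair xy.
exists (fun w => (y w)%:E); split=> //; exists Xn, Yn; split=> //.
- by apply/(qs_decreasesP hsl hsu (leey 0%E) (leey 0%E) (fun n => (LXn n).1) LX).
- apply: (proj2 (qs_decreasesP hsl hsu t0E t0E _ LY) dy) => n.
  by case: (Y1 n).
Qed.

Lemma cond_LGinc_exists X : LGinc +oo%E X -> exists Y, cond_LGinc sl su t X Y.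
Proof.
move=> [LX [Xn LXn /(qs_increasesP hsl hsu (leey 0%E) (leey 0%E) (fun n => (LXn n).1) LX) d]].
have [_ hx _ _] := L1_toR hsl hsu (leey 0%E) LX.
pose Yn n := projT1 (cid (cond_LGdec_exists (LXn n))).
have Y1 n : cond_LGdec sl su t (Xn n) (Yn n) by rewrite /Yn; case: cid.
have [y xy dy] := rpair_exists_inc hsl hsu t0 (fun n => cond_LGdec_pair (Y1 n)) hx d.
have LY := L1_EFin_pair xy.
exists (fun w => (y w)%:E); split=> //; exists Xn, Yn; split=> //.
- by apply/(qs_increasesP hsl hsu (leey 0%E) (leey 0%E) (fun n => (LXn n).1) LX).
- apply: (proj2 (qs_increasesP hsl hsu t0E t0E _ LY) dy) => n.
  by case: (Y1 n).
Qed.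

Lemma cond_LGbar_exists X : LGbar +oo%E X -> exists Y, cond_LGbar sl su t X Y.
Proof.
move=> [LX [Xn LXn /(cvg_L1P hsl hsu (leey 0%E) (leey 0%E) (fun n => (LXn n).1) LX) d]].
have [_ hx _ _] := L1_toR hsl hsu (leey 0%E) LX.
pose Yn n := projT1 (cid (cond_LGinc_exists (LXn n))).
have Y1 n : cond_LGinc sl su t (Xn n) (Yn n) by rewrite /Yn; case: cid.
have [y xy dy] := rpair_exists_lim hsl hsu t0 (fun n => cond_LGinc_pair (Y1 n)) hx d.
have LY := L1_EFin_pair xy.
exists (fun w => (y w)%:E); split=> //; exists Xn, Yn; split=> //.
- by apply/(cvg_L1P hsl hsu (leey 0%E) (leey 0%E) (fun n => (LXn n).1) LX).
- apply: (proj2 (cvg_L1P hsl hsu t0E t0E _ LY) dy) => n.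
  by case: (Y1 n).
Qed.

(** [Et] selects a version by [xget]. Existence makes the selection meaningful, and by
    [rpair_unique] any other version agrees with it q.s. *)
Lemma Et_pair t' X : (0 <= t')%E -> LGbar t' X -> L1 t%:E (Et sl su t X) /\ rpair t (toR X) (toR (Et sl su t X)).
Proof.
move=> t0' /(LGbar_oo t0') LX; have h : cond_LGbar sl su t X (Et sl su t X).
  rewrite /Et; have [Y hY] := cond_LGbar_exists LX.
  exact: (xgetPex _ (ex_intro _ Y hY)).
by split; [case: h|exact: cond_LGbar_pair].
Qed.

Lemma rpair_unique x y y' : rpair t x y -> rpair t x y' -> qs (fun w => y w = y' w).
Proof.
move=> h h'; apply: (qs_and hsl hsu (rpair_mono hsl hsu t0 h h'.1 _) (rpair_mono hsl hsu t0 h' h.1 _)).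
- by apply: (qs_true hsl hsu) => w.
- by apply: (qs_true hsl hsu) => w.
- by move=> w ? ?; apply/eqP; rewrite eq_le; apply/andP.
Qed.

(** The construction for L_G^1 yields a version lying in L_G^1; the selected one equals it q.s. *)
Lemma Et_LG1 t' X : (0 <= t')%E -> LG1 t' X -> LG1 t%:E (Et sl su t X).
Proof.
move=> t0' LX; have [Y [/cond_LG1_pair[_ XY] GY]] := cond_LG1_exists (LG1_oo t0' LX).
have LB : LGbar t' X by apply/LGinc_sub_LGbar/LGdec_sub_LGinc/LG1_sub_LGdec.
have [L2 XY'] := Et_pair t0' LB; apply: RG_LG1 => //.
by apply: (RG_qs GY); [case: XY' => -[]|exact: rpair_unique XY XY'].
Qed.

End at_time.
End pairs_of_the_definitions.

(** * Pointwise limits and integrals of possibly nonmeasurable functions *)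

Section limits_of_measurable_functions.
Context {d : measure_display} {T : measurableType d} {R : realType}.

Lemma limn_esup_einf (u : nat -> \bar R) : limn_esup u = limn_einf u -> u @ \oo --> limn_esup u.
Proof.
move=> h.
have ce : esups u @ \oo --> limn_esup u by rewrite limn_esup_lim; exact: is_cvg_esups.
have ci : einfs u @ \oo --> limn_esup u by rewrite h limn_einf_lim; exact: is_cvg_einfs.
apply: squeeze_cvge ci ce; apply: nearW => n; apply/andP; split.
  by apply: ereal_inf_lbound; exists n => /=.
by apply: ereal_sup_ubound; exists n => /=.
Qed.

(** Where the sequence diverges [limn] is the default [point]; the set of convergence is where the
    limit superior is at most the limit inferior, a measurable set. *)
Lemma measurable_limn (f : nat -> T -> \bar R) : (forall n, measurable_fun setT (f n)) ->
  measurable_fun setT (fun w => limn (f ^~ w)).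
Proof.
move=> mf.
have ms : measurable_fun setT (fun w => limn_esup (f ^~ w)) by exact: measurable_fun_limn_esup.
have mi : measurable_fun setT (fun w => limn_einf (f ^~ w)).
  apply: measurableT_comp => //.
  apply: (measurable_fun_limn_esup (f := fun n w => (- f n w)%E)) => n.
  exact: measurableT_comp.
rewrite (_ : (fun w => _) = fun w => if (limn_esup (f ^~ w) <= limn_einf (f ^~ w))%E
    then limn_esup (f ^~ w) else point).
  apply: measurable_fun_ifT => //.
  apply: (measurable_fun_bool true); have := measurable_lee measurableT ms mi.
  by congr (measurable _); apply/seteqP; split => w /=.
apply/funext => w; case: ifP => [h|/negP h].
  have E : limn_esup (f ^~ w) = limn_einf (f ^~ w).
    by apply/eqP; rewrite eq_le h limn_einf_sup.
  exact: cvg_lim (limn_esup_einf E).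
apply: dvgP => /cvg_ex[l cl]; apply: h.
by have [-> ->] := cvg_limn_einf_sup cl.
Qed.

Variable mu : measure T R.
Import HBNNSimple.

(** The integral of a nonnegative function is a supremum over simple functions below it, whether or
    not the function is measurable. *)
Lemma ge0_integral_le_any (f g : T -> \bar R) : (forall w, (0 <= f w)%E) -> (forall w, (f w <= g w)%E) ->
  (\int[mu]_w f w <= \int[mu]_w g w)%E.
Proof.
move=> f0 fg; rewrite !ge0_integralTE//; last by move=> w; exact: le_trans (fg w).
by apply: ereal_sup_le => _ [h hf <-]; exists h => // w; exact: le_trans (fg w).
Qed.

Lemma ge0_integral_eq_off_null (f g : T -> \bar R) N : measurable N -> mu N = 0%E ->
  (forall w, (0 <= f w)%E) -> (forall w, (0 <= g w)%E) -> (forall w, ~ N w -> f w = g w) ->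
  (\int[mu]_w f w = \int[mu]_w g w)%E.
Proof.
move=> mN N0; suff H u v : (forall w, (0 <= u w)%E) -> (forall w, (0 <= v w)%E) -> (forall w, ~ N w -> u w = v w) ->
    (\int[mu]_w u w <= \int[mu]_w v w)%E.
  by move=> f0 g0 fg; apply/eqP; rewrite eq_le !H// => w /fg.
move=> u0 v0 uv; rewrite ge0_integralTE//; apply: ge_ereal_sup => _ [h hu <-].
have := integral_nnsfun mu measurableT h; rewrite patch_setT => <-.
have mh : measurable_fun setT (fun w => (h w)%:E) by apply/measurable_EFinP; exact: measurable_funPT.
pose h' w := if w \in N then 0%E else (h w)%:E.
have mh' : measurable_fun setT h'.
  apply: measurable_fun_ifT => //.
  apply: (measurable_fun_bool true); rewrite setTI (_ : _ @^-1` _ = N)//.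
  by apply/seteqP; split => w /= => [/set_mem|/mem_set].
rewrite (_ : (\int[mu]_w (h w)%:E = \int[mu]_w h' w)%E).
  apply: ge0_integral_le_any => w; rewrite /h'; case: ifP => //; first by rewrite lee_fin.
  by move/negP => nN; rewrite -uv => // Nw; apply: nN; exact: mem_set.
apply: ae_eq_integral => //; exists N; split => // w /= h1; apply: contrapT => nN; apply: h1 => _.
by rewrite /h' memNset.
Qed.

(** For X evaluated at a random time, which is only shown to agree with a Borel function outside a
    polar set. *)
Lemma integral_eq_off_null (f g : T -> \bar R) N : measurable N -> mu N = 0%E ->
  (forall w, ~ N w -> f w = g w) -> (\int[mu]_w f w = \int[mu]_w g w)%E.
Proof.
move=> mN N0 fg; rewrite [LHS]integralE [RHS]integralE; congr (_ - _)%E;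
  apply: (@ge0_integral_eq_off_null _ _ N) => // w /fg h; by rewrite ?funeposE ?funenegE h.
Qed.

End limits_of_measurable_functions.

(** * Stability of the class of norm limits of cylinder functions *)

Section closure_of_RG.
Context {R : realType}.
Variables (sl su : R) (hsl : 0 <= sl) (hsu : sl <= su).
Implicit Types (x y z : Omega R -> R) (t : \bar R).
Local Notation qs := (@qs R sl su).
Local Notation nle := (@nle R sl su).
Local Notation Lr := (@Lr R sl su).
Local Notation adapted := (@adapted R sl su).
Local Notation rcvg := (@rcvg R sl su).
Local Notation RG := (@RG R sl su).

Lemma nle_eq0 x : Lr x -> (forall e, 0 < e -> nle x e) -> qs (fun w => x w = 0).
Proof.
move=> hx H; have m0 : measurable (x @^-1` [set~ 0]).
  by rewrite -[X in measurable X]setTI; apply: hx.1 => //; apply: measurableC.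
have h : qs (fun w => ~ (x @^-1` [set~ 0]) w).
  apply: (qs_meas hsl hsu m0) => P GP.
  have rx := rint_norm (Lr_rint hx GP).
  have /(rEP_eq0 rx) : EP P (fun w => `|x w|) <= 0.
    by apply/ler_addgt0Pl => e e0; rewrite addr0; exact: H.
  case=> [|N [mN N0 h]]; first by apply: aeW => w /=.
  apply: (subset_measure0 _ _ _ N0) => // w /= nx; apply: h => /= /eqP; rewrite normr_eq0 => /eqP; exact: nx.
by apply: (qs_imp h) => w /= ?; apply: contrapT.
Qed.

Lemma rcvg_unique xn x y : (forall n, Lr (xn n)) -> Lr x -> Lr y -> rcvg xn x -> rcvg xn y ->
  qs (fun w => x w = y w).
Proof.
move=> hn hx hy cx cy; have h : qs (fun w => x w - y w = 0).
  apply: nle_eq0 => [|e e0]; first exact: LrB.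
  have e2 : 0 < e / 2 by rewrite divr_gt0.
  have [k hk] := cx _ e2; have [l hl] := cy _ e2; pose m := maxn k l; rewrite [e]splitr.
  apply: (nle_trans hx (hn m) hy); last by apply: hl; exact: leq_maxr.
  by apply: nleC; apply: hk; exact: leq_maxl.
by apply: (qs_imp h) => w /eqP; rewrite subr_eq0 => /eqP.
Qed.

Lemma cyl_stop (t : R) Z w : cyl t%:E Z -> Z (stop t w) = Z w.
Proof.
move=> [ts hts cZ]; apply: (cylon_dep cZ) => s /hts[_]; rewrite lee_fin => st.
by rewrite B_stop min_l.
Qed.

Lemma adapted_qs (t : R) x y : adapted t x -> qs (fun w => y w = x w) -> adapted t y.
Proof. by move=> [x' mx' h] h'; exists x' => //; apply: (qs_and hsl hsu h h') => w <-. Qed.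

Lemma RG_adapted (t : R) x : 0 <= t -> RG t%:E x -> adapted t x.
Proof.
move=> t0 Gx; have [Zn cZ c] := RG_seq Gx.
have LZ n : Lr (Zn n) by exact: Lr_bmeas (bmeas_cyl (cZ n)).
have aZ n : adapted t (Zn n).
  exists (Zn n); first exact: measurable_cyl (cZ n).
  by apply: (qs_true hsl hsu) => w; rewrite cyl_stop.
have [|y [hy ay cy]] := @adapted_complete _ sl su hsl hsu t Zn t0 LZ aZ.
  exact: rcvg_cauchy LZ Gx.1 c.
exact: adapted_qs ay (rcvg_unique LZ Gx.1 hy c cy).
Qed.

Lemma RG_op (op : R -> R -> R) (K : R) t x y : 0 < K ->
  (forall a b a' b', `|op a b - op a' b'| <= K * (`|a - a'| + `|b - b'|)) ->
  (forall Z Z', cyl t Z -> cyl t Z' -> cyl t (fun w => op (Z w) (Z' w))) ->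
  Lr (fun w => op (x w) (y w)) -> RG t x -> RG t y -> RG t (fun w => op (x w) (y w)).
Proof.
move=> K0 lip cop hop [hx Hx] [hy Hy]; split=> // e e0.
have e2 : 0 < e / 2 / K by rewrite !divr_gt0.
have [Z cZ nZ] := Hx _ e2; have [Z' cZ' nZ'] := Hy _ e2.
exists (fun w => op (Z w) (Z' w)) => [|P GP]; first exact: cop.
have LZ : Lr Z by exact: Lr_bmeas (bmeas_cyl cZ).
have LZ' : Lr Z' by exact: Lr_bmeas (bmeas_cyl cZ').
have LC : Lr (fun w => op (Z w) (Z' w)) by exact: Lr_bmeas (bmeas_cyl (cop _ _ cZ cZ')).
have r1 := rint_norm (Lr_rint (LrB hsl hsu LZ hx) GP).
have r2 := rint_norm (Lr_rint (LrB hsl hsu LZ' hy) GP).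
apply: (@le_trans _ _ (EP P (fun w => K * (`|Z w - x w| + `|Z' w - y w|)))).
  apply: rEP_le; [exact: rint_norm (Lr_rint (LrB hsl hsu LC hop) GP)|exact: rintZ (rintD r1 r2)|].
  by apply: aeW => w.
rewrite rEPZ ?rEPD//; last exact: rintD.
rewrite (_ : e = K * (e / 2 / K + e / 2 / K)); last by field; lra.
by rewrite ler_pM2l// lerD// ?nZ ?nZ'.
Qed.

Lemma RG_max t x y : RG t x -> RG t y -> RG t (fun w => Num.max (x w) (y w)).
Proof.
move=> Gx Gy; apply: (@RG_op Num.max 1) => //; [|by move=> *; exact: cyl_max|exact: Lr_max Gx.1 Gy.1].
move=> a b a' b'; rewrite mul1r; have := ler_norm (a - a'); have := ler_norm (b - b').
have := ler_norm (a' - a); have := ler_norm (b' - b); rewrite (distrC a') (distrC b') => *.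
have := normr_ge0 (a - a'); have := normr_ge0 (b - b') => *.
by rewrite ler_norml; case: (leP a b) => ?; case: (leP a' b') => ?; apply/andP; split; lra.
Qed.

Lemma RG_lin t (a b c : R) x y : RG t x -> RG t y -> RG t (fun w => a * x w + b * y w + c).
Proof.
move=> Gx Gy; apply: (@RG_op (fun u v => a * u + b * v + c) (`|a| + `|b| + 1)).
- by apply: ltr_wpDl => //; exact: addr_ge0.
- move=> u v u' v'; rewrite (_ : _ - _ = a * (u - u') + b * (v - v')); last by ring.
  apply: le_trans (ler_normD _ _) _; rewrite !normrM.
  have := normr_ge0 a; have := normr_ge0 b; have := normr_ge0 (u - u'); have := normr_ge0 (v - v').
  move: `|a| `|b| `|u - u'| `|v - v'| => p q r s *; nra.
- by move=> Z Z' cZ cZ'; apply: cylD (cyl_cst _ _); apply: cylD; exact: cylZ.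
- apply: LrD => //; last exact: Lr_bmeas (bmeas_cst c).
  by apply: LrD => //; apply: LrZ => //; [exact: Gx.1|exact: Gy.1].
- exact: Gx.
- exact: Gy.
Qed.

Lemma RG_le s t x : (s <= t)%E -> RG s x -> RG t x.
Proof. by move=> st [hx H]; split=> // e /H[Z cZ nZ]; exists Z => //; exact: cyl_le cZ. Qed.

Lemma RG_cst t (c : R) : RG t (fun=> c).
Proof. exact: RG_cyl (cyl_cst _ _). Qed.

End closure_of_RG.

(** * Processes in S_G *)

Section regular_processes.
Context {R : realType}.
Variables (sl su : R) (hsl : 0 <= sl) (hsu : sl <= su).
Implicit Types (x y z : Omega R -> R) (e t s T : R) (w : Omega R).
Local Notation GM := (@G_measures R sl su).
Local Notation qs := (@qs R sl su).
Local Notation nle := (@nle R sl su).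
Local Notation Lr := (@Lr R sl su).
Local Notation RG := (@RG R sl su).
Local Notation Ehat := (@Ehat R sl su).

Lemma Ehat_ge0 (f : Omega R -> \bar R) : (forall w, (0 <= f w)%E) -> (0 <= Ehat f)%E.
Proof.
move=> f0; have [P GP] := G_measures_nonempty hsl hsu; apply: le_trans (Ehat_ge _ GP); exact: integral_ge0.
Qed.

Lemma Ehat_envelope (Z : Omega R -> \bar R) e : measurable_fun setT Z -> (forall w, (0 <= Z w)%E) ->
  (Ehat Z <= e%:E)%E ->
  [/\ Lr (toR Z), nle (toR Z) e, qs (fun w => Z w = (toR Z w)%:E) & forall w, 0 <= toR Z w].
Proof.
move=> mZ Z0 Ze; have [||_ hZ qZ _] := @L1_toR _ _ _ hsl hsu +oo%E Z; first exact: leey.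
  split; first by split=> //; exists Z; [move=> A mA; rewrite -[_ @^-1` _]setTI; exact: mZ|exact: (qs_true hsl hsu)].
  rewrite (_ : (fun w => `|Z w|%E) = Z); first by apply: le_lt_trans Ze _; rewrite ltry.
  by apply/funext => w; rewrite gee0_abs.
have D0 w : 0 <= toR Z w by exact: fine_ge0.
split=> //; apply: (proj1 (Ehat_nle hsl hsu e mZ _ hZ) Ze).
by apply: (qs_imp qZ) => w {1}->; rewrite ger0_norm.
Qed.

(** f is Borel only up to a polar set. Its Borel version, replaced by 0 on that set, lies below f
    everywhere, so its expectation is no larger, and equals f q.s. *)
Lemma Ehat_envelope_le (f Z : Omega R -> \bar R) e : measurable_fun setT Z ->
  qs (fun w => f w = Z w) -> (forall w, (0 <= f w)%E) -> (Ehat f <= e%:E)%E ->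
  exists D, [/\ Lr D, nle D e, forall w, 0 <= D w & qs (fun w => (f w <= (D w)%:E)%E)].
Proof.
move=> mZ /(qsE hsl hsu)[N [mN N0 fZ]] f0 fe; pose Z' w := if w \in N then 0%E else Z w.
have mZ' : measurable_fun setT Z'.
  apply: measurable_fun_ifT => //; apply: (measurable_fun_bool true); rewrite setTI (_ : _ @^-1` _ = N)//.
  by apply/seteqP; split => w /= => [/set_mem|/mem_set].
have Zf w : (Z' w <= f w)%E.
  rewrite /Z'; case: ifP => [_|/negP nN]; first exact: f0.
  by rewrite -fZ// => Nw; apply: nN; exact: mem_set.
have Z0 w : (0 <= Z' w)%E.
  rewrite /Z'; case: ifP => [_|/negP nN]; first by [].
  by rewrite -fZ// => Nw; apply: nN; exact: mem_set.
have [|h1 h2 h3 h4] := @Ehat_envelope Z' e mZ' Z0.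
  apply: Ehat_le => P GP; apply: le_trans fe; apply: le_trans (Ehat_ge _ GP).
  exact: ge0_integral_le_any.
exists (toR Z'); split=> //.
have qN : qs (fun w => ~ N w) by exact: (qs_meas hsl hsu).
by apply: (qs_and hsl hsu h3 qN) => w <- nN; rewrite /Z' memNset// fZ.
Qed.

Lemma Lr_qs_le x y : measurable_fun setT x -> Lr y -> qs (fun w => `|x w| <= y w) -> Lr x.
Proof.
move=> mx hy xy; pose y' w := Num.max (y w) `|x w|.
have my' : measurable_fun setT y'.
  by apply: measurable_maxr; [exact: hy.1|exact: measurableT_comp].
have E : qs (fun w => y w = y' w) by apply: (qs_imp xy) => w h; rewrite /y' max_l.
have [M _ nM] := Lr_nle hsl hsu hy.
have ry' P : GM P -> rint P y' by move=> GP; exact: rint_ae (Lr_rint hy GP) my' (qs_ae hsl hsu E GP).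
have rx P : GM P -> rint P x.
  move=> GP; apply: (rint_le mx _ (ry' P GP)) => w; apply: le_trans (ler_norm _).
  by rewrite /y' le_max lexx orbT.
apply: (@LrI _ _ _ _ M) => // P GP; apply: le_trans (nM P GP); apply: rEP_le.
- exact: rint_norm (rx P GP).
- exact: rint_norm (Lr_rint hy GP).
- by apply: filterS (qs_ae hsl hsu xy GP) => w h; apply: le_trans h (ler_norm _).
Qed.

Lemma SG0_modulus T (eta : R -> Omega R -> R) : SG0 T eta -> exists (ts : seq R) (M L : R), [/\ 0 <= L,
  forall s, s \in ts -> 0 <= s <= T,
  forall t w, 0 <= t <= T -> `|eta t w| <= M &
  forall t w t' w', 0 <= t <= T -> 0 <= t' <= T ->
    `|eta t w - eta t' w'| <= L * (`|t - t'| + \sum_(s <- ts) `|B (Num.min s t) w - B (Num.min s t') w'|)].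
Proof.
move=> [ts [h [/bounded_lipschitzP[M [L [L0 hM hL]]] hts he]]]; exists ts, M, L; split=> //.
- by move=> t w ht; rewrite he.
- move=> t w t' w' ht ht'; rewrite !he//; apply: le_trans (hL _ _) _.
  rewrite ler_wpM2l//; apply: le_trans (row_norm_le_sum _) _.
  rewrite big_ord_recl !mxE /= lerD2l (big_nth 0) big_mkord; apply: ler_sum => i _.
  by rewrite mxE [X in `|_ + X|]mxE !vecE /= !(nth_map 0) ?ltn_ord.
Qed.

Lemma SG0_cyl T eta t : SG0 T eta -> 0 <= t <= T -> cyl t%:E (eta t).
Proof.
move=> /SG0_modulus[ts [M [L [L0 hts hM hL]]]] tT; have /andP[t0 _] := tT.
exists [seq Num.min s t | s <- ts].
  move=> _ /mapP[s /hts/andP[s0 _] ->]; split; first by rewrite le_min s0.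
  by rewrite lee_fin ge_min lexx orbT.
exists M, L; split=> // [w|w w']; first exact: hM.
by apply: le_trans (hL t w t w' tT tT) _; rewrite subrr normr0 add0r /path_dist big_map.
Qed.

Lemma SG0_cvg T eta w s (u : nat -> R) : SG0 T eta -> 0 <= s <= T -> (forall n, 0 <= u n <= T) ->
  u @ \oo --> s -> (fun n => eta (u n) w) @ \oo --> eta s w.
Proof.
move=> /SG0_modulus[ts [M [L [L0 hts hM hL]]]] sT uT us.
have D0 (f g : nat -> R) : f @ \oo --> (0 : R) -> g @ \oo --> (0 : R) -> (fun n => f n + g n) @ \oo --> (0 : R).
  by move=> cf cg; have := cvgD cf cg; rewrite addr0; apply.
have N0 (f : nat -> R) (l : R) : f @ \oo --> l -> (fun n => `|f n - l|) @ \oo --> (0 : R).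
  by move=> cf; have := cvg_norm (cvgB cf (cvg_cst l)); rewrite subrr normr0; apply.
have c1 : (fun n => `|u n - s| + \sum_(r <- ts) `|B (Num.min r (u n)) w - B (Num.min r s) w|) @ \oo --> (0 : R).
  apply: (D0); first exact: N0.
  elim: ts {hts hL} => [|r ts IH].
    rewrite (_ : (fun _ => _) = fun=> 0); first exact: cvg_cst.
    by apply/funext => n; rewrite big_nil.
  rewrite (_ : (fun _ => _) = (fun n => `|B (Num.min r (u n)) w - B (Num.min r s) w| +
    \sum_(r <- ts) `|B (Num.min r (u n)) w - B (Num.min r s) w|)); last first.
    by apply/funext => n; rewrite big_cons.
  apply: (D0) => //; apply: (N0).
  apply: (@cvg_comp _ _ _ (fun n => Num.min r (u n)) (fun t => B t w)); last exact: B_continuous.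
  apply: (@cvg_comp _ _ _ u (fun t => Num.min r t) _ _ _ us).
  by apply: (@continuous_min R R (cst r) id); [exact: cvg_cst|exact: cvg_id].
apply/cvgrPdist_le => e e0.
have e1 : 0 < e / (L + 1) by rewrite divr_gt0// ltr_wpDl.
move/cvgr0Pnorm_le : c1 => /(_ _ e1); apply: filterS => n h.
apply: le_trans (hL s w (u n) w sT (uT n)) _.
rewrite ger0_norm in h; last by rewrite addr_ge0// sumr_ge0.
rewrite distrC; under eq_bigr do rewrite distrC.
apply: (@le_trans _ _ ((L + 1) * (e / (L + 1)))); last by rewrite mulrC divfK// gt_eqF// ltr_wpDl.
apply: ler_pM => //; [by rewrite addr_ge0// sumr_ge0|by rewrite lerDl].
Qed.

(** A pathwise reading of convergence in S_G: a single variable D of small expectation dominates the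
    errors at all times. *)
Lemma SG_approx beta T X e : 1 < beta -> 0 <= T -> SG sl su beta T X -> 0 < e -> exists eta D,
  [/\ SG0 T eta, Lr D, nle D e, forall w, 0 <= D w &
      qs (fun w => forall t, 0 <= t <= T -> `|eta t w - X t w| `^ beta <= D w)].
Proof.
move=> b1 T0 [mX [etan [S0 mS c]]] e0; have b0 : 0 < beta by lra.
pose sp k := sup_power beta `[0%R, T] (fun t w => (etan k t w - X t w)%R).
have sp0 k w : (0 <= sp k w)%E.
  apply: (@le_trans _ _ (`|etan k 0 w - X 0 w| `^ beta)%:E).
    by rewrite lee_fin powR_ge0.
  by apply: ereal_sup_ubound; exists 0 => //=; rewrite in_itv/= lexx T0.
have [k hk] := proj1 (cvge0P (fun n => poweR_ge0 _ _)) c (e `^ beta^-1) (powR_gt0 _ e0).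
have h := hk k (leqnn k); rewrite /SG_norm -/(sp k) in h.
have {}h : (Ehat (sp k) <= e%:E)%E.
  have E0 := Ehat_ge0 (sp0 k).
  have := gt0_ler_poweR (ltW b0) _ _ h; rewrite !in_itv/= !poweR_ge0 !leey lee_fin powR_ge0.
  move=> /(_ isT isT); rewrite -poweRrM -powRrM mulVf ?gt_eqF// poweRe1//.
  by rewrite powRr1//; exact: ltW.
have [Z mZ qZ] := mS k; have [D [hD nD D0 qD]] := Ehat_envelope_le mZ qZ (sp0 k) h.
exists (etan k), D; split=> //; apply: (qs_imp qD) => w hw t /andP[t0 tT].
rewrite -lee_fin; apply: le_trans hw; apply: ereal_sup_ubound; exists t => //=.
by rewrite in_itv/= t0 tT.
Qed.

(** For d > e one has d = d^beta / d^(beta - 1), at most d^beta / e^(beta - 1). This converts small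
    moments of order beta into small first moments. *)
Lemma le_addr_powR (beta e d : R) : 1 < beta -> 0 < e -> 0 <= d -> d <= e + (e `^ (beta - 1))^-1 * d `^ beta.
Proof.
move=> b1 e0 d0; have c0 : 0 < e `^ (beta - 1) by exact: powR_gt0.
have [de|de] := leP d e; first by rewrite (le_trans de)// lerDl mulr_ge0 ?powR_ge0// invr_ge0 ltW.
apply: (@le_trans _ _ ((e `^ (beta - 1))^-1 * d `^ beta)); last by rewrite lerDr ltW.
have b0 : 0 < beta by lra.
rewrite -(mulr_powRB1 d0 b0).
rewrite mulrCA ler_peMr// -ler_pdivrMl ?invr_gt0// invrK mulr1.
by apply: ge0_ler_powR; rewrite ?nnegrE; lra.
Qed.

Variables (beta : R) (b1 : 1 < beta) (X : R -> Omega R -> R).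
Hypothesis X_SG : forall n : nat, (0 < n)%N -> SG sl su beta n%:R X.

Lemma X_measurable t : 0 <= t -> measurable_fun setT (X t).
Proof.
move=> t0; have [k kt] := nat_ge t; have [+ _] := X_SG (ltn0Sn k); apply.
by rewrite t0 (le_trans kt)// ler_nat.
Qed.

Lemma X_RG t : 0 <= t -> RG t%:E (X t).
Proof.
move=> t0; have mX := X_measurable t0; have [k kt] := nat_ge t.
have tT : 0 <= t <= k.+1%:R by rewrite t0 (le_trans kt)// ler_nat.
have ap e : 0 < e -> exists eta D, [/\ cyl t%:E eta, Lr D, nle D e &
    qs (fun w => `|eta w - X t w| <= D w)].
  move=> e0; have e2 : 0 < e / 2 by rewrite divr_gt0.
  pose c := ((e / 2) `^ (beta - 1))^-1; have c0 : 0 < c by rewrite invr_gt0 powR_gt0.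
  have ec : 0 < e / 2 / c by rewrite divr_gt0.
  have [eta [D [S0 hD nD D0 qD]]] := SG_approx b1 (ler0n _ _) (X_SG (ltn0Sn k)) ec.
  have hc : Lr (fun=> e / 2) by exact: Lr_bmeas (bmeas_cst _).
  have hE : Lr (fun w => e / 2 + c * D w) by apply: LrD => //; exact: LrZ.
  exists (eta t), (fun w => e / 2 + c * D w); split=> //.
  - exact: SG0_cyl S0 tT.
  - have E0 w : 0 <= e / 2 + c * D w by apply: addr_ge0; [exact: ltW|apply: mulr_ge0 => //; exact: ltW].
    move=> P GP; rewrite (_ : (fun w => `|_|) = (fun w => e / 2 + c * D w)); last first.
      by apply/funext => w; rewrite ger0_norm.
    rewrite rEPD ?EP_cst ?rEPZ; [|exact: Lr_rint hD GP|exact: Lr_rint hc GP|exact: Lr_rint (LrZ hsl hsu c hD) GP].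
    have : EP P D <= e / 2 / c.
      apply: le_trans (nD P GP); apply: rEP_le; [exact: Lr_rint hD GP|exact: rint_norm (Lr_rint hD GP)|].
      by apply: aeW => w; exact: ler_norm.
    by rewrite ler_pdivlMr// mulrC => ?; lra.
  - apply: (qs_imp qD) => w h; apply: le_trans (le_addr_powR b1 e2 (normr_ge0 _)) _.
    by rewrite lerD2l ler_pM2l// h.
have hX : Lr (X t).
  have [eta [D [ceta hD _ qD]]] := ap 1 ltr01.
  have heta : Lr (fun w => `|eta w|) by apply: Lr_norm => //; exact: Lr_bmeas (bmeas_cyl ceta).
  apply: (Lr_qs_le mX (LrD hsl hsu heta hD)); apply: (qs_imp qD) => w h.
  by rewrite (le_trans _ (lerD (lexx `|eta w|) h))// -lerBlDl distrC lerB_dist.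
split=> // e e0; have [eta [D [ceta hD nD qD]]] := ap e e0; exists eta => //.
have he : Lr eta by exact: Lr_bmeas (bmeas_cyl ceta).
move=> P GP; apply: le_trans (nD P GP); apply: rEP_le.
- exact: rint_norm (Lr_rint (LrB hsl hsu he hX) GP).
- exact: rint_norm (Lr_rint hD GP).
- by apply: filterS (qs_ae hsl hsu qD GP) => w h; exact: le_trans h (ler_norm _).
Qed.

(** Markov's inequality: for every i, the set where all the variables are at least 1 / (r + 1) has
    measure at most (r + 1) / (i + 1). *)
Lemma qs_infimum0 (D : nat -> Omega R -> R) : (forall i, Lr (D i)) -> (forall i w, 0 <= D i w) ->
  (forall i, nle (D i) i.+1%:R^-1) -> qs (fun w => forall r : nat, exists i, D i w < r.+1%:R^-1).
Proof.
move=> hD D0 nD; apply: (qs_all hsl hsu) => r.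
pose A := \bigcap_i [set w | r.+1%:R^-1 <= D i w].
have mA : measurable A.
  apply: bigcap_measurable => // i _; rewrite -[X in measurable X]setTI.
  by apply: (measurable_fun_le (f := fun=> r.+1%:R^-1) (g := D i)) => //; exact: (hD i).1.
have h : qs (fun w => ~ A w).
  apply: (qs_meas hsl hsu mA) => P GP.
  have h i : EP P (\1_A : Omega R -> R) <= r.+1%:R / i.+1%:R.
    apply: (@le_trans _ _ (EP P (fun w => r.+1%:R * D i w))); last first.
      rewrite rEPZ; last exact: Lr_rint (hD i) GP.
      rewrite ler_pM2l// (le_trans _ (nD i P GP))//; apply: rEP_le.
      - exact: Lr_rint (hD i) GP.
      - exact: rint_norm (Lr_rint (hD i) GP).
      - by apply: aeW => w; exact: ler_norm.
    apply: rEP_le; [exact: rint_bmeas (bmeas_indic mA)|exact: rintZ (Lr_rint (hD i) GP)|].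
    apply: aeW => w; rewrite indicE; case: (boolP (w \in A)) => [/set_mem/(_ i I)/= h|_].
      by rewrite mulrC -ler_pdivrMr// div1r.
    by rewrite mulr_ge0.
  have h0 : EP P (\1_A : Omega R -> R) <= 0.
    apply/ler_addgt0Pl => e e0; rewrite addr0; have [i hi] := nat_ge (r.+1%:R / e).
    by apply: le_trans (h i) _; rewrite ler_pdivrMr// mulrC -ler_pdivrMr// (le_trans hi)// ler_nat.
  have h1 : 0 <= EP P (\1_A : Omega R -> R) by rewrite -lee_fin EP_indic// measure_ge0.
  by rewrite -EP_indic//; congr _%:E; apply/eqP; rewrite eq_le h0 h1.
apply: (qs_imp h) => w nA; apply: contrapT => /forallNP H; apply: nA => i _ /=.
by rewrite leNgt; apply/negP; exact: H.
Qed.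

(** Outside one polar set, approximating processes with continuous paths come uniformly as close as
    desired on [0, k + 1], with an index depending on the path. *)
Lemma X_continuous : qs (fun w => forall s (u : nat -> R), 0 <= s -> (forall n, 0 <= u n) -> u @ \oo --> s ->
  (fun n => X (u n) w) @ \oo --> X s w).
Proof.
have H (k : nat) : qs (fun w => forall s (u : nat -> R), 0 <= s <= k.+1%:R -> (forall n, 0 <= u n <= k.+1%:R) ->
    u @ \oo --> s -> (fun n => X (u n) w) @ \oo --> X s w).
  have ap (i : nat) : exists p : (R -> Omega R -> R) * (Omega R -> R),
      [/\ SG0 k.+1%:R p.1, Lr p.2, nle p.2 i.+1%:R^-1, forall w, 0 <= p.2 w &
      qs (fun w => forall t, 0 <= t <= k.+1%:R -> `|p.1 t w - X t w| `^ beta <= p.2 w)].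
    have i0 : 0 < i.+1%:R^-1 :> R by rewrite invr_gt0.
    by have [eta [D h]] := SG_approx b1 (ler0n _ _) (X_SG (ltn0Sn k)) i0; exists (eta, D).
  have [p hp] := choice ap.
  have q1 : qs (fun w => forall i t, 0 <= t <= k.+1%:R -> `|(p i).1 t w - X t w| `^ beta <= (p i).2 w).
    by apply: (qs_all hsl hsu) => i; case: (hp i).
  have q2 : qs (fun w => forall r : nat, exists i, (p i).2 w < r.+1%:R^-1).
    by apply: (qs_infimum0 (D := fun i => (p i).2)) => [i|i w|i]; case: (hp i).
  apply: (qs_and hsl hsu q1 q2) => w h1 h2 s u sT uT us.
  apply/cvgrPdist_le => e e0; have e3 : 0 < e / 3 by rewrite divr_gt0.
  have [r hr] := nat_ge ((e / 3) `^ beta)^-1; have [i hi] := h2 r.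
  have close t : 0 <= t <= k.+1%:R -> `|(p i).1 t w - X t w| <= e / 3.
    move=> tT; rewrite leNgt; apply/negP => lt.
    have b0 : 0 < beta by exact: lt_trans ltr01 b1.
    have m1 : e / 3 \in Num.nneg by rewrite nnegrE ltW.
    have m2 : `|(p i).1 t w - X t w| \in Num.nneg by rewrite nnegrE.
    have := gt0_ltr_powR b0 m1 m2 lt => /lt_le_trans/(_ (h1 i t tT))/lt_trans/(_ hi); apply/negP; rewrite -leNgt.
    by rewrite invf_ple ?posrE ?powR_gt0// (le_trans hr)// ler_nat.
  have [S0 _ _ _ _] := hp i; have := SG0_cvg (w := w) S0 sT uT us.
  move/cvgrPdist_le/(_ _ e3); apply: filterS => n hn.
  have := close _ sT; have := close _ (uT n); rewrite !ler_norml => /andP[? ?] /andP[? ?].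
  by move: hn; rewrite !ler_norml => /andP[? ?]; apply/andP; split; lra.
apply: (qs_imp (qs_all hsl hsu H)) => w h s u s0 u0 us.
have [k hk] := nat_ge s; have k1 : s < k.+1%:R by rewrite (le_lt_trans hk)// ltr_nat.
have near_k : \forall n \near \oo, u n < k.+1%:R by exact: (cvgr_lt _ us).
(* Truncation at k + 1 brings the times into the interval and changes only finitely many of them. *)
pose v n := Num.min (u n) k.+1%:R.
have vs : v @ \oo --> s.
  apply: cvg_trans us; apply: near_eq_cvg; apply: filterS near_k => n hn.
  by rewrite /v min_l// ltW.
have := h k s v _ _ vs; rewrite s0 ltW// => /(_ isT) h'.
have {}h' := h' (fun n => _); apply: cvg_trans (h' _); last first.
  by move=> n; rewrite /v ge_min lexx orbT le_min u0 ler0n.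
by apply: near_eq_cvg; apply: filterS near_k => n hn; rewrite /v min_l// ltW.
Qed.

Hypothesis X_sup : (Ehat (sup_power beta [set t : R | (0 <= t)%R] X) < +oo)%E.

(** Over the countably many dyadic times the supremum is measurable, and these are the times at
    which the recursion and the dyadic stopping rules evaluate X. *)
Lemma X_envelope : exists D, [/\ Lr D, forall w, 0 <= D w & qs (fun w => forall n k, `|X (dyadic R n k) w| <= D w)].
Proof.
pose g n k w := (`|X (dyadic R n k) w| `^ beta)%:E.
pose Z w := esups (fun n => esups (g n ^~ w) 0) 0.
have mZ : measurable_fun setT Z.
  apply: (measurable_fun_esups (f := fun n w => esups (g n ^~ w) 0)) => n.
  apply: (measurable_fun_esups (f := g n)) => k; apply/measurable_EFinP.
  apply: (measurableT_comp (measurable_powR beta)); apply: measurableT_comp => //.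
  by apply: X_measurable; exact: dyadic_ge0.
have Zub w n k : (g n k w <= Z w)%E.
  apply: (@le_trans _ _ (esups (g n ^~ w) 0)); first by apply: ereal_sup_ubound; exists k.
  by apply: ereal_sup_ubound; exists n.
have Z0 w : (0 <= Z w)%E.
  by apply: le_trans (Zub w 0%N 0%N); rewrite lee_fin powR_ge0.
have Zle w : (Z w <= sup_power beta [set t : R | (0 <= t)%R] X w)%E.
  apply: ge_ereal_sup => _ [n _ <-]; apply: ge_ereal_sup => _ [k _ <-].
  by apply: ereal_sup_ubound; exists (dyadic R n k) => //; exact: dyadic_ge0.
have EZ : (Ehat Z <= Ehat (sup_power beta [set t : R | (0 <= t)%R] X))%E.
  by apply: Ehat_le => P GP; apply: le_trans (Ehat_ge _ GP); exact: ge0_integral_le_any.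
have EZf : Ehat Z = (fine (Ehat Z))%:E.
  by rewrite fineK// ge0_fin_numE ?Ehat_ge0//; exact: le_lt_trans EZ X_sup.
have [|hD _ qD D0] := @Ehat_envelope Z (fine (Ehat Z)) mZ Z0; first by rewrite -EZf.
exists (fun w => 1 + toR Z w); split=> [|w|].
- by apply: LrD => //; exact: Lr_bmeas (bmeas_cst 1).
- by rewrite addr_ge0.
- apply: (qs_imp qD) => w h n k; have := le_addr_powR b1 ltr01 (normr_ge0 (X (dyadic R n k) w)).
  rewrite powR1 invr1 mul1r => /le_trans; apply; rewrite lerD2l -lee_fin -h; exact: Zub.
Qed.

End regular_processes.

(** * The Snell envelope *)

Section adapted_sets.
Context {R : realType}.
Variables (sl su : R) (hsl : 0 <= sl) (hsu : sl <= su).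
Implicit Types (P Q : probability (Omega R) R) (A : set (Omega R)) (x y z : Omega R -> R) (e t s : R).
Local Notation GM := (@G_measures R sl su).
Local Notation qs := (@qs R sl su).
Local Notation Lr := (@Lr R sl su).
Local Notation adapted := (@adapted R sl su).
Local Notation rpair := (@rpair R sl su).
Local Notation rdom := (@rdom R sl su).

(** Events of F_t up to a polar set. Stopping rules are written with selected versions, which are
    only q.s. equal to functions of the stopped path. *)
Definition adapted_set t A := measurable A /\ exists2 A', Ft t%:E A' & qs (fun w => A w <-> A' w).

Lemma indicE_iff A A' w : (A w <-> A' w) -> (\1_A w : R) = \1_A' w.
Proof.
move=> h; rewrite !indicE; congr (_ %:R); congr nat_of_bool.
by apply/idP/idP => /set_mem hw; apply/mem_set/h.
Qed.

Lemma EP_ind_qs P x A A' : GM P -> Lr x -> measurable A -> measurable A' -> qs (fun w => A w <-> A' w) ->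
  EP P (fun w => x w * \1_A w) = EP P (fun w => x w * \1_A' w).
Proof.
move=> GP hx mA mA' h; have rx := Lr_rint hx GP.
by apply/eqP; rewrite eq_le; apply/andP; split; apply: rEP_le; try exact: rint_ind;
  apply: filterS (qs_ae hsl hsu h GP) => w hw; rewrite (indicE_iff hw).
Qed.

Lemma adapted_setT t : 0 <= t -> adapted_set t setT.
Proof.
move=> t0; split; first exact: measurableT.
by exists setT; [exact: Ft_setT|exact: (qs_true hsl hsu)].
Qed.

Lemma adapted_setC t A : adapted_set t A -> adapted_set t (~` A).
Proof.
move=> [mA [A' FA h]]; split; first exact: measurableC.
by exists (~` A'); [exact: Ft_setC|apply: (qs_imp h) => w [h1 h2]; split => /= n m; apply: n; auto].
Qed.

Lemma adapted_setI t A A' : adapted_set t A -> adapted_set t A' -> adapted_set t (A `&` A').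
Proof.
move=> [mA [A1 FA h]] [mA' [A2 FA' h']]; split; first exact: measurableI.
exists (A1 `&` A2).
  by move: FA FA' => /FtE[D mD ->] /FtE[D' mD' ->]; apply/FtE; exists (D `&` D') => //; exact: measurableI.
by apply: (qs_and hsl hsu h h') => w [a b] [c d]; split => -[? ?]; split; auto.
Qed.

Lemma adapted_set_le s t A : 0 <= s -> s <= t -> adapted_set s A -> adapted_set t A.
Proof.
move=> s0 st [mA [A1 FA h]]; split=> //; exists A1 => //.
exact: (Ft_le hsl hsu (le_trans s0 st) st FA).
Qed.

Lemma adapted_set_lt t x y : 0 <= t -> Lr x -> Lr y -> adapted t x -> adapted t y -> adapted_set t [set w | x w < y w].
Proof.
move=> t0 hx hy ax ay; split.
  have m := measurableC (measurable_fun_le measurableT hy.1 hx.1); rewrite setTI in m.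
  by move: m; congr measurable; apply/seteqP; split => w /=; rewrite ltNge => /negP.
have [A [FA h]] := adapted_lt hsl hsu t0 ax ay; exists A => //.
by apply: (qs_imp h) => w [h1 h2]; split.
Qed.

Lemma rdom_adapted_set t x y P A : 0 <= t -> rdom t x y -> GM P -> adapted_set t A ->
  EP P (fun w => x w * \1_A w) <= EP P (fun w => y w * \1_A w).
Proof.
move=> t0 [hx hy _ dom] GP [mA [A' FA h]]; have mA' := Ft_meas t0 FA.
by rewrite (EP_ind_qs GP hx mA mA' h) (EP_ind_qs GP hy mA mA' h); exact: dom.
Qed.

Lemma agree_adapted_set t P Q y A : 0 <= t -> GM P -> GM Q -> agree t P Q -> Lr y -> adapted t y ->
  adapted_set t A -> EP Q (fun w => y w * \1_A w) = EP P (fun w => y w * \1_A w).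
Proof.
move=> t0 GP GQ PQ hy ay [mA [A' FA h]]; have mA' := Ft_meas t0 FA.
rewrite (EP_ind_qs GP hy mA mA' h) (EP_ind_qs GQ hy mA mA' h).
exact: (agree_adapted hsl hsu t0 GP GQ PQ hy ay FA).
Qed.

Lemma rpair_loc_adapted_set t x y P e : 0 <= t -> rpair t x y -> GM P -> 0 < e ->
  exists Q, [/\ GM Q, agree t P Q & forall A, adapted_set t A ->
    EP P (fun w => y w * \1_A w) <= EP Q (fun w => x w * \1_A w) + e].
Proof.
move=> t0 xy GP e0; have [Q [GQ PQ H]] := rpair_loc hsl hsu t0 xy GP e0.
have [[hx hy _ _] _] := xy; exists Q; split=> // A [mA [A' FA h]]; have mA' := Ft_meas t0 FA.
by rewrite (EP_ind_qs GP hy mA mA' h) (EP_ind_qs GQ hx mA mA' h); exact: H.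
Qed.

Lemma EP_split P x A D : measurable A -> measurable D -> rint P x ->
  EP P (fun w => x w * \1_D w) = EP P (fun w => x w * \1_(D `&` A) w) + EP P (fun w => x w * \1_(D `&` ~` A) w).
Proof.
move=> mA mD rx; rewrite (rEP_ind_split mA (rint_ind mD rx)); congr (EP _ _ + EP _ _);
  by apply/funext => w; rewrite indicI /= mulrA.
Qed.

End adapted_sets.

Section dyadic_times.
Context {R : realType}.

Lemma dyadic_double n k : dyadic R n.+1 k.*2 = dyadic R n k.
Proof. by rewrite -mul2n dyadicS. Qed.

Lemma dyadicD n m k : dyadic R (n + m) (k * 2 ^ m) = dyadic R n k.
Proof.
elim: m => [|m IH]; first by rewrite addn0 expn0 muln1.
by rewrite addnS expnS mulnCA mul2n dyadic_double.
Qed.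

Lemma dyadic_le n k l : (k <= l)%N -> dyadic R n k <= dyadic R n l.
Proof. by move=> kl; rewrite /dyadic ler_pM2r ?invr_gt0 ?exprn_gt0// ler_nat. Qed.

Lemma dyadicS_time n k : dyadic R n k.+1 = dyadic R n k + (2 ^+ n)^-1.
Proof. by rewrite /dyadic -natr1 mulrDl mul1r. Qed.

End dyadic_times.

(** * Backward induction, stopping rules, and the limit in horizon and mesh *)

Section snell_envelope.
Context {R : realType}.
Variables (sl su : R) (hsl : 0 <= sl) (hsu : sl <= su).
Implicit Types (P Q : probability (Omega R) R) (x y z : Omega R -> R) (e t s : R) (n m j k i : nat).
Local Notation GM := (@G_measures R sl su).
Local Notation qs := (@qs R sl su).
Local Notation nle := (@nle R sl su).
Local Notation Lr := (@Lr R sl su).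
Local Notation adapted := (@adapted R sl su).
Local Notation adapted_set := (@adapted_set R sl su).
Local Notation rpair := (@rpair R sl su).
Local Notation rinc := (@rinc R sl su).
Local Notation RG := (@RG R sl su).
Local Notation LG1 := (@LG1 R sl su).
Local Notation L1 := (@L1 R sl su).
Variable X : R -> Omega R -> R.
Hypothesis X_RG : forall t, 0 <= t -> RG t%:E (X t).
Local Notation snS := (snell_steps sl su (fun t w => (X t w)%:E)).
Local Notation dy := (dyadic R).

Let dy0 n k : 0 <= dy n k. Proof. exact: dyadic_ge0. Qed.
Let dy0E n k : (0 <= (dy n k)%:E)%E. Proof. by rewrite lee_fin. Qed.

(** V^{n,k+j} at the time [dyadic n k]: j counts the remaining steps. [snell_cont] is the
    corresponding continuation value. *)
Definition snell_val n j k : Omega R -> R := toR (snS n j k).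
Definition snell_cont n j k : Omega R -> R := toR (Et sl su (dy n k) (snS n j k.+1)).
Local Notation v := snell_val.
Local Notation u := snell_cont.

Lemma RG_L1_EFin t x : 0 <= t -> RG t%:E x -> L1 t%:E (fun w => (x w)%:E).
Proof. by move=> t0 Gx; apply: L1_EFin => //; [exact: Gx.1|split=> //; exact: RG_adapted]. Qed.

Lemma snell_LG1 n j k : LG1 (dy n k)%:E (snS n j k).
Proof.
elim: j k => [|j IH] k /=.
  by apply: RG_LG1 => //; [apply: RG_L1_EFin => //; exact: X_RG|exact: X_RG].
have LE := Et_LG1 hsl hsu (dy0 n k) (dy0E n k.+1) (IH k.+1).
have [mE hE qE tE] := L1_toR hsl hsu (dy0E n k) LE.1.
have GM := RG_max hsl hsu (X_RG (dy0 n k)) (LG1_RG hsl hsu (dy0E n k) LE).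
set f := (fun w => _).
have qf : qs (fun w => f w = (Num.max (X (dy n k) w) (toR (Et sl su (dy n k) (snS n j k.+1)) w))%:E).
  by apply: (qs_imp qE) => w; rewrite /f => {1}->; rewrite -EFin_max.
have mf : measurable_fun setT f.
  apply: measurable_maxe => //; apply/measurable_EFinP; exact: (X_RG (dy0 n k)).1.1.
have Lf : L1 (dy n k)%:E f.
  by apply: (L1_of_real hsl hsu mf qf GM.1); split=> //; exact: RG_adapted.
apply: RG_LG1 => //; apply: (RG_qs hsl hsu GM); first by case: (L1_toR hsl hsu (dy0E n k) Lf).
by apply: (qs_imp qf) => w hw; rewrite /toR hw.
Qed.

Lemma snell_qs n j k : qs (fun w => snS n j k w = (v n j k w)%:E).
Proof. by case: (L1_toR hsl hsu (dy0E n k) (snell_LG1 n j k).1). Qed.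

Lemma snell_measurable n j k : measurable_fun setT (snS n j k).
Proof. by case: (L1_toR hsl hsu (dy0E n k) (snell_LG1 n j k).1). Qed.

Lemma snell_val_RG n j k : RG (dy n k)%:E (v n j k).
Proof. exact: (LG1_RG hsl hsu (dy0E n k) (snell_LG1 n j k)). Qed.

Lemma snell_val_Lr n j k : Lr (v n j k). Proof. exact: (snell_val_RG n j k).1. Qed.

Lemma LG1_LGbar (t : \bar R) Z : (0 <= t)%E -> LG1 t Z -> @LGbar R sl su t Z.
Proof. by move=> t0 h; apply/LGinc_sub_LGbar/LGdec_sub_LGinc/LG1_sub_LGdec. Qed.

Lemma snell_pair n j k : rpair (dy n k) (v n j k.+1) (u n j k).
Proof.
exact: (Et_pair hsl hsu (dy0 n k) (dy0E n k.+1) (LG1_LGbar (dy0E n k.+1) (snell_LG1 n j k.+1))).2.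
Qed.

Lemma snell_cont_RG n j k : RG (dy n k)%:E (u n j k).
Proof.
exact: (LG1_RG hsl hsu (dy0E n k) (Et_LG1 hsl hsu (dy0 n k) (dy0E n k.+1) (snell_LG1 n j k.+1))).
Qed.

Lemma snell_valS n j k : qs (fun w => v n j.+1 k w = Num.max (X (dy n k) w) (u n j k w)).
Proof.
have [] := L1_toR hsl hsu (dy0E n k) (Et_LG1 hsl hsu (dy0 n k) (dy0E n k.+1) (snell_LG1 n j k.+1)).1.
move=> _ _ h _; apply: (qs_imp h) => w hw.
have -> : v n j.+1 k w = fine (maxe (X (dy n k) w)%:E (Et sl su (dy n k) (snS n j k.+1) w)) by [].
by rewrite hw -EFin_max.
Qed.

Lemma snell_ge n j k : qs (fun w => X (dy n k) w <= v n j k w).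
Proof.
case: j => [|j]; first by apply: (qs_true hsl hsu).
by apply: (qs_imp (snell_valS n j k)) => w ->; rewrite le_max lexx.
Qed.

Lemma snell_cont_le n j k : qs (fun w => u n j k w <= v n j.+1 k w).
Proof. by apply: (qs_imp (snell_valS n j k)) => w ->; rewrite le_max lexx orbT. Qed.

Lemma qs_le_trans x y z : qs (fun w => x w <= y w) -> qs (fun w => y w <= z w) -> qs (fun w => x w <= z w).
Proof. by move=> h h'; apply: (qs_and hsl hsu h h') => w; exact: le_trans. Qed.

Lemma snell_step n j j' k : qs (fun w => v n j k.+1 w <= v n j' k.+1 w) ->
  qs (fun w => v n j.+1 k w <= v n j'.+1 k w).
Proof.
move=> h; have h1 := rpair_mono hsl hsu (dy0 n k) (snell_pair n j k) (snell_pair n j' k).1 h.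
apply: (qs_and hsl hsu h1 (_ : qs (fun w => v n j.+1 k w = Num.max (X (dy n k) w) (u n j k w) /\
  v n j'.+1 k w = Num.max (X (dy n k) w) (u n j' k w)))).
  by apply: (qs_and hsl hsu (snell_valS n j k) (snell_valS n j' k)).
by move=> w h2 [-> ->]; rewrite ge_max !le_max lexx h2 orbT.
Qed.

Lemma snell_mono1 n j k : qs (fun w => v n j k w <= v n j.+1 k w).
Proof. by elim: j k => [|j IH] k; [exact: snell_ge|exact: snell_step]. Qed.

Lemma snell_mono n j j' k : (j <= j')%N -> qs (fun w => v n j k w <= v n j' k w).
Proof.
move=> /subnK <-; elim: (j' - j)%N => [|d IH]; first by apply: (qs_true hsl hsu).
exact: qs_le_trans IH (snell_mono1 n _ k).
Qed.

Lemma rpair_refl t x : Lr x -> adapted t x -> rpair t x x.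
Proof.
move=> hx ax; split=> // P GP e e0; exists P; split=> //.
by rewrite lerDl ltW.
Qed.

Lemma RG_oo t x : RG t%:E x -> RG +oo%E x.
Proof. by apply: RG_le; exact: leey. Qed.

(** The tower property splits off the first of the i steps, and the value dominates the continuation
    value. *)
Lemma snell_supermartingale i n j k y : rpair (dy n k) (v n j (k + i)) y -> qs (fun w => y w <= v n (j + i) k w).
Proof.
elim: i j k y => [|i IH] j k y; rewrite ?addn0.
  move=> h; have := rpair_unique hsl hsu (dy0 n k) h (rpair_refl (snell_val_Lr n j k) (RG_adapted hsl hsu (dy0 n k) (snell_val_RG n j k))).
  by move=> q; apply: (qs_imp q) => w ->.
rewrite addnS -addSn => h.
have [z [_ [vz Gz _ _ _]]] := rpair_exists_RG hsl hsu (dy0 n k.+1) (RG_oo (snell_val_RG n j (k.+1 + i))).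
have [y' [_ [zy' _ _ _ _]]] := rpair_exists_RG hsl hsu (dy0 n k) (RG_oo Gz).
have tw := rpair_tower hsl hsu (dy0 n k) (dyadic_le n (leqnSn k)) vz zy'.
have e1 := rpair_unique hsl hsu (dy0 n k) h tw.
have e2 := rpair_mono hsl hsu (dy0 n k) zy' (snell_pair n (j + i) k).1 (IH _ _ _ vz).
rewrite addnS; apply: qs_le_trans (snell_cont_le n (j + i) k).
by apply: (qs_and hsl hsu e1 e2) => w ->.
Qed.

(** One coarse step is two fine ones, so both indices double. The finer value dominates X and, by
    the supermartingale property over two steps, the coarse continuation value. *)
Lemma snell_refine n j k : qs (fun w => v n j k w <= v n.+1 j.*2 k.*2 w).
Proof.
elim: j k => [|j IH] k; first by apply: (qs_true hsl hsu) => w; rewrite /v /toR /= dyadic_double.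
have G2 := snell_val_RG n.+1 j.*2 k.+1.*2.
have [y [_ [vy _ _ _ _]]] := rpair_exists_RG hsl hsu (dy0 n k) (RG_oo G2).
have e1 := rpair_mono hsl hsu (dy0 n k) (snell_pair n j k) vy.1 (IH k.+1).
have e2 : qs (fun w => y w <= v n.+1 j.+1.*2 k.*2 w).
  rewrite (_ : j.+1.*2 = (j.*2 + 2)%N); last by rewrite doubleS addn2.
  by apply: snell_supermartingale; rewrite dyadic_double addn2 -doubleS.
have e3 := qs_le_trans e1 e2; have e4 := snell_ge n.+1 j.+1.*2 k.*2; rewrite dyadic_double in e4.
apply: (qs_and hsl hsu (snell_valS n j k) (_ : qs (fun w => X (dy n k) w <= v n.+1 j.+1.*2 k.*2 w /\
  u n j k w <= v n.+1 j.+1.*2 k.*2 w))).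
  exact: (qs_and hsl hsu e4 e3).
by move=> w -> [a b]; rewrite ge_max a b.
Qed.

(** The rule A may depend on the number of steps that would remain as well as on the time, and
    stopping is forced at the horizon. *)
Fixpoint stop_time n (A : nat -> nat -> set (Omega R)) j k w : R :=
  if j is j'.+1 then if w \in A j' k then dy n k else stop_time n A j' k.+1 w else dy n k.

Lemma stop_time_dyadic n A j k w : exists m, stop_time n A j k w = dy n m.
Proof. by elim: j k => [|j IH] k /=; [exists k|case: ifP => _; [exists k|exact: IH]]. Qed.

Definition stop_val n A j k w := X (stop_time n A j k w) w.

Lemma stop_valS n A j k w : stop_val n A j.+1 k w = if w \in A j k then X (dy n k) w else stop_val n A j k.+1 w.
Proof. by rewrite /stop_val /=; case: ifP. Qed.

Variable D : Omega R -> R.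
Hypotheses (hD : Lr D) (D0 : forall w, 0 <= D w).
Hypothesis XD : qs (fun w => forall n k, `|X (dy n k) w| <= D w).

Lemma stop_val_le n A j k : qs (fun w => `|stop_val n A j k w| <= D w).
Proof. by apply: (qs_imp XD) => w h; rewrite /stop_val; have [m ->] := stop_time_dyadic n A j k w. Qed.

Lemma stop_val_Lr n A j k : (forall j k, measurable (A j k)) -> Lr (stop_val n A j k).
Proof.
move=> mA; apply: (Lr_qs_le hsl hsu _ hD (stop_val_le n A j k)).
elim: j k => [|j IH] k; first exact: (X_RG (dy0 n k)).1.1.
rewrite (_ : stop_val n A j.+1 k = fun w => if w \in A j k then X (dy n k) w else stop_val n A j k.+1 w); last first.
  by apply/funext => w; rewrite stop_valS.
apply: measurable_fun_ifT; [|exact: (X_RG (dy0 n k)).1.1|exact: IH].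
apply: (measurable_fun_bool true); rewrite setTI (_ : _ @^-1` _ = A j k)//.
by apply/seteqP; split => w /= => [/set_mem|/mem_set].
Qed.

Lemma stop_val_split P n A j k E : GM P -> (forall j k, measurable (A j k)) -> measurable E ->
  EP P (fun w => stop_val n A j.+1 k w * \1_E w) =
  EP P (fun w => X (dy n k) w * \1_(E `&` A j k) w) + EP P (fun w => stop_val n A j k.+1 w * \1_(E `&` ~` A j k) w).
Proof.
move=> GP mA mE; rewrite (EP_split (mA j k) mE (Lr_rint (stop_val_Lr n j.+1 k mA) GP)).
by congr (EP _ _ + EP _ _); apply/funext => w; rewrite stop_valS !indicE !in_setI ?in_setC; case: (w \in A j k); rewrite ?andbF ?mulr0.
Qed.

(** Optional sampling by backward induction. The event E is general because it has to record that
    stopping has not yet occurred. *)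
Lemma stopped_le_snell n A j k P E : (forall j k, adapted_set (dy n k) (A j k)) -> GM P -> adapted_set (dy n k) E ->
  EP P (fun w => stop_val n A j k w * \1_E w) <= EP P (fun w => v n j k w * \1_E w).
Proof.
move=> aA GP; have mA j' k' : measurable (A j' k') by case: (aA j' k').
elim: j k E => [|j IH] k E aE; first exact: lexx.
have [mE _] := aE; rewrite (stop_val_split _ _ _ GP mA mE).
rewrite (EP_split (mA j k) mE (Lr_rint (snell_val_Lr n j.+1 k) GP)).
have ae1 := adapted_setI hsl hsu aE (aA j k).
have ae2 := adapted_setI hsl hsu aE (adapted_setC (aA j k)).
apply: lerD.
  apply: rEP_le; [exact: rint_ind ae1.1 (Lr_rint (X_RG (dy0 n k)).1 GP)|exact: rint_ind ae1.1 (Lr_rint (snell_val_Lr _ _ _) GP)|].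
  apply: filterS (qs_ae hsl hsu (snell_ge n j.+1 k) GP) => w h.
  by rewrite ler_wpM2r// indicE.
apply: le_trans (IH k.+1 _ (adapted_set_le hsl hsu (dy0 n k) (dyadic_le n (leqnSn k)) ae2)) _.
apply: le_trans (rdom_adapted_set hsl hsu (dy0 n k) (snell_pair n j k).1 GP ae2) _.
apply: rEP_le; [exact: rint_ind ae2.1 (Lr_rint (snell_cont_RG n j k).1 GP)|exact: rint_ind ae2.1 (Lr_rint (snell_val_Lr _ _ _) GP)|].
apply: filterS (qs_ae hsl hsu (snell_cont_le n j k) GP) => w h.
by rewrite ler_wpM2r// indicE.
Qed.

(** q.s. the event that the value equals X, expressed through the continuation value. *)
Definition snell_rule n j k := [set w | u n j k w <= X (dy n k) w].

Lemma snell_rule_adapted n j k : adapted_set (dy n k) (snell_rule n j k).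
Proof.
have := adapted_set_lt hsl hsu (dy0 n k) (X_RG (dy0 n k)).1 (snell_cont_RG n j k).1
  (RG_adapted hsl hsu (dy0 n k) (X_RG (dy0 n k))) (RG_adapted hsl hsu (dy0 n k) (snell_cont_RG n j k)).
move=> /adapted_setC; congr (adapted_set _ _); apply/seteqP; split => w /=.
  by move=> /negP; rewrite -leNgt.
by rewrite /snell_rule /= leNgt => /negP.
Qed.

(** Q comes from successive near attainment: each stage agrees with the preceding measure up to the
    current time, with half of the remaining error. Agreement with P at time k lets the part already
    stopped be computed under P. *)
Lemma snell_attained n j k P e : GM P -> 0 < e -> exists Q, [/\ GM Q, agree (dy n k) P Q &
  forall E, adapted_set (dy n k) E ->
    EP P (fun w => v n j k w * \1_E w) <= EP Q (fun w => stop_val n (snell_rule n) j k w * \1_E w) + e].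
Proof.
have mA j' k' : measurable (snell_rule n j' k') by case: (snell_rule_adapted n j' k').
elim: j k P e => [|j IH] k P e GP e0.
  by exists P; split=> // E aE; rewrite lerDl ltW.
have e2 : 0 < e / 2 by rewrite divr_gt0.
have [Q1 [GQ1 PQ1 H1]] := rpair_loc_adapted_set hsl hsu (dy0 n k) (snell_pair n j k) GP e2.
have [Q [GQ PQ H]] := IH k.+1 Q1 _ GQ1 e2.
have kk := dyadic_le n (leqnSn k) : dy n k <= dy n k.+1.
have PQ' : agree (dy n k) P Q := agree_trans hsl hsu (dy0 n k.+1) kk PQ1 PQ.
exists Q; split=> // E aE; have [mE _] := aE; have aA := snell_rule_adapted n j k.
have ae1 := adapted_setI hsl hsu aE aA.
have ae2 := adapted_setI hsl hsu aE (adapted_setC aA).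
rewrite (stop_val_split _ _ _ GQ mA mE) (EP_split (mA j k) mE (Lr_rint (snell_val_Lr n j.+1 k) GP)).
have -> : EP Q (fun w => X (dy n k) w * \1_(E `&` snell_rule n j k) w) =
    EP P (fun w => X (dy n k) w * \1_(E `&` snell_rule n j k) w).
  exact: (agree_adapted_set hsl hsu (dy0 n k) GP GQ PQ' (X_RG (dy0 n k)).1 (RG_adapted hsl hsu (dy0 n k) (X_RG (dy0 n k))) ae1).
rewrite -addrA; apply: lerD.
  apply: rEP_le; [exact: rint_ind ae1.1 (Lr_rint (snell_val_Lr _ _ _) GP)|exact: rint_ind ae1.1 (Lr_rint (X_RG (dy0 n k)).1 GP)|].
  apply: filterS (qs_ae hsl hsu (snell_valS n j k) GP) => w ->; rewrite indicE in_setI.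
  case: (boolP (w \in snell_rule n j k)) => [/set_mem/=|_]; last by rewrite andbF !mulr0.
  by rewrite /snell_rule /= => h; rewrite max_l.
apply: (@le_trans _ _ (EP P (fun w => u n j k w * \1_(E `&` ~` snell_rule n j k) w))).
  apply: rEP_le; [exact: rint_ind ae2.1 (Lr_rint (snell_val_Lr _ _ _) GP)|exact: rint_ind ae2.1 (Lr_rint (snell_cont_RG n j k).1 GP)|].
  apply: filterS (qs_ae hsl hsu (snell_valS n j k) GP) => w ->; rewrite indicE in_setI in_setC.
  case: (boolP (w \in snell_rule n j k)) => [_|h]; first by rewrite andbF !mulr0.
  by rewrite max_r// ltW// ltNge; apply/negP => h'; move/negP: h; apply; exact: mem_set.
have h1 := H1 _ ae2; have h2 := H _ (adapted_set_le hsl hsu (dy0 n k) kk ae2).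
by apply: (le_trans h1); rewrite [leRHS](_ : _ = EP Q (fun w => stop_val n (snell_rule n) j k.+1 w * \1_(E `&` ~` snell_rule n j k) w) + e / 2 + e / 2) ?lerD2r//; field.
Qed.

Lemma snell_attained0 n j k P e : GM P -> 0 < e -> exists2 Q, GM Q &
  EP P (v n j k) <= EP Q (stop_val n (snell_rule n) j k) + e.
Proof.
move=> GP e0; have [Q [GQ _ H]] := snell_attained n j k GP e0; exists Q => //.
have := H _ (adapted_setT hsl hsu (dy0 n k)).
have E (g : Omega R -> R) : (fun w => g w * \1_setT w) = g by apply/funext => w; rewrite indicT mulr1.
by rewrite !E.
Qed.

(** From below the value is at least X, hence at least - D; from above its expectation is nearly
    that of X at a stopping rule, hence at most that of D. The absolute value is thus below
    [v + 2 * D]. *)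
Lemma snell_bound : exists M, forall n j k, nle (v n j k) M.
Proof.
have [M M0 nD] := Lr_nle hsl hsu hD.
have ED P : GM P -> EP P D <= M.
  move=> GP; apply: le_trans (nD P GP); apply: rEP_le; [exact: Lr_rint hD GP|exact: rint_norm (Lr_rint hD GP)|].
  by apply: aeW => w; exact: ler_norm.
exists (M + 1 + 2 * M) => n j k P GP.
have rv := Lr_rint (snell_val_Lr n j k) GP; have rD := Lr_rint hD GP.
have mA j' k' : measurable (snell_rule n j' k') by case: (snell_rule_adapted n j' k').
apply: (@le_trans _ _ (EP P (fun w => v n j k w + 2 * D w))).
  apply: rEP_le; [exact: rint_norm|exact: rintD (rintZ _ rD)|].
  apply: filterS2 (qs_ae hsl hsu (snell_ge n j k) GP) (qs_ae hsl hsu XD GP) => w h1 /(_ n k).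
  have := D0 w; rewrite !ler_norml => ? /andP[? ?]; apply/andP; split; lra.
rewrite rEPD ?rEPZ//; last exact: rintZ.
apply: lerD; last by rewrite ler_pM2l// ED.
have [Q GQ h] := snell_attained0 n j k GP ltr01; apply: (le_trans h); rewrite lerD2r.
apply: le_trans (ED Q GQ); apply: rEP_le; [exact: Lr_rint (stop_val_Lr _ _ _ mA) GQ|exact: Lr_rint hD GQ|].
by apply: filterS (qs_ae hsl hsu (stop_val_le n (snell_rule n) j k) GQ) => w; rewrite ler_norml => /andP[].
Qed.

(* Horizon and mesh are exhausted along one sequence: an iterated increasing
   limit would not exhibit V_t as an element of L_G^{1^*_*}. *)
Definition snell_diag n k m := v (n + m) ((n + m) * 2 ^ (n + m)) (k * 2 ^ m).

Lemma snell_diag_RG n k m : RG (dy n k)%:E (snell_diag n k m).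
Proof. by rewrite -(dyadicD n m k); exact: snell_val_RG. Qed.

Lemma snell_diag_mono n k m : qs (fun w => snell_diag n k m w <= snell_diag n k m.+1 w).
Proof.
apply: qs_le_trans (snell_refine _ _ _) _; rewrite /snell_diag addnS (_ : k * 2 ^ m.+1 = (k * 2 ^ m).*2)%N; last first.
  by rewrite expnS mulnCA mul2n.
by apply: snell_mono; rewrite expnS mulnCA mul2n leq_double leq_mul2r leqnSn orbT.
Qed.

(** Each value with finite horizon and mesh is overtaken by the diagonal sequence, so the latter
    loses nothing in the limit. *)
Lemma snell_le_diag n k m j : exists p, qs (fun w => v (n + m) j (k * 2 ^ m) w <= snell_diag n k p w).
Proof.
have H p : qs (fun w => v (n + m) j (k * 2 ^ m) w <= v (n + (m + p)) (j * 2 ^ p) (k * 2 ^ (m + p)) w).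
  elim: p => [|p IH]; first by rewrite addn0 expn0 muln1; apply: (qs_true hsl hsu).
  apply: qs_le_trans IH _; rewrite !addnS !expnS !(mulnCA _ 2) !mul2n; exact: snell_refine.
exists (m + j)%N; apply: qs_le_trans (H j) _; apply: snell_mono; rewrite leq_mul//.
  by rewrite addnA leq_addl.
by rewrite leq_exp2l// addnA leq_addl.
Qed.

Lemma snell_limit n k : exists y, [/\ Lr y, adapted (dy n k) y, rinc (snell_diag n k) y &
  qs (fun w => forall m j, v (n + m) j (k * 2 ^ m) w <= y w)].
Proof.
have [M hM] := snell_bound.
have [|||y [hy ay iy]] := @adapted_rinc _ sl su hsl hsu (dy n k) (snell_diag n k) M (dy0 n k) (fun m => (snell_diag_RG n k m).1).
- by move=> m; exact: RG_adapted (snell_diag_RG n k m).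
- by move=> m; exact: hM.
- by move=> m; exact: snell_diag_mono.
exists y; split=> //; apply: (qs_all hsl hsu) => m; apply: (qs_all hsl hsu) => j.
have [p hp] := snell_le_diag n k m j; apply: (qs_and hsl hsu hp (rinc_le iy)) => w h1 h2.
exact: le_trans h1 (h2 p).
Qed.

(** For m >= n the inner limit over the horizon lies between a term of the diagonal sequence and its
    limit y. *)
Lemma snell_limitE n k y : rinc (snell_diag n k) y -> qs (fun w => forall m j, v (n + m) j (k * 2 ^ m) w <= y w) ->
  qs (fun w => limn (fun m => snell sl su (fun t w' => (X t w')%:E) m (k * 2 ^ (m - n)) w) = (y w)%:E).
Proof.
move=> iy yub.
have qv : qs (fun w => forall n j k, snS n j k w = (v n j k w)%:E).
  by do 3 (apply: (qs_all hsl hsu) => ?); exact: snell_qs.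
have qm : qs (fun w => forall n k j, v n j k w <= v n j.+1 k w).
  by do 3 (apply: (qs_all hsl hsu) => ?); exact: snell_mono1.
apply: (qs_and hsl hsu (qs_and hsl hsu iy yub (fun w => @conj _ _)) (qs_and hsl hsu qv qm (fun w => @conj _ _))).
move=> w [[_ cy] ub] [vE mono].
apply: cvg_lim => //.
have nd m k' : nondecreasing_seq (fun N => snellN sl su (fun t w' => (X t w')%:E) m N k' w).
  apply/nondecreasing_seqP => N; rewrite /snellN !vE lee_fin.
  (* For N below k' the truncated difference is 0 and the sequence is constant. *)
  by have [kN|kN] := leqP k' N; [rewrite subSn|rewrite (eqP (ltnW kN)) (eqP kN)].
have cv m k' := ereal_nondecreasing_is_cvgn (nd m k').
have c1 : (fun m => (snell_diag n k (m - n) w)%:E) @ \oo --> (y w)%:E.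
  apply: cvg_EFin; first exact: nearW.
  rewrite (_ : _ \o _ = fun m => snell_diag n k (m - n) w)//.
  by apply: cvg_comp cy; exact: cvg_subnr.
apply: (squeeze_cvge _ c1 (cvg_cst (y w)%:E)).
exists n => // m /= nm; apply/andP; split.
  apply: lime_ge => //; exists ((m * 2 ^ m) + k * 2 ^ (m - n))%N => // N /= hN.
  by apply: le_trans (nd m _ _ _ hN); rewrite /snellN addnK vE /snell_diag subnKC.
apply: lime_le => //; apply: nearW => N; rewrite /snellN vE lee_fin.
by have := ub (m - n)%N (N - k * 2 ^ (m - n))%N; rewrite subnKC.
Qed.

End snell_envelope.

(** * The value process *)

Section snell_supermartingale.
Context {R : realType}.
Variables (sl su : R) (hsl : 0 <= sl) (hsu : sl <= su).
Implicit Types (P Q : probability (Omega R) R) (x y z : Omega R -> R) (e t s : R) (n m j k i : nat).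
Local Notation GM := (@G_measures R sl su).
Local Notation qs := (@qs R sl su).
Local Notation Lr := (@Lr R sl su).
Local Notation adapted := (@adapted R sl su).
Local Notation adapted_set := (@adapted_set R sl su).
Local Notation rpair := (@rpair R sl su).
Local Notation rinc := (@rinc R sl su).
Local Notation RG := (@RG R sl su).
Local Notation dy := (dyadic R).
Variables (beta : R) (b1 : 1 < beta) (X : R -> Omega R -> R).
Hypothesis X_SG : forall n : nat, (0 < n)%N -> SG sl su beta n%:R X.
Hypothesis X_sup : (Ehat sl su (sup_power beta [set t : R | (0 <= t)%R] X) < +oo)%E.
Variable V : R -> Omega R -> \bar R.
Hypothesis V_def : forall (n k : nat) (w : Omega R), V (dyadic R n k) w =
  limn (fun m : nat => snell sl su (fun t w' => (X t w')%:E) m (k * 2 ^ (m - n))%N w).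
Local Notation v := (snell_val sl su X).
Local Notation diag := (snell_diag sl su X).

Let XRG t : 0 <= t -> RG t%:E (X t) := X_RG hsl hsu b1 X_SG (t := t).
Let dy0 n k : 0 <= dy n k. Proof. exact: dyadic_ge0. Qed.
Let dy0E n k : (0 <= (dy n k)%:E)%E. Proof. by rewrite lee_fin. Qed.

Lemma value_limit n k : exists y, [/\ Lr y, adapted (dy n k) y, rinc (diag n k) y,
  qs (fun w => forall m j, v (n + m) j (k * 2 ^ m) w <= y w) & qs (fun w => V (dy n k) w = (y w)%:E)].
Proof.
have [D [hD D0 XD]] := X_envelope hsl hsu b1 X_SG X_sup.
have [y [hy ay iy uy]] := snell_limit hsl hsu XRG hD D0 XD n k.
exists y; split=> //; apply: (qs_imp (snell_limitE hsl hsu XRG iy uy)) => w <-; exact: V_def.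
Qed.

Lemma value_measurable n k : measurable_fun setT (V (dy n k)).
Proof.
rewrite (_ : V _ = fun w => limn (fun m : nat => snell sl su (fun t w' => (X t w')%:E) m (k * 2 ^ (m - n))%N w)); last first.
  by apply/funext => w; exact: V_def.
apply: (measurable_limn (f := fun m w => snell sl su (fun t w' => (X t w')%:E) m (k * 2 ^ (m - n))%N w)) => m.
apply: (measurable_limn (f := fun N w => snellN sl su (fun t w' => (X t w')%:E) m N (k * 2 ^ (m - n))%N w)) => N.
exact: snell_measurable.
Qed.

Lemma value_L1 n k : L1 sl su (dy n k)%:E (V (dy n k)).
Proof.
have [y [hy ay _ _ qy]] := value_limit n k.
by apply: (L1_of_real hsl hsu (value_measurable n k) qy hy); split.
Qed.

Lemma value_LGinc n k : LGinc sl su (dy n k)%:E (V (dy n k)).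
Proof.
have LV := value_L1 n k; split=> //.
pose Z m := snell_steps sl su (fun t w' => (X t w')%:E) (n + m) ((n + m) * 2 ^ (n + m)) (k * 2 ^ m).
have LZ m : LG1 sl su (dy n k)%:E (Z m).
  by rewrite -(dyadicD n m k); exact: snell_LG1.
exists Z => [m|]; first exact: (LG1_sub_LGdec hsl hsu).
apply/(qs_increasesP hsl hsu (dy0E n k) (dy0E n k) (fun m => (LZ m).1) LV).
have [y [_ _ iy _ qy]] := value_limit n k.
apply: (qs_and hsl hsu iy qy) => w [mono cv] E; split=> //.
by rewrite /toR E.
Qed.

Lemma value_LGbar n k : LGbar sl su (dy n k)%:E (V (dy n k)).
Proof. exact: (LGinc_sub_LGbar hsl hsu (dy0E n k) (value_LGinc n k)). Qed.

(** The conditional expectation of the later value is the increasing limit of those of its diagonal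
    approximations, and each of these is below a finite-horizon value at the earlier time. *)
Lemma value_supermartingale n k i :
  qs (fun w => (Et sl su (dy n k) (V (dy n (k + i))) w <= V (dy n k) w)%E).
Proof.
have [y [hy ay iy uy qy]] := value_limit n k.
have [z [hz az iz uz qz]] := value_limit n (k + i).
have [LE pE] := Et_pair hsl hsu (dy0 n k) (dy0E n (k + i)) (value_LGbar n (k + i)).
have [_ _ qE _] := L1_toR hsl hsu (dy0E n k) LE.
have ex m : exists x, rpair (dy n k) (diag n (k + i) m) x.
  by have [x [_ [? _ _ _ _]]] := rpair_exists_RG hsl hsu (dy0 n k) (RG_oo (snell_diag_RG hsl hsu XRG n (k + i) m)); exists x.
have [x hx] := choice ex.
have [z' zz' ix] := rpair_exists_inc hsl hsu (dy0 n k) hx hz iz.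
have xy m : qs (fun w => x m w <= y w).
  have h : qs (fun w => x m w <= v (n + m) ((n + m) * 2 ^ (n + m) + i * 2 ^ m) (k * 2 ^ m) w).
    apply: (snell_supermartingale hsl hsu XRG); rewrite -mulnDl dyadicD; exact: hx.
  by apply: (qs_and hsl hsu h uy) => w h1 h2; exact: le_trans h1 (h2 m _).
have z'y : qs (fun w => z' w <= y w).
  apply: (qs_and hsl hsu ix (qs_all hsl hsu xy)) => w [_ c] h.
  by rewrite -(cvg_lim _ c)//; apply: limr_le; [apply/cvg_ex; exists (z' w)|exact: nearW].
have e1 : qs (fun w => toR (Et sl su (dy n k) (V (dy n (k + i)))) w <= z' w).
  apply: (rpair_mono hsl hsu (dy0 n k) pE zz'.1).
  by apply: (qs_imp qz) => w h; rewrite /toR h.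
apply: (qs_and hsl hsu (qs_and hsl hsu qE qy (fun w => @conj _ _)) (qs_and hsl hsu e1 z'y (fun w => @conj _ _))).
by move=> w [-> ->] [h1 h2]; rewrite lee_fin (le_trans h1).
Qed.

Lemma value_dominates n k : qs (fun w => ((X (dy n k) w)%:E <= V (dy n k) w)%E).
Proof.
have [y [_ _ _ uy qy]] := value_limit n k.
apply: (qs_and hsl hsu uy qy) => w h ->; have := h 0%N 0%N.
by rewrite lee_fin addn0 expn0 muln1.
Qed.

Lemma value_minimal U : G_supermartingale sl su U -> dominates sl su U (fun t w => (X t w)%:E) ->
  forall n k, qs (fun w => (V (dy n k) w <= U (dy n k) w)%E).
Proof.
move=> [UB US] UX.
have dyd n k : dyadics (dy n k) by exists n, k.
have UL n k := L1_toR hsl hsu (dy0E n k) (UB _ (dyd n k)).1.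
have H n j k : qs (fun w => v n j k w <= toR (U (dy n k)) w).
  elim: j k => [|j IH] k; have [_ _ qU _] := UL n k.
    by apply: (qs_and hsl hsu qU (UX _ (dyd n k))) => w ->.
  have [LE pE] := Et_pair hsl hsu (dy0 n k) (dy0E n k.+1) (UB _ (dyd n k.+1)).
  have [_ _ qE _] := L1_toR hsl hsu (dy0E n k) LE.
  have h1 := rpair_mono hsl hsu (dy0 n k) (snell_pair hsl hsu XRG n j k) pE.1 (IH k.+1).
  have h2 := US _ _ (dyd n k) (dyd n k.+1) (dyadic_le n (leqnSn k)).
  apply: (qs_and hsl hsu (qs_and hsl hsu qU qE (fun w => @conj _ _)) (qs_and hsl hsu (qs_and hsl hsu h1 h2 (fun w => @conj _ _))
    (qs_and hsl hsu (snell_valS hsl hsu XRG n j k) (UX _ (dyd n k)) (fun w => @conj _ _)) (fun w => @conj _ _))).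
  move=> w [qU' qE'] [[a b] [-> d]]; rewrite ge_max; apply/andP; split.
    by rewrite -lee_fin -qU'.
  by apply: (le_trans a); rewrite -lee_fin -qE' -qU'.
move=> n k; have [y [_ _ iy _ qy]] := value_limit n k; have [_ _ qU _] := UL n k.
have h : qs (fun w => forall m, diag n k m w <= toR (U (dy n k)) w).
  by apply: (qs_all hsl hsu) => m; rewrite -(dyadicD n m k); exact: H.
apply: (qs_and hsl hsu (qs_and hsl hsu iy h (fun w => @conj _ _)) (qs_and hsl hsu qy qU (fun w => @conj _ _))).
move=> w [[_ c] ub] [-> ->]; rewrite lee_fin.
by rewrite -(cvg_lim _ c)//; apply: limr_le; [apply/cvg_ex; exists (y w)|exact: nearW].
Qed.

Lemma dyadics_common s t : dyadics s -> dyadics t -> s <= t ->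
  exists n k i, s = dy n k /\ t = dy n (k + i).
Proof.
move=> [n [k ->]] [m [l ->]]; rewrite -(dyadicD n m k) -(dyadicD m n l) (addnC m n) => h.
exists (n + m)%N, (k * 2 ^ m)%N, (l * 2 ^ n - k * 2 ^ m)%N; split=> //; rewrite subnKC//.
by move: h; rewrite /dyadic ler_pM2r ?invr_gt0 ?exprn_gt0// ler_nat.
Qed.

Lemma value_smallest : smallest_G_supermartingale_dominating sl su V (fun t w => (X t w)%:E).
Proof.
split; first split.
- by move=> _ [n [k ->]]; exact: value_LGbar.
- move=> s t ds dt st; have [n [k [i [-> ->]]]] := dyadics_common ds dt st.
  exact: value_supermartingale.
- by move=> _ [n [k ->]]; exact: value_dominates.
- by move=> U sU dU _ [n [k ->]]; exact: value_minimal.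
Qed.

Lemma stop0 (w w' : Omega R) : stop 0 w = stop 0 w'.
Proof.
have h (s : R) : Num.min s 0 <= 0 by rewrite ge_min lexx orbT.
by apply: B_inj => s; rewrite !B_stop !(B_le0 _ (h s)).
Qed.

(** All paths stopped at 0 coincide, so a variable adapted at time 0 is q.s. the constant c. *)
Lemma value_init : exists c : R, [/\ qs (fun w => V 0 w = c%:E),
  forall n j, qs (fun w => v n j 0 w <= c) &
  forall P e, GM P -> 0 < e -> exists m, c - e <= EP P (v m (m * 2 ^ m) 0)].
Proof.
have d00 : dy 0 0 = 0 by rewrite /dyadic mul0r.
have [y [hy [y' my' yy'] iy uy qy]] := value_limit 0 0; rewrite d00 in yy' qy.
pose c := y' (stop 0 point); have yc : qs (fun w => y w = c).
  by apply: (qs_imp yy') => w ->; rewrite /c (stop0 w point).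
exists c; split.
- by apply: (qs_and hsl hsu qy yc) => w -> ->.
- by move=> n j; apply: (qs_and hsl hsu uy yc) => w h <-; have := h n j.
- move=> P e GP e0.
  have := EP_monotone0 hsl hsu GP (fun m => (snell_diag_RG hsl hsu XRG 0 0 m).1) hy (rinc_dom hsl hsu iy).
  have -> : EP P y = c.
    rewrite -[RHS](EP_cst P); have rc := Lr_rint (Lr_bmeas sl su (bmeas_cst c)) GP.
    by apply/eqP; rewrite eq_le; apply/andP; split; apply: rEP_le => //; try exact: Lr_rint hy GP;
      apply: filterS (qs_ae hsl hsu yc GP) => w ->.
  move/cvgrPdist_le/(_ _ e0) => [m _ /(_ m (leqnn m))]; rewrite ler_norml => /andP[_ h].
  by exists m; move: h; rewrite /snell_diag add0n mul0n lerBlDl -lerBlDr.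
Qed.

End snell_supermartingale.

(** * Optimal stopping *)

Section optimal_stopping.
Context {R : realType}.
Variables (sl su : R) (hsl : 0 <= sl) (hsu : sl <= su).
Implicit Types (P Q : probability (Omega R) R) (x y z tau : Omega R -> R) (e t s : R) (n m j k i : nat) (A : set (Omega R)).
Local Notation GM := (@G_measures R sl su).
Local Notation qs := (@qs R sl su).
Local Notation Lr := (@Lr R sl su).
Local Notation adapted := (@adapted R sl su).
Local Notation adapted_set := (@adapted_set R sl su).
Local Notation RG := (@RG R sl su).
Local Notation dy := (dyadic R).
Let dy0 n k : 0 <= dy n k. Proof. exact: dyadic_ge0. Qed.

Lemma adapted_set_ind t A : 0 <= t -> adapted_set t A <-> measurable A /\ adapted t (\1_A : Omega R -> R).
Proof.
move=> t0; split=> [[mA [A' /FtE[D mD ->] h]]|[mA aA]].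
  split=> //; exists (\1_D : Omega R -> R); first exact: measurable_indic.
  by apply: (qs_imp h) => w hw; rewrite (indicE_iff hw) !indicE; congr (_ %:R); congr nat_of_bool;
    apply/idP/idP => /set_mem hw'; apply/mem_set.
split=> //; have h2 : adapted t (fun=> 2^-1).
  by apply: (RG_adapted hsl hsu t0); exact: RG_cst.
have [A' [FA' h]] := adapted_lt hsl hsu t0 h2 aA; exists A' => //.
apply: (qs_imp h) => w [h1 h3]; split=> [Aw|/h1].
  by apply: h3; rewrite indicE mem_set//= invf_lt1// ltr1n.
by rewrite indicE; case: (boolP (w \in A)) => [/set_mem//|_]; rewrite ltNge invr_ge0 ler0n.
Qed.

Lemma adapted_setU t A A' : adapted_set t A -> adapted_set t A' -> adapted_set t (A `|` A').
Proof.
move=> aA aA'; rewrite -[_ `|` _]setCK setCU; apply: adapted_setC; apply: (adapted_setI hsl hsu); exact: adapted_setC.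
Qed.

Lemma le_stop_time n (rule : nat -> nat -> set (Omega R)) j k w :
  dy n k <= stop_time n rule j k w <= dy n (k + j).
Proof.
elim: j k => [|j IH] k /=; first by rewrite addn0 lexx.
have [h1 h2] := andP (IH k.+1).
case: ifP => _; apply/andP; split=> //; first by apply: dyadic_le; exact: leq_addr.
  by apply: le_trans h1; exact: dyadic_le.
by apply: (le_trans h2); rewrite addSnnS.
Qed.

(** The rule stops at the first grid time not before tau, provided that the horizon lies beyond tau
    and that the starting time is at most one mesh late. *)
Lemma stop_time_approx n tau j k w : 0 <= tau w ->
  tau w <= dy n (k + j) -> dy n k <= tau w + (2 ^+ n)^-1 ->
  tau w <= stop_time n (fun _ k => [set w | tau w <= dy n k]) j k w <= tau w + (2 ^+ n)^-1.
Proof.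
move=> t0; elim: j k => [|j IH] k; first by rewrite addn0 /= => -> ->.
move=> h1 h2 /=; case: (boolP (w \in _)) => [/set_mem/= -> //|h3]; apply: IH.
  by rewrite addSnnS.
by rewrite dyadicS_time lerD2r leNgt; apply/negP => h4; move/negP: h3; apply; apply: mem_set; exact: ltW.
Qed.

Variables (beta : R) (b1 : 1 < beta) (X : R -> Omega R -> R).
Hypothesis X_SG : forall n : nat, (0 < n)%N -> SG sl su beta n%:R X.
Hypothesis X_sup : (Ehat sl su (sup_power beta [set t : R | (0 <= t)%R] X) < +oo)%E.
Local Notation v := (snell_val sl su X).
Local Notation u := (snell_cont sl su X).
Let XRG t : 0 <= t -> RG t%:E (X t) := X_RG hsl hsu b1 X_SG (t := t).

Lemma pow2_gt n : n%:R < 2 ^+ n :> R.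
Proof. by rewrite -natrX ltr_nat ltn_expl. Qed.

Lemma stopping_time_set tau t : 0 <= t -> G_stopping_time sl su tau -> adapted_set t [set w | tau w <= t].
Proof.
move=> t0 [_ /(_ t t0)[LI _]]; have t0E : (0 <= t%:E)%E by rewrite lee_fin.
have [mI _ _ [_ aI]] := L1_toR hsl hsu t0E LI.
apply/adapted_set_ind => //; split=> //.
have mi : measurable_fun setT (\1_[set w | tau w <= t] : Omega R -> R) by apply/measurable_EFinP.
have := mi measurableT [set 1] (measurable_set1 _); rewrite setTI; congr measurable.
apply/seteqP; split => w /=; rewrite indicE.
  by case: (boolP (w \in _)) => [/set_mem//|_] /= /eqP; rewrite eq_sym oner_eq0.
by move=> h; rewrite mem_set.
Qed.

Lemma stopped_le_value tau (c : R) : (forall n j, qs (fun w => v n j 0 w <= c)) -> G_stopping_time sl su tau ->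
  (Ehat sl su (fun w => (X (tau w) w)%:E) <= c%:E)%E.
Proof.
move=> vc st; have [tau0 _] := st.
have [D [hD D0 XD]] := X_envelope hsl hsu b1 X_SG X_sup.
pose rule m (_ k : nat) := [set w | tau w <= dy m k].
have aR m j k : adapted_set (dy m k) (rule m j k) by exact: stopping_time_set.
have mR m j k : measurable (rule m j k) by case: (aR m j k).
(* Mesh 2^-m and horizon m: at a given path the horizon eventually exceeds tau. *)
pose Y m := stop_val X m (rule m) (m * 2 ^ m) 0.
have LY m : Lr (Y m) by exact: (stop_val_Lr hsl hsu XRG hD XD).
have cY : qs (fun w => (fun m => Y m w) @ \oo --> X (tau w) w).
  apply: (qs_imp (X_continuous hsl hsu b1 X_SG)) => w; apply => //.
    by move=> m; have /andP[+ _] := le_stop_time m (rule m) (m * 2 ^ m) 0 w; apply: le_trans.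
  apply/cvgrPdist_le => e e0; have [p hp] := nat_ge e^-1; have [q hq] := nat_ge (tau w).
  exists (maxn p q) => // m /=; rewrite geq_max => /andP[pm qm].
  have h1 : tau w <= dy m (0 + m * 2 ^ m).
    rewrite add0n /dyadic natrM natrX mulfK ?expf_neq0 ?pnatr_eq0//.
    by apply: (le_trans hq); rewrite ler_nat.
  have h2 : dy m 0 <= tau w + (2 ^+ m)^-1 by rewrite /dyadic mul0r addr_ge0// invr_ge0 exprn_ge0.
  have := stop_time_approx (tau0 w) h1 h2.
  have h3 : (2 ^+ m)^-1 <= e.
    rewrite invf_ple ?posrE ?exprn_gt0//; apply: (le_trans hp); apply/ltW/le_lt_trans/(pow2_gt m).
    by rewrite ler_nat.
  by move=> /andP[h4 h5]; rewrite /rule ler_norml; apply/andP; split; lra.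
(* A Borel function defined everywhere that q.s. equals X at tau, whose own measurability is not
   given. *)
pose g w := limn (fun m => (Y m w)%:E).
have mg : measurable_fun setT g.
  by apply: measurable_limn => m; apply/measurable_EFinP; exact: (LY m).1.
have gE : qs (fun w => g w = (X (tau w) w)%:E).
  by apply: (qs_imp cY) => w h; apply: cvg_lim => //; apply: cvg_EFin => //; exact: nearW.
have mx : measurable_fun setT (toR g) by exact: measurableT_comp.
have YD m := stop_val_le XD m (rule m) (m * 2 ^ m) 0.
apply: Ehat_le => P GP.
have [N [mN N0 Ng]] := qsE hsl hsu gE.
rewrite (@integral_eq_off_null _ _ _ P _ (EFin \o toR g) N) //; last 2 first.
- exact: N0.
- by move=> w nN; rewrite /= /toR Ng.
have cx : {ae P, forall w, (Y ^~ w) @ \oo --> toR g w}.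
  by apply: filterS2 (qs_ae hsl hsu cY GP) (qs_ae hsl hsu gE GP) => w h E; rewrite /toR E.
have dom : {ae P, forall w m, `|Y m w| <= D w}.
  exact: (qs_ae hsl hsu (qs_all hsl hsu YD) GP).
have rx : rint P (toR g).
  have hx : qs (fun w => `|toR g w| <= D w).
    apply: (qs_and hsl hsu (qs_and hsl hsu cY gE (fun w => @conj _ _)) (qs_all hsl hsu YD)) => w [h E] d.
    rewrite /toR E /= -(cvg_lim _ (cvg_norm h))//.
    by apply: limr_le; [apply/cvg_ex; exists `|X (tau w) w|; exact: cvg_norm|exact: nearW].
  exact: Lr_rint (Lr_qs_le hsl hsu mx hD hx) GP.
have cE := rEP_dominated (fun m => (LY m).1) mx cx (Lr_rint hD GP) dom.
rewrite (rEPE rx) lee_fin -(cvg_lim _ cE)//.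
apply: limr_le; [by apply/cvg_ex; exists (EP P (toR g))|apply: nearW => m].
have := stopped_le_snell hsl hsu XRG hD XD (m * 2 ^ m) (aR m) GP (adapted_setT hsl hsu (dy0 m 0)).
have E (f : Omega R -> R) : (fun w => f w * \1_setT w) = f by apply/funext => w; rewrite indicT mulr1.
rewrite !E => /le_trans; apply; rewrite -(EP_cst P c); apply: rEP_le.
- exact: Lr_rint (snell_val_Lr hsl hsu XRG _ _ _) GP.
- exact: Lr_rint (Lr_bmeas sl su (bmeas_cst c)) GP.
- exact: (qs_ae hsl hsu (vc _ _) GP).
Qed.

(* A decreasing sequence in L_G^1 with limit the indicator of {stop_time <= t}
   for the optimal rule: the indicator of {u <= X} is the limit of
   (1 - r (u - X)^+)^+. *)
Fixpoint rule_approx n t j k (r : nat) w : R :=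
  if t < dy n k then 0 else
  if j is j'.+1 then
    Num.max (Num.max (1 - r%:R * Num.max (u n j' k w - X (dy n k) w) 0) 0) (rule_approx n t j' k.+1 r w)
  else 1.

Local Notation sigma n := (stop_time n (snell_rule sl su X n)).

Lemma rule_approx_RG n t j k r : 0 <= t -> RG t%:E (rule_approx n t j k r).
Proof.
move=> t0; elim: j k => [|j IH] k.
  rewrite (_ : rule_approx _ _ _ _ _ = fun=> if t < dy n k then 0 else 1)//; exact: RG_cst.
have [h|h] := ltP t (dy n k).
  rewrite (_ : rule_approx _ _ _ _ _ = fun=> 0); first exact: RG_cst.
  by apply/funext => w /=; rewrite h.
have le x : RG (dy n k)%:E x -> RG t%:E x by apply: RG_le; rewrite lee_fin.
have G1 := le _ (snell_cont_RG hsl hsu XRG n j k); have G2 := le _ (XRG (dy0 n k)).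
have G3 := RG_max hsl hsu (RG_lin hsl hsu 1 (-1) 0 G1 G2) (RG_cst sl su t%:E 0).
have G4 := RG_max hsl hsu (RG_lin hsl hsu (- r%:R) 0 1 G3 G3) (RG_cst sl su t%:E 0).
have := RG_max hsl hsu G4 (IH k.+1); congr (RG _ _); apply/funext => w /=.
rewrite ltNge h /=; congr (Num.max (Num.max _ _) _).
rewrite (_ : 1 * u n j k w + -1 * X (dy n k) w + 0 = u n j k w - X (dy n k) w); last by ring.
by ring.
Qed.

Lemma rule_approx_itv n t j k r w : 0 <= rule_approx n t j k r w <= 1.
Proof.
elim: j k => [|j IH] k /=; case: ifP => _; rewrite ?lexx ?ler01//.
have /andP[h1 h2] := IH k.+1; rewrite !le_max h1 orbT /= !ge_max h2 ler01 !andbT.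
by rewrite lerBlDr lerDl mulr_ge0// le_max lexx orbT.
Qed.

Lemma rule_approx_decr n t j k r r' w : (r <= r')%N -> rule_approx n t j k r' w <= rule_approx n t j k r w.
Proof.
have M (a b c d : R) : a <= c -> b <= d -> Num.max a b <= Num.max c d.
  by move=> h1 h2; rewrite ge_max !le_max h1 h2 orbT.
move=> rr; elim: j k => [|j IH] k /=; case: ifP => // _.
apply: (M) (IH k.+1); apply: (M) => //; rewrite lerD2l lerN2.
by rewrite ler_wpM2r ?ler_nat// le_max lexx orbT.
Qed.

(** Where u <= X the approximation is 1 for every r. Where u > X the new term vanishes once
    [r * (u - X)] reaches 1, and the later times decide. *)
Lemma rule_approx_cvg n t j k w :
  (fun r => rule_approx n t j k r w) @ \oo --> (\1_[set w | sigma n j k w <= t] w : R).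
Proof.
have ind j' k' : (\1_[set w | sigma n j' k' w <= t] w : R) = ((sigma n j' k' w <= t)%R : bool)%:R.
  rewrite indicE; congr (_ %:R); congr nat_of_bool.
  by apply/idP/idP => [/set_mem//|h]; exact: mem_set.
rewrite ind; elim: j k => [|j IH] k.
  rewrite /= ltNge; case: (dy n k <= t); exact: cvg_cst.
have [h|h] := ltP t (dy n k).
  have /andP[h1 _] := le_stop_time n (snell_rule sl su X n) j.+1 k w.
  rewrite leNgt (lt_le_trans h h1) /= h; exact: cvg_cst.
rewrite /= ltNge h /=; case: (boolP (w \in _)) => [/set_mem|] hw.
  rewrite h; rewrite (_ : (fun r => _) = fun=> 1); first exact: cvg_cst.
  apply/funext => r; have /andP[_ h2] := rule_approx_itv n t j k.+1 r w.
  rewrite (max_r (_ : u n j k w - X (dy n k) w <= 0)); last by rewrite subr_le0.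
  by rewrite mulr0 subr0 (max_l ler01) max_l.
have d0 : 0 < u n j k w - X (dy n k) w.
  by rewrite subr_gt0 ltNge; apply/negP => h'; move/negP: hw; apply; exact: mem_set.
apply: cvg_trans (IH k.+1); apply: near_eq_cvg.
have [p hp] := nat_ge (u n j k w - X (dy n k) w)^-1; exists p => // r /= pr.
have /andP[h1 _] := rule_approx_itv n t j k.+1 r w.
rewrite (max_l (ltW d0)) [X in Num.max X _]max_r ?max_r//.
rewrite subr_le0 -ler_pdivrMr// div1r; apply: (le_trans hp); by rewrite ler_nat.
Qed.

Lemma optimal_stopping_set n t j k : 0 <= t -> adapted_set t [set w | sigma n j k w <= t].
Proof.
move=> t0; have e0 : adapted_set t set0 by rewrite -setCT; apply: adapted_setC; exact: adapted_setT.
elim: j k => [|j IH] k.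
  have [h|h] := leP (dy n k) t.
    rewrite (_ : [set w | _] = setT); first exact: adapted_setT.
    by apply/seteqP; split => w.
  by rewrite (_ : [set w | _] = set0)//; apply/seteqP; split => [w|w []].
have [h|h] := ltP t (dy n k).
  rewrite (_ : [set w | _] = set0)//; apply/seteqP; split => [w h'|w []].
  have /andP[h1 _] := le_stop_time n (snell_rule sl su X n) j.+1 k w.
  by have := lt_le_trans h (le_trans h1 h'); rewrite ltxx.
have a1 := adapted_set_le hsl hsu (dy0 n k) h (snell_rule_adapted hsl hsu XRG n j k).
have := adapted_setU a1 (IH k.+1); congr (adapted_set _ _); apply/seteqP; split => w /=.
  case: (boolP (w \in _)) => [//|hw] [hw'|//]; exfalso; move/negP: hw; apply; exact: mem_set.
by case: (boolP (w \in _)) => [/set_mem hw _|_]; [left|right].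
Qed.

Lemma optimal_stopping_time n j : G_stopping_times_fin sl su (sigma n j 0).
Proof.
split; first split.
- by move=> w; have /andP[+ _] := le_stop_time n (snell_rule sl su X n) j 0 w; apply: le_trans.
- move=> t t0; have t0E : (0 <= t%:E)%E by rewrite lee_fin.
  have [mA aA] := proj1 (adapted_set_ind _ t0) (optimal_stopping_set n j 0 t0).
  have LA : Lr (\1_[set w | sigma n j 0 w <= t]) by exact: Lr_bmeas (bmeas_indic mA).
  have L1A : L1 sl su t%:E (fun w => (\1_[set w | sigma n j 0 w <= t] w)%:E) by apply: L1_EFin.
  have LG r : LG1 sl su t%:E (fun w => (rule_approx n t j 0 r w)%:E).
    by apply: RG_LG1 => //; [apply: (RG_L1_EFin hsl hsu t0)|]; exact: rule_approx_RG.
  split=> //; exists (fun r w => (rule_approx n t j 0 r w)%:E) => //.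
  apply/(qs_decreasesP hsl hsu t0E t0E (fun r => (LG r).1) L1A); apply: (qs_true hsl hsu) => w; split.
    by move=> r r'; exact: rule_approx_decr.
  exact: rule_approx_cvg.
(* The rule stops at its horizon at the latest, so the capacity is exactly 0 once N exceeds it. *)
- have [q hq] := nat_ge (dy n (0 + j)).
  have c0 (N : nat) : (q <= N)%N -> cap sl su [set w | N%:R < sigma n j 0 w] = 0%E.
    move=> qN; rewrite (_ : [set w | _] = set0).
      by apply/(cap_eq0 hsl hsu measurable0) => P _; rewrite measure0.
    apply/seteqP; split => [w h'|w []]; have /andP[_ h] := le_stop_time n (snell_rule sl su X n) j 0 w.
    have : N%:R < q%:R :> R by exact: lt_le_trans h' (le_trans h hq).
    by rewrite ltr_nat ltnNge qN.
  apply: cvg_near_cst; exists q => // N /= qN; exact: c0.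
Qed.

Lemma value_le_stopped (c : R) :
  (forall P e, GM P -> 0 < e -> exists m, c - e <= EP P (v m (m * 2 ^ m) 0)) ->
  (c%:E <= ereal_sup [set Ehat sl su (fun w => (X (tau w) w)%:E) | tau in @G_stopping_times_fin R sl su])%E.
Proof.
move=> H; have [D [hD D0 XD]] := X_envelope hsl hsu b1 X_SG X_sup.
have [P GP] := G_measures_nonempty hsl hsu.
apply/lee_subgt0Pr => e e0; have e2 : 0 < e / 2 by rewrite divr_gt0.
have [m hm] := H P _ GP e2.
have [Q GQ hQ] := snell_attained0 hsl hsu XRG hD XD m (m * 2 ^ m) 0 GP e2.
apply: (@le_trans _ _ (EP Q (stop_val X m (snell_rule sl su X m) (m * 2 ^ m) 0))%:E).
  by rewrite -EFinB lee_fin; lra.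
have mA j k : measurable (snell_rule sl su X m j k) by case: (snell_rule_adapted hsl hsu XRG m j k).
have LS := stop_val_Lr hsl hsu XRG hD XD m (m * 2 ^ m) 0 mA.
rewrite -(rEPE (Lr_rint LS GQ)); apply: le_trans (Ehat_ge _ GQ) _.
by apply: ereal_sup_ubound; exists (sigma m (m * 2 ^ m) 0) => //; exact: optimal_stopping_time.
Qed.

End optimal_stopping.

Theorem proposition4p8 (R : realType) (sl su : R) (hsl : 0 <= sl)
    (hsu : sl <= su) (beta : R) (hbeta : 1 < beta)
    (X : R -> Omega R -> R)
    (X_lb : exists C : R, forall t : R, 0 <= t ->
       qs sl su (fun w => C <= X t w))
    (X_SG : forall n : nat, (0 < n)%N -> SG sl su beta n%:R X)
    (X_sup : (Ehat sl su (sup_power beta [set t : R | (0 <= t)%R] X) < +oo)%E)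
    (V : R -> Omega R -> \bar R)
    (V_def : forall (n k : nat) (w : Omega R),
       V (dyadic R n k) w =
       limn (fun m : nat =>
         snell sl su (fun t w' => (X t w')%:E) m (k * 2 ^ (m - n))%N w)) :
  smallest_G_supermartingale_dominating sl su V (fun t w => (X t w)%:E) /\
  qs sl su (fun w =>
    V 0 w = ereal_sup [set Ehat sl su (fun w' => (X (tau w') w')%:E)
                      | tau in @G_stopping_times_fin R sl su]).
Proof.
split; first exact: (value_smallest hsl hsu hbeta X_SG X_sup V_def).
have [c [V0 vc vlow]] := value_init hsl hsu hbeta X_SG X_sup V_def.
apply: (qs_imp V0) => w ->; apply/eqP; rewrite eq_le; apply/andP; split.
  exact: (value_le_stopped hsl hsu hbeta X_SG X_sup).
apply: ge_ereal_sup => _ [tau [st _] <-].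
exact: (stopped_le_value hsl hsu hbeta X_SG X_sup).
Qed.
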